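(* Let $u_0\in L^2(\Omega;V_{h,\mathrm{div}})$ be $\mathcal F_0$-measurable, let $(G_n)_{n\in[N]}$ satisfy the data stability assumption (see context), let $u=(u_n)_{n=1}^N\in[V_{h,\mathrm{div}}]^N$ be the solution of the velocity scheme $$(u_n-u_{n-1},\xi)+\tau\,(S(\varepsilon u_n),\nabla\xi)=\big(G_n(u_{(n-2)\vee 0})\,\Delta_n\mathbb W,\xi\big)\quad\forall\xi\in V_{h,\mathrm{div}},\ n\in[N],\ \mathbb P\text{-a.s.},$$ and let $\pi^{\mathrm{init}}\in Q_h^\sim$ be the solution of $(\pi^{\mathrm{init}},\operatorname{div}\xi)=(u_0,\xi)$ for all $\xi\in V_{h,\mathrm{div}}^\perp$. Then: (1) (Existence) There exists a unique $\pi=(\pi_n)_{n=0}^N\in[Q_h^\sim]^{N+1}$ with $\pi_0=\pi^{\mathrm{init}}$ such that for all $\xi\in V_{h,\mathrm{div}}^\perp$, $n\in[N]$ and $\mathbb P$-a.s. $$(\pi_n-\pi_{n-1},\operatorname{div}\xi)=(u_n-u_{n-1},\xi)+\tau(S(\varepsilon u_n),\nabla\xi)-\big(G_n(u_{(n-2)\vee0})\Delta_n\mathbb W,\xi\big).$$ (2) (Measurability) $\pi_n$ is $\mathcal F^N_n$-measurable. (3) (Decomposition) There exist $(\pi^{\mathrm{det}},\pi^{\mathrm{sto}})\in[Q_h^\sim\times Q_h^\sim]^N$ such that $\pi_0=\pi^{\mathrm{init}}$ and $\pi_n=\pi^{\mathrm{init}}+\pi^{\mathrm{det}}_n+\pi^{\mathrm{sto}}_n$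 for all $n\in[N]$. (4) (Explicit formula) For all $\xi\in V_{h,\mathrm{div}}^\perp$, $n\in[N]$ and $\mathbb P$-a.s. $$(\pi^{\mathrm{det}}_n,\operatorname{div}\xi)=\Big(\sum_{l=1}^n\tau S(\varepsilon u_l),\nabla\xi\Big),\qquad (\pi^{\mathrm{sto}}_n,\operatorname{div}\xi)=-\Big(\sum_{l=1}^nG_l(u_{(l-2)\vee0})\Delta_l\mathbb W,\xi\Big).$$ (5) (Stability) With $\pi^{\mathrm{det}}_0:=0$ and $\pi^{\mathrm{sto}}_0:=0$ it holds $$\mathbb E\Big[\sum_{n=1}^N\tau\Big\|\frac{\pi^{\mathrm{det}}_n-\pi^{\mathrm{det}}_{n-1}}{\tau}\Big\|_{Q_{\mathrm{det}}}^{p'}\Big]+\mathbb E\Big[\max_{n\in[N]}\|\pi^{\mathrm{sto}}_n\|_{Q_{\mathrm{sto}}}^2\Big]\lesssim\mathbb E[\|u_0\|_{L^2_x}^2]+1,$$ and for all $r\in[2,\infty)$ $$\Big(\max_{k\in[N]}\sum_{n=k}^N\tau\Big(\frac{\mathbb E[\|\pi^{\mathrm{sto}}_n-\pi^{\mathrm{sto}}_{n-k}\|_{Q_{\mathrm{sto}}}^2]}{\tau k}\Big)^{r/2}\Big)^{2/r}\lesssim\mathbb E[\|u_0\|_{L^2_x}^2]+1 .$$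
   Context: Setting. $\mathcal O\subset\mathbb R^n$ is a bounded Lipschitz domain, $T>0$, $I=(0,T)$, $p\in(1,\infty)$, $p'=p/(p-1)$. $L^q_x=L^q(\mathcal O)$, $W^{1,q}_x=W^{1,q}(\mathcal O)$, $W^{1,q}_{0,x}$ is the subspace with zero boundary values, $L^q_{0,x}$ the mean-value free functions; $(\cdot,\cdot)$ is the $L^2(\mathcal O)$ inner product (duality pairing). $(\Omega,\mathcal F,(\mathcal F_t)_{t\in I},\mathbb P)$ is a stochastic basis with complete right-continuous filtration, $W$ a cylindrical $(\mathcal F_t)$-Wiener process on a separable Hilbert space $\mathfrak U$, and $L_2(\mathfrak U;L^2_x)$ the Hilbert–Schmidt operators. $\varepsilon u=\frac12(\nabla u+(\nabla u)^T)$ and $S(A)=|A|^{p-2}A$ (the case $\kappa=0$ of $S(A)=(\kappa+|A|)^{p-2}A$). $[N]=\{1,\dots,N\}$, $a\vee b=\max\{a,b\}$. Space discretization. For $h\in(0,1]$, $V_h\subset W^{1,\infty}_x\cap W^{1,1}_{0,x}$ (vector fields) and $Q_h\subset L^\infty_x\cap L^1_{0,x}$ (scalar functions) are finite dimensional linear spaces, $V_{h,\mathrm{div}}=\{v\in V_h:\ (q,\operatorname{div}v)=0\ \forall q\in Q_h\}$, and $V_{h,\mathrm{div}}^\perp=\{v\in V_h:(v,w)=0\ \forall w\in V_{h,\mathrm{div}}\}$. On $Q_h$ let $q_1\sim q_2$ iff $(q_1-q_2,\operatorname{div}v)=0$ for all $v\in V_{h,\mathrm{div}}^\perp$, and $Q_h^\sim=Q_h/\sim$.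 Norms on $Q_h^\sim$ (suprema over nonzero $v$): $$\|q\|_{Q_{\mathrm{sto}}}=\sup_{v\in V_{h,\mathrm{div}}^\perp}\frac{(q,\operatorname{div}v)}{\|v\|_{L^2_x}},\qquad \|q\|_{Q_{\mathrm{det}}}=\sup_{v\in V_{h,\mathrm{div}}^\perp}\frac{(q,\operatorname{div}v)}{\|\nabla v\|_{L^p_x}}.$$ Time discretization. $N\in\mathbb N$, $\tau=T/(N+1)$, $t_n=n\tau$, $J_n=[t_n-\tau/2,t_n+\tau/2]$ for $n\ge1$, $J_0=[0,\tau/2]$. Weights: $a_1(t)=1_{J_0}(t)+\frac{t_1+\tau/2-t}{\tau}1_{J_1}(t)$ and, for $n\ge2$, $a_n(t)=\frac{t-(t_{n-1}-\tau/2)}{\tau}1_{J_{n-1}}(t)+\frac{t_n+\tau/2-t}{\tau}1_{J_n}(t)$. Increments $\Delta_n\mathbb W=\int a_n(t)\,dW(t)$, so that $G_n(v)\Delta_n\mathbb W=\int a_n(t)G_n(v)\,dW(t)$. Discrete filtration: $\mathcal F^N_n=\mathcal F_{t_n+\tau/2}$ for $n\ge1$, $\mathcal F^N_0=\mathcal F_0$. Data stability assumption. There is $C>0$ independent of $n,N$ such that for all $n\in[N]$: (1) $G_n:\Omega\times L^2_x\to L_2(\mathfrak U;L^2_x)$ is $\mathcal F^N_{(n-2)\vee0}$-measurable; (2) $\mathbb E[\|G_n(v_n)\|_{L_2(\mathfrak U;L^2_x)}^2]\le C(1+\|v_n\|^2_{L^2(\Omega;L^2_x)})$ for all $\mathcal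 F^N_{(n-2)\vee0}$-measurable $v_n\in L^2(\Omega;L^2_x)$; (3) $\mathbb E[\|G_n(v_n)-G_n(w_n)\|_{L_2(\mathfrak U;L^2_x)}^2]\le C\|v_n-w_n\|^2_{L^2(\Omega;L^2_x)}$ for all $\mathcal F^N_{(n-2)\vee0}$-measurable $v_n,w_n\in L^2(\Omega;L^2_x)$. $f\lesssim g$ means $f\le c\,g$ with a constant $c$ independent of the discretization parameters $h$, $N$, $\tau$ (and of $u_0$). *)

(* Defs.v *)
From HB Require Import structures.
From mathcomp Require Import all_boot all_order all_algebra.
From mathcomp Require Import all_classical all_reals all_analysis.

Set Implicit Arguments.
Unset Strict Implicit.
Unset Printing Implicit Defensive.

Import Order.TTheory GRing.Theory Num.Theory.
Import numFieldNormedType.Exports.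

Local Open Scope classical_set_scope.
Local Open Scope ring_scope.

(* A box is given by its two corners; it is empty, and has volume 0, as soon as
   one of its edges is not of positive length. *)
Definition box (R : realType) (n : nat) (c : 'rV[R]_n.+1 * 'rV[R]_n.+1) :
  set 'rV[R]_n.+1 := [set x | forall i, c.1 ord0 i < x ord0 i < c.2 ord0 i].

Definition box_vol (R : realType) (n : nat) (c : 'rV[R]_n.+1 * 'rV[R]_n.+1) : R :=
  \prod_(i < n.+1) Num.max 0 (c.2 ord0 i - c.1 ord0 i).

Definition leb_outer (R : realType) (n : nat) (A : set 'rV[R]_n.+1) : \bar R :=
  ereal_inf [set (\sum_(k <oo) (box_vol (F k))%:E)%E
    | F in [set F : nat -> 'rV[R]_n.+1 * 'rV[R]_n.+1 | A `<=` \bigcup_k box (F k)]].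

Section leb_outer_is_outer_measure.
Context (R : realType) (n : nat).
Local Open Scope ereal_scope.
Local Notation corners := ('rV[R]_n.+1 * 'rV[R]_n.+1)%type.

Lemma box_vol_ge0 (c : corners) : 0 <= (box_vol c)%:E.
Proof. by rewrite lee_fin; apply: prodr_ge0 => i _; rewrite le_max lexx. Qed.

Lemma box_vol0 : box_vol ((0, 0)%R : corners) = 0%R.
Proof. by rewrite /box_vol big_ord_recl /= !mxE subrr maxxx mul0r. Qed.

Lemma leb_outer_ge0 (A : set 'rV[R]_n.+1) : 0 <= leb_outer A.
Proof.
apply: le_ereal_inf_tmp => x [F _ <-{x}].
by apply: nneseries_ge0 => k _ _; exact: box_vol_ge0.
Qed.

Lemma leb_outer0 : leb_outer (set0 : set 'rV[R]_n.+1) = 0.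
Proof.
apply/eqP; rewrite eq_le leb_outer_ge0 andbT.
apply: ereal_inf_lbound; exists (fun=> (0, 0)%R); first by move=> x.
by apply: eseries0 => k _ _; rewrite box_vol0.
Qed.

Lemma le_leb_outer :
  {homo (@leb_outer R n) : A B / A `<=` B >-> (A <= B)%E}.
Proof.
move=> A B AB; apply/ereal_inf_le_tmp => x [F BF <-{x}].
by exists F => //; exact: subset_trans BF.
Qed.

Lemma leb_outer_sigma_subadditive : sigma_subadditive (@leb_outer R n).
Proof.
move=> A; have [[i ioo]|] := pselect (exists i, leb_outer (A i) = +oo).
  rewrite (eseries_pinfty _ _ ioo) ?leey// => k _.
  by rewrite -ltNye (lt_le_trans _ (leb_outer_ge0 _)).
rewrite -forallNE => Aoo.
suff add2e (e : {posnum R}) :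
    leb_outer (\bigcup_n A n) <= \sum_(i <oo) leb_outer (A i) + e%:num%:E.
  by apply/lee_addgt0Pr => _/posnumP[].
rewrite (le_trans _ (epsilon_trick _ _ _))//; last first.
  by move=> k; exact: leb_outer_ge0.
pose P k (F : nat -> corners) := A k `<=` \bigcup_j box (F j) /\
  \sum_(j <oo) (box_vol (F j))%:E <= leb_outer (A k) + (e%:num / (2 ^ k.+1)%:R)%:E.
have [G PG] : {G : nat -> nat -> corners & forall k, P k (G k)}.
  apply: (@choice _ _ P) => k; rewrite /P /leb_outer.
  set S := (X in ereal_inf X); move infS : (ereal_inf S) => iS.
  case: iS infS => [r Sr|Soo|Soo].
  - have ek : (0 < e%:num / (2 ^ k.+1)%:R)%R by [].
    have /(lb_ereal_inf_adherent ek) : ereal_inf S \is a fin_num by rewrite Sr.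
    move=> [x [F AF Fx] xS].
    by exists F; split => //; rewrite Fx -Sr; exact/ltW.
  - by have := Aoo k; rewrite /leb_outer Soo.
  - suff : lbound S 0 by move/le_ereal_inf_tmp; rewrite Soo.
    by move=> /= _ [F _ <-]; apply: nneseries_ge0 => j _ _; exact: box_vol_ge0.
pose g (ij : nat * nat) := (box_vol (G ij.1 ij.2))%:E : \bar R.
have g_ge0 ij : 0 <= g ij by exact: box_vol_ge0.
apply: (@le_trans _ _ (\esum_(ij in setT) g ij)).
  apply: ereal_inf_lbound => /=.
  have /card_esym/ppcard_eqP[f] := card_nat2.
  exists (fun k => G (f k).1 (f k).2).
    move=> t [i _ /(PG i).1[j _ Gt]].
    by exists (f^-1%FUN (i, j)) => //=; rewrite invK ?inE.
  rewrite -[LHS]/(\sum_(k <oo) g (f k)).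
  rewrite -(esum_pred_image g _ xpredT) ?[fun=> _]set_true//.
  by rewrite image_eq.
rewrite (_ : esum _ _ = \sum_(i <oo) \sum_(j <oo ) g (i, j)); last first.
  pose J : nat -> set (nat * nat) := fun i => [set (i, j) | j in setT].
  rewrite (_ : setT = \bigcup_k J k); last first.
    by rewrite predeqE => -[a b]; split => // _; exists a => //; exists b.
  rewrite esum_bigcupT /=; last 2 first.
    - apply/trivIsetP => i j _ _ ij.
      rewrite predeqE => -[k m] /=; split => //= -[] [_] _ [<-{k} _].
      by move=> [m' _] [] /esym/eqP; rewrite (negbTE ij).
    - by [].
  rewrite -(image_id [set: nat]) -fun_true esum_pred_image//; last first.
    by move=> k _; exact: esum_ge0.
  apply: eq_eseriesr => /= j _.
  rewrite -(esum_pred_image g (pair j) predT)//=; last first.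
    by move=> ? ? _ _; exact: (@can_inj _ _ _ snd).
  by congr esum; rewrite predeqE => -[a b]; split; move=> [i _ <-]; exists i.
apply: lee_lim.
- apply: is_cvg_nneseries => k _ _.
  by apply: nneseries_ge0 => m _ _; exact: (g_ge0 (k, m)).
- apply: is_cvg_nneseries => k _ _.
  by apply: adde_ge0 => //; exact: leb_outer_ge0.
- by near=> k; apply: lee_sum => i _; exact: (PG i).2.
Unshelve. all: by end_near. Qed.

HB.instance Definition _ := isOuterMeasure.Build R 'rV[R]_n.+1 (@leb_outer R n)
  leb_outer0 leb_outer_ge0 le_leb_outer leb_outer_sigma_subadditive.

End leb_outer_is_outer_measure.

Definition leb_outer_measure (R : realType) (n : nat) :
  {outer_measure set 'rV[R]_n.+1 -> \bar R} := @leb_outer R n.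

(* R^(n+1) with its Lebesgue-measurable sets, and Lebesgue measure on it. *)
Notation Rn R n := (caratheodory_type (leb_outer_measure R n)).

Definition leb (R : realType) (n : nat) : {measure set (Rn R n) -> \bar R} :=
  leb_outer_measure R n : set (Rn R n) -> \bar R.

Definition frob_dot (R : realType) (m k : nat) (A B : 'M[R]_(m, k)) : R :=
  \sum_(i < m) \sum_(j < k) A i j * B i j.

(* The library's norm on matrices is the maximum norm; this is the Euclidean
   (Frobenius) one. *)
Definition frob (R : realType) (m k : nat) (A : 'M[R]_(m, k)) : R :=
  Num.sqrt (frob_dot A A).

Section fields.
Context (R : realType) (n : nat).
Local Notation E := 'rV[R]_n.+1.
Local Notation mat := 'M[R]_n.+1.
Local Notation leb := (leb R n).
Implicit Types (O : set E) (p : R).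

(* Near each boundary point O is, in a rotated frame with vertical axis e, the
   set above the graph of a Lipschitz function of the component orthogonal
   to e. *)
Definition lipschitz_domain O : Prop :=
  [/\ O !=set0, open O, connected O, bounded_set O &
   forall x, closure O x -> ~ O x ->
     exists (e : E) (r L : R) (gamma : E -> R),
       [/\ frob e = 1, 0 < r,
           forall y z, `|gamma y - gamma z| <= L * frob (y - z) &
           forall y, frob (y - x) < r ->
             (O y <-> gamma (y - x - frob_dot (y - x) e *: e)
                      < frob_dot (y - x) e)]].

(* Fields are functions on R^(n+1) of which only the values on O matter;
   elements of Lebesgue and Sobolev spaces are represented by such functions,
   and equality of elements is almost everywhere equality on O. *)
Definition ae_on O (Pr : E -> Prop) : Prop := {ae leb, forall x, O x -> Pr x}.

Definition measurable_field O (m k : nat) (f : E -> 'M[R]_(m, k)) : Prop :=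
  forall i j, measurable_fun (O : set (Rn R n)) (fun x : Rn R n => f x i j).

Definition Lq O (q : R) {m k : nat} : set (E -> 'M[R]_(m, k)) := [set f |
  measurable_field O f /\ (\int[leb]_(x in O) (frob (f x) `^ q)%:E < +oo)%E].

Definition Lq_norm O (q : R) (m k : nat) (f : E -> 'M[R]_(m, k)) : R :=
  (\int[leb]_(x in O) (frob (f x) `^ q)) `^ q^-1.

Definition Loo O {m k : nat} : set (E -> 'M[R]_(m, k)) := [set f |
  measurable_field O f /\ exists M : R, ae_on O (fun x => frob (f x) <= M)].

Definition L2x O : set (E -> E) := Lq O 2.

Definition L2x_norm O (f : E -> E) : R := Lq_norm O 2 f.

Definition ip O (m k : nat) (f g : E -> 'M[R]_(m, k)) : R :=
  \int[leb]_(x in O) frob_dot (f x) (g x).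

Definition partial (i : 'I_n.+1) (f : E -> R) : E -> R :=
  fun x => 'D_(delta_mx ord0 i) f x.

Definition smooth (f : E -> R) : Prop :=
  forall (s : seq 'I_n.+1) x, differentiable (foldr partial f s) x.

Definition test_function O (f : E -> R) : Prop :=
  smooth f /\
  exists K : set E, [/\ compact K, K `<=` O & forall x, ~ K x -> f x = 0].

Definition is_weak_grad O (v : E -> E) (g : E -> mat) : Prop :=
  [/\ Lq O 1 v, Lq O 1 g &
   forall (phi : E -> R) (i j : 'I_n.+1), test_function O phi ->
     \int[leb]_(x in O) (v x ord0 i * partial j phi x) =
     - \int[leb]_(x in O) (g x i j * phi x)].

(* Weak gradients are unique up to a.e. equality on O. *)
Definition grad O (v : E -> E) : E -> mat :=
  xget (fun=> 0) [set g | is_weak_grad O v g].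

Definition div O (v : E -> E) : E -> R := fun x => \tr (grad O v x).

Definition sym_grad O (v : E -> E) : E -> mat :=
  fun x => 2^-1 *: (grad O v x + (grad O v x)^T).

Definition shear p (A : mat) : mat := (frob A `^ (p - 2)) *: A.

Definition W1oo O : set (E -> E) := [set v |
  [/\ is_weak_grad O v (grad O v), Loo O v & Loo O (grad O v)]].

(* closure in W^{1,1} of the smooth compactly supported fields *)
Definition W110 O : set (E -> E) := [set v |
  is_weak_grad O v (grad O v) /\
  exists phi : nat -> E -> E,
    (forall k i, test_function O (fun x => phi k x ord0 i)) /\
    (\int[leb]_(x in O)
       (frob (phi k x - v x) +
        frob (\matrix_(i, j) partial j (fun y => phi k y ord0 i) x
              - grad O v x))%:E @[k --> \oo] --> 0)%E].

Definition fin_dim_space O (X : lmodType R) (V : set (E -> X)) : Prop :=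
  [/\ V (fun=> 0),
      forall (a : R) v w, V v -> V w -> V (fun x => a *: v x + w x) &
      exists (m : nat) (b : 'I_m -> E -> X),
        (forall i, V (b i)) /\
        forall v, V v -> exists c : 'I_m -> R,
          ae_on O (fun x => v x = \sum_(i < m) c i *: b i x)].

Definition velocity_space O (V : set (E -> E)) : Prop :=
  [/\ fin_dim_space O V, V `<=` W1oo O & V `<=` W110 O].

Definition pressure_space O (Q : set (E -> R)) : Prop :=
  @fin_dim_space O R^o Q /\
  forall q, Q q ->
    [/\ measurable_fun (O : set (Rn R n)) (q : Rn R n -> R),
        exists M : R, ae_on O (fun x => `|q x| <= M),
        leb.-integrable O (fun x => (q x)%:E) &
        \int[leb]_(x in O) q x = 0].

Definition pair_div O (q : E -> R) (v : E -> E) : R :=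
  \int[leb]_(x in O) (q x * div O v x).

Definition Vdiv O (V : set (E -> E)) (Q : set (E -> R)) : set (E -> E) :=
  [set v | V v /\ forall q, Q q -> pair_div O q v = 0].

Definition Vperp O (V : set (E -> E)) (Q : set (E -> R)) : set (E -> E) :=
  [set v | V v /\ forall w, Vdiv O V Q w -> ip O v w = 0].

(* Elements of the quotient Q/~ are represented by elements of Q; equality in
   the quotient is [qsim]. *)
Definition qsim O (V : set (E -> E)) (Q : set (E -> R)) (q1 q2 : E -> R) : Prop :=
  forall v, Vperp O V Q v -> pair_div O (q1 \- q2) v = 0.

(* [sup] is 0 on the empty set, i.e. when Vperp is trivial. *)
Definition Qsto O V Q (q : E -> R) : R :=
  sup [set pair_div O q v / L2x_norm O v
      | v in [set v | Vperp O V Q v /\ ~ ae_on O (fun x => v x = 0)]].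

Definition Qdet O V Q p (q : E -> R) : R :=
  sup [set pair_div O q v / Lq_norm O p (grad O v)
      | v in [set v | Vperp O V Q v /\ ~ ae_on O (fun x => v x = 0)]].

End fields.

Section hilbert_schmidt.
Context (R : realType) (n : nat) (U : completeNormedModType R).
Local Notation E := 'rV[R]_n.+1.
Variable (inner : {dot U for idfun}) (B : set U).

Definition inner_product_norm : Prop := forall x : U, inner x x = `|x| ^+ 2.

Definition separable : Prop := exists2 D : set U, countable D & dense D.

Definition orthonormal_basis : Prop :=
  [/\ forall e, B e -> inner e e = 1,
      forall e f, B e -> B f -> e <> f -> inner e f = 0 &
      forall x, (forall e, B e -> inner x e = 0) -> x = 0].

Definition HS_norm2 (O : set E) (A : U -> E -> E) : \bar R :=
  (\esum_(e in B) ((L2x_norm O (A e)) ^+ 2)%:E)%E.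

Definition HS (O : set E) : set (U -> E -> E) := [set A |
  [/\ forall x, L2x O (A x),
      forall (a : R) x y, ae_on O (fun z => A (a *: x + y) z = a *: A x z + A y z),
      exists M : R, forall x, L2x_norm O (A x) <= M * `|x| &
      (HS_norm2 O A < +oo)%E]].

Definition HS_norm (O : set E) (A : U -> E -> E) : R :=
  Num.sqrt (fine (HS_norm2 O A)).

End hilbert_schmidt.

(* Borel sets of the space D with respect to the seminorm N. *)
Definition norm_open (R : realType) (X : zmodType) (D : set X) (N : X -> R) :
  set (set X) := [set A | A `<=` D /\ forall f, A f ->
    exists2 r : R, 0 < r & forall g, D g -> N (g - f) < r -> A g].

Definition norm_borel (R : realType) (X : zmodType) (D : set X) (N : X -> R) :
  set (set X) := <<s D, norm_open D N >>.

Definition random_elt (R : realType) (T : Type) (F : set (set T)) (X : zmodType)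
    (D : set X) (N : X -> R) (f : T -> X) : Prop :=
  (forall w, D (f w)) /\ forall A, norm_borel D N A -> F (f @^-1` A).

Section stochastics.
Context (R : realType) (n : nat) (d : measure_display) (Omega : measurableType d)
  (P : probability Omega R).
Local Notation E := 'rV[R]_n.+1.
Implicit Types (O : set E) (F : R -> set (set Omega)) (T : R).

Definition stochastic_basis T F : Prop :=
  [/\ forall t, 0 <= t <= T ->
        sigma_algebra [set: Omega] (F t) /\ F t `<=` measurable,
      forall s t, 0 <= s -> s <= t -> t <= T -> F s `<=` F t,
      forall A, P.-negligible A -> F 0 A &
      forall t, 0 <= t < T -> \bigcap_(s in `]t, T]) F s `<=` F t].

Definition second_moment O (v : Omega -> E -> E) : \bar R :=
  (\int[P]_w ((L2x_norm O (v w)) ^+ 2)%:E)%E.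

(* the F0-measurable elements of L^2(Omega; L^2_x) *)
Definition L2_random O (F0 : set (set Omega)) (v : Omega -> E -> E) : Prop :=
  random_elt F0 (L2x O) (L2x_norm O) v /\ (second_moment O v < +oo)%E.

Variables (U : completeNormedModType R) (inner : {dot U for idfun}) (B : set U).

Definition HS_second_moment O (A : Omega -> U -> E -> E) : \bar R :=
  (\int[P]_w ((HS_norm B O (A w)) ^+ 2)%:E)%E.

(* W t x is the real random variable <W(t), x>. Independence and joint
   Gaussianity of the increments in several directions follow from linearity. *)
Definition cylindrical_wiener T F (W : R -> U -> Omega -> R) : Prop :=
  [/\ forall t x (A : set R), 0 <= t <= T -> measurable A -> F t (W t x @^-1` A),
      forall t (a : R) x y, 0 <= t <= T ->
        {ae P, forall w, W t (a *: x + y) w = a * W t x w + W t y w},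
      forall x, {ae P, forall w, W 0 x w = 0},
      forall x, {ae P, forall w, {within `[0, T], continuous (fun t => W t x w)}} &
      forall s t x, 0 <= s -> s < t -> t <= T -> x != 0 ->
        let incr := fun w => W t x w - W s x w in
        (forall A : set R, measurable A ->
          P (incr @^-1` A) = normal_prob 0 (Num.sqrt (t - s) * `|x|) A) /\
        (forall (C : set Omega) (A : set R), F s C -> measurable A ->
          P (C `&` incr @^-1` A) = (P C * P (incr @^-1` A))%E)].

(* The term (s, t, C, x, h) stands for the process
   r |-> 1_(s,t](r) 1_C <., x> h. *)
Record ito_term := ItoTerm {
  it_s : R; it_t : R; it_C : set Omega; it_x : U; it_h : E -> E }.

Definition adapted_term T F O (z : ito_term) : Prop :=
  [/\ 0 <= it_s z, it_s z <= it_t z, it_t z <= T,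
      F (it_s z) (it_C z) & L2x O (it_h z)].

Definition elementary_process (l : seq ito_term) : R -> Omega -> U -> E -> E :=
  fun r w y a => \sum_(z <- l)
    (\1_(`]it_s z, it_t z]%classic) r * \1_(it_C z) w * inner y (it_x z))
      *: it_h z a.

Definition elementary_integral (W : R -> U -> Omega -> R) (l : seq ito_term) :
    Omega -> E -> E :=
  fun w a => \sum_(z <- l)
    (\1_(it_C z) w * (W (it_t z) (it_x z) w - W (it_s z) (it_x z) w))
      *: it_h z a.

Definition is_ito_integral T F O (W : R -> U -> Omega -> R)
    (Phi : R -> Omega -> U -> E -> E) (X : Omega -> E -> E) : Prop :=
  [/\ forall t w, 0 <= t <= T -> HS B O (Phi t w),
      random_elt measurable (L2x O) (L2x_norm O) X &
      exists l : nat -> seq ito_term,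
        [/\ forall k i, (i < size (l k))%N ->
              adapted_term T F O (nth (ItoTerm 0 0 set0 0 (fun=> 0)) (l k) i),
            ((\int[lebesgue_measure]_(t in `[0%R, T])
               HS_second_moment O
                 (fun w => elementary_process (l k) t w - Phi t w)%R)
               @[k --> \oo] --> 0)%E &
            (second_moment O (fun w => elementary_integral W (l k) w - X w)%R
               @[k --> \oo] --> 0)%E]].

(* The integral is determined up to P-a.s. equality of elements of L^2_x; the
   value is 0 if Phi is not integrable. *)
Definition ito_integral T F O W Phi : Omega -> E -> E :=
  xget (fun=> fun=> 0) [set X | is_ito_integral T F O W Phi X].

Definition dual_cell (tau : R) (m : nat) : set R :=
  if m == 0%N then `[0, tau / 2]%classic
  else `[m%:R * tau - tau / 2, m%:R * tau + tau / 2]%classic.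

Definition weight (tau : R) (m : nat) (t : R) : R :=
  if m == 1%N then
    \1_(dual_cell tau 0) t
    + (tau + tau / 2 - t) / tau * \1_(dual_cell tau 1) t
  else
    (t - (m.-1%:R * tau - tau / 2)) / tau * \1_(dual_cell tau m.-1) t
    + (m%:R * tau + tau / 2 - t) / tau * \1_(dual_cell tau m) t.

Definition disc_filtration F (tau : R) (m : nat) : set (set Omega) :=
  if m == 0%N then F 0 else F (m%:R * tau + tau / 2).

(* In [(m - 2)%N] the subtraction is truncated at 0. *)
Definition data_stability O F (tau : R) (N : nat) (C : R)
    (G : nat -> Omega -> (E -> E) -> U -> E -> E) : Prop :=
  forall m, (1 <= m <= N)%N ->
    let F0 := disc_filtration F tau (m - 2)%N in
    [/\ forall w f, L2x O f -> HS B O (G m w f),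
        forall A, norm_borel (HS B O) (HS_norm B O) A ->
          <<s ([set: Omega] `*` L2x O),
              [set S `*` D | S in F0 & D in norm_borel (L2x O) (L2x_norm O)] >>
            (([set: Omega] `*` L2x O) `&` [set wf | A (G m wf.1 wf.2)]),
        forall v, L2_random O F0 v ->
          (HS_second_moment O (fun w => G m w (v w))
           <= C%:E * (1 + second_moment O v))%E &
        forall v v', L2_random O F0 v -> L2_random O F0 v' ->
          (HS_second_moment O (fun w => G m w (v w) - G m w (v' w))%R
           <= C%:E * second_moment O (fun w => v w - v' w)%R)%E].

Definition noise T F O W (tau : R) (G : nat -> Omega -> (E -> E) -> U -> E -> E)
    (u : nat -> Omega -> E -> E) (m : nat) : Omega -> E -> E :=
  ito_integral T F O W
    (fun t w x a => weight tau m t *: G m w (u (m - 2)%N w) x a).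

Definition velocity_scheme T F O W p (V : set (E -> E)) (Q : set (E -> R))
    (N : nat) G (u0 : Omega -> E -> E) (u : nat -> Omega -> E -> E) : Prop :=
  let tau := T / N.+1%:R in
  [/\ u 0%N = u0,
      forall m w, (1 <= m <= N)%N -> Vdiv O V Q (u m w) &
      forall m xi, (1 <= m <= N)%N -> Vdiv O V Q xi ->
        {ae P, forall w,
          ip O (u m w - u m.-1 w) xi
          + tau * ip O (shear p \o sym_grad O (u m w)) (grad O xi)
          = ip O (noise T F O W tau G u m w) xi}].

Definition initial_pressure O (V : set (E -> E)) (Q : set (E -> R))
    (u0 : Omega -> E -> E) (pi_init : Omega -> E -> R) : Prop :=
  (forall w, Q (pi_init w)) /\
  forall xi, Vperp O V Q xi ->
    {ae P, forall w, pair_div O (pi_init w) xi = ip O (u0 w) xi}.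

Definition pressure_equation T F O W p (V : set (E -> E)) (Q : set (E -> R))
    (N : nat) G (u : nat -> Omega -> E -> E) (pi_init : Omega -> E -> R)
    (pi : nat -> Omega -> E -> R) : Prop :=
  let tau := T / N.+1%:R in
  [/\ forall m w, (m <= N)%N -> Q (pi m w),
      {ae P, forall w, qsim O V Q (pi 0%N w) (pi_init w)} &
      forall m xi, (1 <= m <= N)%N -> Vperp O V Q xi ->
        {ae P, forall w,
          pair_div O (pi m w \- pi m.-1 w) xi
          = ip O (u m w - u m.-1 w) xi
            + tau * ip O (shear p \o sym_grad O (u m w)) (grad O xi)
            - ip O (noise T F O W tau G u m w) xi}].

End stochastics.

(* Main.v *)
(* Choose L^2-orthonormal bases (f_i) of V_div and (e_j) of V_div^perp. Only the zero functional on
   V_div^perp vanishes against all e_j, and q_j in Q_h with (q_j, div e_i) = delta_ij exist because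
   no nonzero element of V_div^perp annihilates Q_h; hence Q_h/~ is the dual of V_div^perp, a
   pressure is its vector of pairings with the e_j, and the norm Q_sto is the Euclidean norm of that
   vector. This gives existence, uniqueness and the explicit formulas by summing the increments.

   The integrand a_l G_l(u_(l-2)) is F_(t_(l-2) + tau/2)-measurable up to the weight, whose support
   starts at t_(l-1) - tau/2 = t_(l-2) + tau/2. Hence the noise increments with even index, and those
   with odd index, are martingale differences: squares of sums are bounded by sums of squares, and
   Doob's maximal inequality applies. Testing the velocity scheme with u_n and writing
   (noise, u_n) = (noise, u_n - u_(n-1)) + (noise, u_(n-1) - u_(n-2)) + (noise, u_(n-2)), where the
   last term has mean zero, the first two are absorbed by the jump terms, and a discrete Gronwall
   argument bounds E|u_n|^2 and the dissipation. Hoelder's inequality gives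
   |(S(eps u), grad xi)| <= (S(eps u), eps u)^(1/p') |grad xi|_p, so the p'-th power of the Q_det norm
   of the deterministic increment is controlled by the dissipation. *)
Require Import Defs.
From mathcomp Require Import all_boot all_order all_algebra.
From mathcomp Require Import all_classical all_reals all_analysis.
From mathcomp Require Import measurable_realfun.
From mathcomp Require Import ring lra.
Import Order.TTheory GRing.Theory Num.Theory.
Import numFieldNormedType.Exports.

Set Implicit Arguments.
Unset Strict Implicit.
Unset Printing Implicit Defensive.

Local Open Scope classical_set_scope.
Local Open Scope ring_scope.

(** * Lebesgue measure and the fundamental lemma *)

(** The velocities are given only as some solution of the scheme, so their adaptedness and square
    integrability have to be derived. Subtracting the scheme at two outcomes and using monotonicity
    of the viscous form shows that, off a null set, [u_m] is a 1-Lipschitz function of [u_(m-1)]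
    plus noise; this yields measurability for the complete discrete filtration and a second moment.
    Three conventions shape the rest. [grad] is an arbitrary choice among weak gradients, so its
    linearity rests on their uniqueness almost everywhere. The Ito integral is characterised by some
    sequence of elementary processes, which may live outside the support of the weight; clipping
    their time intervals restores adaptedness and orthogonality before the limit is taken. The
    [Qdet] norms and Hilbert-Schmidt errors come without measurability in the outcome, so they are
    bounded through the monotonicity of the nonnegative integral, which holds for all functions.
    Since [u_0] lies in [Vdiv], the class of the initial pressure vanishes almost surely, and the
    velocity increments drop out of the pressure equation. *)

Section lebesgue_boxes.
Context (R : realType) (n : nat).
Local Notation E := 'rV[R]_n.+1.
Local Notation leb := (leb R n).
Local Notation corners := (E * E)%type.

Lemma leb_box_le (c : corners) : (leb_outer (box c) <= (box_vol c)%:E)%E.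
Proof.
apply: ereal_inf_lbound => /=.
exists (fun k => if k == 0%N then c else (0, 0)).
  by move=> x cx; exists 0%N.
rewrite (nneseries_split 0%N 1%N); last by move=> k _; exact: box_vol_ge0.
rewrite add0n big_nat1 eseries0 ?adde0// => -[|i]// _ _.
by rewrite box_vol0.
Qed.

Definition set_coord (x : E) (i : 'I_n.+1) (a : R) : E :=
  \row_j (if j == i then a else x ord0 j).

Lemma box_vol_split (c : corners) i : box_vol c =
  (\prod_(j < n.+1 | j != i) Num.max 0 (c.2 ord0 j - c.1 ord0 j))
  * Num.max 0 (c.2 ord0 i - c.1 ord0 i).
Proof. by rewrite /box_vol (bigD1 i)//= mulrC. Qed.

(** Each box of a cover is cut at [a] into two boxes. Boxes are open, so the upper one starts at
    [a - dl] to catch the points on the hyperplane; the overlap has volume at most [A * dl], where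
    [A] is the cross-section, and [dl = e / (A + 1)] keeps this below [e]. *)
Lemma halfspace_caratheodory (i : 'I_n.+1) (a : R) :
  (leb_outer_measure R n).-caratheodory [set x : E | x ord0 i < a].
Proof.
set H := (X in _.-caratheodory X).
apply: le_caratheodory_measurable => X.
have boxH (c : corners) :
    (leb_outer (box c `&` H) + leb_outer (box c `&` ~` H) <= (box_vol c)%:E)%E.
  apply/lee_addgt0Pr => e e0.
  rewrite (box_vol_split c i).
  set A := \prod_(j < _ | _) _.
  have A0 : 0 <= A by apply: prodr_ge0 => j _; rewrite le_max lexx.
  pose dl := e / (A + 1).
  have dl0 : 0 < dl by rewrite divr_gt0// ltr_wpDl.
  pose c1 : corners := (c.1, set_coord c.2 i (Num.min (c.2 ord0 i) a)).
  pose c2 : corners := (set_coord c.1 i (Num.max (c.1 ord0 i) (a - dl)), c.2).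
  have v1 : box_vol c1 = A * Num.max 0 (Num.min (c.2 ord0 i) a - c.1 ord0 i).
    rewrite (box_vol_split c1 i) /= mxE eqxx; congr (_ * _).
    by apply: eq_bigr => j /negPf ji; rewrite /= mxE ji.
  have v2 : box_vol c2 = A * Num.max 0 (c.2 ord0 i - Num.max (c.1 ord0 i) (a - dl)).
    rewrite (box_vol_split c2 i) /= mxE eqxx; congr (_ * _).
    by apply: eq_bigr => j /negPf ji; rewrite /= mxE ji.
  have s1 : box c `&` H `<=` box c1.
    move=> x [cx Hx] j; rewrite /= mxE; have /andP[-> xj] := cx j.
    by case: eqP => [ji|//]; rewrite lt_min -ji xj ji.
  have s2 : box c `&` ~` H `<=` box c2.
    move=> x [cx /negP Hx] j; rewrite /= mxE; have /andP[xj ->] := cx j.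
    rewrite andbT; case: eqP => [ji|//]; rewrite gt_max -ji xj ji.
    by move: Hx; rewrite -leNgt; lra.
  apply: (@le_trans _ _ ((box_vol c1)%:E + (box_vol c2)%:E)%E).
    apply: leeD.
      exact: le_trans (le_leb_outer s1) (leb_box_le _).
    exact: le_trans (le_leb_outer s2) (leb_box_le _).
  rewrite -!EFinD lee_fin v1 v2 -mulrDr.
  apply: (@le_trans _ _ (A * (Num.max 0 (c.2 ord0 i - c.1 ord0 i) + dl))).
    rewrite ler_wpM2l//.
    move: dl0; rewrite !maxEle minEle; do ! case: ifPn; rewrite -?ltNge; lra.
  rewrite mulrDr lerD2l /dl mulrCA ger_pMr// ler_pdivrMr ?ltr_wpDl// mul1r; lra.
apply: le_ereal_inf_tmp => _ [F XF <-].
apply: (@le_trans _ _ (\sum_(k <oo) (leb_outer (box (F k) `&` H)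
    + leb_outer (box (F k) `&` ~` H)))%E); last first.
  by apply: lee_nneseries => k _ //=; rewrite adde_ge0 ?leb_outer_ge0.
rewrite nneseriesD; [|by move=> *; exact: leb_outer_ge0..].
apply: leeD.
  apply: (@le_trans _ _ (leb_outer (\bigcup_k (box (F k) `&` H)))).
    by apply: le_leb_outer => x [/XF[k _ kx] Hx]; exists k.
  exact: leb_outer_sigma_subadditive.
apply: (@le_trans _ _ (leb_outer (\bigcup_k (box (F k) `&` ~` H)))).
  by apply: le_leb_outer => x [/XF[k _ kx] Hx]; exists k.
exact: leb_outer_sigma_subadditive.
Qed.

Lemma measurable_coord (i : 'I_n.+1) :
  measurable_fun [set: Rn R n] (fun x : Rn R n => x ord0 i : R).
Proof.
apply: (measurability _ (RGenInftyO.measurableE R)) => /= _ [_ [a ->] <-].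
rewrite setTI.
rewrite (_ : _ @^-1` _ = [set x : E | x ord0 i < a]); first exact: halfspace_caratheodory.
by apply/seteqP; split => x /=; rewrite in_itv.
Qed.

Lemma measurable_box (c : corners) : measurable (box c : set (Rn R n)).
Proof.
rewrite (_ : box c = \bigcap_(i in [set: 'I_n.+1])
  ((fun x : Rn R n => x ord0 i : R) @^-1` `]c.1 ord0 i, c.2 ord0 i[)).
  apply: fin_bigcap_measurable => // i _.
  rewrite -[X in measurable X]setTI; apply: measurable_coord => //.
by apply/seteqP; split => [x cx i _|x cx i]; have := cx i; rewrite /= in_itv//=; apply.
Qed.

Definition rat_box (q : 'rV[rat]_n.+1 * 'rV[rat]_n.+1) : corners :=
  (map_mx ratr q.1, map_mx ratr q.2).

Definition cbox (c : corners) : set E :=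
  [set x | forall i, c.1 ord0 i <= x ord0 i <= c.2 ord0 i].

Lemma box_cbox c : box c `<=` cbox c.
Proof. by move=> x cx i; have /andP[/ltW -> /ltW ->] := cx i. Qed.

Lemma open_rat_box (O : set E) x : open O -> O x ->
  exists q, box (rat_box q) x /\ cbox (rat_box q) `<=` O.
Proof.
move=> oO Ox.
have /nbhs_ballP[e /= e0 eO] : nbhs x O by exact: open_nbhs_nbhs.
have hl i : {q : rat | x ord0 i - e / 2 < ratr q < x ord0 i}.
  by apply/cid; have [|q qi] := @rat_in_itvoo R (x ord0 i - e / 2) (x ord0 i);
    [lra|exists q; rewrite in_itv in qi].
have hu i : {q : rat | x ord0 i < ratr q < x ord0 i + e / 2}.
  by apply/cid; have [|q qi] := @rat_in_itvoo R (x ord0 i) (x ord0 i + e / 2);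
    [lra|exists q; rewrite in_itv in qi].
exists (\row_i sval (hl i), \row_i sval (hu i)); split.
  move=> i; rewrite /= !mxE; case: (hl i) => a /= /andP[_ ->].
  by case: (hu i) => b /= /andP[-> _].
move=> y cy; apply: eO; rewrite mx_norm_ball /ball_ /=.
rewrite [`|_|]mx_normrE; apply/bigmax_ltP; split => // -[j i] _ /=; rewrite ord1 !mxE.
have := cy i; rewrite /= !mxE; case: (hl i) => a /=; case: (hu i) => b /=.
move=> /andP[? ?] /andP[? ?] /andP[? ?].
by rewrite ltr_norml; apply/andP; split; lra.
Qed.

(** Rational corners make the family countable; codes that decode to nothing, or to a box not inside
    [O], yield the empty box [(0, 0)]. Asking for the closed boxes to lie in [O] is what later gives
    bump functions a compact support inside [O]. *)
Lemma open_bigcup_boxes (O : set E) : open O -> exists F : nat -> corners,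
  (forall k, cbox (F k) `<=` O \/ F k = (0, 0)) /\ O = \bigcup_k box (F k).
Proof.
move=> oO.
pose F k := if unpickle k is Some q then
  if `[< cbox (rat_box q) `<=` O >] then rat_box q else (0, 0) else (0, 0).
exists F; split.
  move=> k; rewrite /F; case: unpickle => [q|]; last by right.
  by case: asboolP; [left|right].
apply/seteqP; split => x.
  move=> Ox; have [q [qx qO]] := open_rat_box oO Ox.
  by exists (pickle q) => //; rewrite /F pickleK asboolT.
have b0 : box ((0, 0) : corners) x -> O x.
  by move=> /(_ ord0); rewrite /= !mxE => /andP[/lt_trans/[apply]]; rewrite ltxx.
move=> [k _]; rewrite /F; case: unpickle => [q|//].
by case: asboolP => // + qx; apply; exact: box_cbox.
Qed.

Lemma open_box (c : corners) : open (box c).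
Proof.
rewrite openE => x cx.
suff : \forall y \near x, forall i, c.1 ord0 i < (y : E) ord0 i < c.2 ord0 i by [].
apply: (@filter_forall _ _ (fun i (y : E) => c.1 ord0 i < y ord0 i < c.2 ord0 i) (nbhs x) (nbhs_filter x)) => i.
have /andP[h1 h2] := cx i.
have /= cc := @coord_continuous R 1 n.+1 ord0 i x.
near=> y; apply/andP; split; near: y.
  exact: cc _ (lt_nbhsr h1).
exact: cc _ (lt_nbhsl h2).
Unshelve. all: by end_near. Qed.

Lemma measurable_open (O : set E) : open O -> measurable (O : set (Rn R n)).
Proof.
by move=> /open_bigcup_boxes[F [_ ->]]; apply: bigcup_measurable => k _; exact: measurable_box.
Qed.

Lemma measurable_continuous (f : E -> R) :
  continuous f -> measurable_fun [set: Rn R n] (f : Rn R n -> R).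
Proof.
move=> /continuousP cf; apply: (measurability _ (RGenOpens.measurableE R)).
move=> _ [_ [a [b ->] <-]]; rewrite setTI; apply: measurable_open; apply: cf.
exact: interval_open.
Qed.

Lemma leb_bounded_lty (O : set E) : bounded_set O -> (leb O < +oo)%E.
Proof.
move=> [M [_ MO]].
have {}MO x : O x -> `|x| <= M + 1 by apply: MO; lra.
pose c : corners := (const_mx (- (M + 2)), const_mx (M + 2)).
have Oc : O `<=` box c.
  move=> x /MO xM i; rewrite /= !mxE -ltr_norml.
  apply: (@le_lt_trans _ _ (M + 1)); last lra.
  apply: le_trans xM; rewrite [leRHS]mx_normrE.
  by apply: (le_bigmax _ (fun ij => `|x ij.1 ij.2|) (ord0, i)).
apply: (@le_lt_trans _ _ (leb_outer (box c))); first exact: le_leb_outer.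
exact: le_lt_trans (leb_box_le _) (ltry _).
Qed.

End lebesgue_boxes.

(** * Smooth functions with compact support in boxes *)

Section bump.
Context (R : realType).

(** The factor [x ^- k] in front of [exp (- c / x)] makes the family stable under differentiation:
    the derivative is a combination of the members [k + 1] and [k + 2]. *)
Definition bexp (c : R) (k : nat) (x : R) : R :=
  if 0 < x then x ^- k * expR (- (c / x)) else 0.

Implicit Types (c x : R) (k : nat).

Lemma bexp_ge0 c k x : 0 <= bexp c k x.
Proof.
by rewrite /bexp; case: ifPn => // x0; rewrite mulr_ge0 ?expR_ge0// invr_ge0 exprn_ge0// ltW.
Qed.

Lemma bexp0_le1 c x : 0 < c -> bexp c 0 x <= 1.
Proof.
rewrite /bexp; case: ifPn => // x0 c0.
by rewrite expr0 invr1 mul1r -expR0 ler_expR oppr_le0 divr_ge0// ltW.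
Qed.

(** The inequality [exp y >= (y / (k + 2)) ^ (k + 2)], taken at [y = c / x], beats the negative
    power and leaves [x ^ 2]. This quadratic decay gives the derivative 0 at the origin. *)
Lemma bexp_le c k x : 0 < c -> bexp c k x <= (k.+2%:R / c) ^+ k.+2 * x ^+ 2.
Proof.
move=> c0; rewrite /bexp; case: ifPn => [x0|_]; last first.
  by rewrite mulr_ge0 ?sqr_ge0// exprn_ge0// divr_ge0// ltW.
have y0 : 0 < c / x / k.+2%:R by rewrite !divr_gt0.
have yle : (c / x / k.+2%:R) ^+ k.+2 <= expR (c / x).
  rewrite -[c / x in leRHS](@divfK _ k.+2%:R)// expRM_natr.
  rewrite ler_pXn2r ?nnegrE ?expR_ge0 ?(ltW y0)//.
  by apply: le_trans (expR_ge1Dx _); rewrite lerDr.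
rewrite expRN.
apply: (@le_trans _ _ (x ^- k * ((c / x / k.+2%:R) ^+ k.+2)^-1)).
  rewrite ler_wpM2l ?invr_ge0 ?exprn_ge0 ?(ltW x0)// lef_pV2 ?posrE ?expR_gt0//.
  by rewrite exprn_gt0.
rewrite !exprMn !exprVn le_eqVlt; apply/orP; left; apply/eqP.
by rewrite -[in x ^- k.+2]addn2 exprD; field; rewrite !lt0r_neq0 ?exprn_gt0.
Qed.

Lemma is_derive_bexp c k x : 0 < c ->
  is_derive x 1 (bexp c k) (- k%:R * bexp c k.+1 x + c * bexp c k.+2 x).
Proof.
move=> c0; have [x0|x0|->] := ltgtP x 0.
- rewrite (_ : _ + _ = 0); last first.
    by rewrite /bexp ltNge (ltW x0)/= !mulr0 addr0.
  apply: (@near_eq_is_derive _ _ _ (cst 0)).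
  near=> y; rewrite /bexp ltNge ifN//= negbK; apply: ltW; near: y.
  exact: lt_nbhsl.
- pose f y : R := (y^-1) ^+ k * expR (- c * y^-1).
  apply: (@near_eq_is_derive _ _ _ f).
    near=> y; rewrite /bexp/f ifT ?exprVn ?mulNr//; near: y.
    exact: lt_nbhsr.
  have xn0 : x != 0 by rewrite gt_eqF.
  have d1 : is_derive x 1 (fun y : R => y^-1) (- x ^- 2).
    apply: is_derive_eq; first exact: (@is_deriveV R id).
    by rewrite scaler1.
  have d2 := is_deriveZ (- c) d1.
  have d3 := is_derive1_comp (is_derive_expR _) d2.
  have d5 := is_deriveM (is_deriveX k d1) d3.
  rewrite (_ : f = (fun y => y^-1) ^+ k * (expR \o (- c \*: (fun y => y^-1)))).
    apply: (is_derive_eq d5).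
    rewrite /bexp x0 !exprfctE /= /GRing.scale /= !mulNr.
    case: k {f d5} => [|k]; rewrite -!exprVn ?expr0 ?exprS /=; ring.
  by apply/funext => y; rewrite /f /= exprfctE.
(* At 0 the difference quotient is at most a constant times [|h|], by [bexp_le]. *)
- rewrite /bexp ltxx !mulr0 addr0.
  have h0 : h^-1 *: ((bexp c k \o shift 0) (h *: 1) - bexp c k 0) @[h --> 0^'] --> (0 : R).
    rewrite /bexp ltxx; apply/cvgr0Pnorm_le => e e0; near=> h.
    rewrite /= subr0 addr0 /GRing.scale /= mulr1 -/(bexp c k h).
    have hn0 : h != 0 by near: h; exact: nbhs_dnbhs_neq.
    rewrite normrM normfV (ger0_norm (bexp_ge0 _ _ _)).
    rewrite mulrC ler_pdivrMr ?normr_gt0//.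
    apply: (le_trans (bexp_le _ _ c0)).
    rewrite -real_normK ?num_real// expr2 mulrA ler_wpM2r//.
    rewrite -ler_pdivlMl ?exprn_gt0 ?divr_gt0//.
    near: h; apply: dnbhs0_le.
    by rewrite mulr_gt0// invr_gt0 exprn_gt0// divr_gt0.
  by apply: DeriveDef; [exact: cvgP h0|exact: cvg_lim h0].
Unshelve. all: by end_near.
Qed.

End bump.

Section bump_functions.
Context (R : realType) (n : nat).
Local Notation E := 'rV[R]_n.+1.
Local Notation leb := (leb R n).
Local Notation corners := (E * E)%type.

(** An algebra of functions that contains its own partial derivatives; smoothness, which quantifies
    over all iterated partials, then follows by induction on the list of directions. *)
Inductive bumpalg : (E -> R) -> Prop :=
| bump_cst a : bumpalg (fun=> a)
| bump_base c k s i a : 0 < c -> bumpalg (fun x => bexp c k (s * x ord0 i + a))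
| bump_add f g : bumpalg f -> bumpalg g -> bumpalg (fun x => f x + g x)
| bump_mul f g : bumpalg f -> bumpalg g -> bumpalg (fun x => f x * g x).

Lemma differentiable_bump_base (c : R) k s i a (x : E) : 0 < c ->
  differentiable (fun x : E => bexp c k (s * x ord0 i + a)) x.
Proof.
move=> c0; apply: (@differentiable_comp _ _ _ _ (fun x : E => s * x ord0 i + a) (bexp c k)).
  apply: differentiableD => //; apply: differentiableM => //.
  exact: differentiable_coord.
apply/derivable1_diffP.
by have [] := is_derive_bexp k (s * x ord0 i + a) c0.
Qed.

Lemma partial_bump_base (c : R) k s i a j : 0 < c ->
  partial j (fun x : E => bexp c k (s * x ord0 i + a)) =
  (fun x => s *+ (i == j) * (- k%:R * bexp c k.+1 (s * x ord0 i + a)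
                   + c * bexp c k.+2 (s * x ord0 i + a))).
Proof.
move=> c0; apply/funext => x; rewrite /partial.
set y := s * x ord0 i + a.
pose G (h : R) := bexp c k (s *+ (i == j) * h + y).
have -> : 'D_(delta_mx ord0 j) (fun x : E => bexp c k (s * x ord0 i + a)) x = 'D_1 G 0.
  rewrite /derive; set u := (X in lim (X @ _) = _); set v := (X in _ = lim (X @ _)).
  suff -> : u = v by [].
  apply/funext => h; rewrite /u /v /=.
  rewrite !mxE /G eqxx mulr0 add0r addr0 /GRing.scale /= mulr1.
  congr (h^-1 * (bexp _ _ _ - _)).
  by rewrite /y; case: eqP => _; rewrite ?mulr1n ?mulr0n ?mulr1 ?mulr0; ring.
have := is_deriveD (is_deriveZ (s *+ (i == j)) (is_derive_id (0 : R) 1))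
  (is_derive_cst y (0 : R) 1).
rewrite addr0 [_ *: 1]mulr1 => d1.
have d0 : ((s *+ (i == j)) \*: id + cst y) 0 = y by rewrite !fctE /cst /= [_ *: 0]mulr0 add0r.
have := is_derive_bexp k y c0; rewrite -{1}d0 => d2.
have [_] := is_derive1_comp d2 d1.
rewrite (_ : _ \o _ = G); first by move=> ->; rewrite mulrC.
by [].
Qed.

Lemma bumpalg_partial f : bumpalg f ->
  (forall x, differentiable f x) /\ forall j, bumpalg (partial j f).
Proof.
elim=> {f} [a|c k s i a c0|f g bf [df Df] bg [dg Dg]|f g bf [df Df] bg [dg Dg]].
- split=> [x|j]; first exact: differentiable_cst.
  rewrite (_ : partial _ _ = fun=> 0); first exact: bump_cst.
  by apply/funext => x; rewrite /partial derive_cst.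
- split=> [x|j]; first exact: differentiable_bump_base.
  rewrite partial_bump_base//; apply: bump_mul; first exact: bump_cst.
  by apply: bump_add; (apply: bump_mul; [exact: bump_cst|exact: bump_base]).
- split=> [x|j]; first exact: differentiableD.
  rewrite (_ : partial _ _ = fun x => partial j f x + partial j g x).
    exact: bump_add.
  by apply/funext => x; rewrite /partial deriveD//; exact: diff_derivable.
- split=> [x|j]; first exact: differentiableM.
  rewrite (_ : partial _ _ = fun x => f x * partial j g x + g x * partial j f x).
    by apply: bump_add; exact: bump_mul.
  by apply/funext => x; rewrite /partial deriveM//; exact: diff_derivable.
Qed.

Lemma bumpalg_smooth f : bumpalg f -> smooth f.
Proof.
move=> bf s; suff /bumpalg_partial[] : bumpalg (foldr (@partial R n) f s) by [].
by elim: s => //= j s /bumpalg_partial[].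
Qed.

Lemma bump_prod (I : Type) (s : seq I) (F : I -> E -> R) :
  (forall i, bumpalg (F i)) -> bumpalg (fun x => \prod_(i <- s) F i x).
Proof.
move=> bF; elim: s => [|i s IH].
  rewrite (_ : (fun _ => _) = fun=> 1); first exact: bump_cst.
  by apply/funext => x; rewrite big_nil.
rewrite (_ : (fun _ => _) = fun x => F i x * \prod_(i <- s) F i x).
  exact: bump_mul.
by apply/funext => x; rewrite big_cons.
Qed.

(** Positive inside the box, zero outside, and tending to 1 inside as the parameter [e] decreases to
    0. *)
Definition box_bump (e : R) (c : corners) (x : E) : R :=
  \prod_(i < n.+1) (bexp e 0 (x ord0 i - c.1 ord0 i) * bexp e 0 (c.2 ord0 i - x ord0 i)).

Lemma bumpalg_box_bump e c : 0 < e -> bumpalg (box_bump e c).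
Proof.
move=> e0; apply: bump_prod => i; apply: bump_mul.
  rewrite (_ : (fun _ => _) = (fun x : E => bexp e 0 (1 * x ord0 i + - c.1 ord0 i))).
    exact: bump_base.
  by apply/funext => x; rewrite mul1r.
rewrite (_ : (fun _ => _) = (fun x : E => bexp e 0 (-1 * x ord0 i + c.2 ord0 i))).
  exact: bump_base.
by apply/funext => x; rewrite mulN1r addrC.
Qed.

Lemma box_bump_itv (e : R) c x : 0 < e -> 0 <= box_bump e c x <= 1.
Proof.
move=> e0; apply/andP; split.
  by apply: prodr_ge0 => i _; rewrite mulr_ge0 ?bexp_ge0.
apply: (@le_trans _ _ (\prod_(i < n.+1) (1 : R))); last by rewrite big1.
apply: ler_prod => i _.
by rewrite mulr_ge0 ?bexp_ge0//= mulr_ile1 ?bexp_ge0 ?bexp0_le1.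
Qed.

Lemma box_bump_out (e : R) c x : ~ box c x -> box_bump e c x = 0.
Proof.
move=> /existsNP[i /negP]; rewrite negb_and -!leNgt => /orP h.
rewrite /box_bump (bigD1 i)//=; case: h => h; rewrite /bexp.
  by rewrite [0 < _ - c.1 _ _]ltNge subr_le0 h /= !mul0r.
by rewrite [0 < c.2 _ _ - _]ltNge subr_le0 h /= mulr0 mul0r.
Qed.

Lemma cvg_bexp0 (y : R) : 0 < y -> bexp k.+1%:R^-1 0 y @[k --> \oo] --> (1 : R).
Proof.
move=> y0; rewrite /bexp y0 expr0 invr1 -[X in _ --> X](@mulr1 R).
apply: cvgM; first exact: cvg_cst.
rewrite -[X in _ --> X](@expR0 R).
apply: continuous_cvg; first exact: continuous_expR.
rewrite -oppr0; apply: cvgN; rewrite -(mul0r y^-1); apply: cvgMr_tmp; exact: cvg_harmonic.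
Qed.

Lemma cvg_box_bump c x : box c x -> box_bump k.+1%:R^-1 c x @[k --> \oo] --> (1 : R).
Proof.
move=> cx; rewrite /box_bump.
have step i : bexp k.+1%:R^-1 0 (x ord0 i - c.1 ord0 i)
    * bexp k.+1%:R^-1 0 (c.2 ord0 i - x ord0 i) @[k --> \oo] --> (1 : R).
  have /andP[h1 h2] := cx i; rewrite -[X in _ --> X](@mulr1 R).
  by apply: cvgM; apply: cvg_bexp0; rewrite subr_gt0.
have := (@cvg_big _ _ ( *%R : R -> R -> R) 1 xpredT mul_continuous _ _ (index_enum 'I_n.+1)
  _ (fun=> 1) _ (fun i _ => step i)).
by rewrite [\prod_i 1]big1//; apply.
Qed.

End bump_functions.

Lemma cvg_Rintegral d (T : measurableType d) (R : realType)
    (mu : {measure set T -> \bar R}) (D : set T) (mD : measurable D)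
    (f_ : nat -> T -> R) (f g : T -> R) :
  (forall k, measurable_fun D (f_ k)) -> measurable_fun D f ->
  mu.-integrable D (EFin \o g) ->
  {ae mu, forall x, D x -> f_ k x @[k --> \oo] --> f x} ->
  {ae mu, forall x, D x -> forall k, `|f_ k x| <= g x} ->
  (\int[mu]_(x in D) f_ k x) @[k --> \oo] --> \int[mu]_(x in D) f x.
Proof.
move=> mf_ mf ig ff fg.
have [//|||//||intf _ cv] := @dominated_convergence _ _ _ mu D mD
  (fun k => EFin \o f_ k) (EFin \o f) (EFin \o g).
- by move=> k; apply/measurable_EFinP.
- exact/measurable_EFinP.
- by apply: filterS ff => x h Dx; apply: cvg_EFin; [near=> k|exact: h].
- by apply: filterS fg => x h k Dx; rewrite /= lee_fin h.
rewrite /Rintegral; apply: fine_cvg; rewrite fineK; last exact: integrable_fin_num.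
exact: cv.
Unshelve. all: by end_near. Qed.

Section ae_on_filter.
Context (R : realType) (n : nat) (O : set 'rV[R]_n.+1).
Implicit Types P Q S : 'rV[R]_n.+1 -> Prop.

Lemma ae_onW P : (forall x, O x -> P x) -> ae_on O P.
Proof. by move=> h; apply: aeW. Qed.

Let F := ae_filter_ringOfSetsType (leb R n).

Lemma ae_onS P S : (forall x, O x -> P x -> S x) -> ae_on O P -> ae_on O S.
Proof. by move=> h; rewrite /ae_on; apply: (@filterS _ _ F) => x Px Ox; exact: h (Px Ox). Qed.

Lemma ae_onS2 P Q S : (forall x, O x -> P x -> Q x -> S x) ->
  ae_on O P -> ae_on O Q -> ae_on O S.
Proof.
move=> h; rewrite /ae_on; apply: (@filterS2 _ _ F) => x Px Qx Ox.
exact: h (Px Ox) (Qx Ox).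
Qed.

Lemma ae_on_forall (I : finType) (P : I -> 'rV[R]_n.+1 -> Prop) :
  (forall i, ae_on O (P i)) -> ae_on O (fun x => forall i, P i x).
Proof.
move=> h; have := @filter_forall _ _ (fun i x => O x -> P i x) _ F h.
by rewrite /ae_on; apply: (@filterS _ _ F) => x hx Ox i; exact: hx.
Qed.

End ae_on_filter.

(** * The fundamental lemma of the calculus of variations *)

Section fundamental_lemma.
Context (R : realType) (n : nat) (O : set 'rV[R]_n.+1) (oO : open O).
Local Notation E := 'rV[R]_n.+1.
Local Notation leb := (leb R n).
Local Notation corners := (E * E)%type.

Lemma compact_cbox (c : corners) : compact (cbox c).
Proof.
have := @rV_compact R n.+1 (fun i => `[c.1 ord0 i, c.2 ord0 i]%classic)
  (fun i => @segment_compact _ _ _).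
by rewrite (_ : [set v | _] = cbox c).
Qed.

(** A smooth replacement for the indicator of the union of the first [m] boxes: it stays between 0
    and 1 and dominates each single bump. The one index [m] drives both the number of boxes and
    their sharpness, so a single limit yields the whole union. *)
Definition boxes_bump (F : nat -> corners) (m : nat) (x : E) : R :=
  1 - \prod_(k < m) (1 - box_bump m.+1%:R^-1 (F k) x).

Lemma boxes_bump_prod (F : nat -> corners) m (x : E) : 0 <= \prod_(k < m) (1 - box_bump m.+1%:R^-1 (F k) x) <= 1.
Proof.
have b k : 0 <= 1 - box_bump (m.+1%:R^-1 : R) (F k) x <= 1.
  have /andP[h0 h1] := @box_bump_itv R n m.+1%:R^-1 (F k) x ltac:(by []).
  by rewrite subr_ge0 h1 gerBl.
rewrite prodr_ge0 => [|k _]; last by have /andP[] := b k.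
apply: (@le_trans _ _ (\prod_(k < m) (1 : R))); last by rewrite big1.
exact: ler_prod.
Qed.

Lemma boxes_bump_test (U : set E) (F : nat -> corners) m : (forall k, cbox (F k) `<=` U \/ F k = (0, 0)) ->
  U `<=` O -> test_function O (boxes_bump F m).
Proof.
move=> FU UO; split.
  apply: bumpalg_smooth; rewrite (_ : boxes_bump _ _ = (fun x => 1 +
    -1 * \prod_(k <- enum 'I_m) (1 + -1 * box_bump m.+1%:R^-1 (F k) x))).
    apply: bump_add; first exact: bump_cst.
    apply: bump_mul; first exact: bump_cst.
    apply: bump_prod => k; apply: bump_add; first exact: bump_cst.
    by apply: bump_mul; [exact: bump_cst|exact: bumpalg_box_bump].
  apply/funext => x; rewrite mulN1r big_enum /boxes_bump /=; congr (1 - _).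
  by apply: eq_bigr => k _; rewrite mulN1r.
(* The closed box of the dummy corners [(0, 0)] is the point 0, which may lie outside [U]; it is
   then replaced by the empty set. *)
exists (\bigcup_(k < m) (if `[< cbox (F k) `<=` U >] then cbox (F k) else set0)); split.
- rewrite bigcup_mkord; apply: bigsetU_compact => k _.
  by case: ifPn => _; [exact: compact_cbox|exact: compact0].
- move=> x [k _]; case: ifPn => // /asboolP kU /kU; exact: UO.
- move=> x nx; rewrite /boxes_bump big1 ?subrr// => k _.
  rewrite box_bump_out ?subr0// => kx; apply: nx.
  have [kU|k0] := FU k; last first.
    have := kx ord0; rewrite k0 /= !mxE => /andP[/lt_trans/[apply]].
    by rewrite ltxx.
  by exists k => //=; rewrite asboolT//; exact: box_cbox.
Qed.

Lemma cvg_boxes_bump (F : nat -> corners) (x : E) :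
  boxes_bump F m x @[m --> \oo] --> (\1_(\bigcup_k box (F k)) x : R).
Proof.
rewrite indicE; have [/set_mem [k _ kx]|/negP nx] := boolP (x \in _).
  apply: (@squeeze_cvgr nat \oo _ R (fun m => box_bump m.+1%:R^-1 (F k) x) (fun=> 1)).
  - near=> m.
    have /andP[h0 h1] := boxes_bump_prod F m x.
    rewrite /boxes_bump; apply/andP; split; last by rewrite gerBl.
    rewrite lerBrDl.
    have km : (k < m)%N by near: m; exists k.+1.
    rewrite -lerBrDr (bigD1 (Ordinal km))//= ler_piMr//.
      by have /andP[] := @box_bump_itv R n m.+1%:R^-1 (F k) x ltac:(by []); rewrite subr_ge0.
    apply: (@le_trans _ _ (\prod_(i < m | i != Ordinal km) (1 : R))); last by rewrite big1.
    apply: ler_prod => i _.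
    have /andP[h2 h3] := @box_bump_itv R n m.+1%:R^-1 (F i) x ltac:(by []).
    by rewrite subr_ge0 h3 gerBl.
  - exact: cvg_box_bump.
  - exact: cvg_cst.
rewrite (_ : (fun m => _) = fun=> 0); first exact: cvg_cst.
apply/funext => m; rewrite /boxes_bump big1 ?subrr// => k _.
by rewrite box_bump_out ?subr0// => kx; apply: nx; rewrite inE; exists k.
Unshelve. all: by end_near. Qed.

(** The indicator of [U] is a pointwise limit of test functions with values in [[0, 1]]; dominated
    convergence with majorant [|g|] carries the vanishing over to the limit. *)
Lemma integral_open0 (g : E -> R) (U : set E) : leb.-integrable O (EFin \o g) ->
  (forall phi, test_function O phi -> (forall x, `|phi x| <= 1) -> \int[leb]_(x in O) (g x * phi x) = 0) ->
  open U -> U `<=` O -> \int[leb]_(x in U) g x = 0.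
Proof.
move=> ig g0 oU UO; have [F [FU UF]] := open_bigcup_boxes oU.
have mO := measurable_open oO.
have tst m := boxes_bump_test m FU UO.
have mt m : measurable_fun (O : set (Rn R n)) (boxes_bump F m).
  apply: measurable_funTS; apply: measurable_continuous => x.
  by apply: differentiable_continuous; exact: ((tst m).1 [::]).
have mg : measurable_fun (O : set (Rn R n)) g.
  by apply/measurable_EFinP; exact: measurable_int ig.
have := @cvg_Rintegral _ _ _ leb O mO (fun m x => g x * boxes_bump F m x)
  (fun x => g x * \1_U x) (fun x => `|g x|).
have -> : (fun m => \int[leb]_(x in O) (g x * boxes_bump F m x)) = fun=> 0.
  apply/funext => m; apply: g0 => // x; have /andP[h0 h1] := boxes_bump_prod F m x.
  by rewrite /boxes_bump ger0_norm ?subr_ge0// gerBl.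
move=> cv; have {cv} : (fun=> 0 : R) @ \oo --> \int[leb]_(x in O) (g x * \1_U x).
  apply: cv.
  - by move=> m; exact: measurable_funM.
  - by apply: measurable_funM => //; exact: measurable_indic (measurable_open oU).
  - exact: integrable_norm.
  - apply: aeW => x Ox; apply: cvgM; first exact: cvg_cst.
    by rewrite UF; exact: cvg_boxes_bump.
  - apply: aeW => x Ox m; rewrite normrM ler_piMr//.
    have /andP[h0 h1] := boxes_bump_prod F m x.
    by rewrite /boxes_bump ger0_norm ?subr_ge0// gerBl.
move=> /(cvg_lim (@Rhausdorff R)); rewrite lim_cst// => ->; rewrite /Rintegral; congr fine.
rewrite -[in LHS](setIidr UO) integral_mkcondr; apply: eq_integral => x xO.
by rewrite patchE indicE; case: ifPn => xU; rewrite ?mulr1 ?mulr0.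
Qed.

(** Outer regularity is built into [leb_outer], whose covers consist of open boxes. *)
Lemma leb_outer_approx (A : set E) (e : R) : A `<=` O -> (leb O < +oo)%E -> 0 < e ->
  exists V : set E, [/\ open V, A `<=` V, V `<=` O & (leb V < leb A + e%:E)%E].
Proof.
move=> AO Ofin e0.
have finA : leb_outer A \is a fin_num.
  rewrite ge0_fin_numE ?leb_outer_ge0//; apply: le_lt_trans Ofin; exact: le_leb_outer.
have [_ [F AF <-] Fe] := lb_ereal_inf_adherent e0 finA.
exists ((\bigcup_k box (F k)) `&` O); split.
- apply: openI => //; apply: bigcup_open => k _; exact: open_box.
- by move=> x Ax; split; [exact: AF|exact: AO].
- by move=> x [].
- apply: le_lt_trans Fe.
  apply: (@le_trans _ _ (leb_outer (\bigcup_k box (F k)))).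
    by apply: le_leb_outer => x [].
  apply: (le_trans (leb_outer_sigma_subadditive _)).
  by apply: lee_nneseries => [k _ _|k _]; [exact: (leb_outer_ge0 (box (F k)))|exact: leb_box_le].
Qed.

(** Let [A] be the part of [O] where [g > 0], and [V] an open superset of nearly the same measure.
    As the integral over [V] vanishes, the one over [A] is minus that over the difference of [V] and
    [A], which is small by absolute continuity. Hence it is 0, and [A] is null. *)
Lemma fundamental_lemma_le (g : E -> R) : (leb O < +oo)%E -> leb.-integrable O (EFin \o g) ->
  (forall phi, test_function O phi -> (forall x, `|phi x| <= 1) -> \int[leb]_(x in O) (g x * phi x) = 0) ->
  ae_on O (fun x => g x <= 0).
Proof.
move=> Ofin ig g0; have mO := measurable_open oO.
have mg : measurable_fun (O : set (Rn R n)) g.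
  by apply/measurable_EFinP; exact: measurable_int ig.
pose A : set E := O `&` [set x | 0 < g x].
have mA : measurable (A : set (Rn R n)).
  rewrite /A (_ : [set x | 0 < g x] = g @^-1` `]0, +oo[); first exact: mg.
  by apply/seteqP; split => x /=; rewrite in_itv/= andbT.
have AO : A `<=` O by move=> x [].
have gA x : A x -> 0 <= g x by move=> [_ /ltW].
have igA : leb.-integrable A (EFin \o g) by exact: integrableS ig.
have A0 : \int[leb]_(x in A) g x = 0.
  apply/eqP; rewrite eq_le Rintegral_ge0// andbT.
  apply/ler_addgt0Pr => e e0; rewrite add0r.
  have igT : leb.-integrable [set: Rn R n] (EFin \o (g \_ O)).
    by rewrite -restrict_EFin; exact: ((integrable_mkcond _ mO).1 ig).
  have [dl [dl0 Hdl]] := integral_normr_continuous igT e0.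
  have [V [oV AV VO Vdl]] := leb_outer_approx AO Ofin dl0.
  have mV := measurable_open oV.
  have mVA : measurable (V `\` A : set (Rn R n)) by exact: measurableD.
  have VA : (leb (V `\` A) < dl%:E)%E.
    rewrite measureD//; last by apply: le_lt_trans Ofin; exact: le_leb_outer.
    have finA : leb A \is a fin_num.
      rewrite ge0_fin_numE; last exact: measure_ge0.
      apply: le_lt_trans Ofin; exact: le_leb_outer.
    rewrite (setIidr AV) lteBlDr; last exact: finA.
    by rewrite addeC; exact: Vdl.
  have igVA : leb.-integrable (V `\` A) (EFin \o g).
    by apply: integrableS ig => // x [/VO].
  have := integral_open0 ig g0 oV VO.
  rewrite -{1}(setDUK AV) Rintegral_setU//; last 2 first.
  - by rewrite setDUK//; exact: integrableS ig.
  - by apply/disj_setPS => x [? []].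
  move=> /eqP; rewrite addr_eq0 => /eqP ->.
  apply: (le_trans (ler_norm _)); rewrite normrN.
  apply: (le_trans (le_normr_Rintegral mVA igVA)).
  apply: (le_trans _ (ltW (Hdl _ mVA VA))).
  rewrite le_eqVlt; apply/orP; left; apply/eqP; apply: eq_Rintegral => x.
  by rewrite inE => -[/VO Ox _]; rewrite patchE mem_set.
have /ae_eq_integral_abs : (\int[leb]_(x in A) `|(g x)%:E| = 0)%E.
  rewrite -[RHS](congr1 EFin A0) /Rintegral fineK; last exact: integrable_fin_num.
  by apply: eq_integral => x; rewrite inE => /gA gx; rewrite gee0_abs// lee_fin.
move=> /(_ mA) h; have {h} := (h ltac:(by apply/measurable_EFinP; exact: measurable_funS mg)).
apply: filterS => x h Ox; rewrite leNgt; apply/negP => gx.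
by have /eqP := h (conj Ox gx); rewrite /= eqe gt_eqF.
Qed.

Lemma fundamental_lemma (g : E -> R) : (leb O < +oo)%E -> leb.-integrable O (EFin \o g) ->
  (forall phi, test_function O phi -> (forall x, `|phi x| <= 1) -> \int[leb]_(x in O) (g x * phi x) = 0) ->
  ae_on O (fun x => g x = 0).
Proof.
move=> Ofin ig g0; have mO := measurable_open oO.
have h1 := fundamental_lemma_le Ofin ig g0.
have h2 : ae_on O (fun x => - g x <= 0).
  apply: fundamental_lemma_le => //.
    rewrite (_ : _ \o _ = -%E \o (EFin \o g))//; exact: integrableN.
  move=> phi tphi phi1; rewrite (_ : (fun x => _) = (fun x => -1 * (g x * phi x))); last first.
    by apply/funext => x; rewrite mulN1r mulNr.
  rewrite RintegralZl ?g0 ?mulr0//.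
  apply: (le_integrable mO _ _ ig) => [|x Ox].
    apply/measurable_EFinP; apply: measurable_funM.
      by apply/measurable_EFinP; exact: measurable_int ig.
    apply: measurable_funTS; apply: measurable_continuous => x.
    by apply: differentiable_continuous; exact: (tphi.1 [::]).
  by rewrite /= lee_fin normrM ler_piMr.
apply: ae_onS2 h1 h2 => x Ox h1 h2.
by apply/eqP; rewrite eq_le h1//= -oppr_le0 h2.
Qed.

End fundamental_lemma.

(** * Square-integrable fields and weak gradients *)

(** The form is only asked to behave well on a subset [S], because integrals of arbitrary functions
    are not linear, and it may vanish on nonzero vectors, because functions equal almost everywhere
    are not identified. The same record serves matrices, fields, random variables and the space
    [U]. *)
Record semi_inner (R : realType) (X : lmodType R) (S : set X) (b : X -> X -> R) : Prop :=
  SemiInner {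
    si_0 : S 0;
    si_lin : forall (a : R) v w, S v -> S w -> S (a *: v + w);
    si_C : forall v w, S v -> S w -> b v w = b w v;
    si_bilin : forall (a : R) v w z, S v -> S w -> S z ->
      b (a *: v + w) z = a * b v z + b w z;
    si_ge0 : forall v, S v -> 0 <= b v v }.

Definition orthonormal (R : realType) (X : lmodType R) (b : X -> X -> R) (r : nat)
  (e : 'I_r -> X) : Prop := forall i j, b (e i) (e j) = (i == j)%:R.

Section semi_inner_product.
Context (R : realType) (X : lmodType R) (S : set X) (b : X -> X -> R).
Hypothesis H : semi_inner S b.
Local Notation orthonormal := (orthonormal b).
Let S0 := si_0 H.
Let Slin := si_lin H.
Let bC := si_C H.
Let blin := si_bilin H.
Let b_ge0 := si_ge0 H.

Lemma subspD v w : S v -> S w -> S (v + w).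
Proof. by move=> Sv Sw; rewrite -[v]scale1r; exact: Slin. Qed.

Lemma subspZ a v : S v -> S (a *: v).
Proof. by move=> Sv; rewrite -[_ *: _]addr0; exact: Slin. Qed.

Lemma subspB v w : S v -> S w -> S (v - w).
Proof. by move=> Sv Sw; rewrite addrC -scaleN1r; exact: Slin. Qed.

Lemma subsp_sum (I : Type) (s : seq I) (F : I -> X) :
  (forall i, S (F i)) -> S (\sum_(i <- s) F i).
Proof.
move=> SF; elim: s => [|i s IH]; rewrite ?big_nil// big_cons.
exact: subspD.
Qed.

Lemma form0l z : S z -> b 0 z = 0.
Proof.
by move=> Sz; have := blin (-1) S0 S0 Sz; rewrite scaler0 addr0 => ->; rewrite mulN1r addNr.
Qed.

Lemma formZl a v z : S v -> S z -> b (a *: v) z = a * b v z.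
Proof. by move=> Sv Sz; rewrite -[_ *: _]addr0 blin// form0l// addr0. Qed.

Lemma formDl v w z : S v -> S w -> S z -> b (v + w) z = b v z + b w z.
Proof. by move=> Sv Sw Sz; rewrite -[v in LHS]scale1r blin// mul1r. Qed.

Lemma formBl v w z : S v -> S w -> S z -> b (v - w) z = b v z - b w z.
Proof.
by move=> Sv Sw Sz; rewrite addrC -scaleN1r blin// mulN1r addrC.
Qed.

Lemma formBr v w z : S v -> S w -> S z -> b z (v - w) = b z v - b z w.
Proof. by move=> Sv Sw Sz; rewrite bC ?formBl 1?bC ?(bC Sw)//; exact: subspB. Qed.

Lemma formDr v w z : S v -> S w -> S z -> b z (v + w) = b z v + b z w.
Proof. by move=> Sv Sw Sz; rewrite bC ?formDl 1?bC ?(bC Sw)//; exact: subspD. Qed.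

Lemma formZr a v z : S v -> S z -> b z (a *: v) = a * b z v.
Proof. by move=> Sv Sz; rewrite bC ?formZl 1?bC//; exact: subspZ. Qed.

Lemma form_suml (I : Type) (s : seq I) (c : I -> R) (F : I -> X) z :
  (forall i, S (F i)) -> S z ->
  b (\sum_(i <- s) c i *: F i) z = \sum_(i <- s) c i * b (F i) z.
Proof.
move=> SF Sz; elim: s => [|i s IH]; rewrite ?big_nil ?form0l// !big_cons.
by rewrite blin ?IH//; apply: subsp_sum => j; exact: subspZ.
Qed.

Lemma form_sumr (I : Type) (s : seq I) (c : I -> R) (F : I -> X) z :
  (forall i, S (F i)) -> S z ->
  b z (\sum_(i <- s) c i *: F i) = \sum_(i <- s) c i * b z (F i).
Proof.
move=> SF Sz; rewrite bC//; last by apply: subsp_sum => j; exact: subspZ.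
by rewrite form_suml//; apply: eq_bigr => i _; rewrite bC.
Qed.

Lemma formBB v w x y : S v -> S w -> S x -> S y ->
  b (v - w) (x - y) = b v x - b v y - b w x + b w y.
Proof.
move=> Sv Sw Sx Sy; rewrite formBl//; last exact: subspB.
by rewrite !formBr// opprB addrA addrAC.
Qed.

Lemma form_sqrD v w : S v -> S w -> b (v + w) (v + w) = b v v + 2 * b v w + b w w.
Proof.
move=> Sv Sw; have Svw := subspD Sv Sw.
by rewrite formDl// !formDr// (bC Sw Sv); ring.
Qed.

Lemma form_sqrB v w : S v -> S w -> b (v - w) (v - w) = b v v - 2 * b v w + b w w.
Proof.
move=> Sv Sw; have Svw := subspB Sv Sw.
by rewrite formBl// !formBr// (bC Sw Sv); ring.
Qed.

Lemma form_CS v w : S v -> S w -> b v w ^+ 2 <= b v v * b w w.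
Proof.
move=> Sv Sw.
have pos t : 0 <= b v v - 2 * t * b v w + t ^+ 2 * b w w.
  have Stw : S (t *: w) by exact: subspZ.
  have := b_ge0 (subspB Sv Stw); rewrite form_sqrB// !formZr// formZl//.
  by move=> h; rewrite (_ : _ + _ = b v v - 2 * (t * b v w) + t * (t * b w w))//; ring.
have := b_ge0 Sw; rewrite le_eqVlt => /orP[/eqP w0|w0].
  rewrite -w0 mulr0; have [->|vw0] := eqVneq (b v w) 0; first by rewrite expr0n.
  (* With [b w w = 0] the quadratic is affine in [t]; at this [t] it would equal -1. *)
  have := pos ((b v v + 1) / (2 * b v w)); rewrite -w0 mulr0 addr0.
  rewrite (_ : 2 * _ * _ = b v v + 1); last by field.
  by rewrite opprD addrA subrr sub0r oppr_ge0 ler10.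
have := pos (b v w / b w w).
rewrite (_ : _ + _ = (b v v * b w w - b v w ^+ 2) / b w w); last by field; rewrite gt_eqF.
by rewrite pmulr_lge0 ?invr_gt0// subr_ge0.
Qed.

Lemma form_le2 v w : S v -> S w -> b v v <= 2 * b w w + 2 * b (v - w) (v - w).
Proof.
move=> Sv Sw; have Svw := subspB Sv Sw.
have -> : v = w + (v - w) by rewrite addrC subrK.
rewrite {1}form_sqrD//; have := b_ge0 (subspB Sw Svw).
by rewrite form_sqrB// [w + (v - w)]addrC subrK; lra.
Qed.

Lemma form_le_young (dl : R) v w : 0 < dl -> S v -> S w ->
  b v v <= (1 + dl) * b w w + (1 + dl^-1) * b (v - w) (v - w).
Proof.
move=> dl0 Sv Sw; have Svw := subspB Sv Sw.
have e : b v v = b w w + 2 * b w (v - w) + b (v - w) (v - w).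
  by rewrite -form_sqrD// [w + _]addrC subrK.
have Sdw : S (dl *: w) by exact: subspZ.
have := b_ge0 (subspB Sdw Svw); rewrite (form_sqrB Sdw Svw) !formZl// formZr//.
rewrite (_ : _ - _ + _ = dl * (dl * b w w - 2 * b w (v - w) + dl^-1 * b (v - w) (v - w))).
  by rewrite pmulr_rge0// e; lra.
by field; rewrite gt_eqF.
Qed.

Lemma form_sqrB_le v w : S v -> S w -> b (v - w) (v - w) <= 2 * b v v + 2 * b w w.
Proof.
move=> Sv Sw; have := b_ge0 (subspD Sv Sw); rewrite (form_sqrD Sv Sw) (form_sqrB Sv Sw); lra.
Qed.

Lemma form_sqrD_le v w : S v -> S w -> b (v + w) (v + w) <= 2 * b v v + 2 * b w w.
Proof.
move=> Sv Sw; have := b_ge0 (subspB Sv Sw); rewrite (form_sqrD Sv Sw) (form_sqrB Sv Sw); lra.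
Qed.

Lemma form_norm_le v w : S v -> S w ->
  Num.sqrt (b v v) <= Num.sqrt (b w w) + Num.sqrt (b (v - w) (v - w)).
Proof.
move=> Sv Sw; have Svw := subspB Sv Sw.
rewrite -ler_sqr ?nnegrE ?sqrtr_ge0 ?addr_ge0 ?sqrtr_ge0// sqrrD !sqr_sqrtr ?b_ge0//.
have -> : b v v = b w w + 2 * b w (v - w) + b (v - w) (v - w).
  by rewrite -form_sqrD// [w + _]addrC subrK.
rewrite lerD2r lerD2l mulr_natl lerMn2r/=.
apply: (le_trans (ler_norm _)); rewrite -sqrtrM ?b_ge0// -sqrtr_sqr ler_sqrt ?mulr_ge0 ?b_ge0//.
exact: form_CS.
Qed.

Section bessel.
Variables (r : nat) (e : 'I_r -> X).
Hypotheses (Se : forall i, S (e i)) (oe : orthonormal e).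

Lemma form_onb_sum (c : 'I_r -> R) j : b (\sum_i c i *: e i) (e j) = c j.
Proof.
rewrite form_suml// (bigD1 j)//= oe eqxx mulr1 big1 ?addr0// => i /negPf ij.
by rewrite oe ij mulr0.
Qed.

Lemma form_onb_sqr (c : 'I_r -> R) :
  b (\sum_i c i *: e i) (\sum_i c i *: e i) = \sum_i c i ^+ 2.
Proof.
rewrite form_sumr//; last by apply: subsp_sum => i; exact: subspZ.
by apply: eq_bigr => i _; rewrite form_onb_sum expr2.
Qed.

Lemma form_resid v : S v -> b (v - \sum_i b v (e i) *: e i) (v - \sum_i b v (e i) *: e i)
  = b v v - \sum_i b v (e i) ^+ 2.
Proof.
move=> Sv; have Ss : S (\sum_i b v (e i) *: e i) by apply: subsp_sum => i; exact: subspZ.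
rewrite form_sqrB// form_onb_sqr form_sumr//.
under eq_bigr do rewrite -expr2; ring.
Qed.

Lemma bessel v : S v -> \sum_i b v (e i) ^+ 2 <= b v v.
Proof.
move=> Sv; rewrite -subr_ge0 -form_resid//; apply: b_ge0; apply: subspB => //.
by apply: subsp_sum => i; exact: subspZ.
Qed.

End bessel.

Lemma form_null v w : S v -> S w -> b v v = 0 -> b v w = 0.
Proof.
move=> Sv Sw v0; apply/eqP; rewrite -sqrf_eq0 eq_le sqr_ge0 andbT.
by apply: le_trans (form_CS Sv Sw) _; rewrite v0 mul0r.
Qed.

Lemma orthonormal_dim (m r : nat) (g : 'I_m -> X) (e : 'I_r -> X) :
  (forall i, S (g i)) -> (forall i, S (e i)) -> orthonormal e ->
  (forall j, exists c : 'I_m -> R,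
     b (e j - \sum_i c i *: g i) (e j - \sum_i c i *: g i) = 0) ->
  (r <= m)%N.
Proof.
move=> Sg Se oe /choice[c ce]; rewrite leqNgt; apply/negP => mr.
pose M : 'M[R]_(r, m) := \matrix_(j, i) c j i.
have /rowV0Pn[v /sub_kermxP vM v0] : kermx M != 0.
  rewrite -mxrank_eq0 mxrank_ker subn_eq0 -ltnNge.
  exact: leq_ltn_trans (rank_leq_col _) mr.
have Sc j : S (\sum_i c j i *: g i) by apply: subsp_sum => i; exact: subspZ.
have Sd j : S (e j - \sum_i c j i *: g i) by exact: subspB.
have /rV0Pn[k vk] := v0.
have : b (\sum_j v ord0 j *: e j) (e k) = v ord0 k by rewrite form_onb_sum.
have -> : \sum_j v ord0 j *: e j = \sum_j v ord0 j *: (e j - \sum_i c j i *: g i).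
  under [RHS]eq_bigr do rewrite scalerBr; rewrite sumrB.
  rewrite [X in _ - X](_ : _ = 0) ?subr0//.
  under eq_bigr do rewrite scaler_sumr; rewrite exchange_big/= big1// => i _.
  under eq_bigr do rewrite scalerA; rewrite -scaler_suml.
  move/rowP : vM => /(_ i); rewrite !mxE => vi.
  by rewrite (_ : \sum_j _ = 0) ?scale0r// -[RHS]vi; apply: eq_bigr => j _; rewrite mxE.
rewrite form_suml// big1 => [/esym/eqP|j _]; first by rewrite (negPf vk).
by rewrite form_null// mulr0.
Qed.

(** A largest orthonormal family in [S'] exists since sizes are bounded by [m], and a residual of
    positive norm could be normalised and added to it. The generators [g] may lie outside [S'], as
    happens when [S'] is cut out of a space with a known spanning family. *)
Lemma onb_exists (S' : set X) (m : nat) (g : 'I_m -> X) :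
  S' `<=` S -> S' 0 -> (forall (a : R) v w, S' v -> S' w -> S' (a *: v + w)) ->
  (forall i, S (g i)) ->
  (forall v, S' v -> exists c : 'I_m -> R,
     b (v - \sum_i c i *: g i) (v - \sum_i c i *: g i) = 0) ->
  exists (r : nat) (e : 'I_r -> X), [/\ forall i, S' (e i), orthonormal e &
    forall v, S' v -> b (v - \sum_i b v (e i) *: e i) (v - \sum_i b v (e i) *: e i) = 0].
Proof.
move=> S'S S'0 S'lin Sg gen.
pose Pr r := `[< exists e : 'I_r -> X, (forall i, S' (e i)) /\ orthonormal e >].
have exP : exists r, Pr r.
  by exists 0%N; apply/asboolP; exists (fun=> 0); split => // -[].
have leP r : Pr r -> (r <= m)%N.
  move=> /asboolP[e [S'e oe]]; apply: (@orthonormal_dim m r g e) => // i; last exact: gen.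
  exact: S'S.
have [r /asboolP[e [S'e oe]] max] := ex_maxnP exP leP.
exists r, e; split => // v S'v.
have Se i : S (e i) by exact: S'S.
have Sv := S'S _ S'v.
set w := v - _.
have S's : S' (\sum_i b v (e i) *: e i).
  elim/big_ind : _ => // [x y Sx Sy|i _]; first by rewrite -[x]scale1r; exact: S'lin.
  by rewrite -[_ *: _]addr0; exact: S'lin.
have S'w : S' w by rewrite /w addrC -scaleN1r; exact: S'lin.
have Sw := S'S _ S'w.
have we i : b w (e i) = 0.
  by rewrite /w formBl//; [rewrite form_onb_sum// subrr|exact: S'S].
apply/eqP; apply: contraT => w0.
have w_gt0 : 0 < b w w by rewrite lt_neqAle eq_sym w0 b_ge0.
suff : Pr r.+1 by move=> /max; rewrite ltnn.
apply/asboolP; exists (fun i => if unlift ord0 i is Some j then e j else (Num.sqrt (b w w))^-1 *: w).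
have Sz : S ((Num.sqrt (b w w))^-1 *: w) by exact: subspZ.
split=> [i|i j].
  case: unliftP => [j _|_] //; rewrite -[_ *: _]addr0; exact: S'lin.
case: unliftP => [i' ->|->]; case: unliftP => [j' ->|->].
- by rewrite oe (inj_eq (@lift_inj _ _)).
- by rewrite formZr// bC// we mulr0.
- by rewrite formZl// we mulr0.
- by rewrite formZl// formZr// mulrA -expr2 exprVn sqr_sqrtr ?ltW// mulVf.
Qed.

End semi_inner_product.

Lemma ge0_integrableP d (T : measurableType d) (R : realType)
    (mu : {measure set T -> \bar R}) (D : set T) (f : T -> R) :
  measurable_fun D f -> (forall x, 0 <= f x) ->
  mu.-integrable D (EFin \o f) <-> (\int[mu]_(x in D) (f x)%:E < +oo)%E.
Proof.
move=> mf f0.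
have e : (\int[mu]_(x in D) `|(EFin \o f) x| = \int[mu]_(x in D) (f x)%:E)%E.
  by apply: eq_integral => x _; rewrite gee0_abs// lee_fin.
split=> [/integrableP[_]|h]; first by rewrite e.
by apply/integrableP; split; [exact/measurable_EFinP|rewrite e].
Qed.

Section frobenius.
Context (R : realType) (m k : nat).
Implicit Types A B : 'M[R]_(m, k).

Lemma frob_dotC A B : frob_dot A B = frob_dot B A.
Proof. by apply: eq_bigr => i _; apply: eq_bigr => j _; rewrite mulrC. Qed.

Lemma frob_dot_linl a A B D : frob_dot (a *: A + B) D = a * frob_dot A D + frob_dot B D.
Proof.
rewrite /frob_dot mulr_sumr -big_split/=; apply: eq_bigr => i _.
rewrite mulr_sumr -big_split/=; apply: eq_bigr => j _.
by rewrite !mxE mulrDl mulrA.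
Qed.

Lemma frob_dot_ge0 A : 0 <= frob_dot A A.
Proof. by apply: sumr_ge0 => i _; apply: sumr_ge0 => j _; rewrite -expr2 sqr_ge0. Qed.

Lemma frob_semi_inner : semi_inner [set: 'M[R]_(m, k)] (@frob_dot R m k).
Proof.
split=> // *; [exact: frob_dotC|exact: frob_dot_linl|exact: frob_dot_ge0].
Qed.

Lemma frob_ge0 A : 0 <= frob A. Proof. exact: sqrtr_ge0. Qed.

Lemma sqr_frob A : frob A ^+ 2 = frob_dot A A.
Proof. by rewrite sqr_sqrtr ?frob_dot_ge0. Qed.

Lemma frob_dot_CS A B : `|frob_dot A B| <= frob A * frob B.
Proof.
rewrite -ler_sqr ?nnegrE ?mulr_ge0 ?frob_ge0// real_normK ?num_real// exprMn !sqr_frob.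
exact: (form_CS frob_semi_inner).
Qed.

Lemma frob_triangle A B : frob A <= frob B + frob (A - B).
Proof. exact: (form_norm_le frob_semi_inner). Qed.

Lemma frob_dotZl a A B : frob_dot (a *: A) B = a * frob_dot A B.
Proof. exact: (formZl frob_semi_inner). Qed.

Lemma frob_dotZr a A B : frob_dot B (a *: A) = a * frob_dot B A.
Proof. by rewrite frob_dotC frob_dotZl frob_dotC. Qed.

Lemma frob_dotDl A B D : frob_dot (A + B) D = frob_dot A D + frob_dot B D.
Proof. exact: (formDl frob_semi_inner). Qed.

Lemma frob_dotDr A B D : frob_dot D (A + B) = frob_dot D A + frob_dot D B.
Proof. by rewrite frob_dotC frob_dotDl !(frob_dotC D). Qed.

Lemma frob_dotBl A B D : frob_dot (A - B) D = frob_dot A D - frob_dot B D.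
Proof. exact: (formBl frob_semi_inner). Qed.

Lemma frob_dot0l A : frob_dot 0 A = 0. Proof. exact: (form0l frob_semi_inner). Qed.

Lemma frobZ a A : frob (a *: A) = `|a| * frob A.
Proof.
by rewrite /frob frob_dotZl frob_dotZr mulrA -expr2 sqrtrM ?sqr_ge0// sqrtr_sqr.
Qed.

Lemma frob0 : frob (0 : 'M[R]_(m, k)) = 0.
Proof. by rewrite /frob frob_dot0l sqrtr0. Qed.

Lemma frobD A B : frob (A + B) <= frob A + frob B.
Proof. by have := frob_triangle (A + B) A; rewrite [A + B - A]addrAC subrr add0r. Qed.

Lemma ler_entry_frob A i j : `|A i j| <= frob A.
Proof.
rewrite -ler_sqr ?nnegrE ?frob_ge0// sqr_frob real_normK ?num_real//.
rewrite /frob_dot (bigD1 i)//= (bigD1 j)//= -expr2 -addrA lerDl addr_ge0//.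
  by apply: sumr_ge0 => l _; rewrite -expr2 sqr_ge0.
by apply: sumr_ge0 => l _; apply: sumr_ge0 => j' _; rewrite -expr2 sqr_ge0.
Qed.

Lemma frob_eq0 A : frob A = 0 -> A = 0.
Proof.
move=> A0; apply/matrixP => i j; rewrite mxE; apply/eqP.
by rewrite -normr_le0 -A0 ler_entry_frob.
Qed.

End frobenius.

Section L2_fields.
Context (R : realType) (n : nat) (O : set 'rV[R]_n.+1).
Local Notation E := 'rV[R]_n.+1.
Local Notation leb := (leb R n).
Hypotheses (mO : measurable (O : set (Rn R n))) (Ofin : (leb O < +oo)%E).

Section fixed_format.
Context (m k : nat).
Local Notation fld := (E -> 'M[R]_(m, k)).
Implicit Types f g : fld.

Lemma measurable_frob_dot f g : measurable_field O f -> measurable_field O g ->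
  measurable_fun (O : set (Rn R n)) (fun x => frob_dot (f x) (g x)).
Proof.
move=> mf mg; apply: measurable_sum => i; apply: measurable_sum => j.
by apply: measurable_funM; [exact: mf|exact: mg].
Qed.

Lemma measurable_frob f : measurable_field O f ->
  measurable_fun (O : set (Rn R n)) (fun x => frob (f x)).
Proof.
move=> mf; apply: (measurableT_comp (f := Num.sqrt : R -> R)); last exact: measurable_frob_dot.
by apply: continuous_measurable_fun; exact: sqrt_continuous.
Qed.

Lemma measurable_field_lin a f g : measurable_field O f -> measurable_field O g ->
  measurable_field O (a *: f + g).
Proof.
move=> mf mg i j.
rewrite (_ : (fun x => _) = (fun x => a * f x i j + g x i j)); last first.
  by apply/funext => x; rewrite !mxE.
by apply: measurable_funD; [apply: measurable_funM => //; exact: mf|exact: mg].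
Qed.

Lemma measurable_field0 : measurable_field O (0 : fld).
Proof.
move=> i j; rewrite (_ : (fun x => _) = (fun=> 0))//.
by apply/funext => x; rewrite mxE.
Qed.

Lemma L2P f : Lq O 2 f <-> measurable_field O f /\
  leb.-integrable O (EFin \o (fun x => frob_dot (f x) (f x))).
Proof.
have e : (fun x => (frob (f x) `^ 2)%:E) = (fun x => (frob_dot (f x) (f x))%:E).
  by apply/funext => x; rewrite -sqr_frob powR_mulrn ?frob_ge0.
rewrite /Lq /= e; split=> -[mf If]; split => //;
  have [h1 h2] := ge0_integrableP leb (measurable_frob_dot mf mf) (fun x => frob_dot_ge0 (f x)).
  exact: h2.
exact: h1.
Qed.

Lemma L2_integrable f g : Lq O 2 f -> Lq O 2 g ->
  leb.-integrable O (EFin \o (fun x => frob_dot (f x) (g x))).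
Proof.
move=> /L2P[mf If] /L2P[mg Ig].
apply: (le_integrable mO _ _ (integrableD mO If Ig)).
  by apply/measurable_EFinP; exact: measurable_frob_dot.
move=> x Ox; rewrite /= lee_fin [leRHS]ger0_norm ?addr_ge0 ?frob_dot_ge0//.
apply: (le_trans (frob_dot_CS _ _)); rewrite -!sqr_frob.
have := sqr_ge0 (frob (f x) - frob (g x)); rewrite sqrrB.
have := mulr_ge0 (frob_ge0 (f x)) (frob_ge0 (g x)); lra.
Qed.

Lemma L2_0 : Lq O 2 (0 : fld).
Proof.
apply/L2P; split; first exact: measurable_field0.
rewrite (_ : _ \o _ = cst 0%E); first exact: integrable0.
by apply/funext => x; congr EFin; exact: frob_dot0l.
Qed.

Lemma L2_lin (a : R) f g : Lq O 2 f -> Lq O 2 g -> Lq O 2 (a *: f + g).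
Proof.
move=> Lf Lg; apply/L2P; split; first by apply: measurable_field_lin; [case: Lf|case: Lg].
rewrite (_ : _ \o _ = (fun x => ((a ^+ 2)%:E * (frob_dot (f x) (f x))%:E
    + (2 * a)%:E * (frob_dot (f x) (g x))%:E) + (frob_dot (g x) (g x))%:E)%E).
  apply: integrableD => //; last exact: L2_integrable.
  by apply: integrableD => //; apply: integrableZl => //; exact: L2_integrable.
apply/funext => x; rewrite -!EFinM -!EFinD; congr EFin.
rewrite /= !fctE frob_dot_linl ![frob_dot _ (_ + _)]frob_dotC !frob_dot_linl (frob_dotC (g x)); ring.
Qed.

Lemma ipC f g : ip O f g = ip O g f.
Proof. by apply: eq_Rintegral => x _; rewrite frob_dotC. Qed.

Lemma ip_lin (a : R) f g h : Lq O 2 f -> Lq O 2 g -> Lq O 2 h ->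
  ip O (a *: f + g) h = a * ip O f h + ip O g h.
Proof.
move=> Lf Lg Lh; rewrite /ip -RintegralZl//; last exact: L2_integrable.
rewrite -RintegralD//; last 2 first.
- exact: (integrableZl mO a (L2_integrable Lf Lh)).
- exact: L2_integrable.
by apply: eq_Rintegral => x _; rewrite !fctE frob_dot_linl.
Qed.

Lemma ip_ge0 f : 0 <= ip O f f.
Proof. by apply: Rintegral_ge0 => x _; exact: frob_dot_ge0. Qed.

Lemma L2_semi_inner : semi_inner (Lq O 2) (@ip R n O m k).
Proof.
split; [exact: L2_0|exact: L2_lin|by move=> *; exact: ipC|exact: ip_lin|].
by move=> *; exact: ip_ge0.
Qed.

Lemma sqr_L2_norm f : Lq_norm O 2 f ^+ 2 = ip O f f.
Proof.
rewrite /Lq_norm -powR_mulrn ?powR_ge0// -powRrM mulVf// powRr1.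
  by apply: eq_Rintegral => x _; rewrite powR_mulrn ?frob_ge0// sqr_frob.
by apply: Rintegral_ge0 => x _; exact: powR_ge0.
Qed.

Lemma L2_norm_sqrt f : Lq_norm O 2 f = Num.sqrt (ip O f f).
Proof. by rewrite -sqr_L2_norm sqrtr_sqr ger0_norm// powR_ge0. Qed.

Lemma ip_null f : Lq O 2 f -> ip O f f = 0 -> ae_on O (fun x => f x = 0).
Proof.
move=> Lf f0; have := L2_integrable Lf Lf => If.
have : (\int[leb]_(x in O) `|(frob_dot (f x) (f x))%:E| = 0)%E.
  under eq_integral do rewrite gee0_abs ?lee_fin ?frob_dot_ge0//.
  by rewrite -[RHS](congr1 EFin f0) /ip /Rintegral fineK//; exact: integrable_fin_num.
move/(ae_eq_integral_abs _ mO (measurable_int _ If)); apply: filterS => x /[apply] /= /eqP.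
by rewrite eqe -sqr_frob sqrf_eq0 => /eqP /frob_eq0.
Qed.

Lemma ae_ip_null f g : Lq O 2 f -> Lq O 2 g -> ae_on O (fun x => f x = 0) -> ip O f g = 0.
Proof.
move=> Lf Lg f0; rewrite /ip /Rintegral (ae_eq_integral (fun=> 0%E)) ?integral0//.
  by have /measurable_int := L2_integrable Lf Lg.
by apply: (ae_onS _ f0) => x Ox ->; rewrite frob_dot0l.
Qed.

Lemma Loo_Lq (q : R) f : 0 <= q -> Loo O f -> Lq O q f.
Proof.
move=> q0 [mf [M fM]]; split => //.
apply: (@le_lt_trans _ _ (\int[leb]_(x in O) ((Num.max 0 M) `^ q)%:E)%E); last first.
  rewrite integral_cst//.
  by apply: lte_mul_pinfty; [rewrite lee_fin powR_ge0|by []|exact: Ofin].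
apply: ae_ge0_le_integral => //.
- by move=> x _; rewrite lee_fin powR_ge0.
- apply/measurable_EFinP; apply: (@measurableT_comp _ _ _ _ _ _ (@powR R ^~ q)) => //.
  exact: measurable_frob.
- by move=> x _; rewrite lee_fin powR_ge0.
- apply: (ae_onS _ fM) => x Ox xM; rewrite lee_fin ge0_ler_powR ?nnegrE ?frob_ge0//.
    by rewrite le_max lexx.
  by rewrite le_max xM orbT.
Qed.

Lemma Loo_lin (a : R) f g : Loo O f -> Loo O g -> Loo O (a *: f + g).
Proof.
move=> [mf [M fM]] [mg [N gN]]; split; first exact: measurable_field_lin.
exists (`|a| * M + N); apply: ae_onS2 fM gN => x Ox fx gx.
apply: (le_trans (frobD _ _)); rewrite frobZ lerD// ler_wpM2l//.
Qed.

End fixed_format.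
End L2_fields.

Lemma ae_on_Rintegral (R : realType) (n : nat) (O : set 'rV[R]_n.+1)
    (f g : 'rV[R]_n.+1 -> R) : measurable (O : set (Rn R n)) ->
  measurable_fun (O : set (Rn R n)) f -> measurable_fun (O : set (Rn R n)) g ->
  ae_on O (fun x => f x = g x) ->
  \int[leb R n]_(x in O) f x = \int[leb R n]_(x in O) g x.
Proof.
move=> mO /measurable_EFinP mf /measurable_EFinP mg fg.
rewrite /Rintegral; apply: (congr1 fine); apply: (ae_eq_integral _ _ mO mf mg).
by apply: (ae_onS _ fg) => x _ e; rewrite /= e.
Qed.

Section weak_gradients.
Context (R : realType) (n : nat) (O : set 'rV[R]_n.+1).
Local Notation E := 'rV[R]_n.+1.
Local Notation mat := 'M[R]_n.+1.
Local Notation leb := (leb R n).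
Hypotheses (oO : open O) (Ofin : (leb O < +oo)%E).
Let mO : measurable (O : set (Rn R n)) := measurable_open oO.

Lemma compact_support_bounded (f : E -> R) (K : set E) : continuous f -> compact K ->
  (forall x, ~ K x -> f x = 0) -> exists M, forall x, `|f x| <= M.
Proof.
move=> cf cK f0.
have /compact_bounded [M [_ MK]] : compact (f @` K).
  by apply: continuous_compact => //; exact: continuous_subspaceT.
exists (Num.max 0 (M + 1)) => x; rewrite le_max; have [Kx|nK] := pselect (K x).
  by apply/orP; right; apply: MK; [rewrite ltrDl|exists x].
by rewrite f0// normr0 lexx.
Qed.

Lemma test_function_bounded (phi : E -> R) : test_function O phi ->
  exists M, forall x, `|phi x| <= M.
Proof.
move=> [sphi [K [cK _ K0]]]; apply: compact_support_bounded cK K0.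
by move=> x; apply: differentiable_continuous; exact: (sphi [::]).
Qed.

Lemma partial_test_bounded (phi : E -> R) j : test_function O phi ->
  exists M, forall x, `|partial j phi x| <= M.
Proof.
move=> [sphi [K [cK _ K0]]]; apply: (compact_support_bounded _ cK).
  by move=> x; apply: differentiable_continuous; exact: (sphi [:: j]).
move=> x nK; rewrite /partial.
have oK : open (~` K) by apply: closed_openC; apply: (compact_closed _ cK); exact: (@norm_hausdorff R E).
rewrite (@near_eq_derive _ _ _ phi (cst 0)) ?derive_cst//.
by near=> y; apply: K0; near: y; exact: open_nbhs_nbhs.
Unshelve. all: by end_near. Qed.

Lemma measurable_partial_test (phi : E -> R) j : test_function O phi ->
  measurable_fun (O : set (Rn R n)) (partial j phi).
Proof.
move=> [sphi _]; apply: measurable_funTS; apply: measurable_continuous => x.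
by apply: differentiable_continuous; exact: (sphi [:: j]).
Qed.

Lemma measurable_test (phi : E -> R) : test_function O phi ->
  measurable_fun (O : set (Rn R n)) phi.
Proof.
move=> [sphi _]; apply: measurable_funTS; apply: measurable_continuous => x.
by apply: differentiable_continuous; exact: (sphi [::]).
Qed.

Lemma L1P (m k : nat) (f : E -> 'M[R]_(m, k)) : Lq O 1 f <->
  measurable_field O f /\ leb.-integrable O (EFin \o (fun x => frob (f x))).
Proof.
have e : (fun x => (frob (f x) `^ 1)%:E) = (fun x => (frob (f x))%:E).
  by apply/funext => x; rewrite powRr1 ?frob_ge0.
rewrite /Lq /= e; split=> -[mf If]; split => //;
  have [h1 h2] := ge0_integrableP leb (measurable_frob mf) (fun x => frob_ge0 (f x)).
  exact: h2.
exact: h1.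
Qed.

Lemma L1_lin (m k : nat) (a : R) (f g : E -> 'M[R]_(m, k)) :
  Lq O 1 f -> Lq O 1 g -> Lq O 1 (a *: f + g).
Proof.
move=> /L1P[mf If] /L1P[mg Ig]; apply/L1P; split; first exact: measurable_field_lin.
apply: (le_integrable mO _ _ (integrableD mO (integrableZl mO `|a| If) Ig)).
  apply/measurable_EFinP; apply: measurable_frob; exact: measurable_field_lin mf mg.
move=> x Ox; rewrite /= lee_fin ger0_norm ?frob_ge0//.
apply: le_trans (ler_norm _); apply: le_trans (frobD _ _) _.
by rewrite frobZ.
Qed.

Lemma L1_0 (m k : nat) : Lq O 1 (0 : E -> 'M[R]_(m, k)).
Proof.
apply/L1P; split; first exact: measurable_field0.
rewrite (_ : _ \o _ = cst 0%E); first exact: integrable0.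
by apply/funext => x; congr EFin; exact: frob0.
Qed.

Lemma L1_entry_integrable (m k : nat) (f : E -> 'M[R]_(m, k)) (h : E -> R) (M : R) i j :
  Lq O 1 f -> measurable_fun (O : set (Rn R n)) h -> (forall x, `|h x| <= M) ->
  leb.-integrable O (EFin \o (fun x => f x i j * h x)).
Proof.
move=> /L1P[mf If] mh hM.
apply: (le_integrable mO _ _ (integrableZl mO M If)).
  by apply/measurable_EFinP; apply: measurable_funM => //; exact: mf.
move=> x Ox; rewrite /= lee_fin normrM mulrC.
apply: le_trans (ler_norm _); apply: ler_pM => //; exact: ler_entry_frob.
Qed.

Lemma is_weak_grad0 : is_weak_grad O (0 : E -> E) 0.
Proof.
split; [exact: L1_0|exact: L1_0|move=> phi i j _].
rewrite /Rintegral !integral0_eq ?oppr0// => x Ox; rewrite /GRing.zero /= mxE mul0r//.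
Qed.

Lemma is_weak_grad_lin (a : R) (v w : E -> E) (g g' : E -> mat) :
  is_weak_grad O v g -> is_weak_grad O w g' -> is_weak_grad O (a *: v + w) (a *: g + g').
Proof.
move=> [Lv Lg vg] [Lw Lg' wg']; split; [exact: L1_lin|exact: L1_lin|move=> phi i j tphi].
have [M phiM] := test_function_bounded tphi.
have [M' phiM'] := partial_test_bounded j tphi.
have mp := measurable_test tphi; have mp' := measurable_partial_test j tphi.
transitivity (a * \int[leb]_(x in O) (v x ord0 i * partial j phi x)
    + \int[leb]_(x in O) (w x ord0 i * partial j phi x)).
  have I1 := L1_entry_integrable ord0 i Lv mp' phiM'.
  have I2 := L1_entry_integrable ord0 i Lw mp' phiM'.
  rewrite -RintegralZl// -RintegralD//; last exact: (integrableZl mO a I1).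
  by apply: eq_Rintegral => x _; rewrite !mxE mulrDl mulrA.
rewrite vg// wg'// mulrN -opprD; congr (- _).
have I1 := L1_entry_integrable i j Lg mp phiM.
have I2 := L1_entry_integrable i j Lg' mp phiM.
rewrite -RintegralZl// -RintegralD//; last exact: (integrableZl mO a I1).
by apply: eq_Rintegral => x _; rewrite !mxE mulrDl mulrA.
Qed.

Lemma is_weak_grad_sum (m : nat) (c : 'I_m -> R) (b : 'I_m -> E -> E) (g : 'I_m -> E -> mat) :
  (forall i, is_weak_grad O (b i) (g i)) ->
  is_weak_grad O (\sum_i c i *: b i) (\sum_i c i *: g i).
Proof.
move=> bg; elim: (index_enum 'I_m) => [|i s IH]; first by rewrite !big_nil; exact: is_weak_grad0.
by rewrite !big_cons; exact: is_weak_grad_lin.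
Qed.

(** [grad] selects some weak gradient by choice, so each algebraic rule for it holds only almost
    everywhere and goes through this lemma. The entries of the difference are annihilated by all
    test functions bounded by 1. *)
Lemma weak_grad_unique (v w : E -> E) (g g' : E -> mat) : ae_on O (fun x => v x = w x) ->
  is_weak_grad O v g -> is_weak_grad O w g' -> ae_on O (fun x => g x = g' x).
Proof.
move=> vw [Lv Lg vg] [Lw Lg' wg'].
have cst1 : (forall x : E, `|(fun=> 1 : R) x| <= 1) by move=> x; rewrite normr1.
have m1 : measurable_fun (O : set (Rn R n)) (fun=> 1 : R) by [].
suff ij (ij : 'I_n.+1 * 'I_n.+1) : ae_on O (fun x => g x ij.1 ij.2 = g' x ij.1 ij.2).
  apply: (ae_onS _ (ae_on_forall ij)) => x Ox gx; apply/matrixP => i j.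
  exact: (gx (i, j)).
case: ij => i j /=.
suff : ae_on O (fun x => g x i j - g' x i j = 0).
  by apply: ae_onS => x _ /eqP; rewrite subr_eq0 => /eqP.
apply: fundamental_lemma => //.
  have := integrableB mO (L1_entry_integrable i j Lg m1 cst1) (L1_entry_integrable i j Lg' m1 cst1).
  by apply: eq_integrable => // x _ /=; rewrite !mulr1.
move=> phi tphi phi1; have mp := measurable_test tphi.
have [M' phiM'] := partial_test_bounded j tphi.
have mp' := measurable_partial_test j tphi.
have I1 := L1_entry_integrable i j Lg mp phi1.
have I2 := L1_entry_integrable i j Lg' mp phi1.
transitivity (\int[leb]_(x in O) (g x i j * phi x) - \int[leb]_(x in O) (g' x i j * phi x)).
  by rewrite -RintegralB//; apply: eq_Rintegral => x _; rewrite mulrBl.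
apply/eqP; rewrite subr_eq0 -eqr_opp -vg// -wg'//; apply/eqP.
rewrite /Rintegral; congr fine; apply: ae_eq_integral => //.
- exact: measurable_int (L1_entry_integrable ord0 i Lv mp' phiM').
- exact: measurable_int (L1_entry_integrable ord0 i Lw mp' phiM').
- by apply: (ae_onS _ vw) => x Ox /= ->.
Qed.

Lemma grad_comb (m : nat) (c : 'I_m -> R) (b : 'I_m -> E -> E) (v : E -> E) :
  W1oo O v -> (forall i, W1oo O (b i)) ->
  ae_on O (fun x => v x = \sum_i c i *: b i x) ->
  ae_on O (fun x => grad O v x = \sum_i c i *: grad O (b i) x).
Proof.
move=> [gv _ _] gb vb.
have gs : is_weak_grad O (\sum_i c i *: b i) (\sum_i c i *: grad O (b i)).
  by apply: is_weak_grad_sum => i; case: (gb i).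
apply: (ae_onS _ (weak_grad_unique _ gv gs)) => [x _ ->|].
  by rewrite fct_sumE.
by apply: (ae_onS _ vb) => x _ ->; rewrite fct_sumE.
Qed.

End weak_gradients.

(** * The viscous form *)

Lemma Rintegral_hoelder d (T : measurableType d) (R : realType)
    (mu : {measure set T -> \bar R}) (D : set T) (mD : measurable D) (f g : T -> R) (a b : R) :
  measurable_fun D f -> measurable_fun D g -> (forall x, 0 <= f x) -> (forall x, 0 <= g x) ->
  0 < a -> 0 < b -> a^-1 + b^-1 = 1 ->
  mu.-integrable D (EFin \o (fun x => f x `^ a)) ->
  mu.-integrable D (EFin \o (fun x => g x `^ b)) ->
  \int[mu]_(x in D) (f x * g x) <=
  (\int[mu]_(x in D) (f x `^ a)) `^ a^-1 * (\int[mu]_(x in D) (g x `^ b)) `^ b^-1.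
Proof.
move=> mf mg f0 g0 a0 b0 ab If Ig.
have mF : measurable_fun [set: T] (f \_ D) by exact/(measurable_restrictT _ mD).1.
have mG : measurable_fun [set: T] (g \_ D) by exact/(measurable_restrictT _ mD).1.
have Npow (h : T -> R) c : (forall x, 0 <= h x) -> 0 < c ->
    mu.-integrable D (EFin \o (fun x => h x `^ c)) ->
    Lnorm mu c%:E (EFin \o (h \_ D)) = ((\int[mu]_(x in D) (h x `^ c)) `^ c^-1)%:E.
  move=> h0 c0 Ih; rewrite unlock /Lnorm -poweR_EFin; congr (_ `^ _)%E.
  rewrite /Rintegral fineK; last exact: integrable_fin_num.
  rewrite [RHS]integral_mkcond; apply: eq_integral => x _.
  rewrite /= !patchE; case: ifPn => _; first by rewrite ger0_norm.
  by rewrite /= normr0 powR0// gt_eqF.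
have := hoelder mu mF mG a0 b0 ab; rewrite (Npow f)// (Npow g)//.
rewrite Lnorm1 -EFinM.
rewrite (_ : (\int[mu]_x `| (EFin \o ((f \_ D) \* (g \_ D))%R) x|)%E =
    (\int[mu]_(x in D) (f x * g x)%:E)%E); last first.
  rewrite [RHS]integral_mkcond; apply: eq_integral => x _.
  rewrite /= !patchE; case: ifPn => _ /=; first by rewrite ger0_norm ?mulr_ge0.
  by rewrite mulr0 normr0.
have : (0 <= \int[mu]_(x in D) (f x * g x)%:E)%E.
  by apply: integral_ge0 => x _; rewrite lee_fin mulr_ge0.
by rewrite /Rintegral; case: (\int[mu]_(x in D) (f x * g x)%:E)%E.
Qed.

Section shear_matrix.
Context (R : realType) (n : nat) (p : R) (p1 : 1 < p).
Local Notation mat := 'M[R]_n.+1.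
Implicit Types A B G : mat.

Lemma frob_shear A : frob (shear p A) = frob A `^ (p - 1).
Proof.
rewrite /shear frobZ ger0_norm ?powR_ge0//.
have [A0|A0] := eqVneq (frob A) 0.
  by rewrite A0 mulr0 powR0// subr_eq0 gt_eqF.
by rewrite mulrC -{1}(powRr1 (frob_ge0 A)) -powRD ?A0 ?implybT//; congr (_ `^ _); ring.
Qed.

Lemma shear_dot_self A : frob_dot (shear p A) A = frob A `^ p.
Proof.
rewrite /shear frob_dotZl -sqr_frob.
have [A0|A0] := eqVneq (frob A) 0.
  by rewrite A0 expr0n mulr0 powR0// gt_eqF// (lt_trans _ p1).
by rewrite -powR_mulrn ?frob_ge0// -powRD ?A0 ?implybT//; congr (_ `^ _); ring.
Qed.

Lemma shear_dot_le A G : `|frob_dot (shear p A) G| <= frob A `^ (p - 1) * frob G.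
Proof. by rewrite -frob_shear; exact: frob_dot_CS. Qed.

(** Cauchy-Schwarz on the two mixed terms reduces the claim to [(a - b) * (a ^ (p - 1) - b ^ (p -
    1)) >= 0] for the norms [a] and [b], that is, to monotonicity of a power. *)
Lemma shear_mono A B : 0 <= frob_dot (shear p A) A - frob_dot (shear p A) B
  - frob_dot (shear p B) A + frob_dot (shear p B) B.
Proof.
rewrite !shear_dot_self.
have hA := le_trans (ler_norm _) (shear_dot_le A B).
have hB := le_trans (ler_norm _) (shear_dot_le B A).
set a := frob A in hA hB *; set b := frob B in hA hB *.
have a0 : 0 <= a by exact: frob_ge0.
have b0 : 0 <= b by exact: frob_ge0.
have pw x : 0 <= x -> x `^ p = x * x `^ (p - 1).
  by move=> x0; rewrite mulr_powRB1// (lt_trans _ p1).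
rewrite (pw a)// (pw b)//.
have : 0 <= (a - b) * (a `^ (p - 1) - b `^ (p - 1)).
  have [ab|/ltW ba] := leP a b.
    by rewrite mulr_le0// subr_le0// ge0_ler_powR// subr_ge0 ltW.
  by rewrite mulr_ge0// subr_ge0// ge0_ler_powR// subr_ge0 ltW.
by nra.
Qed.

Lemma shear_mono_dot A B : 0 <= frob_dot (shear p A - shear p B) (A - B).
Proof.
rewrite (formBB (@frob_semi_inner R n.+1 n.+1))//; exact: shear_mono.
Qed.

Lemma sym_frob_dot A G : A^T = A -> frob_dot A G = frob_dot A (2^-1 *: (G + G^T)).
Proof.
move=> sA; rewrite frob_dotZr frob_dotDr.
have -> : frob_dot A G^T = frob_dot A G.
  rewrite /frob_dot exchange_big/=; apply: eq_bigr => i _; apply: eq_bigr => j _.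
  by rewrite mxE -{1}sA mxE.
by field.
Qed.

Lemma frob_tr A : frob A^T = frob A.
Proof.
by rewrite /frob /frob_dot exchange_big/=; congr Num.sqrt;
  apply: eq_bigr => i _; apply: eq_bigr => j _; rewrite !mxE.
Qed.

Lemma frob_sym A : frob (2^-1 *: (A + A^T)) <= frob A.
Proof.
rewrite frobZ ger0_norm ?invr_ge0// ler_pdivrMl// mulr_natl mulr2n.
by apply: le_trans (frobD _ _) _; rewrite frob_tr.
Qed.

Lemma cvg_frob (A_ : nat -> mat) A : (frob (A_ k - A) @[k --> \oo] --> (0 : R)) ->
  frob (A_ k) @[k --> \oo] --> frob A.
Proof.
move=> cA; apply/cvgrPdist_le => e e0; near=> k.
apply: (@le_trans _ _ (frob (A_ k - A))).
  rewrite ler_norml; apply/andP; split.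
    by have := frob_triangle (A_ k) A; lra.
  by have := frob_triangle A (A_ k); rewrite -opprB -scaleN1r frobZ normrN1 mul1r; lra.
near: k; move/cvgr0Pnorm_le : cA => /(_ _ e0); apply: filterS => k.
by rewrite ger0_norm ?frob_ge0.
Unshelve. all: by end_near. Qed.

Lemma cvg_frob_dot (A_ : nat -> mat) A G : (frob (A_ k - A) @[k --> \oo] --> (0 : R)) ->
  frob_dot (A_ k) G @[k --> \oo] --> frob_dot A G.
Proof.
move=> cA; apply/cvgrPdist_le => e e0.
have G1 : 0 < frob G + 1 by rewrite ltr_wpDl ?frob_ge0.
near=> k.
rewrite distrC -frob_dotBl; apply: le_trans (frob_dot_CS _ _) _.
apply: (@le_trans _ _ (frob (A_ k - A) * (frob G + 1))).
  by rewrite ler_wpM2l ?frob_ge0// lerDl.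
rewrite -ler_pdivlMr//.
near: k; move/cvgr0Pnorm_le : cA => /(_ _ (divr_gt0 e0 G1)); apply: filterS => k.
by rewrite ger0_norm ?frob_ge0.
Unshelve. all: by end_near. Qed.

(** The factor [frob A ^ (p - 2)] is singular at 0 for [p < 2]. At a zero limit the bound by
    [frob A ^ (p - 1)] is used instead; at a nonzero limit the power is differentiable, hence
    continuous. *)
Lemma cvg_shear_dot (A_ : nat -> mat) A G : (frob (A_ k - A) @[k --> \oo] --> (0 : R)) ->
  frob_dot (shear p (A_ k)) G @[k --> \oo] --> frob_dot (shear p A) G.
Proof.
move=> cA; have cf := cvg_frob cA; have p10 : 0 < p - 1 by rewrite subr_gt0.
have [A0|A0] := eqVneq (frob A) 0.
  have -> : frob_dot (shear p A) G = 0.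
    apply/eqP; rewrite -normr_le0; apply: le_trans (shear_dot_le A G) _.
    by rewrite A0 powR0 ?mul0r// gt_eqF.
  apply/cvgr0Pnorm_le => e e0.
  have G1 : 0 < frob G + 1 by rewrite ltr_wpDl ?frob_ge0.
  have q0 : 0 < e / (frob G + 1) by rewrite divr_gt0.
  have q1 : 0 < (e / (frob G + 1)) `^ (p - 1)^-1 by rewrite powR_gt0.
  near=> k; apply: le_trans (shear_dot_le _ G) _.
  apply: (@le_trans _ _ (frob (A_ k) `^ (p - 1) * (frob G + 1))).
    by rewrite ler_wpM2l ?powR_ge0// lerDl.
  rewrite -ler_pdivlMr//.
  have -> : e / (frob G + 1) = ((e / (frob G + 1)) `^ (p - 1)^-1) `^ (p - 1).
    by rewrite -powRrM mulVf ?gt_eqF// powRr1// ltW.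
  rewrite ge0_ler_powR ?nnegrE ?frob_ge0 ?powR_ge0 ?(ltW p10)//.
  near: k; rewrite A0 in cf.
  move/cvgr0Pnorm_le : cf => /(_ _ q1); apply: filterS => k.
  by rewrite ger0_norm ?frob_ge0.
have A1 : 0 < frob A by rewrite lt_neqAle eq_sym A0 frob_ge0.
rewrite /shear; under eq_fun do rewrite frob_dotZl; rewrite frob_dotZl.
apply: cvgM; last exact: cvg_frob_dot.
have cc : x `^ (p - 2) @[x --> frob A] --> frob A `^ (p - 2).
  have [d _] := is_derive1_powR (p - 2) A1.
  have /differentiable_continuous : differentiable (@powR R ^~ (p - 2)) (frob A).
    exact/derivable1_diffP.
  exact.
exact: (cvg_comp _ _ cf cc).
Unshelve. all: by end_near. Qed.

End shear_matrix.

(* The default [done] would unfold these predicates down to the Caratheodory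
   criterion and not return. *)
Ltac done ::=
  lazymatch goal with
  | |- Lq _ _ _ => assumption
  | |- L2x _ _ => assumption
  | |- Loo _ _ => assumption
  | |- W1oo _ _ => assumption
  | |- measurable_field _ _ => assumption
  | |- _ =>
    trivial; hnf; intros; solve
     [ do ![solve [trivial | apply: sym_equal; trivial]
           | discriminate | contradiction | split]
     | match goal with H : ~ _ |- _ => solve [case H; trivial] end ]
  end.

Section field_functionals.
Context (R : realType) (n : nat) (O : set 'rV[R]_n.+1) (p : R).
Local Notation E := 'rV[R]_n.+1.
Local Notation mat := 'M[R]_n.+1.
Local Notation leb := (leb R n).
Hypotheses (oO : open O) (Ofin : (leb O < +oo)%E) (p1 : 1 < p).
Let mO : measurable (O : set (Rn R n)) := measurable_open oO.
Let L2si m k := @L2_semi_inner R n O mO m k.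
Let gsi := L2si n.+1 n.+1.
Let vsi := L2si 1 n.+1.

Lemma ip_ae (m k : nat) (f f' g : E -> 'M[R]_(m, k)) : Lq O 2 f -> Lq O 2 f' -> Lq O 2 g ->
  ae_on O (fun x => f x = f' x) -> ip O f g = ip O f' g.
Proof.
move=> Lf Lf' Lg ff'; apply/eqP; rewrite -subr_eq0 -(formBl (L2si m k))//.
apply/eqP; apply: (ae_ip_null mO _ Lg); first exact: (subspB (L2si m k) Lf Lf').
by apply: (ae_onS _ ff') => x _ e; rewrite !fctE e subrr.
Qed.

Lemma grad_L2 (v : E -> E) : W1oo O v -> Lq O 2 (grad O v).
Proof. by move=> [_ _ gv]; apply: Loo_Lq. Qed.

Lemma grad_Lp (v : E -> E) : W1oo O v -> Lq O p (grad O v).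
Proof. by move=> [_ _ gv]; apply: Loo_Lq => //; rewrite ltW// (lt_trans _ p1). Qed.

Lemma W1oo_L2 (v : E -> E) : W1oo O v -> L2x O v.
Proof. by move=> [_ gv _]; apply: Loo_Lq. Qed.

Lemma ip_grad_comb (h : E -> mat) (m : nat) (c : 'I_m -> R) (b : 'I_m -> E -> E) (v : E -> E) :
  Lq O 2 h -> W1oo O v -> (forall i, W1oo O (b i)) ->
  ae_on O (fun x => v x = \sum_i c i *: b i x) ->
  ip O h (grad O v) = \sum_i c i * ip O h (grad O (b i)).
Proof.
move=> Lh Wv Wb vb.
have Lb i := grad_L2 (Wb i).
rewrite -(form_sumr gsi _ _ Lb Lh).
rewrite ipC [RHS]ipC; apply: (ip_ae (grad_L2 Wv) _ Lh).
  by apply: (subsp_sum gsi) => i; apply: (subspZ gsi); exact: Lb.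
by apply: (ae_onS _ (grad_comb oO Ofin Wv Wb vb)) => x _ ->; rewrite fct_sumE.
Qed.

Lemma ip_comb (h : E -> E) (m : nat) (c : 'I_m -> R) (b : 'I_m -> E -> E) (v : E -> E) :
  L2x O h -> L2x O v -> (forall i, L2x O (b i)) ->
  ae_on O (fun x => v x = \sum_i c i *: b i x) ->
  ip O h v = \sum_i c i * ip O h (b i).
Proof.
move=> Lh Wv Wb vb.
rewrite -(form_sumr vsi _ _ Wb Lh).
rewrite ipC [RHS]ipC; apply: (ip_ae Wv _ Lh).
  by apply: (subsp_sum vsi) => i; apply: (subspZ vsi); exact: Wb.
by apply: (ae_onS _ vb) => x _ ->; rewrite fct_sumE.
Qed.

(** The isotropic tensor turns the pairing with a divergence into the [L^2] product with a gradient
    ([pair_divE]), so that linearity is inherited from [L2_semi_inner]. *)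
Definition pressure_field (q : E -> R) : E -> mat := fun x => q x *: 1%:M.

Lemma pair_divE q v : pair_div O q v = ip O (pressure_field q) (grad O v).
Proof.
apply: eq_Rintegral => x _; rewrite frob_dotZl; congr (_ * _).
rewrite /div /mxtrace; apply: eq_bigr => i _.
rewrite (bigD1 i)//= mxE eqxx mul1r big1 ?addr0// => j /negPf ij.
by rewrite mxE eq_sym ij mul0r.
Qed.

Definition bounded_pressure (q : E -> R) : Prop :=
  measurable_fun (O : set (Rn R n)) q /\ exists M : R, ae_on O (fun x => `|q x| <= M).

Lemma pressure_field_L2 q : bounded_pressure q -> Lq O 2 (pressure_field q).
Proof.
move=> [mq [M qM]]; apply: Loo_Lq => //; split.
  move=> i j; rewrite (_ : (fun x => _) = (fun x => q x * (1%:M : mat) i j)).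
    exact: measurable_funM.
  by apply/funext => x; rewrite mxE.
exists (M * frob (1%:M : mat)); apply: (ae_onS _ qM) => x _ xM.
by rewrite frobZ ler_wpM2r// frob_ge0.
Qed.

Lemma pair_div_comb q (m : nat) (c : 'I_m -> R) (b : 'I_m -> E -> E) (v : E -> E) :
  bounded_pressure q -> W1oo O v -> (forall i, W1oo O (b i)) ->
  ae_on O (fun x => v x = \sum_i c i *: b i x) ->
  pair_div O q v = \sum_i c i * pair_div O q (b i).
Proof.
move=> bq Wv Wb vb; rewrite pair_divE (ip_grad_comb _ Wv Wb vb)//.
  by apply: eq_bigr => i _; rewrite pair_divE.
exact: pressure_field_L2.
Qed.

Lemma pair_div_lin (a : R) q1 q2 v : bounded_pressure q1 -> bounded_pressure q2 ->
  W1oo O v ->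
  pair_div O (fun x => a * q1 x + q2 x) v = a * pair_div O q1 v + pair_div O q2 v.
Proof.
move=> b1 b2 Wv; rewrite !pair_divE.
rewrite (_ : pressure_field _ = a *: pressure_field q1 + pressure_field q2).
  by rewrite (si_bilin gsi)//; [exact: pressure_field_L2..|exact: grad_L2].
by apply/funext => x; rewrite /pressure_field scalerDl -scalerA.
Qed.

Lemma pair_div_sum (m : nat) (c : 'I_m -> R) (q : 'I_m -> E -> R) v :
  (forall i, bounded_pressure (q i)) -> W1oo O v ->
  pair_div O (fun x => \sum_i c i * q i x) v = \sum_i c i * pair_div O (q i) v.
Proof.
move=> bq Wv; rewrite pair_divE.
rewrite (_ : pressure_field _ = \sum_i c i *: pressure_field (q i)).
  rewrite (form_suml gsi); [|by move=> i; exact: pressure_field_L2|exact: grad_L2].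
  by apply: eq_bigr => i _; rewrite pair_divE.
apply/funext => x; rewrite fct_sumE /pressure_field scaler_suml.
by apply: eq_bigr => i _; rewrite -scalerA.
Qed.

Lemma sym_grad_Loo v : W1oo O v -> Loo O (sym_grad O v).
Proof.
move=> [_ _ [mg [M gM]]]; split.
  move=> i j; rewrite (_ : (fun x => _) = (fun x => 2^-1 * (grad O v x i j + grad O v x j i))).
    apply: measurable_funM; first exact: measurable_cst.
    by apply: measurable_funD; exact: mg.
  by apply/funext => x; rewrite !mxE.
exists M; apply: (ae_onS _ gM) => x _ xM.
exact: le_trans (frob_sym _) xM.
Qed.

Lemma shear_Loo (h : E -> mat) : Loo O h -> Loo O (shear p \o h).
Proof.
move=> [mh [M hM]]; split.
  move=> i j; rewrite (_ : (fun x => _) = (fun x => frob (h x) `^ (p - 2) * h x i j)).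
    apply: measurable_funM; last exact: mh.
    apply: (measurableT_comp (measurable_powR (p - 2))); exact: measurable_frob.
  by apply/funext => x; rewrite mxE.
exists (Num.max 0 M `^ (p - 1)); apply: (ae_onS _ hM) => x _ xM.
rewrite frob_shear// ge0_ler_powR ?nnegrE ?frob_ge0 ?subr_ge0 ?(ltW p1)//.
  by rewrite le_max lexx.
by rewrite le_max xM orbT.
Qed.

Definition visc (u xi : E -> E) : R := ip O (shear p \o sym_grad O u) (grad O xi).

Lemma shear_sym_L2 u : W1oo O u -> Lq O 2 (shear p \o sym_grad O u).
Proof. by move=> Wu; apply: Loo_Lq => //; apply: shear_Loo; exact: sym_grad_Loo. Qed.

Lemma visc_comb (m : nat) (c : 'I_m -> R) (b : 'I_m -> E -> E) (u v : E -> E) :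
  W1oo O u -> W1oo O v -> (forall i, W1oo O (b i)) ->
  ae_on O (fun x => v x = \sum_i c i *: b i x) ->
  visc u v = \sum_i c i * visc u (b i).
Proof. by move=> Wu; apply: ip_grad_comb; exact: shear_sym_L2. Qed.

(** The stress is symmetric and sees only the symmetric part of a gradient. In this form stress and
    argument match, so that pointwise monotonicity applies. *)
Lemma visc_sym u xi : visc u xi = ip O (shear p \o sym_grad O u) (sym_grad O xi).
Proof.
apply: eq_Rintegral => x _; apply: sym_frob_dot.
apply/matrixP => i j; rewrite /= /shear /sym_grad !mxE; congr (_ * (_ * _)).
exact: addrC.
Qed.

Lemma visc_self u : visc u u = \int[leb]_(x in O) (frob (sym_grad O u x) `^ p).
Proof. by rewrite visc_sym; apply: eq_Rintegral => x _; rewrite shear_dot_self. Qed.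

Lemma visc_self_ge0 u : 0 <= visc u u.
Proof. by rewrite visc_self; apply: Rintegral_ge0 => x _; exact: powR_ge0. Qed.

Lemma visc_mono u v : W1oo O u -> W1oo O v ->
  0 <= visc u u - visc u v - visc v u + visc v v.
Proof.
move=> Wu Wv; rewrite !visc_sym.
have Su := shear_sym_L2 Wu; have Sv := shear_sym_L2 Wv.
have Du : Lq O 2 (sym_grad O u) by apply: Loo_Lq => //; exact: sym_grad_Loo.
have Dv : Lq O 2 (sym_grad O v) by apply: Loo_Lq => //; exact: sym_grad_Loo.
have h : 0 <= ip O ((shear p \o sym_grad O u) - (shear p \o sym_grad O v))
    (sym_grad O u - sym_grad O v).
  by apply: Rintegral_ge0 => x _; exact: shear_mono_dot.
by rewrite (formBB gsi Su Sv Du Dv) in h.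
Qed.

(** Written through coordinates [z] in a fixed basis, the strain depends on finitely many reals.
    This is how the viscous term becomes a continuous function of the velocity coordinates, hence
    measurable in the outcome. *)
Definition strain_comb (m : nat) (b : 'I_m -> E -> E) (z : 'I_m -> R) : E -> mat :=
  fun x => \sum_i z i *: sym_grad O (b i) x.

Lemma strain_comb_Loo (m : nat) (b : 'I_m -> E -> E) (z : 'I_m -> R) :
  (forall i, W1oo O (b i)) -> Loo O (strain_comb b z).
Proof.
move=> Wb; rewrite (_ : strain_comb b z = \sum_i z i *: sym_grad O (b i)); last first.
  by apply/funext => x; rewrite fct_sumE.
elim: (index_enum 'I_m) => [|i s IH].
  rewrite big_nil; split; first exact: measurable_field0.
  by exists 0; apply: ae_onW => x _; rewrite frob0.
rewrite big_cons; exact: (Loo_lin (z i) (sym_grad_Loo (Wb i)) IH).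
Qed.

Lemma visc_strain_comb (m : nat) (b : 'I_m -> E -> E) (z : 'I_m -> R) (u xi : E -> E) :
  W1oo O u -> W1oo O xi -> (forall i, W1oo O (b i)) ->
  ae_on O (fun x => u x = \sum_i z i *: b i x) ->
  visc u xi = ip O (shear p \o strain_comb b z) (grad O xi).
Proof.
move=> Wu Wxi Wb ub.
have Lb := strain_comb_Loo z Wb.
have L2b : Lq O 2 (shear p \o strain_comb b z).
  by apply: Loo_Lq => //; exact: shear_Loo.
apply: (ip_ae (shear_sym_L2 Wu) L2b (grad_L2 Wxi)).
apply: (ae_onS _ (grad_comb oO Ofin Wu Wb ub)) => x _ /= e.
congr (shear p _); rewrite /sym_grad /strain_comb e linear_sum -big_split/= scaler_sumr.
apply: eq_bigr => i _; rewrite linearZ/= -scalerDr scalerA mulrC -scalerA.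
by [].
Qed.

(** Dominated convergence: bounded coefficients and essentially bounded basis gradients give the
    constant majorant [K], which is integrable because [O] has finite measure. *)
Lemma cvg_visc_comb (m : nat) (b : 'I_m -> E -> E) (z_ : nat -> 'I_m -> R) (z : 'I_m -> R)
    (M : R) (xi : E -> E) : W1oo O xi -> (forall i, W1oo O (b i)) ->
  (forall i, z_ k i @[k --> \oo] --> z i) -> (forall k i, `|z_ k i| <= M) ->
  ip O (shear p \o strain_comb b (z_ k)) (grad O xi) @[k --> \oo] -->
  ip O (shear p \o strain_comb b z) (grad O xi).
Proof.
move=> Wxi Wb zz zM.
have Lshear y : Loo O (shear p \o strain_comb b y).
  by apply: shear_Loo; exact: strain_comb_Loo.
have [_ _ [mg [Mg gM]]] := Wxi.
have bB i : exists Mi, ae_on O (fun x => frob (sym_grad O (b i) x) <= Mi).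
  by have [_ ] := sym_grad_Loo (Wb i).
have /choice[Mb MbP] := bB.
have MbP' := ae_on_forall MbP.
pose K := (M * \sum_i `|Mb i|) `^ (p - 1) * Mg.
apply: (@cvg_Rintegral _ _ _ leb O mO _ _ (fun=> K)).
- by move=> k; have [mf _] := Lshear (z_ k); exact: measurable_frob_dot.
- by have [mf _] := Lshear z; exact: measurable_frob_dot.
- apply/integrableP; split; first exact: measurable_cst.
  under eq_integral do rewrite /=.
  rewrite integral_cst//; apply: lte_mul_pinfty; [by []|by []|exact: Ofin].
- apply: aeW => x Ox; apply: cvg_shear_dot => //.
  apply/cvgr0Pnorm_le => e e0.
  pose Sx := \sum_i frob (sym_grad O (b i) x).
  have Sx0 : 0 <= Sx by apply: sumr_ge0 => i _; exact: frob_ge0.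
  have q0 : 0 < e / (Sx + 1) by rewrite divr_gt0// ltr_wpDl.
  have : \forall k \near \oo, forall i, `|z i - z_ k i| <= e / (Sx + 1).
    apply: filter_forall => i; move/cvgrPdist_le : (zz i); exact.
  apply: filterS => k zk; rewrite ger0_norm ?frob_ge0// /strain_comb -sumrB.
  apply: (@le_trans _ _ (\sum_i (e / (Sx + 1) * frob (sym_grad O (b i) x)))).
    elim/big_ind2 : _ => [|A a B c|i _].
    + by rewrite frob0.
    + by move=> Aa Bc; apply: (le_trans (frobD _ _)); exact: lerD.
    + by rewrite -scalerBl frobZ ler_wpM2r ?frob_ge0// distrC.
  by rewrite -mulr_sumr mulrAC ler_pdivrMr ?ltr_wpDl// ler_wpM2l ?(ltW e0)// lerDl.
- apply: (ae_onS2 _ gM MbP') => x Ox xg xb k; apply: le_trans (shear_dot_le p1 _ _) _.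
  apply: ler_pM; rewrite ?powR_ge0 ?frob_ge0//.
  have M0 : 0 <= M * \sum_i `|Mb i|.
    rewrite mulr_sumr; apply: sumr_ge0 => i _.
    by rewrite mulr_ge0//; exact: le_trans (zM 0%N i).
  rewrite ge0_ler_powR ?nnegrE ?frob_ge0 ?subr_ge0 ?(ltW p1)//.
  rewrite mulr_sumr /strain_comb; elim/big_ind2 : _ => [|A a B c|i _].
  + by rewrite frob0.
  + by move=> Aa Bc; apply: (le_trans (frobD _ _)); exact: lerD.
  + rewrite frobZ ler_pM ?frob_ge0//.
    exact: le_trans (xb i) (ler_norm _).
Qed.

(** Hoelder's inequality for [|eps u| ^ (p - 1)] and [|grad xi|] with exponents [p / (p - 1)] and
    [p]; the first factor raised to its exponent is [|eps u| ^ p], whose integral is [visc u u]. *)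
Lemma visc_le u xi : W1oo O u -> W1oo O xi ->
  `|visc u xi| <= visc u u `^ ((p - 1) / p) * Lq_norm O p (grad O xi).
Proof.
move=> Wu Wxi; have p0 : 0 < p by exact: lt_trans p1.
have p10 : 0 < p - 1 by rewrite subr_gt0.
have [mu _] := sym_grad_Loo Wu; have Lxi := grad_Lp Wxi.
have [_ _ [mxi _]] := Wxi.
pose f x := frob (sym_grad O u x) `^ (p - 1).
pose g x := frob (grad O xi x).
have mf : measurable_fun (O : set (Rn R n)) f.
  apply: (measurableT_comp (measurable_powR (p - 1))); exact: measurable_frob.
have mg : measurable_fun (O : set (Rn R n)) g by exact: measurable_frob.
have fE x : f x `^ (p / (p - 1)) = frob (sym_grad O u x) `^ p.
  by rewrite /f -powRrM; congr (_ `^ _); field; rewrite gt_eqF.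
have If : leb.-integrable O (EFin \o (fun x => f x `^ (p / (p - 1)))).
  have [_ h] : Lq O p (sym_grad O u).
    by apply: Loo_Lq; rewrite ?(ltW p0)//; exact: sym_grad_Loo.
  have mfp : measurable_fun (O : set (Rn R n)) (fun x => f x `^ (p / (p - 1))).
    exact: (measurableT_comp (measurable_powR _)).
  apply: (ge0_integrableP leb mfp (fun x => powR_ge0 _ _)).2.
  by under eq_integral do rewrite fE.
have Ig : leb.-integrable O (EFin \o (fun x => g x `^ p)).
  have mgp : measurable_fun (O : set (Rn R n)) (fun x => g x `^ p).
    exact: (measurableT_comp (measurable_powR _)).
  by apply: (ge0_integrableP leb mgp (fun x => powR_ge0 _ _)).2; case: Lxi.
have pq : (p / (p - 1))^-1 + p^-1 = 1 by field; rewrite !gt_eqF.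
have Ls := shear_sym_L2 Wu; have Lg := grad_L2 Wxi.
have Ifg : leb.-integrable O (EFin \o (fun x => f x * g x)).
  apply: (le_integrable mO _ _ (integrableD mO If Ig)).
    by apply/measurable_EFinP; exact: measurable_funM.
  move=> x _; rewrite /= lee_fin [leRHS]ger0_norm ?addr_ge0 ?powR_ge0//.
  rewrite ger0_norm ?mulr_ge0 ?powR_ge0 ?frob_ge0//.
  apply: (le_trans (conjugate_powR (powR_ge0 _ _) (frob_ge0 _) (divr_gt0 p0 p10) p0 pq)).
  apply: lerD; rewrite ler_piMr ?powR_ge0// invf_le1 ?divr_gt0// ?(ltW p1)//.
  by rewrite ler_pdivlMr// mul1r gerBl.
have h := Rintegral_hoelder mO mf mg (fun x => powR_ge0 _ _) (fun x => frob_ge0 _)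
  (divr_gt0 p0 p10) p0 pq If Ig.
have e : \int[leb]_(x in O) (f x `^ (p / (p - 1))) = visc u u.
  by rewrite visc_self; apply: eq_Rintegral => x _; exact: fE.
move: h; rewrite e invf_div; apply: le_trans.
apply: (le_trans (le_normr_Rintegral mO (L2_integrable mO Ls Lg))).
apply: le_Rintegral => //.
- exact: integrable_norm (L2_integrable mO Ls Lg).
- by move=> x _; exact: shear_dot_le.
Qed.

End field_functionals.

(** * Discrete velocities and pressures *)

Section discrete_spaces.
Context (R : realType) (n : nat) (O : set 'rV[R]_n.+1).
Local Notation E := 'rV[R]_n.+1.
Local Notation mat := 'M[R]_n.+1.
Local Notation leb := (leb R n).
Hypotheses (oO : open O) (Ofin : (leb O < +oo)%E).
Variables (V : set (E -> E)) (Q : set (E -> R)).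
Hypotheses (hV : velocity_space O V) (hQ : pressure_space O Q).
Let mO : measurable (O : set (Rn R n)) := measurable_open oO.
Let vsi := @L2_semi_inner R n O mO 1 n.+1.

Lemma velocity_W v : V v -> W1oo O v.
Proof. by have [_ VW _] := hV; exact: VW. Qed.

Lemma velocity_L2 v : V v -> L2x O v.
Proof. by move=> /velocity_W; exact: W1oo_L2. Qed.

Lemma velocity0 : V 0.
Proof. by have [[]] := hV. Qed.

Lemma velocity_lin (a : R) v w : V v -> V w -> V (a *: v + w).
Proof. by have [[_ + _] _ _] := hV; exact. Qed.

Lemma pressure_bounded q : Q q -> bounded_pressure O q.
Proof. by have [_ QB] := hQ => /QB[mq qb _ _]; split. Qed.

Lemma pressure0 : Q (fun=> 0).
Proof. by have [[]] := hQ. Qed.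

Lemma pressure_lin (a : R) q1 q2 : Q q1 -> Q q2 -> Q (fun x => a * q1 x + q2 x).
Proof. by have [[_ + _] _] := hQ; exact. Qed.

Lemma pressure_sum (m : nat) (c : 'I_m -> R) (q : 'I_m -> E -> R) :
  (forall i, Q (q i)) -> Q (fun x => \sum_i c i * q i x).
Proof.
move=> Qq; elim: (index_enum 'I_m) => [|i s IH].
  rewrite (_ : (fun x => _) = (fun=> 0)); first exact: pressure0.
  by apply/funext => x; rewrite big_nil.
rewrite (_ : (fun x => _) = (fun x => c i * q i x + \sum_(i <- s) c i * q i x)).
  exact: pressure_lin.
by apply/funext => x; rewrite big_cons.
Qed.

Lemma pair_div_linr (a : R) q v w : bounded_pressure O q -> V v -> V w ->
  pair_div O q (a *: v + w) = a * pair_div O q v + pair_div O q w.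
Proof.
move=> bq Vv Vw.
rewrite (pair_div_comb oO Ofin (c := fun i : 'I_2 => if i == ord0 then a else 1)
  (b := fun i : 'I_2 => if i == ord0 then v else w) bq) ?big_ord_recl ?big_ord0/= ?mul1r ?addr0//.
- by apply: velocity_W; exact: velocity_lin.
- by move=> i; case: ifP => _; exact: velocity_W.
- apply: ae_onW => x _; rewrite !big_ord_recl big_ord0 /= scale1r addr0.
  by [].
Qed.

Lemma pair_div0r q : bounded_pressure O q -> pair_div O q 0 = 0.
Proof.
move=> bq; have := pair_div_linr (-1) bq velocity0 velocity0.
by rewrite scaler0 addr0 mulN1r addNr.
Qed.

Lemma Vdiv0 : Vdiv O V Q 0.
Proof. by split=> [|q /pressure_bounded Qq]; [exact: velocity0|exact: pair_div0r]. Qed.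

Lemma Vdiv_lin (a : R) v w : Vdiv O V Q v -> Vdiv O V Q w -> Vdiv O V Q (a *: v + w).
Proof.
move=> [Vv v0] [Vw w0]; split=> [|q Qq]; first exact: velocity_lin.
by rewrite pair_div_linr ?v0 ?w0 ?mulr0 ?addr0//; exact: pressure_bounded.
Qed.

Lemma Vperp0 : Vperp O V Q 0.
Proof.
split=> [|w [Vw _]]; first exact: velocity0.
by rewrite (form0l vsi)//; exact: velocity_L2.
Qed.

Lemma Vperp_lin (a : R) v w : Vperp O V Q v -> Vperp O V Q w -> Vperp O V Q (a *: v + w).
Proof.
move=> [Vv v0] [Vw w0]; split=> [|z Dz]; first exact: velocity_lin.
have [Vz _] := Dz.
rewrite (si_bilin vsi) ?v0 ?w0 ?mulr0 ?addr0//; exact: velocity_L2.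
Qed.

Lemma L2_null_ae (v w : E -> E) : L2x O v -> L2x O w -> ip O (v - w) (v - w) = 0 ->
  ae_on O (fun x => v x = w x).
Proof.
move=> Lv Lw vw0; have Lvw := subspB vsi Lv Lw.
apply: (ae_onS _ (ip_null mO Lvw vw0)) => x _ /eqP.
by rewrite !fctE subr_eq0 => /eqP.
Qed.

Lemma L2_ae_null (v w : E -> E) : L2x O v -> L2x O w -> ae_on O (fun x => v x = w x) ->
  ip O (v - w) (v - w) = 0.
Proof.
move=> Lv Lw vw; have Lvw := subspB vsi Lv Lw.
apply: (ae_ip_null mO Lvw Lvw); apply: (ae_onS _ vw) => x _ e.
by rewrite !fctE e subrr.
Qed.

Lemma subspace_onb (S' : set (E -> E)) : S' `<=` V -> S' 0 ->
  (forall (a : R) v w, S' v -> S' w -> S' (a *: v + w)) ->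
  exists (r : nat) (e : 'I_r -> E -> E), [/\ forall i, S' (e i), orthonormal (@ip R n O 1 n.+1) e &
    forall v, S' v -> ae_on O (fun x => v x = \sum_i ip O v (e i) *: e i x)].
Proof.
move=> S'V S'0 S'lin; have [[_ _ [m [b [Vb gen]]]] _ _] := hV.
have Lb i : L2x O (b i) := velocity_L2 (Vb i).
have S'L : S' `<=` L2x O by move=> v /S'V /velocity_L2.
have genL v : S' v -> exists c : 'I_m -> R,
    ip O (v - \sum_i c i *: b i) (v - \sum_i c i *: b i) = 0.
  move=> S'v; have [c cv] := gen _ (S'V _ S'v); exists c.
  apply: L2_ae_null; [exact: S'L| |].
    by apply: (subsp_sum vsi) => i; apply: (subspZ vsi); exact: Lb.
  by apply: (ae_onS _ cv) => x _ ->; rewrite fct_sumE.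
have [r [e [S'e oe ge]]] := onb_exists vsi S'L S'0 S'lin Lb genL.
exists r, e; split => // v S'v.
have Le i : L2x O (e i) by apply: S'L.
have := @L2_null_ae v _ (S'L _ S'v) _ (ge _ S'v).
move=> /(_ ltac:(by apply: (subsp_sum vsi) => i; apply: (subspZ vsi); exact: Le)).
by apply: ae_onS => x _; rewrite fct_sumE.
Qed.

Lemma Vdiv_onb : exists (r : nat) (f : 'I_r -> E -> E), [/\ forall i, Vdiv O V Q (f i),
  orthonormal (@ip R n O 1 n.+1) f &
  forall v, Vdiv O V Q v -> ae_on O (fun x => v x = \sum_i ip O v (f i) *: f i x)].
Proof. by apply: subspace_onb; [move=> v []|exact: Vdiv0|exact: Vdiv_lin]. Qed.

Lemma Vperp_onb : exists (r : nat) (e : 'I_r -> E -> E), [/\ forall i, Vperp O V Q (e i),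
  orthonormal (@ip R n O 1 n.+1) e &
  forall v, Vperp O V Q v -> ae_on O (fun x => v x = \sum_i ip O v (e i) *: e i x)].
Proof. by apply: subspace_onb; [move=> v []|exact: Vperp0|exact: Vperp_lin]. Qed.

Lemma pair_div_ae p1 p2 v : bounded_pressure O p1 -> bounded_pressure O p2 -> V v ->
  ae_on O (fun x => p1 x = p2 x) -> pair_div O p1 v = pair_div O p2 v.
Proof.
move=> b1 b2 Vv p12; rewrite !pair_divE.
apply: (ip_ae oO (pressure_field_L2 oO Ofin b1) (pressure_field_L2 oO Ofin b2)
  (grad_L2 oO Ofin (velocity_W Vv))).
by apply: (ae_onS _ p12) => x _ e; rewrite /pressure_field e.
Qed.

Section perp_basis.
Context (r : nat) (e : 'I_r -> E -> E).
Hypotheses (Pe : forall i, Vperp O V Q (e i)) (oe : orthonormal (@ip R n O 1 n.+1) e)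
  (ge : forall v, Vperp O V Q v -> ae_on O (fun x => v x = \sum_i ip O v (e i) *: e i x)).

Let Ve i : V (e i). Proof. by case: (Pe i). Qed.
Let Le i : L2x O (e i). Proof. exact: velocity_L2. Qed.

Lemma dual_pressures : exists q : 'I_r -> E -> R, (forall i, Q (q i)) /\
  forall i j, pair_div O (q i) (e j) = (i == j)%:R.
Proof.
have [[_ _ [k [g [Qg gen]]]] _] := hQ.
pose M : 'M[R]_(k, r) := \matrix_(a, j) pair_div O (g a) (e j).
suff full : row_full M.
  have /row_fullP[N NM] := full.
  exists (fun i x => \sum_a N i a * g a x); split=> [i|i j]; first exact: pressure_sum.
  rewrite (pair_div_sum oO Ofin); [|by move=> a; exact: pressure_bounded|exact: velocity_W].
  have /matrixP/(_ i j) := NM; rewrite !mxE => <-.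
  by apply: eq_bigr => a _; rewrite mxE.
rewrite /row_full -mxrank_tr -/(row_free M^T) -kermx_eq0.
apply: contraT => /rowV0Pn[v /sub_kermxP vM v0].
(* [xi] pairs to 0 with all generators of [Q], so it lies in [Vdiv] as well as in [Vperp] and is
   orthogonal to itself; orthonormality then forces [v = 0]. *)
pose xi : E -> E := \sum_j v ord0 j *: e j.
have Pxi : Vperp O V Q xi.
  rewrite /xi; elim: (index_enum 'I_r) => [|j s IH].
    by rewrite big_nil; exact: Vperp0.
  by rewrite big_cons; exact: Vperp_lin.
have [Vxi xi0] := Pxi.
have xiE : ae_on O (fun x => xi x = \sum_j v ord0 j *: e j x).
  by apply: ae_onW => x _; rewrite /xi fct_sumE.
have gxi a : pair_div O (g a) xi = 0.
  rewrite (pair_div_comb oO Ofin (pressure_bounded (Qg a)) (velocity_W Vxi) (fun j => velocity_W (Ve j)) xiE).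
  move/rowP : vM => /(_ a); rewrite !mxE => vMa; rewrite -[RHS]vMa.
  by apply: eq_bigr => j _; rewrite !mxE.
have Dxi : Vdiv O V Q xi.
  split=> // q Qq; have [c cq] := gen _ Qq.
  have bq := pressure_bounded (pressure_sum c Qg).
  have -> := pair_div_ae (pressure_bounded Qq) bq Vxi cq.
  rewrite (pair_div_sum oO Ofin); [|by move=> a; exact: pressure_bounded|exact: velocity_W].
  by rewrite big1// => a _; rewrite gxi mulr0.
have := xi0 _ Dxi; rewrite /xi (form_onb_sqr vsi Le oe) => /eqP.
rewrite psumr_eq0; last by move=> j _; rewrite sqr_ge0.
move=> /allP v00; case/negP : v0; apply/eqP/rowP => j; rewrite mxE; apply/eqP.
by have := v00 j (mem_index_enum j); rewrite /= sqrf_eq0.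
Qed.

Variable q : 'I_r -> E -> R.
Hypotheses (Qq : forall i, Q (q i)) (qe : forall i j, pair_div O (q i) (e j) = (i == j)%:R).

Definition lift_pressure (y : 'I_r -> R) : E -> R := fun x => \sum_i y i * q i x.

Lemma lift_pressureQ y : Q (lift_pressure y).
Proof. exact: pressure_sum. Qed.

Lemma pair_lift_e y j : pair_div O (lift_pressure y) (e j) = y j.
Proof.
rewrite (pair_div_sum oO Ofin); [|by move=> a; exact: pressure_bounded|exact: velocity_W].
rewrite (bigD1 j)//= qe eqxx mulr1 big1 ?addr0// => i /negPf ij.
by rewrite qe ij mulr0.
Qed.

Lemma pair_div_perp p0 xi : Q p0 -> Vperp O V Q xi ->
  pair_div O p0 xi = \sum_j ip O xi (e j) * pair_div O p0 (e j).
Proof.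
move=> Qp0 Pxi; have [Vxi _] := Pxi.
exact: (pair_div_comb oO Ofin (pressure_bounded Qp0) (velocity_W Vxi)
  (fun j => velocity_W (Ve j)) (ge Pxi)).
Qed.

Lemma qsim_perp p1 p2 : Q p1 -> Q p2 ->
  (forall j, pair_div O p1 (e j) = pair_div O p2 (e j)) -> qsim O V Q p1 p2.
Proof.
move=> Q1 Q2 p12 xi Pxi.
have Q12 : Q (p1 \- p2).
  rewrite (_ : p1 \- p2 = (fun x => -1 * p2 x + p1 x)); first exact: pressure_lin.
  by apply/funext => x; rewrite mulN1r addrC.
rewrite (pair_div_perp Q12 Pxi) big1// => j _.
rewrite (_ : p1 \- p2 = (fun x => -1 * p2 x + p1 x)); last first.
  by apply/funext => x; rewrite mulN1r addrC.
rewrite (pair_div_lin oO Ofin _ (pressure_bounded Q2) (pressure_bounded Q1) (velocity_W (Ve j))).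
by rewrite p12 mulN1r addNr mulr0.
Qed.

Lemma L2x_norm_pos v : L2x O v -> ~ ae_on O (fun x => v x = 0) -> 0 < L2x_norm O v.
Proof.
move=> Lv nv; rewrite lt_neqAle powR_ge0 andbT eq_sym; apply/negP => /eqP v0; apply: nv.
by apply: (ip_null mO Lv); rewrite -sqr_L2_norm -/(L2x_norm O v) v0 expr0n.
Qed.

Lemma Qsto_le p0 (K : R) : Q p0 -> 0 <= K ->
  (forall v, Vperp O V Q v -> pair_div O p0 v <= K * L2x_norm O v) -> Qsto O V Q p0 <= K.
Proof.
move=> Qp0 K0 H; rewrite /Qsto; set S := [set _ | _ in _].
have [->|/set0P S0] := eqVneq S set0; first by rewrite sup0.
apply: ge_sup => // _ [v [Pv nv] <-].
have [Vv _] := Pv.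
by rewrite (ler_pdivrMr _ _ (L2x_norm_pos (velocity_L2 Vv) nv)); exact: H.
Qed.

Lemma VperpN v : Vperp O V Q v -> Vperp O V Q (- v).
Proof. by move=> Pv; rewrite -scaleN1r -[_ *: _]addr0; apply: Vperp_lin => //; exact: Vperp0. Qed.

Lemma pair_divNr p0 v : Q p0 -> V v -> pair_div O p0 (- v) = - pair_div O p0 v.
Proof.
move=> Qp0 Vv; have bp := pressure_bounded Qp0.
by rewrite -scaleN1r -[_ *: _]addr0 (pair_div_linr _ bp Vv velocity0) (pair_div0r bp) addr0 mulN1r.
Qed.

Lemma nzN (v : E -> E) : ~ ae_on O (fun x => v x = 0) -> ~ ae_on O (fun x => (- v) x = 0).
Proof.
by move=> nv h; apply: nv; apply: (ae_onS _ h) => x _ /eqP; rewrite oppr_eq0 => /eqP.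
Qed.

Lemma L2x_normN (v : E -> E) : L2x_norm O (- v) = L2x_norm O v.
Proof.
rewrite /L2x_norm !L2_norm_sqrt; congr Num.sqrt; apply: eq_Rintegral => x _.
by rewrite -scaleN1r frob_dotZl frob_dotZr !mulN1r opprK.
Qed.

Lemma Lq_grad_normN p v : 1 < p -> V v ->
  Lq_norm O p (grad O (- v)) = Lq_norm O p (grad O v).
Proof.
move=> p1 Vv; have VNv : V (- v).
  by rewrite -scaleN1r -[_ *: _]addr0; apply: velocity_lin => //; exact: velocity0.
have := @grad_comb _ _ _ oO Ofin 1 (fun=> -1) (fun=> v) (- v) (velocity_W VNv)
  (fun=> velocity_W Vv).
have vN : ae_on O (fun x => (- v) x = \sum_(i < 1) -1 *: v x).
  by apply: ae_onW => x _; rewrite big_ord_recl big_ord0 addr0 scaleN1r.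
move=> /(_ vN) gN.
suff ee : \int[leb]_(x in O) (frob (grad O (- v) x) `^ p) =
    \int[leb]_(x in O) (frob (grad O v x) `^ p) by exact: (congr1 (fun t => t `^ p^-1) ee).
have [_ _ [mg _]] := velocity_W Vv; have [_ _ [mg' _]] := velocity_W VNv.
have mp (g : E -> mat) : measurable_field O g ->
    measurable_fun (O : set (Rn R n)) (fun x => frob (g x) `^ p).
  by move=> mg0; apply: (measurableT_comp (measurable_powR p)); exact: measurable_frob.
apply: (ae_on_Rintegral mO (mp _ mg') (mp _ mg)).
apply: (ae_onS _ gN) => x _ e1; apply: (congr1 (fun t => t `^ p)).
by rewrite e1 big_ord_recl big_ord0 addr0 scaleN1r -scaleN1r frobZ normrN1 mul1r.
Qed.

(** The sets of quotients behind [Qsto] and [Qdet] contain the opposite of each member; this makes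
    those suprema nonnegative. *)
Lemma sup_sym_ge0 (S : set R) : (forall x, S x -> S (- x)) -> has_ubound S -> 0 <= sup S.
Proof.
move=> Ss ubS; have [->|/set0P[x Sx]] := eqVneq S set0; first by rewrite sup0.
have := ub_le_sup ubS Sx; have := ub_le_sup ubS (Ss _ Sx); lra.
Qed.

(** [xi] is the Riesz representative of the pairing on [Vperp]. Cauchy-Schwarz bounds all quotients
    by its norm, and [xi] attains the bound unless it is null; in that case the lower bound 0 comes
    from the symmetry of the set of quotients. *)
Lemma QstoE p0 : Q p0 -> Qsto O V Q p0 = Num.sqrt (\sum_j pair_div O p0 (e j) ^+ 2).
Proof.
move=> Qp0; set s := \sum_j _; have s0 : 0 <= s by apply: sumr_ge0 => j _; exact: sqr_ge0.
pose xi : E -> E := \sum_j pair_div O p0 (e j) *: e j.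
have Lxi : L2x O xi by apply: (subsp_sum vsi) => j; apply: (subspZ vsi); exact: Le.
have Pxi : Vperp O V Q xi.
  rewrite /xi; elim: (index_enum 'I_r) => [|j t IH].
    by rewrite big_nil; exact: Vperp0.
  by rewrite big_cons; exact: Vperp_lin.
have xixi : ip O xi xi = s by rewrite /xi (form_onb_sqr vsi Le oe).
have pxi v : Vperp O V Q v -> pair_div O p0 v = ip O v xi.
  move=> Pv; rewrite (pair_div_perp Qp0 Pv) /xi (form_sumr vsi _ _ Le).
    by apply: eq_bigr => j _; rewrite mulrC.
  by apply: velocity_L2; case: Pv.
have ub v : Vperp O V Q v -> pair_div O p0 v <= Num.sqrt s * L2x_norm O v.
  move=> Pv; have Lv : L2x O v by apply: velocity_L2; case: Pv.
  rewrite pxi// mulrC /L2x_norm L2_norm_sqrt -sqrtrM ?ip_ge0//.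
  apply: le_trans (ler_norm _) _; rewrite -sqrtr_sqr ler_sqrt ?mulr_ge0 ?ip_ge0//.
  by rewrite -xixi; exact: (form_CS vsi Lv Lxi).
apply/eqP; rewrite eq_le Qsto_le ?sqrtr_ge0//=.
rewrite /Qsto; set S := [set _ | _ in _].
have ubS : has_ubound S.
  exists (Num.sqrt s) => _ [v [Pv nv] <-].
  have Lv : L2x O v by apply: velocity_L2; case: Pv.
  rewrite (ler_pdivrMr _ _ (L2x_norm_pos Lv nv)); exact: ub.
have [s00|s00] := eqVneq s 0.
  rewrite s00 sqrtr0; apply: sup_sym_ge0 => // _ [v [Pv nv] <-].
  exists (- v); first by split; [exact: VperpN|exact: nzN].
  by case: Pv => Vv _; rewrite (pair_divNr Qp0 Vv) L2x_normN mulNr.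
apply: ub_le_sup => //; exists xi.
  split=> // xi0; move/eqP : s00; apply; rewrite -xixi.
  exact: (ae_ip_null mO Lxi Lxi xi0).
rewrite pxi// xixi /L2x_norm L2_norm_sqrt xixi -{1}(sqr_sqrtr s0) expr2 mulfK//.
by rewrite sqrtr_eq0 -ltNge lt_neqAle eq_sym s00.
Qed.

Lemma Qsto_ge0 p0 : Q p0 -> 0 <= Qsto O V Q p0.
Proof. by move=> Qp0; rewrite QstoE// sqrtr_ge0. Qed.

Lemma sqr_Qsto p0 : Q p0 -> Qsto O V Q p0 ^+ 2 = \sum_j pair_div O p0 (e j) ^+ 2.
Proof. by move=> Qp0; rewrite QstoE// sqr_sqrtr// sumr_ge0// => j _; exact: sqr_ge0. Qed.

Lemma Qdet_bounds p p0 (K : R) : 1 < p -> Q p0 -> 0 <= K ->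
  (forall v, Vperp O V Q v -> `|pair_div O p0 v| <= K * Lq_norm O p (grad O v)) ->
  0 <= Qdet O V Q p p0 <= K.
Proof.
move=> p1 Qp0 K0 H; rewrite /Qdet; set S := [set _ | _ in _].
have ub : ubound S K.
  move=> _ [v [Pv nv] <-].
  (* A vanishing gradient norm makes the quotient 0, since the inverse of 0 is 0. *)
  have [g0|g0] := leP (Lq_norm O p (grad O v)) 0.
    have -> : Lq_norm O p (grad O v) = 0 by apply/eqP; rewrite eq_le g0 powR_ge0.
    by rewrite invr0 mulr0.
  by rewrite ler_pdivrMr//; apply: le_trans (ler_norm _) (H v Pv).
apply/andP; split.
  apply: sup_sym_ge0; last by exists K.
  move=> _ [v [Pv nv] <-]; exists (- v); first by split; [exact: VperpN|exact: nzN].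
  case: Pv => Vv _.
  by rewrite (pair_divNr Qp0 Vv) (Lq_grad_normN p1 Vv) mulNr.
have [->|/set0P S0] := eqVneq S set0; first by rewrite sup0.
exact: ge_sup.
Qed.

End perp_basis.
End discrete_spaces.

(** * Hilbert-Schmidt norms *)

(** The orthonormal basis is an arbitrary set, so sums over it are controlled through finite
    duplicate-free sequences. *)
Lemma esum_seqP (R : realType) (T : choiceType) (S : set T) (a : T -> R) (M : R) :
  (forall t, 0 <= a t) ->
  (\esum_(t in S) (a t)%:E <= M%:E)%E <->
  (forall s : seq T, uniq s -> (forall t, t \in s -> S t) -> \sum_(t <- s) a t <= M).
Proof.
move=> a0; split=> [aM s us sS|H].
  rewrite -lee_fin; apply: le_trans aM; rewrite -sumEFin (fsbig_seq _ _ us).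
  by apply: esum_ge; exists [set` s].
apply: ge_ereal_sup => _ [A [fA AS] <-].
rewrite fsbig_finite// sumEFin lee_fin; apply: H; first exact: finmap.fset_uniq.
by move=> t; rewrite in_fset_set// inE; exact: AS.
Qed.

Section hilbert_basis.
Context (R : realType) (U : completeNormedModType R) (inner : {dot U for idfun}) (B : set U).
Hypotheses (hU : inner_product_norm inner) (hB : orthonormal_basis inner B).

Lemma inner_semi_inner : semi_inner [set: U] (fun x y => inner x y).
Proof.
split=> // [v w _ _|a v w z _ _ _|v _].
- by rewrite hermC expr0 mul1r.
- by rewrite linearPl.
- by rewrite hU sqr_ge0.
Qed.
Local Notation si := inner_semi_inner.

Lemma innerC x y : inner x y = inner y x. Proof. exact: (si_C si). Qed.

Lemma inner_continuous_le x y : `|inner x y| <= `|x| * `|y|.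
Proof.
rewrite -ler_sqr ?nnegrE ?mulr_ge0// real_normK ?num_real// exprMn -!hU.
exact: (form_CS si).
Qed.

Definition proj_seq (x : U) (s : seq U) : U := \sum_(e <- s) inner x e *: e.

Lemma inner_proj_seq x s e : uniq s -> (forall t, t \in s -> B t) -> B e ->
  inner (proj_seq x s) e = if e \in s then inner x e else 0.
Proof.
move=> us sB Be; have [onr1 onr2 _] := hB.
rewrite /proj_seq (form_suml si) //.
case: ifPn => es; last first.
  rewrite big_seq big1// => t ts; rewrite (onr2 _ _ (sB _ ts) Be) ?mulr0// => te.
  by move: es; rewrite -te ts.
rewrite (bigD1_seq e)//= onr1// mulr1 big_seq_cond big1 ?addr0// => t /andP[ts /eqP te].
by rewrite (onr2 _ _ (sB _ ts) Be te) mulr0.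
Qed.

Lemma inner_proj_sub x s t : uniq s -> uniq t -> (forall e, e \in t -> B e) ->
  {subset s <= t} -> inner (proj_seq x t) (proj_seq x s) = \sum_(e <- s) inner x e ^+ 2.
Proof.
move=> us ut tB st; rewrite [X in inner _ X]/proj_seq (form_sumr si) //.
rewrite big_seq [RHS]big_seq; apply: eq_bigr => e es.
by rewrite inner_proj_seq// ?(st _ es)//; exact: tB (st _ es).
Qed.

Lemma inner_proj_self x s : inner x (proj_seq x s) = \sum_(e <- s) inner x e ^+ 2.
Proof. by rewrite (form_sumr si). Qed.

Lemma bessel_seq x s : uniq s -> (forall t, t \in s -> B t) ->
  \sum_(e <- s) inner x e ^+ 2 <= `|x| ^+ 2.
Proof.
move=> us sB; rewrite -subr_ge0 -hU.
have := si_ge0 si (v := x - proj_seq x s) ltac:(by []).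
rewrite (form_sqrB si)// inner_proj_self inner_proj_sub//; lra.
Qed.

Lemma bessel_esum x : (\esum_(e in B) (inner x e ^+ 2)%:E <= (`|x| ^+ 2)%:E)%E.
Proof.
apply/(esum_seqP B (`|x| ^+ 2) (fun t => sqr_ge0 (inner x t))) => s us sB.
exact: bessel_seq.
Qed.

(** Finite sets [s k] that nearly exhaust the Bessel sum give partial projections [y k]. These form
    a Cauchy sequence in the complete space [U], and [x] minus their limit is orthogonal to [B],
    hence 0. *)
Lemma parseval_le x : ((`|x| ^+ 2)%:E <= \esum_(e in B) (inner x e ^+ 2)%:E)%E.
Proof.
have [onr1 onr2 total] := hB.
set S := (X in (_ <= X)%E).
have S0 : (0 <= S)%E by apply: esum_ge0 => e _; rewrite lee_fin sqr_ge0.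
have Sfin : S \is a fin_num.
  by rewrite ge0_fin_numE//; apply: le_lt_trans (bessel_esum x) (ltry _).
have Ssum s : uniq s -> (forall t, t \in s -> B t) -> \sum_(e <- s) inner x e ^+ 2 <= fine S.
  by move: s; apply/(esum_seqP B (fine S) (fun t => sqr_ge0 (inner x t))); rewrite fineK.
have near_sup (d : R) : 0 < d -> exists s, [/\ uniq s, forall t, t \in s -> B t &
    fine S - d < \sum_(e <- s) inner x e ^+ 2].
  move=> d0; apply: contrapT => nex.
  suff : (S <= (fine S - d)%:E)%E by rewrite -{1}(fineK Sfin) lee_fin; lra.
  apply/(esum_seqP B (fine S - d) (fun t => sqr_ge0 (inner x t))) => s us sB.
  rewrite leNgt; apply/negP => h; apply: nex; exists s; split=> //.
have near_k (k : nat) := near_sup (k.+1%:R^-1 : R) ltac:(by rewrite invr_gt0).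
have /choice[s sP] := near_k.
have us k : uniq (s k) by case: (sP k).
have sB k t : t \in s k -> B t by case: (sP k) => _ + _; exact.
have sS k : fine S - k.+1%:R^-1 < \sum_(e <- s k) inner x e ^+ 2 by case: (sP k).
pose y k := proj_seq x (s k).
(* Two projections are compared through the one on the union of their index sets: enlarging [s k]
   adds at most [1 / (k + 1)] to the squared norm. *)
have dist k l : `|y k - proj_seq x (undup (s k ++ s l))| ^+ 2 <= k.+1%:R^-1.
  set t := undup _.
  have ut : uniq t by exact: undup_uniq.
  have tB e : e \in t -> B e by rewrite mem_undup mem_cat => /orP[/sB|/sB].
  have st : {subset s k <= t} by move=> e es; rewrite mem_undup mem_cat es.
  rewrite -hU (form_sqrB si)// [inner (y k) (proj_seq _ _)]innerC.
  have -> : inner (y k) (y k) = \sum_(e <- s k) inner x e ^+ 2.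
    by rewrite inner_proj_sub//; exact: sB.
  have := Ssum t ut tB; have := sS k.
  rewrite (inner_proj_sub x (us k) ut tB st) (inner_proj_sub x ut ut tB)//.
  by move: (\sum_(e <- s k) _) (\sum_(e <- t) _) (k.+1%:R^-1) (fine S) => a b c f; lra.
have Cy : cauchy (y @ \oo).
  apply: cauchy_exP => e e0.
  have e20 : 0 < (e / 3) ^+ 2 by rewrite exprn_gt0// divr_gt0.
  have small : \forall k \near \oo, k.+1%:R^-1 < (e / 3) ^+ 2.
    have /cvgrPdist_lt/(_ _ e20) := @cvg_harmonic R; apply: filterS => k.
    by rewrite sub0r normrN; apply: le_lt_trans; exact: ler_norm.
  have [k0 _ k0P] := small.
  exists (y k0); exists k0 => // l /= k0l; rewrite -ball_normE /=.
  have h1 := le_lt_trans (dist k0 l) (k0P _ (leqnn _)).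
  have h2 := le_lt_trans (dist l k0) (k0P _ k0l).
  have b3 (a : R) : 0 <= a -> a ^+ 2 < (e / 3) ^+ 2 -> a < e / 3.
    by move=> a0; rewrite ltr_pXn2r// nnegrE// divr_ge0// ltW.
  have {}h1 := b3 _ (normr_ge0 _) h1; have {}h2 := b3 _ (normr_ge0 _) h2.
  have te : proj_seq x (undup (s l ++ s k0)) = proj_seq x (undup (s k0 ++ s l)).
    apply: perm_big; apply: uniq_perm; rewrite ?undup_uniq// => z.
    by rewrite !mem_undup !mem_cat orbC.
  rewrite te in h2.
  rewrite -(subrKA (proj_seq x (undup (s k0 ++ s l)))); apply: le_lt_trans (ler_normD _ _) _.
  by rewrite [X in _ + X]distrC; lra.
have cy : cvg (y @ \oo) by exact/cauchy_cvgP.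
have [y0 yy0] : exists y0 : U, y @ \oo --> y0 by exists (lim (y @ \oo)).
have yE e : B e -> inner (x - y0) e = 0.
  move=> Be; apply/eqP; rewrite -normr_le0; apply/ler_addgt0Pr => d d0; rewrite add0r.
  have d20 : 0 < d / 2 by rewrite divr_gt0.
  have d40 : 0 < (d / 2) ^+ 2 by rewrite exprn_gt0.
  have : \forall k \near \oo, k.+1%:R^-1 < (d / 2) ^+ 2 /\ `|y0 - y k| < d / 2.
    apply: filterI; last by move/cvgrPdist_lt : yy0 => /(_ _ d20).
    have /cvgrPdist_lt/(_ _ d40) := @cvg_harmonic R; apply: filterS => k.
    by rewrite sub0r normrN; apply: le_lt_trans; exact: ler_norm.
  move=> [k _ /(_ _ (leqnn k)) [kd yk]].
  have xyk : inner (x - y k) e ^+ 2 <= k.+1%:R^-1.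
    rewrite (formBl si)// inner_proj_seq//; last exact: sB.
    case: ifPn => es; first by rewrite subrr expr0n /= invr_ge0.
    (* Adding a missing [e] to [s k] raises the partial sum by [inner x e ^ 2], which is therefore
       below [1 / (k + 1)]. *)
    have ues : uniq (e :: s k) by rewrite /= es us.
    have esB t : t \in e :: s k -> B t by rewrite inE => /orP[/eqP->//|]; exact: sB.
    have := Ssum _ ues esB; have := sS k; rewrite subr0 big_cons.
    by move: (\sum_(j <- s k) _) (inner x e ^+ 2) (k.+1%:R^-1) (fine S) => a b c f; lra.
  rewrite (_ : x - y0 = (x - y k) - (y0 - y k)); last by rewrite opprB addrA subrK.
  rewrite (formBl si)//; apply: le_trans (ler_normB _ _) _.
  have h1 : `|inner (x - y k) e| < d / 2.
    have := le_lt_trans xyk kd; rewrite -real_normK ?num_real// ltr_pXn2r// nnegrE//.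
    exact: ltW.
  have h2 := inner_continuous_le (y0 - y k) e.
  have e1 : `|e| = 1.
    have := onr1 _ Be; rewrite hU => /eqP; rewrite sqrf_eq1 => /orP[/eqP//|/eqP en].
    by have := normr_ge0 e; rewrite en; lra.
  rewrite e1 mulr1 in h2; lra.
have xy0 : x = y0 by apply/eqP; rewrite -subr_eq0; apply/eqP; exact: total.
rewrite -(fineK Sfin) lee_fin; apply/ler_addgt0Pr => d d0.
have d20 : 0 < Num.sqrt d by rewrite sqrtr_gt0.
have /cvgrPdist_lt/(_ _ d20)[k _ /(_ _ (leqnn k)) yk] := yy0.
have yk2 : `|x - y k| ^+ 2 <= d.
  by rewrite xy0 -[leRHS](sqr_sqrtr (ltW d0)) ler_pXn2r ?nnegrE ?sqrtr_ge0// ltW.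
have sBk : forall t, t \in s k -> B t by exact: sB.
move: yk2; rewrite -hU (form_sqrB si)// inner_proj_self (inner_proj_sub x (us k) (us k) sBk)//.
have := Ssum _ (us k) sBk; rewrite hU.
by move: (\sum_(j <- s k) _) (`|x| ^+ 2) (fine S) => a b f; lra.
Qed.

End hilbert_basis.

Lemma le_esum_lin (R : realType) (T : choiceType) (S : set T) (a a1 a2 : T -> R) (c1 c2 : R) :
  0 <= c1 -> 0 <= c2 -> (forall t, 0 <= a1 t) -> (forall t, 0 <= a2 t) ->
  (forall t, S t -> a t <= c1 * a1 t + c2 * a2 t) ->
  (\esum_(t in S) (a t)%:E <=
   c1%:E * (\esum_(t in S) (a1 t)%:E) + c2%:E * (\esum_(t in S) (a2 t)%:E))%E.
Proof.
move=> c10 c20 a10 a20 H; apply: ge_ereal_sup => _ [A [fA AS] <-].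
have aux (b : T -> R) : (\sum_(t \in A) (b t)%:E <= \esum_(t in S) (b t)%:E)%E.
  by apply: esum_ge; exists A.
apply: (@le_trans _ _ (c1%:E * (\sum_(t \in A) (a1 t)%:E) + c2%:E * (\sum_(t \in A) (a2 t)%:E)))%E.
  rewrite !fsbig_finite// !sumEFin -!EFinM -EFinD lee_fin !mulr_sumr -big_split/=.
  rewrite big_seq [leRHS]big_seq; apply: ler_sum => t; rewrite in_fset_set// inE => At.
  exact: H (AS _ At).
by apply: leeD; apply: lee_wpmul2l; rewrite ?lee_fin//; exact: aux.
Qed.

(** A perturbation argument from a triangle inequality in squared form: [N] and [M] stand for the
    norms of two vectors at distance [D]. The weight [dl] spends half of the gap [a ^ 2 - N ^ 2] on
    the first term, and [q] keeps the second term within the other half. *)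
Lemma young_gap (R : realType) (N a : R) : 0 <= N -> N < a -> exists dl q : R,
  [/\ 0 < dl, 0 < q & forall D M, 0 <= D -> 0 <= M -> D < q ->
     M ^+ 2 <= (1 + dl) * N ^+ 2 + (1 + dl^-1) * D ^+ 2 -> M < a].
Proof.
move=> N0 fa.
have Na : 0 < a ^+ 2 - N ^+ 2 by rewrite subr_gt0 ltr_pXn2r// nnegrE// (le_trans N0) ?ltW.
pose dl := (a ^+ 2 - N ^+ 2) / (2 * (N ^+ 2 + 1)).
have N1 : 0 < N ^+ 2 + 1 by rewrite ltr_wpDl ?sqr_ge0.
have dl0 : 0 < dl by rewrite divr_gt0// mulr_gt0.
have idl0 : 0 < 1 + dl^-1 by rewrite ltr_wpDr// invr_ge0 ltW.
pose q := (a ^+ 2 - N ^+ 2) / 2 / (1 + dl^-1).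
have q0 : 0 < q by rewrite !divr_gt0.
exists dl, (Num.sqrt q); split; [by []|by rewrite sqrtr_gt0|move=> D M D0 M0 Dq h].
have gf2 : D ^+ 2 < q by rewrite -(sqr_sqrtr (ltW q0)) ltr_pXn2r// nnegrE sqrtr_ge0.
have h1 : (1 + dl^-1) * D ^+ 2 < (a ^+ 2 - N ^+ 2) / 2 by rewrite mulrC -ltr_pdivlMr.
have h2 : (1 + dl) * N ^+ 2 <= N ^+ 2 + (a ^+ 2 - N ^+ 2) / 2.
  rewrite mulrDl mul1r lerD2l (_ : dl * _ = (a ^+ 2 - N ^+ 2) / 2 * (N ^+ 2 / (N ^+ 2 + 1))).
    by rewrite ler_piMr ?divr_ge0 ?(ltW Na)// ler_pdivrMr// mul1r lerDl.
  by rewrite /dl; field; rewrite gt_eqF.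
have : M ^+ 2 < a ^+ 2 by apply: le_lt_trans h _; lra.
by rewrite ltr_pXn2r// nnegrE// (le_trans N0) ?ltW.
Qed.

Section hilbert_schmidt_norm.
Context (R : realType) (n : nat) (U : completeNormedModType R).
Local Notation E := 'rV[R]_n.+1.
Variables (inner : {dot U for idfun}) (B : set U) (O : set E).
Hypotheses (hU : inner_product_norm inner) (hB : orthonormal_basis inner B).
Hypothesis (mO : measurable (O : set (Rn R n))).
Local Notation vsi := (@L2_semi_inner R n O mO 1 n.+1).
Local Notation si := (inner_semi_inner hU).
Implicit Types A : U -> E -> E.

Definition HSfin A : Prop := (forall x, L2x O (A x)) /\ (HS_norm2 B O A < +oo)%E.

Lemma HS_HSfin A : HS B O A -> HSfin A.
Proof. by move=> [h1 _ _ h2]; split. Qed.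

Lemma HS_norm2E A : HS_norm2 B O A = (\esum_(e in B) (ip O (A e) (A e))%:E)%E.
Proof. by apply: eq_esum => e _; rewrite -sqr_L2_norm. Qed.

Lemma HS_norm2_ge0 A : (0 <= HS_norm2 B O A)%E.
Proof. by apply: esum_ge0 => e _; rewrite lee_fin sqr_ge0. Qed.

Lemma sqr_HS_norm A : HSfin A -> ((HS_norm B O A ^+ 2)%:E = HS_norm2 B O A)%E.
Proof.
move=> [_ fA]; rewrite sqr_sqrtr ?fine_ge0 ?HS_norm2_ge0// fineK//.
by rewrite ge0_fin_numE// HS_norm2_ge0.
Qed.

Lemma HS_norm2_lin (c1 c2 : R) A A1 A2 : 0 <= c1 -> 0 <= c2 ->
  (forall x, ip O (A x) (A x) <= c1 * ip O (A1 x) (A1 x) + c2 * ip O (A2 x) (A2 x)) ->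
  (HS_norm2 B O A <= c1%:E * HS_norm2 B O A1 + c2%:E * HS_norm2 B O A2)%E.
Proof.
move=> c10 c20 H; rewrite !HS_norm2E.
by apply: le_esum_lin => // t; exact: ip_ge0.
Qed.

Lemma HSfin_lin (c1 c2 : R) A A1 A2 : 0 <= c1 -> 0 <= c2 -> (forall x, L2x O (A x)) ->
  (forall x, ip O (A x) (A x) <= c1 * ip O (A1 x) (A1 x) + c2 * ip O (A2 x) (A2 x)) ->
  HSfin A1 -> HSfin A2 -> HSfin A.
Proof.
move=> c10 c20 LA H [_ f1] [_ f2]; split; first exact: LA.
apply: le_lt_trans (HS_norm2_lin c10 c20 H) _.
by apply: lte_add_pinfty; [apply: lte_mul_pinfty; [rewrite lee_fin|by []|exact: f1]
  |apply: lte_mul_pinfty; [rewrite lee_fin|by []|exact: f2]].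
Qed.

Lemma HSfin_sub A1 A2 : HSfin A1 -> HSfin A2 -> HSfin (A1 - A2).
Proof.
move=> H1 H2; have [L1 _] := H1; have [L2 _] := H2.
apply: (HSfin_lin (ler0n R 2) (ler0n R 2) _ _ H1 H2) => x; first exact: (subspB vsi (L1 x) (L2 x)).
exact: (form_sqrB_le vsi (L1 x) (L2 x)).
Qed.

Lemma HSfin_add A1 A2 : HSfin A1 -> HSfin A2 -> HSfin (A1 + A2).
Proof.
move=> H1 H2; have [L1 _] := H1; have [L2 _] := H2.
apply: (HSfin_lin (ler0n R 2) (ler0n R 2) _ _ H1 H2) => x; first exact: (subspD vsi (L1 x) (L2 x)).
exact: (form_sqrD_le vsi (L1 x) (L2 x)).
Qed.

Lemma sqr_HS_norm_le (c1 c2 : R) A A1 A2 : 0 <= c1 -> 0 <= c2 ->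
  (forall x, ip O (A x) (A x) <= c1 * ip O (A1 x) (A1 x) + c2 * ip O (A2 x) (A2 x)) ->
  HSfin A -> HSfin A1 -> HSfin A2 ->
  HS_norm B O A ^+ 2 <= c1 * HS_norm B O A1 ^+ 2 + c2 * HS_norm B O A2 ^+ 2.
Proof.
move=> c10 c20 H fA f1 f2.
have := HS_norm2_lin c10 c20 H.
by rewrite -(sqr_HS_norm fA) -(sqr_HS_norm f1) -(sqr_HS_norm f2) -!EFinM -EFinD lee_fin.
Qed.

(** Openness of sublevel sets turns the measurability granted by [data_stability] into measurability
    of the real function [HS_norm]. *)
Lemma HS_norm_open (a : R) : norm_open (HS B O) (HS_norm B O)
  [set A | HS B O A /\ HS_norm B O A < a].
Proof.
split=> [A []//|f [Hf fa]].
have [dl [q [dl0 q0 H]]] := young_gap (sqrtr_ge0 _ : 0 <= HS_norm B O f) fa.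
exists q; first exact: q0.
move=> g Hg gf; split; first exact: Hg.
have Fg := HS_HSfin Hg; have Ff := HS_HSfin Hf; have Fd := HSfin_sub Fg Ff.
have c1 : 0 <= 1 + dl by rewrite addr_ge0// ltW.
have c2 : 0 <= 1 + dl^-1 by rewrite addr_ge0// invr_ge0 ltW.
have h := sqr_HS_norm_le c1 c2 (fun x => form_le_young vsi dl0 (Fg.1 x) (Ff.1 x)) Fg Ff Fd.
exact: (H _ _ (sqrtr_ge0 _) (sqrtr_ge0 _) gf h).
Qed.

Section finite_rank.
Context (m : nat) (k : 'I_m -> R) (x : 'I_m -> U) (h : 'I_m -> E -> E).
Hypothesis (Lh : forall i, L2x O (h i)).

Definition fin_rank : U -> E -> E := fun y => \sum_i (k i * inner y (x i)) *: h i.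
(** The adjoint of [fin_rank] at [xi] ([ip_fin_rank]); for an elementary process it is the
    [U]-valued integrand of the coordinate along [xi]. *)
Definition fin_rank_dual (xi : E -> E) : U := \sum_i (k i * ip O (h i) xi) *: x i.

Lemma fin_rank_L2 y : L2x O (fin_rank y).
Proof. by apply: (subsp_sum vsi) => i; apply: (subspZ vsi); exact: Lh. Qed.

Lemma ip_fin_rank y xi : L2x O xi -> ip O (fin_rank y) xi = inner y (fin_rank_dual xi).
Proof.
move=> Lxi; rewrite /fin_rank_dual (form_sumr si)// (form_suml vsi _ _ Lh Lxi).
by apply: eq_bigr => i _; rewrite mulrAC.
Qed.

Lemma HSfin_fin_rank : HSfin fin_rank.
Proof.
have -> : fin_rank = \sum_i (fun y : U => (k i * inner y (x i)) *: h i).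
  by apply/funext => y; rewrite fct_sumE.
elim: (index_enum 'I_m) => [|i s IH].
  rewrite big_nil; split=> [y|]; first exact: (si_0 vsi).
  rewrite HS_norm2E esum1// => e _; congr EFin.
  exact: (form0l vsi (si_0 vsi)).
rewrite big_cons; apply: HSfin_add IH; split=> [y|]; first exact: (subspZ vsi _ (Lh i)).
pose K := (k i) ^+ 2 * ip O (h i) (h i).
have K0 : 0 <= K by rewrite mulr_ge0 ?sqr_ge0 ?ip_ge0.
have h1 e : B e -> ip O ((k i * inner e (x i)) *: h i) ((k i * inner e (x i)) *: h i)
    <= K * inner (x i) e ^+ 2 + 0 * 0.
  move=> _; rewrite (formZl vsi _ (Lh i) (subspZ vsi _ (Lh i))) (formZr vsi _ (Lh i) (Lh i)).
  by rewrite mul0r addr0 /K (innerC hU e) le_eqVlt; apply/orP; left; apply/eqP; ring.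
rewrite HS_norm2E; apply: le_lt_trans.
  exact: (@le_esum_lin _ _ _ _ _ (fun=> 0) _ _ K0 (lexx 0) (fun e => sqr_ge0 _) (fun=> lexx 0) h1).
rewrite mul0e adde0; apply: lte_mul_pinfty; [by rewrite lee_fin|by []|].
exact: le_lt_trans (bessel_esum hU hB (x i)) (ltry _).
Qed.

(** Parseval in [U] turns the left side into a double sum of squared inner products; for each basis
    vector [e], Bessel in [L^2] bounds the sum over [j] by the squared norm of the image of [e]. The
    number [q] of directions does not enter. *)
Lemma fin_rank_dual_le (q : nat) (xi : 'I_q -> E -> E) : (forall j, L2x O (xi j)) ->
  orthonormal (@ip R n O 1 n.+1) xi ->
  \sum_j `|fin_rank_dual (xi j)| ^+ 2 <= HS_norm B O fin_rank ^+ 2.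
Proof.
move=> Lxi oxi; rewrite -lee_fin sqr_HS_norm; last exact: HSfin_fin_rank.
apply: (@le_trans _ _ (\esum_(e in B) (\sum_j inner (fin_rank_dual (xi j)) e ^+ 2)%:E)%E).
  rewrite -sumEFin.
  under [X in (_ <= X)%E]eq_esum do rewrite -sumEFin.
  rewrite esum_sum; last by move=> *; rewrite lee_fin sqr_ge0.
  by apply: lee_sum => j _; exact: (parseval_le hU hB).
rewrite HS_norm2E; apply: le_esum => e _; rewrite lee_fin.
apply: le_trans (bessel vsi Lxi oxi (fin_rank_L2 e)).
rewrite le_eqVlt; apply/orP; left; apply/eqP; apply: eq_bigr => j _.
by rewrite (ip_fin_rank _ (Lxi j)) (innerC hU).
Qed.

Lemma fin_rank_dual_le2 (q : nat) (xi : 'I_q -> E -> E) A : (forall j, L2x O (xi j)) ->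
  orthonormal (@ip R n O 1 n.+1) xi -> HSfin A ->
  \sum_j `|fin_rank_dual (xi j)| ^+ 2 <=
    2 * HS_norm B O A ^+ 2 + 2 * HS_norm B O (fin_rank - A) ^+ 2.
Proof.
move=> Lxi oxi FA; have Fk := HSfin_fin_rank.
apply: le_trans (fin_rank_dual_le Lxi oxi) _.
apply: (sqr_HS_norm_le (ler0n R 2) (ler0n R 2) _ Fk FA (HSfin_sub Fk FA)) => y.
exact: (form_le2 vsi (Fk.1 y) (FA.1 y)).
Qed.

End finite_rank.
End hilbert_schmidt_norm.

(** * Square-integrable random variables and Doob's inequality *)

(** The integral of a nonnegative function is a supremum over the simple functions below it, hence
    monotone for all functions. It is applied to norms and errors that come without
    measurability. *)
Lemma ge0_integral_mono (d : measure_display) (T : measurableType d) (R : realType)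
    (mu : {measure set T -> \bar R}) (D : set T) (f g : T -> \bar R) :
  (forall x, D x -> 0 <= f x)%E -> (forall x, D x -> f x <= g x)%E ->
  (\int[mu]_(x in D) f x <= \int[mu]_(x in D) g x)%E.
Proof.
move=> f0 fg; have g0 x : D x -> (0 <= g x)%E by move=> Dx; exact: le_trans (f0 _ Dx) (fg _ Dx).
have f0' x : (0 <= (f \_ D) x)%E by apply: erestrict_ge0.
have g0' x : (0 <= (g \_ D) x)%E by apply: erestrict_ge0.
rewrite integral_mkcond (integral_mkcond _ g) !ge0_integralTE//.
apply: ereal_sup_le => _ [h hf <-]; exists h => // x; apply: le_trans (hf x) _.
by rewrite /patch; case: ifPn => // /set_mem; exact: fg.
Qed.

Lemma ae_ge0_integral_mono (d : measure_display) (T : measurableType d) (R : realType)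
    (mu : {measure set T -> \bar R}) (f g : T -> \bar R) :
  measurable_fun [set: T] g -> (forall x, 0 <= f x)%E -> (forall x, 0 <= g x)%E ->
  {ae mu, forall x, f x <= g x}%E ->
  (\int[mu]_x f x <= \int[mu]_x g x)%E.
Proof.
move=> mg f0 g0 [N [mN N0 fgN]].
(* Raising [g] to infinity on the exceptional null set makes the bound hold everywhere and leaves
   the integral unchanged. *)
pose g' x := (g x + (+oo%E * (\1_N x)%:E))%E.
have g'0 x : (0 <= g' x)%E by rewrite /g' adde_ge0// mule_ge0// lee_fin.
have mg' : measurable_fun [set: T] g'.
  apply: emeasurable_funD => //; apply: emeasurable_funM => //.
  by apply/measurable_EFinP; exact: measurable_indic.
rewrite (@ge0_ae_eq_integral _ _ _ mu _ g g')//.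
  apply: ge0_integral_mono => [x _|x _]; first exact: f0.
  rewrite /g' indicE; case: (boolP (x \in N)) => [_|/negP xN].
    by rewrite mulr1n mule1 addey ?leey// gt_eqF// (lt_le_trans _ (g0 x)).
  rewrite mule0 adde0; apply: contrapT => fg; apply: xN; rewrite inE.
  by apply: fgN => /=.
exists N; split => // x /= H; apply: contrapT => xN; apply: H => _.
by rewrite /g' indicE memNset// mule0 adde0.
Qed.

(** [h] is an error term without measurability. The positive part of [f - g] is measurable and lies
    below [h], so additivity is used for measurable functions and monotonicity does the rest. *)
Lemma integral_le_add (d : measure_display) (T : measurableType d) (R : realType)
    (mu : {measure set T -> \bar R}) (D : set T) (f g : T -> R) (h : T -> \bar R) :
  measurable D -> measurable_fun D f -> measurable_fun D g ->
  (forall x, D x -> 0 <= f x) -> (forall x, D x -> 0 <= g x) ->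
  (forall x, D x -> 0 <= h x)%E ->
  (forall x, D x -> (f x)%:E <= (g x)%:E + h x)%E ->
  (\int[mu]_(x in D) (f x)%:E <= \int[mu]_(x in D) (g x)%:E + \int[mu]_(x in D) h x)%E.
Proof.
move=> mD mf mg f0 g0 h0 fgh.
pose k x := Num.max 0 (f x - g x).
have mk : measurable_fun D k by apply: measurable_maxr => //; exact: measurable_funB.
have k0 x : 0 <= k x by rewrite le_max lexx.
apply: (@le_trans _ _ (\int[mu]_(x in D) ((g x)%:E + (k x)%:E))%E).
  apply: ge0_integral_mono => x Dx; first by rewrite lee_fin f0.
  by rewrite -EFinD lee_fin -lerBlDl le_max lexx orbT.
rewrite ge0_integralD//; last 3 first.
- exact/measurable_EFinP.
- by move=> x Dx; rewrite lee_fin.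
- exact/measurable_EFinP.
apply: leeD => //; apply: ge0_integral_mono => x Dx; first by rewrite lee_fin.
rewrite /k EFin_max ge_max h0//=; have := fgh x Dx.
by rewrite EFinB leeBlDl.
Qed.

Lemma cvg_finsum (R : realType) (T : Type) (F : set_system T) {FF : Filter F} (I : Type)
    (s : seq I) (f : I -> T -> R) (l : I -> R) :
  (forall i, f i x @[x --> F] --> l i) ->
  \sum_(i <- s) f i x @[x --> F] --> \sum_(i <- s) l i.
Proof.
move=> fl; elim: s => [|i s IH].
  by rewrite big_nil; under eq_fun do rewrite big_nil; exact: cvg_cst.
by rewrite big_cons; under eq_fun do rewrite big_cons; apply: cvgD.
Qed.

Lemma Rintegral_finsum (d : measure_display) (T : measurableType d) (R : realType)
    (mu : {measure set T -> \bar R}) (D : set T) (I : Type) (s : seq I) (f : I -> T -> R) :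
  measurable D -> (forall i, mu.-integrable D (EFin \o f i)) ->
  mu.-integrable D (EFin \o (fun x => \sum_(i <- s) f i x)) /\
  \int[mu]_(x in D) (\sum_(i <- s) f i x) = \sum_(i <- s) \int[mu]_(x in D) f i x.
Proof.
move=> mD If.
have J : mu.-integrable D (EFin \o (fun x => \sum_(i <- s) f i x)).
  have := integrable_sum mD s (fun i (_ : xpredT i) => If i).
  by apply: eq_integrable => // x _; rewrite /= sumEFin.
split => //; elim: s J => [|i s IH] J.
  by rewrite big_nil; under eq_Rintegral do rewrite big_nil; rewrite /Rintegral integral0.
have J' : mu.-integrable D (EFin \o (fun x => \sum_(i <- s) f i x)).
  have := integrable_sum mD s (fun i (_ : xpredT i) => If i).
  by apply: eq_integrable => // x _; rewrite /= sumEFin.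
by under eq_Rintegral do rewrite big_cons; rewrite RintegralD// IH// big_cons.
Qed.

Section square_integrable.
Context (R : realType) (d : measure_display) (Omega : measurableType d)
  (P : probability Omega R).
Implicit Types (X Y Z : Omega -> R^o) (G : set (set Omega)).

Definition sqi : set (Omega -> R^o) := [set X | measurable_fun [set: Omega] (X : Omega -> R) /\
  P.-integrable [set: Omega] (EFin \o (fun w => (X w : R) ^+ 2))].

Definition EE X Y : R := \int[P]_w ((X w : R) * Y w).

Lemma sqi_integrable X Y : sqi X -> sqi Y ->
  P.-integrable [set: Omega] (EFin \o (fun w => (X w : R) * Y w)).
Proof.
move=> [mX IX] [mY IY]; apply: (le_integrable measurableT _ _ (integrableD measurableT IX IY)).
  by apply/measurable_EFinP; exact: measurable_funM.
move=> w _; rewrite /= lee_fin [leRHS]ger0_norm ?addr_ge0 ?sqr_ge0// normrM.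
rewrite -(real_normK (num_real (X w))) -(real_normK (num_real (Y w))).
have := sqr_ge0 (`|X w : R| - `|Y w : R|); rewrite sqrrB.
have := mulr_ge0 (normr_ge0 (X w : R)) (normr_ge0 (Y w : R)); lra.
Qed.

Lemma sqi_measurable X : sqi X -> measurable_fun [set: Omega] (X : Omega -> R).
Proof. by case. Qed.

Lemma sqiP X : measurable_fun [set: Omega] (X : Omega -> R) ->
  sqi X <-> (\int[P]_w ((X w : R) ^+ 2)%:E < +oo)%E.
Proof.
move=> mX; have m2 : measurable_fun [set: Omega] (fun w => (X w : R) ^+ 2).
  exact: measurable_funX.
split=> [[_ /integrableP[_]]|h].
  by under eq_integral do rewrite /= ger0_norm ?sqr_ge0//.
split=> //; apply/integrableP; split; first exact/measurable_EFinP.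
by under eq_integral do rewrite /= ger0_norm ?sqr_ge0//.
Qed.

Lemma sqi_cst (a : R) : sqi (fun=> a).
Proof.
split; first exact: measurable_cst.
exact: finite_measure_integrable_cst.
Qed.

Lemma sqi_semi_inner : semi_inner sqi EE.
Proof.
split=> [|a X Y sX sY|X Y _ _|a X Y Z sX sY sZ|X _].
- exact: (sqi_cst 0).
- split; first by apply: measurable_funD; [apply: measurable_funM => //|];
    exact: sqi_measurable.
  have := integrableD measurableT (integrableD measurableT
    (integrableZl measurableT (a ^+ 2) (sqi_integrable sX sX))
    (integrableZl measurableT (2 * a) (sqi_integrable sX sY))) (sqi_integrable sY sY).
  apply: eq_integrable => // w _; rewrite -!EFinM -!EFinD; congr EFin.
  by rewrite !fctE /GRing.scale /=; ring.
- by apply: eq_Rintegral => w _; rewrite mulrC.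
- have I1 := sqi_integrable sX sZ; have I2 := sqi_integrable sY sZ.
  rewrite /EE -RintegralZl// -RintegralD//; last exact: (integrableZl measurableT a I1).
  by apply: eq_Rintegral => w _; rewrite !fctE /GRing.scale /= mulrDl mulrA.
- by apply: Rintegral_ge0 => w _; rewrite -expr2 sqr_ge0.
Qed.

Lemma EE_integral X : sqi X -> ((EE X X)%:E = \int[P]_w ((X w : R) ^+ 2)%:E)%E.
Proof.
move=> [mX IX]; rewrite /EE /Rintegral fineK.
  by apply: eq_integral => w _; rewrite expr2.
by apply: integrable_fin_num => //; exact: (sqi_integrable (conj mX IX) (conj mX IX)).
Qed.

Lemma sqi_mul_bounded X Y (M : R) : sqi X -> measurable_fun [set: Omega] (Y : Omega -> R) ->
  (forall w, `|Y w| <= M) -> sqi (fun w => (X w : R) * Y w).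
Proof.
move=> sX mY YM; have mX := sqi_measurable sX.
have mXY : measurable_fun [set: Omega] (fun w => (X w : R) * Y w) by exact: measurable_funM.
split=> //; have := integrableZl measurableT (M ^+ 2) sX.2.
apply: le_integrable => //; first by apply/measurable_EFinP; exact: measurable_funX.
move=> w _; rewrite /= lee_fin !normrX [leRHS]normrM !normrX normrM exprMn [leLHS]mulrC.
have M0 : 0 <= M by exact: le_trans (YM w).
by rewrite ler_wpM2r ?sqr_ge0// ler_pXn2r ?nnegrE// (ger0_norm M0).
Qed.

Lemma sqi_abs X : sqi X -> sqi (fun w => `|X w|).
Proof.
move=> [mX IX]; split; first exact: measurableT_comp.
by move: IX; apply: eq_integrable => // w _ /=; rewrite real_normK ?num_real.
Qed.

Lemma sqi_dom X Y : measurable_fun [set: Omega] (X : Omega -> R) -> sqi Y ->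
  (forall w, `|X w : R| <= `|Y w : R|) -> sqi X.
Proof.
move=> mX [mY IY] XY; split=> //; apply: (le_integrable measurableT _ _ IY).
  by apply/measurable_EFinP; exact: measurable_funX.
by move=> w _; rewrite /= lee_fin !normrX ler_pXn2r ?nnegrE.
Qed.

Definition sub_sigma G : Prop := sigma_algebra [set: Omega] G /\ G `<=` measurable.

(** Encoded through the measurable type generated by [G], so that the closure rules of
    [measurable_fun] apply directly; [GmeasP] gives the description by preimages. *)
Definition Gmeas G (X : Omega -> R) : Prop :=
  measurable_fun [set: g_sigma_algebraType G] (X : g_sigma_algebraType G -> R).

Lemma GmeasP G X : sub_sigma G -> Gmeas G X <-> (forall A : set R, measurable A -> G (X @^-1` A)).
Proof.
move=> [sG _]; have e : <<s G >> = G by exact: sigma_algebra_id.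
split=> [mX A mA|H _ A mA].
  by have := mX measurableT A mA; rewrite setTI /measurable /= e.
by rewrite setTI /measurable /= e; exact: H.
Qed.

Lemma Gmeas_measurable G X : sub_sigma G -> Gmeas G X -> measurable_fun [set: Omega] X.
Proof. by move=> sG /(GmeasP _ sG) H _ A mA; rewrite setTI; apply: sG.2; exact: H. Qed.

Lemma Gmeas_sub G G' X : sub_sigma G -> sub_sigma G' -> G `<=` G' -> Gmeas G X -> Gmeas G' X.
Proof.
by move=> sG sG' GG' /(GmeasP _ sG) H; apply/(GmeasP _ sG') => A mA; apply: GG'; exact: H.
Qed.

Lemma Gmeas_indic G (D : set Omega) : sub_sigma G -> G D -> Gmeas G \1_D.
Proof.
move=> [sG _] GD; apply: measurable_indic; rewrite /measurable /= sigma_algebra_id//.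
Qed.

End square_integrable.

Section sub_sigma.
Context (R : realType) (d : measure_display) (Omega : measurableType d)
  (P : probability Omega R).
Implicit Types (X Y Z : Omega -> R^o) (G : set (set Omega)).

Lemma sub_sigmaE G (A : set Omega) : sub_sigma G ->
  measurable (A : set (g_sigma_algebraType G)) = G A.
Proof. by move=> [sG _]; rewrite /measurable /= sigma_algebra_id. Qed.

Import HBNNSimple.

Section orthogonality.
Variables (G : set (set Omega)) (Z : Omega -> R^o).
Hypotheses (sG : sub_sigma G) (sZ : sqi P Z)
  (Z0 : forall D, G D -> EE P (\1_D : Omega -> R) Z = 0).

(** The simple functions that approximate [Y] from below are combinations of indicators of sets in
    [G], against which [Z] vanishes; the passage to the limit is dominated by [|Y * Z|]. This plays
    the part of a conditional expectation. *)
Lemma orth_sqi_ge0 Y : sqi P Y -> Gmeas G Y -> (forall w, 0 <= (Y w : R)) -> EE P Y Z = 0.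
Proof.
move=> sY mY Y0; pose T' := g_sigma_algebraType G.
have mYE : measurable_fun [set: T'] (EFin \o (Y : T' -> R)) by exact/measurable_EFinP.
pose a (k : nat) : g_sigma_algebraType G -> R := nnsfun_approx measurableT mYE k.
have Ya0 (w : T') : [set: T'] w -> (0 <= (EFin \o (Y : T' -> R)) w)%E.
  by move=> _; rewrite /= lee_fin.
have mTa k : Gmeas G (a k) by exact: measurable_funP.
have ma k : measurable_fun [set: Omega] (a k : Omega -> R).
  by apply: (Gmeas_measurable sG); exact: mTa.
have a0 k w : 0 <= (a k w : R) by exact: fun_ge0.
have aY k w : (a k w : R) <= Y w.
  have := @le_approx _ T' R setT _ k w Ya0 Logic.I.
  by rewrite /a nnsfun_approxE lee_fin.
have cva w : (a k w : R) @[k --> \oo] --> (Y w : R).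
  have := @cvg_nnsfun_approx _ T' R setT measurableT _ mYE Ya0 w Logic.I.
  by move=> /fine_cvgP[].
have IYZ := sqi_integrable sY sZ.
have : EE P (a k) Z @[k --> \oo] --> EE P Y Z.
  apply: (@cvg_Rintegral _ _ _ P setT measurableT (fun k w => (a k w : R) * Z w)
    (fun w => (Y w : R) * Z w) (fun w => `|(Y w : R) * Z w|)).
  - by move=> k; apply: measurable_funM => //; exact: sqi_measurable sZ.
  - by apply: measurable_funM; [exact: sqi_measurable sY | exact: sqi_measurable sZ].
  - exact: (integrable_norm IYZ).
  - by apply: aeW => w _; apply: cvgM; [exact: cva | exact: cvg_cst].
  - apply: aeW => w _ k; rewrite !normrM ler_wpM2r//.
    by rewrite !ger0_norm.
have -> : (fun k => EE P (a k) Z) = (fun=> 0).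
  apply/funext => k.
  have [s [c [D [GD aE]]]] : exists (s : nat) (c : 'I_s -> R) (D : 'I_s -> set Omega),
      (forall i, G (D i)) /\ forall w, (a k w : R) = \sum_(i < s) c i * \1_(D i) w.
    set g := nnsfun_approx measurableT mYE k.
    have := fimfunEord g; rewrite /=; set s := finmap.enum_fset _ => H.
    exists (size s), (fun i => s`_i), (fun i => g @^-1` [set s`_i]); split; last exact: H.
    move=> i /=; rewrite -(sub_sigmaE _ sG).
    by rewrite -[X in measurable X]setTI; apply: (@measurable_funP _ _ _ _ _ g) => //; exact: measurable_set1.
  have sD i : sqi P (\1_(D i) : Omega -> R).
    apply: (@sqi_dom _ _ _ _ _ (fun=> 1)); last 2 first.
    - exact: sqi_cst.
    - by move=> w; rewrite indicE; case: (_ \in _); rewrite ?normr0 ?normr1.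
    - by apply: measurable_indic; apply: sG.2; exact: GD.
  have -> : a k = \sum_(i < s) c i *: (\1_(D i) : Omega -> R^o).
    by apply/funext => w; rewrite aE fct_sumE; apply: eq_bigr.
  rewrite (form_suml (sqi_semi_inner P) _ _ sD sZ) big1// => i _.
  by rewrite Z0 ?mulr0.
by move=> h; rewrite -(cvg_lim (@Rhausdorff R) h) lim_cst//; exact: Rhausdorff.
Qed.

Lemma orth_sqi Y : sqi P Y -> Gmeas G Y -> EE P Y Z = 0.
Proof.
move=> sY mY; have IP := sqi_semi_inner P.
pose Yp : Omega -> R^o := fun w => Num.max (Y w : R) 0.
pose Yn : Omega -> R^o := fun w => Num.max (- (Y w : R)) 0.
have mp : Gmeas G Yp by apply: measurable_maxr => //; exact: measurable_cst.
have mn : Gmeas G Yn.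
  by apply: measurable_maxr; [exact: measurable_funN | exact: measurable_cst].
have sp : sqi P Yp.
  apply: (sqi_dom _ sY); first exact: Gmeas_measurable mp.
  move=> w; rewrite /Yp; case: (leP (Y w : R) 0) => h; rewrite ?normr0//.
have sn : sqi P Yn.
  apply: (sqi_dom _ sY); first exact: Gmeas_measurable mn.
  move=> w; rewrite /Yn; case: (leP (- (Y w : R)) 0) => h; rewrite ?normr0 ?normrN//.
have -> : Y = Yp - Yn.
  apply/funext => w; rewrite !fctE /Yp /Yn; case: (leP (Y w : R) 0) => h.
    by rewrite max_l ?oppr_ge0// sub0r opprK.
  by rewrite max_r ?oppr_le0 1?ltW// subr0.
rewrite (formBl IP)// (orth_sqi_ge0 sp)// ?(orth_sqi_ge0 sn)// ?subr0// => w.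
  by rewrite /Yn le_max lexx orbT.
by rewrite /Yp le_max lexx orbT.
Qed.

End orthogonality.

Section complete.
Variable G : set (set Omega).
Hypotheses (sG : sub_sigma G) (cG : forall A, P.-negligible A -> G A).

Lemma ae_eq_preimage (A A' : set Omega) :
  G A -> {ae P, forall w, A w <-> A' w} -> G A'.
Proof.
move=> GA [N [mN N0 HN]].
have GN : G N by apply: cG; exists N; split => // w.
have GI : G (A' `&` N) by apply: cG; exists N; split => // w [].
have -> : A' = (A `\` N) `|` (A' `&` N).
  apply/seteqP; split => w.
    move=> A'w; have [Nw|Nw] := pselect (N w); [by right | left; split => //].
    have : A w <-> A' w by apply: contrapT => h; apply: Nw; exact: HN.
    by move=> [_]; exact.
  move=> [[Aw Nw]|[]//].
  have : A w <-> A' w by apply: contrapT => h; apply: Nw; exact: HN.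
  by move=> [H _]; exact: H.
move: GA GN GI; rewrite -!(sub_sigmaE _ sG) => GA GN GI.
by apply: measurableU => //; exact: measurableD.
Qed.

Lemma ae_eq_Gmeas X Y : Gmeas G X -> {ae P, forall w, X w = Y w} -> Gmeas G Y.
Proof.
move=> /(GmeasP _ sG) mX XY; apply/(GmeasP _ sG) => A mA.
apply: (ae_eq_preimage (mX A mA)); apply: filterS XY => w e.
by rewrite /preimage /= e.
Qed.

(** Along a subsequence with squared errors at most [4 ^ -k] in mean, the series of
    [2 ^ k * (X - Y) ^ 2] has finite expectation, so almost surely the squared errors decay like
    [2 ^ -k]. The pointwise limit is measurable off a null set, and [G] contains the null sets. *)
Lemma sqi_cvg_Gmeas (X : nat -> Omega -> R^o) Y :
  (forall k, sqi P (X k)) -> (forall k, Gmeas G (X k)) -> sqi P Y ->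
  EE P (X k - Y) (X k - Y) @[k --> \oo] --> (0 : R) -> Gmeas G Y.
Proof.
move=> sX mX sY cv; have IP := sqi_semi_inner P.
pose near_enough (k m : nat) : Prop := EE P (X m - Y) (X m - Y) <= (4 ^+ k)^-1.
have H k : exists m, near_enough k m.
  rewrite /near_enough.
  have e0 : 0 < ((4 ^+ k)^-1 : R) by rewrite invr_gt0 exprn_gt0.
  move/cvgrPdist_le : cv => /(_ _ e0)[K _ HK]; exists K.
  have := HK K (leqnn K); rewrite sub0r normrN; apply: le_trans; exact: ler_norm.
have [m Hm] := choice H.
pose f k w : \bar R := (2 ^+ k * ((X (m k) w : R) - Y w) ^+ 2)%:E.
have sD k : sqi P (X (m k) - Y) by exact: (subspB IP).
have mf k : measurable_fun [set: Omega] (f k).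
  apply/measurable_EFinP; apply: measurable_funM => //; apply: measurable_funX.
  exact: (sqi_measurable (sD k)).
have f0 k w : (0 <= f k w)%E by rewrite /f lee_fin; apply: mulr_ge0; [exact: exprn_ge0 | exact: sqr_ge0].
have If k : (\int[P]_w f k w <= (2 / (2 ^ k.+1)%:R)%:E)%E.
  under eq_integral do rewrite /f EFinM.
  rewrite ge0_integralZl//; last 2 first.
  - by apply/measurable_EFinP; apply: measurable_funX; exact: (sqi_measurable (sD k)).
  - by move=> w _; rewrite lee_fin sqr_ge0.
  have -> : (\int[P]_w (((X (m k) w : R) - Y w) ^+ 2)%:E)%E = (EE P (X (m k) - Y) (X (m k) - Y))%:E.
    by rewrite (EE_integral (sD k)).
  rewrite -EFinM lee_fin; apply: le_trans (ler_wpM2l _ (Hm k)) _; first by rewrite exprn_ge0.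
  rewrite natrX exprS invfM mulrA divff// mul1r.
  have -> : 4 = 2 * 2 :> R by rewrite -natrM.
  by rewrite exprMn invfM mulrA divff ?mul1r// expf_neq0.
have Ifin : (\int[P]_w (\sum_(0 <= k <oo) f k w) < +oo)%E.
  rewrite integral_nneseries//; apply: (@le_lt_trans _ _ (2%:E : \bar R)); last exact: ltry.
  have tail := @epsilon_trick0 R 2 xpredT (ler0n _ 2).
  by apply: le_trans tail; apply: lee_nneseries => [k *|k *]; [by apply: integral_ge0 => w _; exact: f0 | exact: If].
have fin : {ae P, forall w, (\sum_(0 <= k <oo) f k w)%E \is a fin_num}.
  have : P.-integrable [set: Omega] (fun w => \sum_(0 <= k <oo) f k w)%E.
    apply/integrableP; split; first exact: ge0_emeasurable_sum.
    by under eq_integral do rewrite gee0_abs ?nneseries_ge0//.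
  by move=> /(integrable_ae measurableT); apply: filterS => w; apply.
have cvae : {ae P, forall w, (X (m k) w : R) @[k --> \oo] --> (Y w : R)}.
  apply: filterS fin => w fw; set M := fine (\sum_(0 <= k <oo) f k w)%E.
  have le k : (2 ^+ k * ((X (m k) w : R) - Y w) ^+ 2) <= M.
    rewrite -lee_fin /M fineK//.
    have := @nneseries_lim_ge R (fun k => f k w) xpredT 0%N k.+1.
    move=> /(_ (fun i _ _ => f0 i w)); apply: le_trans.
    by rewrite big_nat_recr//= leeDr// sume_ge0.
  have sq k : ((X (m k) w : R) - Y w) ^+ 2 <= M / 2 ^+ k.
    by rewrite ler_pdivlMr ?exprn_gt0// mulrC.
  have c0 : (M / 2 ^+ k) @[k --> \oo] --> (0 : R).
    rewrite -(mulr0 M); apply: cvgM; first exact: cvg_cst.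
    under eq_fun do rewrite -exprVn.
    by apply: cvg_expr; rewrite ger0_norm ?invr_ge0// invf_lt1// ltr1n.
  apply/cvgrPdist_lt => e e0; have e20 : 0 < e ^+ 2 by rewrite exprn_gt0.
  move/cvgrPdist_lt : c0 => /(_ _ e20); apply: filterS => k.
  rewrite sub0r normrN => /(le_lt_trans (ler_norm _)) h.
  by rewrite distrC -(ltr_pXn2r (n := 2))// ?nnegrE// ?ltW// real_normK ?num_real// (le_lt_trans (sq k)).
have [N [mN N0 HN]] := cvae.
have GN : G N by apply: cG; exists N; split => // w.
pose X' k : Omega -> R^o := fun w => (X (m k) w : R) * \1_(~` N) w.
pose Y' : Omega -> R^o := fun w => (Y w : R) * \1_(~` N) w.
have mX' k : Gmeas G (X' k).
  apply: measurable_funM; first exact: mX.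
  apply: measurable_indic; apply: measurableC; by rewrite (sub_sigmaE _ sG).
have mY' : Gmeas G Y'.
  apply: (@measurable_fun_cvg _ (g_sigma_algebraType G) R setT X') => // w _.
  rewrite /X' /Y'; have [Nw|Nw] := pselect (N w).
    have -> : \1_(~` N) w = 0 :> R by rewrite indicE memNset//; apply.
    by rewrite mulr0; under eq_fun do rewrite mulr0; exact: cvg_cst.
  by apply: cvgM; [apply: contrapT => h; apply: Nw; exact: HN | exact: cvg_cst].
apply: (ae_eq_Gmeas mY'); exists N; split => // w /= XY'; apply: contrapT => Nw; apply: XY'.
by rewrite /Y' indicE mem_set// mulr1.
Qed.

End complete.
End sub_sigma.

Section measurable_maps.
Context (R : realType) (d : measure_display) (Omega : measurableType d)
  (P : probability Omega R).
Variable G : set (set Omega).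
Hypothesis sG : sub_sigma G.

Lemma Gmeas_comp (g : R -> R) X : measurable_fun [set: R] g -> Gmeas G X -> Gmeas G (g \o X).
Proof. by move=> mg mX; exact: measurableT_comp. Qed.

(** Row vectors here have at least one entry while [r] may be 0, hence the extra coordinate fixed at
    0. An open set is a countable union of boxes, and the preimage of a box is a finite
    intersection. *)
Lemma preimage_open r (y : Omega -> 'I_r -> R) (A : set 'rV[R]_r.+1) :
  (forall i, Gmeas G (fun w => y w i)) -> open A ->
  G [set w | A (\row_i oapp (y w) 0 (unlift ord0 i))].
Proof.
move=> my oA; have [F [_ ->]] := open_bigcup_boxes oA.
rewrite -(sub_sigmaE _ sG).
rewrite (_ : [set w | _] = \bigcup_k \bigcap_(i in [set: 'I_r.+1])
  [set w | (F k).1 ord0 i < oapp (y w) 0 (unlift ord0 i) < (F k).2 ord0 i]); last first.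
  apply/seteqP; split => w /= [k _ H]; exists k => // i.
    by move=> _; have := H i; rewrite mxE.
  by rewrite mxE; exact: H.
apply: bigcup_measurable => k _; apply: fin_bigcap_measurable => // i _.
have mi : measurable_fun [set: g_sigma_algebraType G] (fun w : Omega => oapp (y w) 0 (unlift ord0 i)).
  by case: unliftP => [j _|_] /=; [exact: my | exact: measurable_cst].
rewrite (_ : [set w | _] = (fun w : Omega => oapp (y w) 0 (unlift ord0 i)) @^-1`
   `](F k).1 ord0 i, (F k).2 ord0 i[%classic); last first.
  by apply/seteqP; split => w /=; rewrite in_itv.
by rewrite -[X in measurable X]setTI; apply: mi => //; exact: measurable_itv.
Qed.

(* A function of r real coordinates that is 1-Lipschitz off a null set is a Borel function of them
   there: its sublevel sets are unions of balls. *)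
Lemma Lipschitz_Gmeas r (y : Omega -> 'I_r -> R) (u : Omega -> R) (N : set Omega) :
  (forall A, P.-negligible A -> G A) -> P.-negligible N ->
  (forall i, Gmeas G (fun w => y w i)) ->
  (forall w w', ~ N w -> ~ N w' ->
     (u w - u w') ^+ 2 <= \sum_(i < r) (y w i - y w' i) ^+ 2) ->
  Gmeas G u.
Proof.
move=> cG N0 my Lip; apply: (measurability _ (RGenInftyO.measurableE R)) => /= _ [_ [a ->] <-].
rewrite setTI (sub_sigmaE _ sG).
pose A := [set z : 'rV[R]_r.+1 | exists w, [/\ ~ N w, u w < a &
  \sum_(i < r) (z ord0 (lift ord0 i) - y w i) ^+ 2 < (a - u w) ^+ 2]].
have oA : open A.
  rewrite openE => z [w [Nw ua zw]]; rewrite /interior.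
  have cc : {for z, continuous (fun z : 'rV[R]_r.+1 =>
      \sum_(i < r) (z ord0 (lift ord0 i) - y w i) ^+ 2)}.
    apply: (@cvg_finsum R _ _ (nbhs_filter z)) => i; apply: (@cvg_comp _ _ _ _ (fun x : R => x ^+ 2)); last exact: exprn_continuous.
    by apply: cvgB; [exact: coord_continuous | exact: cvg_cst].
  have : \forall z' \near z, \sum_(i < r) ((z' : 'rV[R]_r.+1) ord0 (lift ord0 i) - y w i) ^+ 2
     < (a - u w) ^+ 2 by exact: (cvgr_lt _ cc).
  by apply: filterS => z' h; exists w.
apply: (ae_eq_preimage sG cG (preimage_open my oA)).
have [N1 [mN1 N10 NN1]] := N0; exists N1; split => // w /= H; apply: NN1.
apply: contrapT => Nw; apply: H.
have e w' : \sum_(i < r) ((\row_i oapp (y w) 0 (unlift ord0 i)) ord0 (lift ord0 i) - y w' i) ^+ 2 =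
    \sum_(i < r) (y w i - y w' i) ^+ 2.
  by apply: eq_bigr => i _; rewrite mxE liftK.
rewrite in_itv /=; split.
  move=> [w' [Nw' ua]]; rewrite e => h; rewrite -subr_gt0.
  have := le_lt_trans (Lip _ _ Nw Nw') h.
  rewrite -(real_normK (num_real (u w - u w'))) ltr_pXn2r ?nnegrE ?subr_ge0 ?(ltW ua)//.
  by move=> /(le_lt_trans (ler_norm _)); lra.
move=> ua; exists w; split => //; rewrite e big1 ?exprn_gt0 ?subr_gt0// => i _.
by rewrite subrr expr0n.
Qed.

Lemma random_elt_open (X : zmodType) (D : set X) (nrm : X -> R) (f : Omega -> X) :
  (forall w, D (f w)) -> (forall A, norm_open D nrm A -> G (f @^-1` A)) ->
  random_elt G D nrm f.
Proof.
move=> Df HA; split => // A nA.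
suff : norm_borel D nrm `<=` [set A | G (f @^-1` A)] by exact.
apply: smallest_sub => //; have [[G0 GC GU] _] := sG; split.
- by rewrite /= preimage_set0.
- move=> B /= GB; have := GC _ GB.
  by congr G; apply/seteqP; split => w /=; [move=> [_]; split | move=> [_]; split].
- by move=> B GB; rewrite /= preimage_bigcup; exact: GU.
Qed.

End measurable_maps.

(** * Doob's maximal inequality in [L^2] for sums of martingale differences *)

Section doob.
Context (R : realType) (d : measure_display) (Omega : measurableType d)
  (P : probability Omega R).
Variables (G : nat -> set (set Omega)) (x : nat -> Omega -> R^o) (n : nat).
Hypotheses (sG : forall k, sub_sigma (G k)) (homoG : forall k, G k `<=` G k.+1)
  (sx : forall k, sqi P (x k)) (mx : forall k, (k < n)%N -> Gmeas (G k.+1) (x k))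
  (x0 : forall k Y, (k < n)%N -> sqi P Y -> Gmeas (G k) Y -> EE P Y (x k) = 0).

Let M k : Omega -> R^o := \sum_(l < k) x l.

Let IP := sqi_semi_inner P.

Let MS k w : M k.+1 w = (M k w : R) + x k w.
Proof. by rewrite /M big_ord_recr. Qed.

Let sM k : sqi P (M k).
Proof. by apply: (subsp_sum IP) => l. Qed.

Let mM k : (k <= n)%N -> Gmeas (G k) (M k).
Proof.
elim: k => [_|k IH kn].
  rewrite (_ : M 0%N = fun=> 0); first exact: measurable_cst.
  by apply/funext => w; rewrite /M big_ord0.
rewrite (_ : M k.+1 = fun w => (M k w : R) + x k w); last by apply/funext => w; rewrite MS.
apply: measurable_funD; last exact: mx.
by apply: (Gmeas_sub (sG k) (sG k.+1) (@homoG k)); apply: IH; exact: ltnW.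
Qed.

Lemma martingale_sqr k : (k <= n)%N -> EE P (M k) (M k) = \sum_(l < k) EE P (x l) (x l).
Proof.
elim: k => [_|k IH kn]; first by rewrite /M !big_ord0 (form0l IP)//; exact: (si_0 IP).
rewrite big_ord_recr /= -IH; last exact: ltnW.
rewrite {1 2}/M big_ord_recr /= -/(M k) (form_sqrD IP)// x0 ?mulr0 ?addr0//.
by apply: mM; exact: ltnW.
Qed.

Fixpoint running_max k w : R :=
  if k is j.+1 then Num.max (running_max j w) `|M k w : R| else 0.

Let S := running_max.

Let S_ge0 k w : 0 <= S k w.
Proof. by elim: k => //= k IH; rewrite le_max IH. Qed.

Let MleS k w : `|M k w : R| <= S k w.
Proof. by case: k => [|k] /=; rewrite ?le_max ?lexx ?orbT// /M big_ord0 normr0. Qed.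

Lemma le_running_max j k w : (j <= k)%N -> `|M j w : R| <= S k w.
Proof.
elim: k => [|k IH]; first by rewrite leqn0 => /eqP ->; exact: MleS.
by rewrite leq_eqVlt => /orP[/eqP ->|/IH h]; [exact: MleS | rewrite /= le_max h].
Qed.

Lemma running_max_sqi k : sqi P (S k).
Proof.
elim: k => [|k IH]; first exact: sqi_cst.
apply: (sqi_dom _ (subspD IP IH (sqi_abs (sM k.+1)))).
  by apply: measurable_maxr; [exact: sqi_measurable IH | exact: sqi_measurable (sqi_abs (sM k.+1))].
move=> w; rewrite !fctE /=; have := S_ge0 k w; have := normr_ge0 (M k.+1 w : R).
move: `|(M k.+1 w : R)| (S k w) => a s a0 s0.
by rewrite !ger0_norm ?addr_ge0// ?le_max ?s0// ge_max lerDl lerDr s0 a0.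
Qed.

Let sS := running_max_sqi.

Let mS k : (k <= n)%N -> Gmeas (G k) (S k).
Proof.
elim: k => [_|k IH kn]; first exact: measurable_cst.
apply: measurable_maxr; last by apply: measurableT_comp => //; exact: mM.
by apply: (Gmeas_sub (sG k) (sG k.+1) (@homoG k)); apply: IH; exact: ltnW.
Qed.

Let sgn (a : R) : R := if 0 <= a then 1 else -1.

Let Hk k : Omega -> R^o := fun w => S k w * sgn (M k w).

Let m_sgn : measurable_fun [set: R] sgn.
Proof.
apply: measurable_fun_ifT; [|exact: measurable_cst|exact: measurable_cst].
by apply: measurable_fun_ler; [exact: measurable_cst | exact: measurable_id].
Qed.

Let mH k : (k <= n)%N -> Gmeas (G k) (Hk k).
Proof.
by move=> kn; apply: measurable_funM; [exact: mS | exact: (Gmeas_comp m_sgn (mM kn))].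
Qed.

Let sH k : sqi P (Hk k).
Proof.
apply: (@sqi_mul_bounded _ _ _ _ (S k) (fun w => sgn (M k w)) 1).
- exact: sS.
- exact: (measurableT_comp m_sgn (sqi_measurable (sM k))).
- by move=> w; rewrite /sgn; case: ifP; rewrite ?normrN normr1.
Qed.

(* Pathwise form of Doob's inequality, with the integrand S_l sgn(M_l) (Acciaio et al.). *)
Let pathwise k w :
  \sum_(l < k) (Hk l w : R) * x l w <= S k w * `|M k w : R| - S k w ^+ 2 / 2.
Proof.
elim: k => [|k IH]; first by rewrite big_ord0 /= mul0r expr0n mul0r subr0.
rewrite big_ord_recr /=; set a := `|M k.+1 w : R|.
have step : (Hk k w : R) * x k w <= S k w * (a - `|M k w : R|).
  rewrite /Hk -mulrA ler_wpM2l ?S_ge0// /a MS /sgn; case: ifP => h.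
    by rewrite (ger0_norm h) mul1r lerBrDl ler_norm.
  have := ler_norm (- ((M k w : R) + x k w)); rewrite normrN.
  by rewrite (@ltr0_norm _ (M k w)) ?ltNge ?h//; lra.
apply: le_trans (lerD IH step) _; rewrite -/(S k w).
have a0 : 0 <= a by exact: normr_ge0.
have := S_ge0 k w; move: (S k w) => s s0.
case: (leP s a) => h; last lra.
have := sqr_ge0 (a - s); rewrite !expr2; lra.
Qed.

Lemma doob_L2 : EE P (S n) (S n) <= 4 * \sum_(l < n) EE P (x l) (x l).
Proof.
rewrite -martingale_sqr//.
have sMa := sqi_abs (sM n).
have I1 := sqi_integrable (sS n) sMa; have I2 := sqi_integrable (sS n) (sS n).
have I3 (l : 'I_n) := sqi_integrable (sH l) (sx l).
have [J JE] := Rintegral_finsum (index_enum 'I_n) measurableT I3.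
have IR : P.-integrable [set: Omega]
    (EFin \o (fun w => (S n w : R) * `|M n w : R| - S n w * S n w / 2)).
  have := integrableB measurableT I1 (integrableZl measurableT (2^-1) I2).
  by apply: eq_integrable => // w _; rewrite /= -?EFinM -?EFinB; congr EFin; lra.
have : \sum_(l < n) EE P (Hk l) (x l) <= EE P (S n) (fun w => `|M n w : R|) - EE P (S n) (S n) / 2.
  rewrite /EE -JE -RintegralZr// -RintegralB//; last exact: (integrableZr measurableT _ I2).
  by apply: le_Rintegral => // w _; rewrite -expr2; exact: pathwise.
(* The expectation of the left side of the pathwise bound vanishes, since [Hk l] is measurable for
   [G l]. What remains is [E S^2 <= 2 E S|M|], and expanding [E (S - 2|M|)^2 >= 0] yields the factor
   4. *)
rewrite big1; last by move=> l _; exact: (x0 (ltn_ord l) (sH l) (mH (ltnW (ltn_ord l)))).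
have := si_ge0 IP (subspB IP (sS n) (subspZ IP 2 sMa)).
rewrite (form_sqrB IP (sS n) (subspZ IP 2 sMa)) (formZr IP 2 sMa (sS n)).
rewrite (formZl IP 2 sMa (subspZ IP 2 sMa)) (formZr IP 2 sMa sMa).
have -> : EE P (fun w => `|M n w : R|) (fun w => `|M n w : R|) = EE P (M n) (M n).
  by apply: eq_Rintegral => w _; rewrite -!expr2 real_normK ?num_real.
by lra.
Qed.

End doob.

(** * The Ito integral *)

Import HBNNSimple.

(** * Integration against densities and Gaussian second moments *)

Section density.
Context (d : measure_display) (T : measurableType d) (R : realType)
  (nu mu : {measure set T -> \bar R}) (p : T -> R).
Hypotheses (mp : measurable_fun [set: T] p) (p0 : forall x, 0 <= p x)
  (nuE : forall A, measurable A -> nu A = (\int[mu]_(x in A) (p x)%:E)%E).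

Let density_nnsfun (h : {nnsfun T >-> R}) :
  (\int[nu]_x (h x)%:E = \int[mu]_x (h x * p x)%:E)%E.
Proof.
have := fimfunEord h; rewrite /=; set s := finmap.enum_fset _ => H.
have hE x : h x = \sum_(i < size s) `|s`_i| * \1_(h @^-1` [set s`_i]) x.
  rewrite H; apply: eq_bigr => i _; rewrite !indicE.
  case: (boolP (x \in _)) => [|_]; last by rewrite !mulr0.
  by rewrite inE /= => hx; rewrite ger0_norm// -hx; exact: fun_ge0.
have mA i : measurable (h @^-1` [set s`_i]).
  by rewrite -[X in measurable X]setTI; apply: (@measurable_funP _ _ _ _ _ h) => //; exact: measurable_set1.
have mI i : measurable_fun [set: T] (\1_(h @^-1` [set s`_i]) : T -> R) by exact: measurable_indic.
transitivity (\sum_(i < size s) (`|s`_i|%:E * nu (h @^-1` [set s`_i])))%E.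
  under eq_integral do rewrite hE -sumEFin.
  rewrite ge0_integral_sum//; last by move=> i; apply/measurable_EFinP; exact: measurable_funM.
  apply: eq_bigr => i _; under eq_integral do rewrite EFinM.
  rewrite ge0_integralZl//; last exact/measurable_EFinP.
  by rewrite integral_indic// setIT.
under [RHS]eq_integral do rewrite hE mulr_suml -sumEFin.
rewrite ge0_integral_sum//; last 2 first.
- by move=> i; apply/measurable_EFinP; apply: measurable_funM => //; exact: measurable_funM.
- by move=> i x _; rewrite lee_fin mulr_ge0// mulr_ge0.
apply: eq_bigr => i _; under eq_integral do rewrite -mulrA EFinM.
rewrite ge0_integralZl//; last 2 first.
- by apply/measurable_EFinP; exact: measurable_funM.
- by move=> x _; rewrite lee_fin mulr_ge0.
congr (_ * _)%E; rewrite nuE// integral_mkcond; apply: eq_integral => x _.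
by rewrite /patch indicE; case: ifP; rewrite ?mul1r ?mul0r.
Qed.

(** Used with three densities: the normal one, the indicator of an event, and a constant, which is
    the probability of that event. Monotone convergence extends the formula from simple
    functions. *)
Lemma ge0_integral_density (g : T -> R) :
  measurable_fun [set: T] g -> (forall x, 0 <= g x) ->
  (\int[nu]_x (g x)%:E = \int[mu]_x (g x * p x)%:E)%E.
Proof.
move=> mg g0; have mgE : measurable_fun [set: T] (EFin \o g) by exact/measurable_EFinP.
pose a k : {nnsfun T >-> R} := nnsfun_approx measurableT mgE k.
have gE0 (x : T) : [set: T] x -> (0 <= (EFin \o g) x)%E by rewrite /= lee_fin.
have cva x : (a k x)%:E @[k --> \oo] --> (g x)%:E.
  exact: (@cvg_nnsfun_approx _ T R setT measurableT _ mgE gE0 x Logic.I).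
have nda x : {homo (fun k => a k x) : i j / (i <= j)%N >-> i <= j}.
  move=> i j ij; have := @nd_nnsfun_approx _ T R setT measurableT _ mgE i j ij.
  by move/lefP; exact.
have a0 k x : 0 <= a k x by exact: fun_ge0.
have ma k : measurable_fun [set: T] (a k) by exact: measurable_funP.
have E1 : (\int[nu]_x (g x)%:E = limn (fun k => \int[nu]_x (a k x)%:E))%E.
  rewrite -monotone_convergence//.
  - by apply: eq_integral => x _; apply/esym/cvg_lim => //; exact: cva.
  - by move=> k; exact/measurable_EFinP.
  - by move=> k x _; rewrite lee_fin.
  - by move=> x _ i j ij; rewrite lee_fin nda.
have E2 : (\int[mu]_x (g x * p x)%:E = limn (fun k => \int[mu]_x (a k x * p x)%:E))%E.
  rewrite -monotone_convergence//.
  - apply: eq_integral => x _; apply/esym/cvg_lim => //.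
    apply: cvg_EFin; first by apply: nearW.
    apply: cvgM; last exact: cvg_cst.
    by have /fine_cvgP[] := cva x.
  - by move=> k; apply/measurable_EFinP; exact: measurable_funM.
  - by move=> k x _; rewrite lee_fin mulr_ge0.
  - by move=> x _ i j ij; rewrite lee_fin ler_wpM2r// nda.
by rewrite E1 E2; under eq_fun do rewrite density_nnsfun.
Qed.

End density.

Section normal_moments.
Context (R : realType).

(** With [v = y^2 / (4 s^2)] one has [v exp (- v) <= 1]. Hence [y^2] times the density is at most a
    constant times [exp (- v)], a multiple of the normal density with standard deviation
    [sqrt 2 * s]. *)
Lemma normal_sqr_lty (s : R) : 0 < s ->
  (\int[normal_prob 0 s]_y (y ^+ 2)%:E < +oo)%E.
Proof.
move=> s0; have m2 : measurable_fun [set: R] (fun y : R => y ^+ 2) by exact: exprn_measurable.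
rewrite (@ge0_integral_density _ _ R (normal_prob 0 s) lebesgue_measure (normal_pdf 0 s)
  (measurable_normal_pdf 0 s) (normal_pdf_ge0 0 s) (fun A _ => erefl) _ m2 (fun y => sqr_ge0 y)).
pose s2 := Num.sqrt 2 * s.
have s20 : 0 < s2 by rewrite mulr_gt0// sqrtr_gt0.
pose c := 4 * s ^+ 2 * (normal_peak s / normal_peak s2).
have le y : y ^+ 2 * normal_pdf 0 s y <= c * normal_pdf 0 s2 y.
  rewrite !normal_pdfE ?gt_eqF// /normal_fun !subr0 mulrCA.
  have -> : c * (normal_peak s2 * expR (- y ^+ 2 / (s2 ^+ 2 *+ 2))) =
      normal_peak s * (4 * s ^+ 2 * expR (- y ^+ 2 / (s2 ^+ 2 *+ 2))).
    by rewrite /c; field; rewrite gt_eqF// normal_peak_gt0// gt_eqF.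
  rewrite ler_wpM2l ?normal_peak_ge0//.
  pose v := y ^+ 2 / (4 * s ^+ 2).
  have sn0 : s != 0 by rewrite gt_eqF.
  have -> : - y ^+ 2 / (s2 ^+ 2 *+ 2) = - v.
    by rewrite /v /s2 exprMn sqr_sqrtr// -mulr_natr; field.
  have -> : - y ^+ 2 / (s ^+ 2 *+ 2) = - v - v by rewrite /v -mulr_natr; field.
  have -> : y ^+ 2 = 4 * s ^+ 2 * v by rewrite /v; field.
  rewrite -(mulrA (4 * s ^+ 2)); apply: ler_wpM2l; first by rewrite mulr_ge0// sqr_ge0.
  rewrite expRD mulrA; apply: ler_piMl; first exact: expR_ge0.
  rewrite expRN ler_pdivrMr ?expR_gt0// mul1r; have := expR_ge1Dx v; lra.
apply: (@le_lt_trans _ _ (\int[lebesgue_measure]_y (c%:E * (normal_pdf 0 s2 y)%:E))%E).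
  apply: ge0_integral_mono => y _.
    by rewrite lee_fin mulr_ge0 ?sqr_ge0 ?normal_pdf_ge0.
  by rewrite -EFinM lee_fin.
rewrite integralZl//; last exact: integrable_normal_pdf.
by rewrite integral_normal_pdf mule1 ltry.
Qed.

End normal_moments.

Section law_and_event.
Context (R : realType) (d : measure_display) (Omega : measurableType d)
  (P : probability Omega R).

(** Restricting [P] to [C] and pushing it forward by [D] gives the measure [nu] with the constant
    density [P C]. *)
Lemma integral_law_event (nu : {measure set (measurableTypeR R) -> \bar R})
    (D : Omega -> measurableTypeR R) (C : set Omega) (g : measurableTypeR R -> R) :
  measurable_fun [set: Omega] D -> measurable C ->
  (forall A, measurable A -> P (C `&` D @^-1` A) = (P C * nu A)%E) ->
  measurable_fun [set: measurableTypeR R] g -> (forall y, 0 <= g y) ->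
  (\int[P]_w (\1_C w * g (D w))%:E = P C * \int[nu]_y (g y)%:E)%E.
Proof.
move=> mD mC H mg g0.
have mC1 : measurable_fun [set: Omega] (\1_C : Omega -> R) by exact: measurable_indic.
have mgD : measurable_fun [set: Omega] (g \o D) by exact: measurableT_comp.
have -> : (\int[P]_w (\1_C w * g (D w))%:E = \int[mrestr P mC]_w ((g \o D) w)%:E)%E.
  rewrite (@ge0_integral_density _ _ R (mrestr P mC) P (\1_C) mC1 _ _ (g \o D) mgD)//.
  - by apply: eq_integral => w _; rewrite mulrC.
  - by move=> A mA; rewrite integral_indic// setIC.
  - by move=> w; exact: g0.
have -> : (\int[mrestr P mC]_w ((g \o D) w)%:E = \int[pushforward (mrestr P mC) D]_y (g y)%:E)%E.
  rewrite (@ge0_integral_pushforward _ _ _ _ R D mD (mrestr P mC) setT (EFin \o g) measurableT)//.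
    exact/measurable_EFinP.
  by move=> y _; rewrite lee_fin.
have Pfin : P C \is a fin_num by exact: fin_num_measure.
have k0 : 0 <= fine (P C) by exact: fine_ge0.
rewrite (@ge0_integral_density _ _ R (pushforward (mrestr P mC) D) nu (fun=> fine (P C)) _ _ _ g mg)//.
  under eq_integral do rewrite EFinM muleC.
  rewrite ge0_integralZl ?fineK//; first exact/measurable_EFinP.
  by move=> y _; rewrite lee_fin.
move=> A mA; rewrite integral_cst// fineK// -H// /pushforward /mrestr setIC//.
Qed.

End law_and_event.

(** * Moments and orthogonality of Wiener increments on events of the past *)

Section wiener.
Context (R : realType) (d : measure_display) (Omega : measurableType d)
  (P : probability Omega R) (T : R) (F : R -> set (set Omega))
  (U : completeNormedModType R) (inner : {dot U for idfun})
  (W : R -> U -> Omega -> R).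
Hypotheses (hF : stochastic_basis P T F) (hU : inner_product_norm inner)
  (hW : cylindrical_wiener P T F W).
Implicit Types (s t r a b : R) (x y : U) (C : set Omega).

Let IP := sqi_semi_inner P.
Let IU := inner_semi_inner hU.

Lemma filtration_sub t : 0 <= t <= T -> sub_sigma (F t).
Proof. by case: hF => H _ _ _ /H. Qed.

Lemma filtration_homo s t : 0 <= s -> s <= t -> t <= T -> F s `<=` F t.
Proof. by case: hF => _ H _ _; exact: H. Qed.

Lemma filtration_complete t : 0 <= t <= T -> forall A, P.-negligible A -> F t A.
Proof.
move=> /andP[t0 tT] A NA; apply: (@filtration_homo 0 t) => //.
by case: hF => _ _ H _; exact: H.
Qed.

Lemma EE_ae X X' Y : sqi P X -> sqi P X' -> sqi P Y ->
  {ae P, forall w, X w = X' w} -> EE P X Y = EE P X' Y.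
Proof.
move=> sX sX' sY XX'; congr fine; apply: ae_eq_integral => //.
- by case/integrableP: (sqi_integrable sX sY).
- by case/integrableP: (sqi_integrable sX' sY).
- by apply: filterS XX' => w e _ /=; rewrite e.
Qed.

Lemma sqi_ae X Y : measurable_fun [set: Omega] (Y : Omega -> R) -> sqi P X ->
  {ae P, forall w, X w = Y w} -> sqi P Y.
Proof.
move=> mY sX XY; apply/sqiP => //; have H := (sqiP P (sqi_measurable sX)).1 sX.
apply: le_lt_trans H; rewrite (@ge0_ae_eq_integral _ _ _ P _ _
  (fun w => ((X w : R) ^+ 2)%:E))//.
- by apply/measurable_EFinP; exact: measurable_funX.
- by apply/measurable_EFinP; apply: measurable_funX; exact: sqi_measurable sX.
- by move=> w _; rewrite lee_fin sqr_ge0.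
- by move=> w _; rewrite lee_fin sqr_ge0.
- by apply: filterS XY => w e _ /=; rewrite e.
Qed.

Definition incr s t x : Omega -> R^o := fun w => W t x w - W s x w.

Definition event_incr C s t x : Omega -> R^o := fun w => \1_C w * incr s t x w.

Lemma incr_Gmeas s t x : 0 <= s -> s <= t -> t <= T -> Gmeas (F t) (incr s t x).
Proof.
move=> s0 st tT; have [H _ _ _ _] := hW.
have st' : 0 <= s <= T by rewrite s0 (le_trans st).
have tt : 0 <= t <= T by rewrite tT (le_trans s0).
have sGt := filtration_sub tt.
apply: measurable_funB; first by apply/(GmeasP _ sGt) => A mA; exact: H.
apply: (Gmeas_sub (filtration_sub st') sGt (filtration_homo s0 st tT)).
by apply/(GmeasP _ (filtration_sub st')) => A mA; exact: H.
Qed.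

Lemma incr_measurable s t x : 0 <= s -> s <= t -> t <= T ->
  measurable_fun [set: Omega] (incr s t x : Omega -> R).
Proof.
move=> s0 st tT; apply: (@Gmeas_measurable _ _ _ (F t)); last exact: incr_Gmeas.
by apply: filtration_sub; rewrite tT (le_trans s0).
Qed.

Lemma incr_lin s t a x y : 0 <= s -> s <= t -> t <= T ->
  {ae P, forall w, incr s t (a *: x + y) w = a * incr s t x w + incr s t y w}.
Proof.
move=> s0 st tT; have [_ H _ _ _] := hW.
have st' : 0 <= s <= T by rewrite s0 (le_trans st).
have tt : 0 <= t <= T by rewrite tT (le_trans s0).
apply: filterS2 (H s a x y st') (H t a x y tt) => w e1 e2.
by rewrite /incr e1 e2; ring.
Qed.

Lemma incr0 s t : 0 <= s -> s <= t -> t <= T -> {ae P, forall w, incr s t 0 w = 0}.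
Proof.
move=> s0 st tT; apply: filterS (incr_lin 1 0 0 s0 st tT) => w.
by rewrite scaler0 addr0 mul1r => /eqP; rewrite -subr_eq0 opprD addrA subrr sub0r oppr_eq0 => /eqP.
Qed.

Lemma incrZ s t a x : 0 <= s -> s <= t -> t <= T ->
  {ae P, forall w, incr s t (a *: x) w = a * incr s t x w}.
Proof.
move=> s0 st tT; apply: filterS2 (incr_lin a x 0 s0 st tT) (incr0 s0 st tT) => w.
by rewrite addr0 => -> ->; rewrite addr0.
Qed.

(* Its value 1 is never needed: it only enters the constants. *)
Definition gauss_var : R := fine (\int[normal_prob 0 1]_y (y ^+ 2)%:E)%E.

Lemma gauss_var_ge0 : 0 <= gauss_var.
Proof. by apply: fine_ge0; apply: integral_ge0 => y _; rewrite lee_fin sqr_ge0. Qed.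

(** Normalised so that the increment is standard normal; the general second moment follows by
    scaling [x], and the one constant [gauss_var] covers all cases. *)
Let incr_unit s t x C : 0 <= s -> s < t -> t <= T -> F s C -> Num.sqrt (t - s) * `|x| = 1 ->
  (\int[P]_w (\1_C w * (incr s t x w : R) ^+ 2)%:E = P C * gauss_var%:E)%E.
Proof.
move=> s0 st tT FC x1; have [_ _ _ _ H] := hW.
have x0 : x != 0.
  by apply/eqP => x0; move: x1; rewrite x0 normr0 mulr0 => /esym/eqP; rewrite oner_eq0.
have [law ind] := H s t x s0 st tT x0.
have mD := incr_measurable x s0 (ltW st) tT.
have mC : measurable C.
  by apply: (filtration_sub _).2; last exact: FC; rewrite s0 (le_trans (ltW st)).
rewrite (@integral_law_event _ _ _ P (normal_prob 0 1) (incr s t x) C (fun z : R => z ^+ 2))//.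
- rewrite /gauss_var fineK// ge0_fin_numE; first exact: normal_sqr_lty.
  by apply: integral_ge0 => y _; rewrite lee_fin sqr_ge0.
- by move=> A mA; rewrite (ind C A FC mA) (law A mA) x1.
- by move=> z; exact: sqr_ge0.
Qed.

Let incr_sqr_gt s t x C : 0 <= s -> s < t -> t <= T -> F s C -> x != 0 ->
  (\int[P]_w (\1_C w * (incr s t x w : R) ^+ 2)%:E
   = P C * (gauss_var * (t - s) * `|x| ^+ 2)%:E)%E.
Proof.
move=> s0 st tT FC x0; set k := Num.sqrt (t - s) * `|x|.
have k0 : 0 < k by rewrite mulr_gt0 ?sqrtr_gt0 ?subr_gt0 ?normr_gt0.
have mC : measurable C.
  by apply: (filtration_sub _).2; last exact: FC; rewrite s0 (le_trans (ltW st)).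
have x1 : Num.sqrt (t - s) * `|k^-1 *: x| = 1.
  by rewrite normrZ gtr0_norm ?invr_gt0// mulrCA mulVf// gt_eqF.
have mI y : measurable_fun [set: Omega] (fun w => \1_C w * (incr s t y w : R) ^+ 2).
  apply: measurable_funM; first exact: measurable_indic.
  by apply: measurable_funX; exact: (incr_measurable y s0 (ltW st) tT).
have g0 y w : (0 <= (\1_C w * (incr s t y w : R) ^+ 2)%:E)%E.
  by rewrite lee_fin mulr_ge0 ?sqr_ge0.
transitivity (\int[P]_w ((k ^+ 2)%:E * (\1_C w * (incr s t (k^-1 *: x) w : R) ^+ 2)%:E))%E.
  apply: ge0_ae_eq_integral => //.
  - exact/measurable_EFinP.
  - by apply: emeasurable_funM; [exact: measurable_cst | exact/measurable_EFinP].
  - by move=> w _; rewrite mule_ge0// lee_fin sqr_ge0.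
  - apply: filterS (incrZ k^-1 x s0 (ltW st) tT) => w -> _.
    by rewrite -EFinM; congr EFin; field; rewrite gt_eqF.
rewrite ge0_integralZl//; last 2 first.
- exact/measurable_EFinP.
- by rewrite lee_fin sqr_ge0.
rewrite incr_unit// muleCA -EFinM; congr (_ * _%:E)%E.
by rewrite /k exprMn sqr_sqrtr ?subr_ge0 1?ltW//; ring.
Qed.

Lemma incr_sqi s t x : 0 <= s -> s <= t -> t <= T -> sqi P (incr s t x).
Proof.
move=> s0 st tT; have mD := incr_measurable x s0 st tT.
have sst : 0 <= s <= T by rewrite s0 (le_trans st).
move: st; rewrite le_eqVlt => /orP[/eqP st|st].
  apply: (sqi_dom mD (sqi_cst P 0)) => w.
  by rewrite /incr st subrr.
have [->|x0] := eqVneq x 0.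
  apply: (sqi_ae (incr_measurable 0 s0 (ltW st) tT) (sqi_cst P 0)).
  by apply: filterS (incr0 s0 (ltW st) tT) => w e; rewrite e.
apply/sqiP => //; have FT : F s setT.
  by have [[F0 FC _] _] := filtration_sub sst; have := FC _ F0; rewrite setD0.
have := incr_sqr_gt s0 st tT FT x0; under eq_integral do rewrite indicE mem_set// mul1r.
by move=> ->; rewrite probability_setT mul1e ltry.
Qed.

Lemma indic_sqi C : measurable C -> sqi P (\1_C : Omega -> R).
Proof.
move=> mC; apply: (sqi_dom _ (sqi_cst P 1)); first exact: measurable_indic.
by move=> w; rewrite indicE; case: (_ \in _); rewrite ?normr0 ?normr1.
Qed.

Lemma event_incr_sqi C s t x : measurable C -> 0 <= s -> s <= t -> t <= T ->
  sqi P (event_incr C s t x).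
Proof.
move=> mC s0 st tT; have sI := incr_sqi x s0 st tT.
apply: (sqi_dom _ sI).
  by apply: measurable_funM; [exact: measurable_indic | exact: sqi_measurable sI].
by move=> w; rewrite normrM ler_piMl// indicE; case: (_ \in _); rewrite ?normr0 ?normr1.
Qed.

Lemma event_incr_lin C s t a x y : 0 <= s -> s <= t -> t <= T ->
  {ae P, forall w, event_incr C s t (a *: x + y) w
     = (a *: event_incr C s t x + event_incr C s t y) w}.
Proof.
move=> s0 st tT; apply: filterS (incr_lin a x y s0 st tT) => w e.
by rewrite !fctE /event_incr e /GRing.scale /=; ring.
Qed.

Lemma event_incr_sqr C s t x : F s C -> 0 <= s -> s <= t -> t <= T ->
  EE P (event_incr C s t x) (event_incr C s t x)
  = gauss_var * (t - s) * `|x| ^+ 2 * fine (P C).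
Proof.
move=> FC s0 st tT; have sst : 0 <= s <= T by rewrite s0 (le_trans st).
have mC : measurable C by apply: (filtration_sub sst).2.
have sK := event_incr_sqi x mC s0 st tT.
move: st; rewrite le_eqVlt => /orP[/eqP st|st].
  subst t; rewrite subrr mulr0 !mul0r -[RHS](form0l IP sK); congr (EE P _ _).
  by apply/funext => w; rewrite /event_incr /incr subrr mulr0.
have [x0|x0] := eqVneq x 0.
  rewrite x0 normr0 expr0n mulr0 mul0r -(form0l IP (event_incr_sqi 0 mC s0 (ltW st) tT)).
  apply: EE_ae; rewrite -?x0//; first exact: (si_0 IP).
  by apply: filterS (incr0 s0 (ltW st) tT) => w; rewrite x0 /event_incr => ->; rewrite mulr0.
apply: EFin_inj; rewrite (EE_integral sK).
transitivity (\int[P]_w (\1_C w * (incr s t x w : R) ^+ 2)%:E)%E.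
  apply: eq_integral => w _; congr EFin; rewrite /event_incr exprMn indicE.
  by case: (_ \in _); rewrite ?expr1n ?expr0n.
have Pfin : P C \is a fin_num by exact: fin_num_measure.
by rewrite incr_sqr_gt// -(fineK Pfin) -EFinM mulrC.
Qed.

(** Polarisation of [event_incr_sqr]. The increment is linear in [x] only almost surely, so the
    square of the sum is transported by [EE_ae]. *)
Lemma event_incr_polar C s t x y : F s C -> 0 <= s -> s <= t -> t <= T ->
  EE P (event_incr C s t x) (event_incr C s t y)
  = gauss_var * (t - s) * inner x y * fine (P C).
Proof.
move=> FC s0 st tT; have sst : 0 <= s <= T by rewrite s0 (le_trans st).
have mC : measurable C by apply: (filtration_sub sst).2.
have sK z := event_incr_sqi z mC s0 st tT.
have e : EE P (event_incr C s t (x + y)) (event_incr C s t (x + y)) =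
  EE P (event_incr C s t x + event_incr C s t y) (event_incr C s t x + event_incr C s t y).
  have ae : {ae P, forall w, event_incr C s t (x + y) w
      = (event_incr C s t x + event_incr C s t y) w}.
    have := event_incr_lin C 1 x y s0 st tT; rewrite !scale1r; exact.
  have sD := subspD IP (sK x) (sK y).
  by rewrite (EE_ae (sK (x + y)) sD (sK (x + y)) ae) (si_C IP sD (sK _))
     (EE_ae (sK (x + y)) sD sD ae).
move: e; rewrite (form_sqrD IP (sK x) (sK y)) !event_incr_sqr// -!hU.
rewrite (form_sqrD IU (I : [set: U] x) (I : [set: U] y)); lra.
Qed.

(** [- x] has the same norm as [x], so both increments have the same law and are independent of [C];
    their positive parts have equal means on [C], and the difference of these positive parts is the
    increment along [x]. *)
Lemma incr_mean0 C s t x : F s C -> 0 <= s -> s <= t -> t <= T ->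
  EE P (\1_C : Omega -> R) (incr s t x) = 0.
Proof.
move=> FC s0 st tT; have sst : 0 <= s <= T by rewrite s0 (le_trans st).
have mC : measurable C by apply: (filtration_sub sst).2.
have sI := incr_sqi x s0 st tT; have sC := indic_sqi mC.
move: st; rewrite le_eqVlt => /orP[/eqP st|st].
  rewrite (si_C IP sC sI) -[RHS](form0l IP sC); congr (EE P _ _).
  by apply/funext => w; rewrite /incr st subrr.
have [x0|x0] := eqVneq x 0.
  rewrite (si_C IP sC sI) -(form0l IP sC); apply: EE_ae => //; first exact: (si_0 IP).
  by apply: filterS (incr0 s0 (ltW st) tT) => w; rewrite x0 => ->.
have [_ _ _ _ H] := hW.
pose pos a := Num.max a 0.
have mpos : measurable_fun [set: R] pos by apply: measurable_maxr => //; exact: measurable_id.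
have pos0 a : 0 <= pos a by rewrite le_max lexx orbT.
have law z : z != 0 -> `|z| = `|x| ->
    (\int[P]_w (\1_C w * pos (incr s t z w))%:E
     = P C * \int[normal_prob 0 (Num.sqrt (t - s) * `|x|)]_a (pos a)%:E)%E.
  move=> z0 zx; have [law ind] := H s t z s0 st tT z0.
  apply: (@integral_law_event _ _ _ P (normal_prob 0 (Num.sqrt (t - s) * `|x|)) (incr s t z) C pos) => //.
    exact: (incr_measurable z s0 (ltW st) tT).
  by move=> A mA; rewrite (ind C A FC mA) (law A mA) zx.
have mp z : measurable_fun [set: Omega] (fun w => \1_C w * pos (incr s t z w)).
  apply: measurable_funM; first exact: measurable_indic.
  exact: (measurableT_comp mpos (incr_measurable z s0 (ltW st) tT)).
have I z : P.-integrable [set: Omega] (EFin \o (fun w => \1_C w * pos (incr s t z w))).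
  have := sqi_integrable sC (incr_sqi z s0 (ltW st) tT).
  apply: le_integrable => //; first exact/measurable_EFinP.
  move=> w _; rewrite lee_fin !normrM ler_wpM2l// /pos.
  by case: (leP (incr s t z w : R) 0) => _; rewrite ?normr0.
have -> : EE P (\1_C : Omega -> R) (incr s t x) =
    \int[P]_w (\1_C w * pos (incr s t x w)) - \int[P]_w (\1_C w * pos (incr s t (- x) w)).
  have mI : measurable_fun [set: Omega] (fun w => \1_C w * incr s t x w).
    by apply: measurable_funM; [exact: measurable_indic | exact: sqi_measurable sI].
  rewrite -RintegralB//; congr fine; apply: ae_eq_integral => //.
  - exact/measurable_EFinP.
  - by apply/measurable_EFinP; apply: measurable_funB.
  have := incrZ (-1) x s0 (ltW st) tT; rewrite scaleN1r; apply: filterS => w -> _ /=.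
  congr EFin; rewrite -mulrBr; congr (_ * _); rewrite /pos mulN1r.
  case: (leP (incr s t x w : R) 0) => h.
    by rewrite max_l ?oppr_ge0// sub0r opprK.
  by rewrite max_r ?oppr_le0 1?ltW// subr0.
rewrite /Rintegral law// law ?oppr_eq0 ?normrN// subrr//.
Qed.

Lemma incr_orth s t x Y : 0 <= s -> s <= t -> t <= T -> sqi P Y -> Gmeas (F s) Y ->
  EE P Y (incr s t x) = 0.
Proof.
move=> s0 st tT; apply: orth_sqi.
- by apply: filtration_sub; rewrite s0 (le_trans st).
- exact: incr_sqi.
- by move=> D FD; exact: incr_mean0.
Qed.

Lemma event_incr_Gmeas C s t x : F s C -> 0 <= s -> s <= t -> t <= T ->
  Gmeas (F t) (event_incr C s t x).
Proof.
move=> FC s0 st tT; apply: measurable_funM; last exact: incr_Gmeas.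
apply: Gmeas_indic; first by apply: filtration_sub; rewrite tT (le_trans s0).
exact: (filtration_homo s0 st tT).
Qed.

Lemma event_incr_orth C s t x Y : F s C -> 0 <= s -> s <= t -> t <= T ->
  sqi P Y -> Gmeas (F s) Y -> EE P Y (event_incr C s t x) = 0.
Proof.
move=> FC s0 st tT sY mY; have sst : 0 <= s <= T by rewrite s0 (le_trans st).
have mC : measurable C by apply: (filtration_sub sst).2.
have mC1 := Gmeas_indic (filtration_sub sst) FC.
transitivity (EE P (fun w => (Y w : R) * \1_C w) (incr s t x)).
  by apply: eq_Rintegral => w _; rewrite /event_incr mulrA.
apply: incr_orth => //; last by apply: measurable_funM; [exact: mY | exact: mC1].
apply: (@sqi_mul_bounded _ _ _ _ Y (\1_C) 1); [exact: sY | exact: measurable_indic |].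
by move=> w; rewrite indicE; case: (_ \in _); rewrite ?normr0 ?normr1.
Qed.

Lemma event_incr_split C s r t x :
  event_incr C s t x = event_incr C s r x + event_incr C r t x.
Proof. by apply/funext => w; rewrite !fctE /event_incr /incr; ring. Qed.

(** The intervals are split at [a = max s s'] and at [t]. Pieces over disjoint intervals are
    orthogonal, because the earlier one is measurable at the start of the later one; only the common
    piece []a, t]] survives. *)
Let isometry_le C C' s t s' t' x y : F s C -> F s' C' -> 0 <= s -> s <= t ->
  0 <= s' -> s' <= t' -> t' <= T -> t <= t' ->
  EE P (event_incr C s t x) (event_incr C' s' t' y)
  = gauss_var * Num.max 0 (Num.min t t' - Num.max s s') * inner x y * fine (P (C `&` C')).
Proof.
move=> FC FC' s0 st s'0 s't' t'T tt'.
have tT := le_trans tt' t'T.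
have sT := le_trans st tT; have s'T := le_trans s't' t'T.
have mC : measurable C by apply: (filtration_sub _).2; last exact: FC; rewrite s0.
have mC' : measurable C' by apply: (filtration_sub _).2; last exact: FC'; rewrite s'0.
rewrite (min_l tt'); set a := Num.max s s'.
have as_ : s <= a by rewrite le_max lexx.
have as' : s' <= a by rewrite le_max lexx orbT.
have [ts'|s't] := leP t s'.
  have -> : a = s' by apply: max_r; exact: le_trans ts'.
  rewrite max_l ?subr_le0// mulr0 !mul0r.
  apply: event_incr_orth => //; first exact: event_incr_sqi.
  apply: (Gmeas_sub (filtration_sub _) (filtration_sub _) (filtration_homo _ ts' s'T)).
  - by rewrite (le_trans s0 st) tT.
  - by rewrite s'0 s'T.
  - exact: le_trans st.
  - exact: event_incr_Gmeas.
have at_ : a <= t by rewrite ge_max st ltW.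
have a0 : 0 <= a by exact: le_trans as_.
have aT : a <= T by exact: le_trans tT.
rewrite max_r ?subr_ge0//.
have FaC := filtration_homo s0 as_ aT FC; have FaC' := filtration_homo s'0 as' aT FC'.
have t0 := le_trans s0 st.
have FtC' := filtration_homo s'0 (ltW s't) tT FC'.
have sub1 := filtration_sub (introT andP (conj a0 aT)).
rewrite (event_incr_split C' s' t t' y) (event_incr_split C s a t x).
rewrite (event_incr_split C' s' a t y).
have sK1 := event_incr_sqi x mC s0 as_ aT; have sK2 := event_incr_sqi x mC a0 at_ tT.
have sL1 := event_incr_sqi y mC' s'0 as' aT; have sL2 := event_incr_sqi y mC' a0 at_ tT.
have sL3 := event_incr_sqi y mC' t0 tt' t'T.
have sK := subspD IP sK1 sK2.
have mK1 : Gmeas (F a) (event_incr C s a x) by exact: event_incr_Gmeas.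
have mL1 : Gmeas (F a) (event_incr C' s' a y) by exact: event_incr_Gmeas.
rewrite (formDr IP (subspD IP sL1 sL2) sL3 sK).
rewrite [X in _ + X](_ : _ = 0) ?addr0; last first.
  rewrite -(event_incr_split C s a t x); apply: event_incr_orth => //.
    exact: event_incr_sqi.
  exact: event_incr_Gmeas.
rewrite (formDr IP sL1 sL2 sK) !(formDl IP sK1 sK2)//.
rewrite (event_incr_orth y FaC' a0 at_ tT sK1 mK1).
rewrite (si_C IP sK2 sL1) (event_incr_orth x FaC a0 at_ tT sL1 mL1) addr0 add0r.
(* One of the two pieces that end at [a] is an increment over an empty interval. *)
rewrite [X in X + _](_ : _ = 0) ?add0r; last first.
  case: (leP s s') => h.
    have e : a = s' by exact: max_r.
    rewrite (si_C IP sK1 sL1) -[RHS](form0l IP sK1); congr (EE P _ _).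
    by apply/funext => w; rewrite /event_incr /incr e subrr mulr0.
  have e : a = s by apply: max_l; exact: ltW.
  rewrite -[RHS](form0l IP sL1); congr (EE P _ _).
  by apply/funext => w; rewrite /event_incr /incr e subrr mulr0.
transitivity (EE P (event_incr (C `&` C') a t x) (event_incr (C `&` C') a t y)).
  apply: eq_Rintegral => w _; rewrite /event_incr indicI.
  by rewrite /= !indicE; case: (_ \in C); case: (_ \in C') => /=; ring.
rewrite event_incr_polar// -(sub_sigmaE _ sub1).
by apply: measurableI; rewrite (sub_sigmaE _ sub1).
Qed.

Lemma event_incr_isometry C C' s t s' t' x y : F s C -> F s' C' -> 0 <= s -> s <= t -> t <= T ->
  0 <= s' -> s' <= t' -> t' <= T ->
  EE P (event_incr C s t x) (event_incr C' s' t' y)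
  = gauss_var * Num.max 0 (Num.min t t' - Num.max s s') * inner x y * fine (P (C `&` C')).
Proof.
move=> FC FC' s0 st tT s'0 s't' t'T; have /orP[tt'|t't] := le_total t t'.
  exact: (isometry_le x y FC FC' s0 st s'0 s't' t'T tt').
have sT := le_trans st tT; have s'T := le_trans s't' t'T.
have mC : measurable C by apply: (filtration_sub _).2; last exact: FC; rewrite s0.
have mC' : measurable C' by apply: (filtration_sub _).2; last exact: FC'; rewrite s'0.
rewrite (si_C IP (event_incr_sqi x mC s0 st tT) (event_incr_sqi y mC' s'0 s't' t'T)).
by rewrite (isometry_le y x FC' FC s'0 s't' s0 st tT t't) (minC t') (maxC s') setIC (si_C IU (I : [set: U] x) (I : [set: U] y)).
Qed.

End wiener.

Lemma integral_indic_finsum (d : measure_display) (T : measurableType d) (R : realType)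
    (mu : {measure set T -> \bar R}) (D : set T) (L : finType) (a : L -> R) (A : L -> set T) :
  measurable D -> (forall l, measurable (A l)) -> (mu D < +oo)%E ->
  (\int[mu]_(x in D) (\sum_l a l * \1_(A l) x)%:E
   = (\sum_l a l * fine (mu (A l `&` D)))%:E)%E.
Proof.
move=> mD mA fD.
have I0 l : mu.-integrable D (EFin \o (\1_(A l) : T -> R)).
  apply/integrableP; split; first by apply/measurable_EFinP; exact: measurable_indic.
  apply: (@le_lt_trans _ _ (\int[mu]_(x in D) 1)%E); last by rewrite integral_cst// mul1e.
  apply: ge0_integral_mono => x _; first exact: abse_ge0.
  by rewrite /= lee_fin indicE; case: (_ \in _); rewrite ?normr0 ?normr1.
have I l : mu.-integrable D (EFin \o (fun x => a l * \1_(A l) x)).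
  have := integrableZl mD (a l) (I0 l).
  by apply: eq_integrable => // x _; rewrite /= EFinM.
have [J JE] := Rintegral_finsum (index_enum L) mD I.
have fin : (\int[mu]_(x in D) (\sum_l a l * \1_(A l) x)%:E)%E \is a fin_num by exact: integrable_fin_num.
rewrite -(fineK fin); congr EFin; rewrite [LHS]JE; apply: eq_bigr => l _.
by rewrite RintegralZl// /Rintegral integral_indic.
Qed.

(** * The isometry for elementary integrals, coordinate by coordinate *)

Section simple_isometry.
Context (R : realType) (d : measure_display) (Omega : measurableType d)
  (P : probability Omega R) (T : R) (F : R -> set (set Omega))
  (U : completeNormedModType R) (inner : {dot U for idfun})
  (W : R -> U -> Omega -> R).
Hypotheses (hT : 0 < T) (hF : stochastic_basis P T F) (hU : inner_product_norm inner)
  (hW : cylindrical_wiener P T F W).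
Context (J I : finType) (c : J -> I -> R) (s t : I -> R) (C : I -> set Omega) (x : I -> U).
Hypotheses (FC : forall i, F (s i) (C i)) (s0 : forall i, 0 <= s i)
  (st : forall i, s i <= t i) (tT : forall i, t i <= T).

(** With [c j i] the product of the [i]-th direction and [xi j], this is the adjoint of the
    elementary process at [xi j]: scalar stochastic integrals replace the [L^2]-valued one. *)
Definition simple_integrand (j : J) (r : R) (w : Omega) : U :=
  \sum_i (c j i * (\1_(`]s i, t i]%classic) r * \1_(C i) w)) *: x i.

Definition simple_integral (j : J) : Omega -> R^o :=
  \sum_i c j i *: event_incr W (C i) (s i) (t i) (x i).

Let IP := sqi_semi_inner P.
Let IU := inner_semi_inner hU.

Let mC i : measurable (C i).
Proof. by apply: (filtration_sub hF _).2; last exact: FC; rewrite s0 (le_trans (st i)). Qed.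

Let sK i : sqi P (event_incr W (C i) (s i) (t i) (x i)).
Proof. exact: (event_incr_sqi hF hW (x i) (mC i) (s0 i) (st i) (tT i)). Qed.

Lemma simple_integral_sqi j : sqi P (simple_integral j).
Proof. by apply: (subsp_sum IP) => i; apply: (subspZ IP); exact: sK. Qed.

(** Both sides are expanded over [l = (j, (i, i'))] into finite sums of interval overlaps, inner
    products and probabilities. The expectation at time [r] is returned as a measurable real
    function [f], as the later comparison with errors lacking measurability requires; [kappa]
    carries the factor [1/2] of that comparison. *)
Lemma simple_isometry (kappa : R) : 0 <= kappa -> exists f : R -> R,
  [/\ measurable_fun [set: R] f, forall r, 0 <= f r,
      forall r, measurable_fun [set: Omega]
        (fun w => kappa * \sum_j `|simple_integrand j r w| ^+ 2),
      forall r, (\int[P]_w (kappa * \sum_j `|simple_integrand j r w| ^+ 2)%:E = (f r)%:E)%E &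
      ((kappa * \sum_j EE P (simple_integral j) (simple_integral j))%:E
       = (gauss_var R)%:E * \int[lebesgue_measure]_(r in `[0%R, T]) (f r)%:E)%E].
Proof.
move=> k0; pose L := (J * (I * I))%type.
pose A (l : L) : set R := `]s l.2.1, t l.2.1] `&` `]s l.2.2, t l.2.2].
pose D (l : L) : set Omega := C l.2.1 `&` C l.2.2.
pose a (l : L) : R := kappa * (c l.1 l.2.1 * c l.1 l.2.2 * inner (x l.2.1) (x l.2.2)).
pose f r := \sum_(l : L) a l * \1_(A l) r * fine (P (D l)).
have mA l : measurable (A l) by apply: measurableI; exact: measurable_itv.
have mD l : measurable (D l) by apply: measurableI; exact: mC.
have E r w : kappa * \sum_j `|simple_integrand j r w| ^+ 2
    = \sum_(l : L) (a l * \1_(A l) r) * \1_(D l) w.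
  rewrite mulr_sumr -(pair_bigA _ (fun j (ii : I * I) =>
    a (j, ii) * \1_(A (j, ii)) r * \1_(D (j, ii)) w)) /=.
  apply: eq_bigr => j _; rewrite -hU /simple_integrand.
  rewrite (form_suml IU)// -(pair_bigA _ (fun i i' =>
    a (j, (i, i')) * \1_(A (j, (i, i'))) r * \1_(D (j, (i, i'))) w)) /= mulr_sumr.
  apply: eq_bigr => i _; rewrite (form_sumr IU)// !mulr_sumr; apply: eq_bigr => i' _.
  by rewrite /a /A /D !indicI /=; ring.
have fE r : (\int[P]_w (kappa * \sum_j `|simple_integrand j r w| ^+ 2)%:E = (f r)%:E)%E.
  under eq_integral do rewrite E.
  rewrite (integral_indic_finsum _ measurableT mD); last first.
    exact: (le_lt_trans (probability_le1 P measurableT) (ltry 1)).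
  by congr EFin; apply: eq_bigr => l _; rewrite setIT.
exists f; split => //.
- apply: measurable_sum => l; apply: measurable_funM; last exact: measurable_cst.
  by apply: measurable_funM; [exact: measurable_cst | exact: measurable_indic].
- move=> r; rewrite -lee_fin -fE; apply: integral_ge0 => w _; rewrite lee_fin.
  by apply: mulr_ge0 => //; apply: sumr_ge0 => j _; exact: sqr_ge0.
- move=> r; under eq_fun do rewrite E.
  by apply: measurable_sum => l; apply: measurable_funM; [exact: measurable_cst | exact: measurable_indic].
have fE' r : f r = \sum_(l : L) (a l * fine (P (D l))) * \1_(A l) r.
  by apply: eq_bigr => l _; rewrite mulrAC.
under eq_integral do rewrite fE'.
rewrite integral_indic_finsum//; last first.
  have lT : (lebesgue_measure (`[0%R, T]%classic : set R) < +oo)%E.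
    by rewrite lebesgue_measure_itv /= lte_fin hT -EFinB ltry.
  exact: lT.
rewrite -EFinM; congr EFin.
rewrite !mulr_sumr -(pair_bigA _ (fun j (ii : I * I) => gauss_var R *
  (a (j, ii) * fine (P (D (j, ii))) * fine (lebesgue_measure (A (j, ii) `&` `[0, T]%classic))))) /=.
apply: eq_bigr => j _.
have sS := simple_integral_sqi j.
rewrite {1}/simple_integral (form_suml IP _ _ sK sS) -(pair_bigA _ (fun i i' => gauss_var R *
  (a (j, (i, i')) * fine (P (D (j, (i, i')))) *
   fine (lebesgue_measure (A (j, (i, i')) `&` `[0, T]%classic))))) /= mulr_sumr.
apply: eq_bigr => i _; rewrite (form_sumr IP _ _ sK (sK i)) !mulr_sumr.
apply: eq_bigr => i' _.
rewrite (event_incr_isometry hF hU hW)//.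
have -> : fine (lebesgue_measure (A (j, (i, i')) `&` `[0, T]%classic))
    = Num.max 0 (Num.min (t i) (t i') - Num.max (s i) (s i')).
  rewrite (_ : _ `&` _ = `]Num.max (s i) (s i'), Num.min (t i) (t i')]%classic); last first.
    apply/seteqP; split => r; rewrite /A /= !in_itv /=.
      by move=> [[/andP[r1 r2] /andP[r3 r4]] _]; rewrite gt_max le_min r1 r2 r3 r4.
    rewrite gt_max le_min => /andP[/andP[r1 r3] /andP[r2 r4]].
    by rewrite r1 r2 r3 r4 (ltW (le_lt_trans (s0 i) r1)) (le_trans r2).
  rewrite lebesgue_measure_itv /= lte_fin; case: ltP => h.
    by rewrite -EFinB /= [RHS]max_r// subr_ge0 ltW.
  by rewrite /= [RHS]max_l// subr_le0.
by rewrite /a /D; ring.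
Qed.

End simple_isometry.

Lemma sub_sigma_measurable (d : measure_display) (T : measurableType d) :
  sub_sigma (measurable : set (set T)).
Proof.
split=> //; split; first exact: measurable0.
- by move=> A mA; exact: measurableD.
- by move=> A mA; exact: bigcupT_measurable.
Qed.

(** * Coordinates of the Ito integral as limits of elementary ones *)

Section ito.
Context (R : realType) (n : nat) (d : measure_display) (Omega : measurableType d)
  (P : probability Omega R) (T : R) (F : R -> set (set Omega))
  (U : completeNormedModType R) (inner : {dot U for idfun}) (B : set U)
  (W : R -> U -> Omega -> R) (O : set 'rV[R]_n.+1).
Local Notation E := 'rV[R]_n.+1.
Hypotheses (hT : 0 < T) (hF : stochastic_basis P T F) (hU : inner_product_norm inner)
  (hB : orthonormal_basis inner B) (hW : cylindrical_wiener P T F W)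
  (mO : measurable (O : set (Rn R n))).
Local Notation vsi := (@L2_semi_inner R n O mO 1 n.+1).
Let IP := sqi_semi_inner P.

(** The functional is Lipschitz for the [L^2] seminorm, so its sublevel sets are [norm_open]; 1 is
    added to the norm of [xi] so that it can be divided by. *)
Lemma random_elt_ip (G : set (set Omega)) (u : Omega -> E -> E) (xi : E -> E) :
  sub_sigma G -> random_elt G (L2x O) (L2x_norm O) u -> L2x O xi ->
  Gmeas G (fun w => ip O (u w) xi).
Proof.
move=> sG [Lu mu] Lxi; apply: (measurability _ (RGenInftyO.measurableE R)) => /= _ [_ [a ->] <-].
rewrite setTI (sub_sigmaE _ sG).
have := mu [set f | L2x O f /\ ip O f xi < a].
rewrite (_ : u @^-1` _ = (fun w => ip O (u w) xi) @^-1` `]-oo, a[%classic); last first.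
  apply/seteqP; split => w /=; rewrite in_itv /=; first by case.
  by move=> h; split; [exact: Lu | exact: h].
apply; apply: sub_sigma_algebra; split; first by move=> f [].
move=> f [Lf fa]; pose N := Num.sqrt (ip O xi xi) + 1.
have N0 : 0 < N by rewrite ltr_wpDl// sqrtr_ge0.
exists ((a - ip O f xi) / N); first by rewrite divr_gt0// subr_gt0.
move=> g Lg; rewrite ltr_pdivlMr// => gf; split; first exact: Lg.
have Lgf := subspB vsi Lg Lf.
rewrite -(subrK (ip O f xi) (ip O g xi)) -(formBl vsi Lg Lf Lxi) -ltrBrDr.
apply: le_lt_trans gf; apply: le_trans (ler_norm _) _.
have CS := form_CS vsi Lgf Lxi.
have L0 : 0 <= L2x_norm O (g - f) by exact: powR_ge0.
have LN0 := mulr_ge0 L0 (ltW N0).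
rewrite -(@ler_pXn2r _ 2%N)// ?nnegrE// real_normK ?num_real// exprMn [L2x_norm _ _ ^+ 2]sqr_L2_norm.
apply: (le_trans CS); apply: ler_wpM2l; first exact: (si_ge0 vsi Lgf).
have x0 := si_ge0 vsi Lxi; rewrite -{1}(sqr_sqrtr x0) ler_sqr ?nnegrE ?sqrtr_ge0 ?ltW//.
by rewrite /N ltrDl.
Qed.

Variables (wt : R -> R) (A : Omega -> U -> E -> E) (gam S : R).
Hypotheses (mwt : measurable_fun [set: R] wt) (HA : forall w, HS B O (A w))
  (mA : measurable_fun [set: Omega] (fun w => HS_norm B O (A w)))
  (A2 : (HS_second_moment P B O A <= gam%:E)%E) (gam0 : 0 <= gam)
  (wt2 : (\int[lebesgue_measure]_(r in `[0%R, T]) (wt r ^+ 2 * gam)%:E <= S%:E)%E).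
Variables (q : nat) (xi : 'I_q -> E -> E).
Hypotheses (Lxi : forall j, L2x O (xi j)) (oxi : orthonormal (@ip R n O 1 n.+1) xi).

Let Phi (r : R) (w : Omega) : U -> E -> E := fun x z => wt r *: A w x z.

Let Phi_fin r w : HSfin B O (Phi r w).
Proof.
have FA := HS_HSfin (HA w); have [LA _] := FA.
have LP x : L2x O (Phi r w x) by exact: (subspZ vsi (wt r) (LA x)).
apply: (@HSfin_lin _ _ _ B O (wt r ^+ 2) 0 (Phi r w) (A w) (A w) (sqr_ge0 _) (lexx 0) LP _ FA FA) => x.
rewrite mul0r addr0 (_ : Phi r w x = wt r *: A w x)//.
by rewrite (formZl vsi _ (LA x) (LP x)) (formZr vsi _ (LA x) (LA x)) mulrA -expr2.
Qed.

Let Phi_le r w : HS_norm B O (Phi r w) ^+ 2 <= wt r ^+ 2 * HS_norm B O (A w) ^+ 2.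
Proof.
have FA := HS_HSfin (HA w); have [LA _] := FA.
have LP x : L2x O (Phi r w x) by exact: (subspZ vsi (wt r) (LA x)).
have := @sqr_HS_norm_le _ _ _ B O (wt r ^+ 2) 0 (Phi r w) (A w) (A w) (sqr_ge0 _) (lexx 0).
rewrite mul0r addr0; apply; [|exact: Phi_fin|exact: FA|exact: FA] => x.
rewrite mul0r addr0 (_ : Phi r w x = wt r *: A w x)//.
by rewrite (formZl vsi _ (LA x) (LP x)) (formZr vsi _ (LA x) (LA x)) mulrA -expr2.
Qed.

Section elementary.
Variable l : seq (@ito_term R n d Omega U).
Let dfl : @ito_term R n d Omega U := ItoTerm 0 0 set0 0 (fun=> 0).
Hypothesis adl : forall i, (i < size l)%N -> adapted_term T F O (nth dfl l i).
Variable err : R.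
Hypothesis errP : (\int[lebesgue_measure]_(r in `[0%R, T])
  HS_second_moment P B O (fun w => elementary_process inner l r w - Phi r w)%R <= err%:E)%E.

Let z (i : 'I_(size l)) := nth dfl l i.
Let s i := it_s (z i).
Let t i := it_t (z i).
Let C i := it_C (z i).
Let x i := it_x (z i).
Let h i := it_h (z i).
Let c j i := ip O (h i) (xi j).

Let adz i : adapted_term T F O (z i). Proof. exact: adl. Qed.
Let FC i : F (s i) (C i). Proof. by case: (adz i). Qed.
Let s0 i : 0 <= s i. Proof. by case: (adz i). Qed.
Let st i : s i <= t i. Proof. by case: (adz i). Qed.
Let tT i : t i <= T. Proof. by case: (adz i). Qed.
Let Lh i : L2x O (h i). Proof. by case: (adz i). Qed.

Definition elementary_coord j := simple_integral W c s t C x j.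

Let elementaryE w : elementary_integral W l w = \sum_i event_incr W (C i) (s i) (t i) (x i) w *: h i.
Proof.
by apply/funext => a; rewrite fct_sumE /elementary_integral (big_nth dfl) big_mkord.
Qed.

Lemma elementary_integral_L2 w : L2x O (elementary_integral W l w).
Proof. by rewrite elementaryE; apply: (subsp_sum vsi) => i; exact: (subspZ vsi _ (Lh i)). Qed.

Lemma elementary_coordE j w : ip O (elementary_integral W l w) (xi j) = elementary_coord j w.
Proof.
rewrite elementaryE (form_suml vsi _ _ Lh (Lxi j)) /elementary_coord /simple_integral fct_sumE.
by apply: eq_bigr => i _; rewrite mulrC.
Qed.

Let processE r w : elementary_process inner l r w =
  fin_rank inner (fun i => \1_(`]s i, t i]%classic) r * \1_(C i) w) x h.
Proof.
apply/funext => y; apply/funext => a.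
by rewrite /elementary_process /fin_rank fct_sumE (big_nth dfl) big_mkord.
Qed.

Let half_dual_le r w : 2^-1 * \sum_j `|simple_integrand c s t C x j r w| ^+ 2 <=
  HS_norm B O (Phi r w) ^+ 2 + HS_norm B O (elementary_process inner l r w - Phi r w) ^+ 2.
Proof.
rewrite processE.
have -> : \sum_j `|simple_integrand c s t C x j r w| ^+ 2 = \sum_j `|fin_rank_dual O
    (fun i => \1_(`]s i, t i]%classic) r * \1_(C i) w) x h (xi j)| ^+ 2.
  by apply: eq_bigr => j _; congr (`|_| ^+ 2); apply: eq_bigr => i _; rewrite mulrC.
have half (a1 b1 b2 : R) : a1 <= 2 * b1 + 2 * b2 -> 2^-1 * a1 <= b1 + b2 by lra.
apply: half.
exact: (@fin_rank_dual_le2 R n U inner B O hU hB mO (size l)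
  (fun i => \1_(`]s i, t i]%classic) r * \1_(C i) w) x h Lh q xi (Phi r w) Lxi oxi (Phi_fin r w)).
Qed.

Lemma elementary_coord_sqi j : sqi P (elementary_coord j).
Proof. exact: (simple_integral_sqi hF hW c x FC s0 st tT j). Qed.

(** By the isometry and [half_dual_le], the left side is bounded through the time integral of the
    target's squared norm plus the squared approximation error. The error comes without
    measurability, hence the two uses of [integral_le_add], in time and in the outcome. *)
Lemma elementary_coord_le :
  2^-1 * \sum_j EE P (elementary_coord j) (elementary_coord j) <= gauss_var R * (S + err).
Proof.
have h20 : 0 <= 2^-1 :> R by rewrite invr_ge0.
have [f [mf f0 mfw fE iso]] := simple_isometry hT hF hU hW c x FC s0 st tT h20.
rewrite -lee_fin [leLHS]iso EFinM; apply: lee_wpmul2l; first by rewrite lee_fin gauss_var_ge0.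
rewrite EFinD; apply: le_trans (leeD wt2 errP).
apply: integral_le_add => //; first exact: measurable_funTS.
- apply: measurable_funTS; apply: measurable_funM => //; exact: measurable_funX.
- by move=> r _; rewrite mulr_ge0 ?sqr_ge0.
- by move=> r _; apply: integral_ge0 => w _; rewrite lee_fin sqr_ge0.
move=> r _; rewrite -fE.
have mg : measurable_fun [set: Omega] (fun w => wt r ^+ 2 * HS_norm B O (A w) ^+ 2).
  by apply: measurable_funM => //; exact: measurable_funX.
apply: (@le_trans _ _ (\int[P]_w (wt r ^+ 2 * HS_norm B O (A w) ^+ 2)%:E +
  HS_second_moment P B O (fun w => elementary_process inner l r w - Phi r w)%R)%E).
  apply: integral_le_add => //.
  - by move=> w _; apply: mulr_ge0 => //; apply: sumr_ge0 => j _; exact: sqr_ge0.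
  - by move=> w _; rewrite mulr_ge0 ?sqr_ge0.
  - by move=> w _; rewrite lee_fin sqr_ge0.
  move=> w _; rewrite -EFinD lee_fin; apply: le_trans (half_dual_le r w) _.
  by rewrite lerD2r Phi_le.
apply: leeD => //; under eq_integral do rewrite EFinM.
rewrite ge0_integralZl//; last 3 first.
- by apply/measurable_EFinP; exact: measurable_funX.
- by move=> w _; rewrite lee_fin sqr_ge0.
- by rewrite lee_fin sqr_ge0.
rewrite (EFinM (wt r ^+ 2) gam); apply: lee_wpmul2l; last exact: A2.
by rewrite lee_fin sqr_ge0.
Qed.

Section clipping.
Variables (a b : R).
Hypotheses (a0 : 0 <= a) (ab : a <= b) (bT : b <= T)
  (wt0 : forall r, 0 < r -> r <= T -> ~ (a < r <= b) -> wt r = 0).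

Let cs i := Num.max a (s i).
(** The outer maximum collapses an interval that misses []a, b]] to a single point, whose increment
    is 0, so that [cs <= ct] in all cases. *)
Let ct i := Num.max (cs i) (Num.min b (t i)).

Let cs0 i : 0 <= cs i. Proof. by rewrite le_max a0. Qed.
Let cst i : cs i <= ct i. Proof. by rewrite le_max lexx. Qed.
Let csT i : cs i <= T. Proof. by rewrite ge_max (le_trans ab bT) (le_trans (st i) (tT i)). Qed.
Let ctT i : ct i <= T. Proof. by rewrite ge_max csT ge_min bT. Qed.
Let FcC i : F (cs i) (C i).
Proof. by apply: (filtration_homo hF (s0 i) _ (csT i)); [rewrite le_max lexx orbT | exact: FC]. Qed.

(* Restricting the integrators to the support ]a, b] of the weight costs nothing in the limit and
   makes each integral F_b-measurable and orthogonal to F_a. *)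
Definition clipped_coord j := simple_integral W c cs ct C x j.

(** Original and clipped terms are indexed together, the latter with opposite sign: the difference
    is again a simple integral, and the isometry applies to it. *)
Let s2 (v : 'I_(size l) + 'I_(size l)) := match v with inl i => s i | inr i => cs i end.
Let t2 (v : 'I_(size l) + 'I_(size l)) := match v with inl i => t i | inr i => ct i end.
Let C2 (v : 'I_(size l) + 'I_(size l)) := match v with inl i => C i | inr i => C i end.
Let x2 (v : 'I_(size l) + 'I_(size l)) := match v with inl i => x i | inr i => x i end.
Let c2 j (v : 'I_(size l) + 'I_(size l)) := match v with inl i => c j i | inr i => - c j i end.

Let diffE j : simple_integral W c2 s2 t2 C2 x2 j = elementary_coord j - clipped_coord j.
Proof.
rewrite /simple_integral big_sumType /=; congr (_ + _).
by rewrite -sumrN; apply: eq_bigr => i _; rewrite scaleNr.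
Qed.

Let clip_indic i r : \1_(`]cs i, ct i]%classic) r = \1_(`]s i, t i]%classic) r * \1_(`]a, b]%classic) r :> R.
Proof.
rewrite -[RHS]/((\1_(`]s i, t i]%classic) \* \1_(`]a, b]%classic)) r) -indicI !indicE; congr ((nat_of_bool _)%:R).
apply/idP/idP; rewrite !inE /= !in_itv /=; rewrite /ct /cs.
  rewrite gt_max => /andP[/andP[h1 h2]]; rewrite le_max => /orP[|].
    by rewrite leNgt gt_max h1 h2.
  by rewrite le_min => /andP[h3 h4]; rewrite h1 h2 h3 h4.
by move=> [/andP[h1 h2] /andP[h3 h4]]; rewrite gt_max h3 h1 le_max le_min h2 h4 orbT.
Qed.

Let diff_integrand j r w : simple_integrand c2 s2 t2 C2 x2 j r w =
  (1 - \1_(`]a, b]%classic) r) *: simple_integrand c s t C x j r w.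
Proof.
rewrite /simple_integrand big_sumType /= -big_split /= scaler_sumr; apply: eq_bigr => i _.
by rewrite clip_indic scalerA -scalerDl; congr (_ *: _); ring.
Qed.

(** The difference lives off []a, b]]. The target integrand vanishes there, so the elementary
    process is pure approximation error, which [err] controls. *)
Lemma clipped_coord_le j :
  2^-1 * EE P (elementary_coord j - clipped_coord j) (elementary_coord j - clipped_coord j)
    <= gauss_var R * err.
Proof.
have h20 : 0 <= 2^-1 :> R by rewrite invr_ge0.
have [||||f [mf f0 mfw fE iso]] :=
  @simple_isometry R d Omega P T F U inner W hT hF hU hW _ _ c2 s2 t2 C2 x2 _ _ _ _ _ h20.
- by case=> i; [exact: FC | exact: FcC].
- by case=> i; [exact: s0 | exact: cs0].
- by case=> i; [exact: st | exact: cst].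
- by case=> i; [exact: tT | exact: ctT].
apply: (@le_trans _ _ (2^-1 * \sum_j EE P (simple_integral W c2 s2 t2 C2 x2 j)
  (simple_integral W c2 s2 t2 C2 x2 j))).
  rewrite ler_wpM2l// (bigD1 j)//= diffE lerDl; apply: sumr_ge0 => i _.
  by rewrite /EE; apply: Rintegral_ge0 => w _; rewrite -expr2 sqr_ge0.
rewrite -lee_fin [leLHS]iso EFinM; apply: lee_wpmul2l; first by rewrite lee_fin gauss_var_ge0.
apply: le_trans errP; apply: ge0_integral_mono => r; first by rewrite lee_fin.
rewrite /= in_itv /= => /andP[r0 rT]; rewrite -fE; apply: ge0_integral_mono => w _.
  by rewrite lee_fin; apply: mulr_ge0 => //; apply: sumr_ge0 => i _; exact: sqr_ge0.
rewrite lee_fin; under eq_bigr do rewrite diff_integrand normrZ exprMn.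
rewrite -mulr_sumr indicE; case: (boolP (r \in _)) => [_|rab].
  by rewrite subrr normr0 expr0n /= mul0r mulr0 sqr_ge0.
rewrite subr0 normr1 expr1n mul1r.
(* [wt0] does not cover the time 0; there the elementary integrand vanishes because its intervals
   are open on the left. *)
move: r0; rewrite le_eqVlt => /orP[/eqP r0|r0].
  rewrite big1 ?mulr0 ?sqr_ge0// => i _; rewrite /simple_integrand big1 ?normr0 ?expr0n// => k _.
  have -> : \1_(`]s k, t k]%classic) r = 0 :> R.
    by rewrite indicE memNset//= in_itv /= -r0 ltNge s0.
  by rewrite mul0r mulr0 scale0r.
apply: le_trans (half_dual_le r w) _; rewrite gerDr.
apply: le_trans (Phi_le r w) _; rewrite wt0//; last first.
  by move=> rab'; move: rab; rewrite notin_setE /= in_itv /=; apply.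
by rewrite expr0n mul0r.
Qed.

Lemma clipped_coord_sqi j : sqi P (clipped_coord j).
Proof. exact: (simple_integral_sqi hF hW c x FcC cs0 cst ctT j). Qed.

Lemma clipped_coord_Gmeas j : Gmeas (F b) (clipped_coord j).
Proof.
have b0 := le_trans a0 ab.
have sb : sub_sigma (F b) by apply: (filtration_sub hF); rewrite b0 bT.
rewrite /clipped_coord /simple_integral.
rewrite (_ : \sum_i _ = fun w => \sum_i c j i * event_incr W (C i) (cs i) (ct i) (x i) w); last first.
  by apply/funext => w; rewrite fct_sumE.
apply: measurable_sum => i; apply: measurable_funM; first exact: measurable_cst.
case: (leP (cs i) b) => csb.
  apply: (Gmeas_sub (filtration_sub hF _) sb (filtration_homo hF _ _ bT) (event_incr_Gmeas hF hW (x i) (FcC i) (cs0 i) (cst i) (ctT i))).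
  - by rewrite (le_trans (cs0 i) (cst i)) ctT.
  - exact: (le_trans (cs0 i) (cst i)).
  - by rewrite ge_max csb ge_min lexx.
rewrite (_ : event_incr _ _ _ _ _ = fun=> 0); first exact: measurable_cst.
apply/funext => w; rewrite /event_incr /incr.
have -> : ct i = cs i by apply: max_l; rewrite ge_min ltW.
by rewrite subrr mulr0.
Qed.

Lemma clipped_coord_orth j Y : sqi P Y -> Gmeas (F a) Y -> EE P Y (clipped_coord j) = 0.
Proof.
move=> sY mY; rewrite /clipped_coord /simple_integral.
have sK i : sqi P (event_incr W (C i) (cs i) (ct i) (x i)).
  apply: (event_incr_sqi hF hW (x i) _ (cs0 i) (cst i) (ctT i)).
  by apply: (filtration_sub hF _).2; last exact: FcC; rewrite cs0 csT.
rewrite (form_sumr IP _ _ sK sY) big1// => i _.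
rewrite (event_incr_orth hF hW (x i) (FcC i) (cs0 i) (cst i) (ctT i) sY) ?mulr0//.
apply: (Gmeas_sub (filtration_sub hF _) (filtration_sub hF _) (filtration_homo hF a0 _ (csT i)) mY).
- by rewrite a0 (le_trans ab).
- by rewrite cs0 csT.
- by rewrite le_max lexx.
Qed.

End clipping.
End elementary.

Let small_ereal (f : nat -> \bar R) (eps : R) : 0 < eps -> f k @[k --> \oo] --> 0%E ->
  \forall k \near \oo, (f k <= eps%:E)%E.
Proof.
move=> e0 /fine_cvgP[fin /cvgrPdist_lt /(_ _ e0)] cv; apply: filterS2 fin cv => k ff.
rewrite sub0r normrN => h; rewrite -(fineK ff) lee_fin.
by apply: ltW; apply: le_lt_trans h; exact: ler_norm.
Qed.

Section integral.
Variable X : Omega -> E -> E.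
Hypothesis hX : is_ito_integral P inner B T F O W (fun r w x z => wt r *: A w x z) X.

Let dfl : @ito_term R n d Omega U := ItoTerm 0 0 set0 0 (fun=> 0).

Let ito_close eps : 0 < eps -> exists l,
  [/\ forall i, (i < size l)%N -> adapted_term T F O (nth dfl l i),
      (\int[lebesgue_measure]_(r in `[0%R, T])
         HS_second_moment P B O (fun w => elementary_process inner l r w - Phi r w)%R <= eps%:E)%E &
      (second_moment P O (fun w => elementary_integral W l w - X w)%R <= eps%:E)%E].
Proof.
move=> e0; have [_ _ [l [al c1 c2]]] := hX.
have [K _ HK] := filterI (small_ereal e0 c1) (small_ereal e0 c2).
have [H1 H2] := HK K (leqnn K).
by exists (l K); split; [exact: al | exact: H1 | exact: H2].
Qed.

Let LX w : L2x O (X w). Proof. by have [_ [H _] _] := hX; exact: H. Qed.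

Definition ito_coord j : Omega -> R^o := fun w => ip O (X w) (xi j).

Let ito_coord_measurable j : measurable_fun [set: Omega] (ito_coord j : Omega -> R).
Proof.
have [_ rX _] := hX.
by have := random_elt_ip (sub_sigma_measurable Omega) rX (Lxi j); apply: Gmeas_measurable; exact: sub_sigma_measurable.
Qed.

Let ito_dist l eps j : (forall i, (i < size l)%N -> adapted_term T F O (nth dfl l i)) ->
  (second_moment P O (fun w => elementary_integral W l w - X w)%R <= eps%:E)%E ->
  sqi P (elementary_coord l j - ito_coord j) /\
  EE P (elementary_coord l j - ito_coord j) (elementary_coord l j - ito_coord j) <= eps.
Proof.
move=> al H; have sZ := elementary_coord_sqi al j.
have mD : measurable_fun [set: Omega] (elementary_coord l j - ito_coord j : Omega -> R).
  by apply: measurable_funB; [exact: sqi_measurable sZ | exact: ito_coord_measurable].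
have le : (\int[P]_w (((elementary_coord l j - ito_coord j) w : R) ^+ 2)%:E <= eps%:E)%E.
  apply: le_trans H; apply: ge0_integral_mono => w _; first by rewrite lee_fin sqr_ge0.
  have LI := elementary_integral_L2 al w; have LD := subspB vsi LI (LX w).
  rewrite lee_fin [L2x_norm _ _ ^+ 2]sqr_L2_norm.
  rewrite [X in X ^+ 2](_ : _ = ip O (elementary_integral W l w - X w) (xi j)); last first.
    by rewrite (formBl vsi LI (LX w) (Lxi j)) (elementary_coordE al).
  by apply: le_trans (form_CS vsi LD (Lxi j)) _; rewrite oxi eqxx mulr1.
have sD : sqi P (elementary_coord l j - ito_coord j).
  by apply/sqiP => //; apply: le_lt_trans le _; exact: ltry.
by split=> //; rewrite -lee_fin (EE_integral sD).
Qed.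

Lemma ito_coord_sqi j : sqi P (ito_coord j).
Proof.
have [l [al _ H]] := ito_close ltr01.
have [sD _] := ito_dist j al H.
have -> : ito_coord j = elementary_coord l j - (elementary_coord l j - ito_coord j).
  by rewrite opprB addrC subrK.
exact: (subspB IP (elementary_coord_sqi al j) sD).
Qed.

Let EE_swap (Y Z : Omega -> R^o) : EE P (Y - Z) (Y - Z) = EE P (Z - Y) (Z - Y).
Proof. by apply: eq_Rintegral => w _; rewrite !fctE; ring. Qed.

Lemma ito_coord_sum : \sum_j EE P (ito_coord j) (ito_coord j) <= 4 * gauss_var R * S.
Proof.
apply/ler_addgt0Pr => e e0; have v0 := gauss_var_ge0 R.
(* The tolerance [e / M] enters through the isometry with factor [4 * gauss_var], and in each of the
   [q] coordinates with factor 2; the 1 keeps [M] positive. *)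
pose M := 4 * gauss_var R + 2 * q%:R + 1.
have M0 : 0 < M by rewrite ltr_wpDl// addr_ge0// mulr_ge0.
have [l [al H1 H2]] := ito_close (divr_gt0 e0 M0).
have le j : EE P (ito_coord j) (ito_coord j) <=
    2 * EE P (elementary_coord l j) (elementary_coord l j) + 2 * (e / M).
  have := form_le_young IP ltr01 (ito_coord_sqi j) (elementary_coord_sqi al j).
  have [_] := ito_dist j al H2; rewrite EE_swap invr1; lra.
apply: (le_trans (ler_sum _ (fun j _ => le j))).
rewrite big_split /= -mulr_sumr sumr_const card_ord -[_ *+ q]mulr_natr.
have := elementary_coord_le al H1.
set Z := \sum_j _; move: Z => Z HZ.
have eM : e = M * (e / M) by field; rewrite gt_eqF.
have h0 : 0 <= e / M by rewrite divr_ge0 ?ltW.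
move: eM h0 HZ; move: (e / M) => h; rewrite /M => eM h0 HZ; rewrite eM; lra.
Qed.

Section adapted.
Variables (a b : R).
Hypotheses (a0 : 0 <= a) (ab : a <= b) (bT : b <= T)
  (wt0 : forall r, 0 < r -> r <= T -> ~ (a < r <= b) -> wt r = 0).

Let ito_approx j eps : 0 < eps -> exists Z : Omega -> R^o,
  [/\ sqi P Z, Gmeas (F b) Z, forall Y, sqi P Y -> Gmeas (F a) Y -> EE P Y Z = 0 &
      EE P (Z - ito_coord j) (Z - ito_coord j) <= eps].
Proof.
move=> e0; have v0 := gauss_var_ge0 R.
(* With [h = eps / M], the clipped coordinate is within [2 * gauss_var * h] of the elementary one,
   which is within [h] of the Ito coordinate, both in mean square; the square of a sum doubles the
   total. *)
pose M := 4 * gauss_var R + 2.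
have M0 : 0 < M by rewrite ltr_wpDl// mulr_ge0.
have [l [al H1 H2]] := ito_close (divr_gt0 e0 M0).
have sZ := clipped_coord_sqi al a0 ab bT j.
exists (clipped_coord l a b j); split.
- exact: sZ.
- exact: (clipped_coord_Gmeas al a0 ab bT j).
- by move=> Y sY mY; exact: (clipped_coord_orth al a0 ab bT j sY mY).
have c1 := clipped_coord_le al H1 a0 ab bT wt0 j.
have [sD c2] := ito_dist j al H2.
have := form_sqrD_le IP (subspB IP sZ (elementary_coord_sqi al j)) sD.
rewrite addrA subrK [X in 2 * X + _]EE_swap => c3; apply: (le_trans c3).
have eM : eps = M * (eps / M) by field; rewrite gt_eqF.
move: c1 c2 eM; move: (eps / M) => h c1 c2 ->; rewrite /M; lra.
Qed.

(** The [F b]-measurable variables are closed in [L^2]; this rests on [F b] containing all null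
    sets. *)
Lemma ito_coord_Gmeas j : Gmeas (F b) (ito_coord j).
Proof.
have b0 := le_trans a0 ab; have bb : 0 <= b <= T by rewrite b0.
have pos k : 0 < (k.+1%:R^-1 : R) by rewrite invr_gt0.
have [Z HZ] := choice (fun k => ito_approx j (pos k)).
apply: (sqi_cvg_Gmeas (filtration_sub hF bb) (filtration_complete hF bb) (X := Z)).
- by move=> k; case: (HZ k).
- by move=> k; case: (HZ k).
- exact: ito_coord_sqi.
apply: (@squeeze_cvgr _ _ _ _ (fun=> 0) (fun k => k.+1%:R^-1)).
- apply: nearW => k; have [sZ _ _ ->] := HZ k; rewrite andbT.
  exact: (si_ge0 IP (subspB IP sZ (ito_coord_sqi j))).
- exact: cvg_cst.
- exact: cvg_harmonic.
Qed.

Lemma ito_coord_orth j Y : sqi P Y -> Gmeas (F a) Y -> EE P Y (ito_coord j) = 0.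
Proof.
move=> sY mY; apply/eqP; rewrite -sqrf_eq0 eq_le sqr_ge0 andbT.
apply/ler_addgt0Pr => e e0; rewrite add0r.
have Y0 := si_ge0 IP sY; have M0 : 0 < EE P Y Y + 1 by rewrite ltr_wpDl.
have [Z [sZ _ oZ cZ]] := ito_approx j (divr_gt0 e0 M0).
have sD := subspB IP sZ (ito_coord_sqi j).
have := form_CS IP sY sD.
rewrite (formBr IP sZ (ito_coord_sqi j) sY) oZ// sub0r sqrrN => H; apply: (le_trans H).
apply: (le_trans (ler_wpM2l Y0 cZ)).
rewrite mulrCA ger_pMr// ler_pdivrMr// mul1r; lra.
Qed.

End adapted.
End integral.
End ito.

(** * The discrete noise *)

(** [g] embeds the coordinates isometrically and [f w] is at seminorm distance 0 from [g (y w)]. A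
    [norm_open] set does not separate points of [D] at distance 0, so its preimage is that of an
    open set of coordinates. Velocities and pressures are both treated this way. *)
Lemma random_elt_coords (R : realType) (d : measure_display) (Omega : measurableType d)
    (G : set (set Omega)) (X : zmodType) (D : set X) (nrm : X -> R) (f : Omega -> X) (r : nat)
    (g : ('I_r -> R) -> X) (y : Omega -> 'I_r -> R) :
  sub_sigma G -> (forall w, D (f w)) -> (forall z, D (g z)) -> (forall z z', 0 <= nrm (g z' - g z)) ->
  (forall z z', nrm (g z' - g z) ^+ 2 = \sum_i (z' i - z i) ^+ 2) ->
  (forall w, nrm (f w - g (y w)) = 0) -> (forall w, nrm (g (y w) - f w) = 0) ->
  (forall i, Gmeas G (fun w => y w i)) -> random_elt G D nrm f.
Proof.
move=> sG Df Dg n0 ng fg gf my; apply: random_elt_open => // A [AD HA].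
pose A' := [set z : 'rV[R]_r.+1 | A (g (fun i => z ord0 (lift ord0 i)))].
have oA : open A'.
  rewrite openE => z Az; rewrite /interior.
  have [rho rho0 Hrho] := HA _ Az.
  have cc : {for z, continuous (fun z' : 'rV[R]_r.+1 =>
      \sum_(i < r) (z' ord0 (lift ord0 i) - z ord0 (lift ord0 i)) ^+ 2)}.
    apply: (@cvg_finsum R _ _ (nbhs_filter z)) => i.
    apply: (@cvg_comp _ _ _ _ (fun x : R => x ^+ 2)); last exact: exprn_continuous.
    by apply: cvgB; [exact: coord_continuous | exact: cvg_cst].
  have : \forall z' \near z,
      \sum_(i < r) ((z' : 'rV[R]_r.+1) ord0 (lift ord0 i) - z ord0 (lift ord0 i)) ^+ 2 < rho ^+ 2.
    apply: (cvgr_lt _ cc); rewrite big1 ?exprn_gt0// => i _.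
    by rewrite subrr expr0n.
  apply: filterS => z' h; apply: Hrho; first exact: Dg.
  by rewrite -(@ltr_pXn2r _ 2%N)// ?nnegrE ?(ltW rho0)// ng.
have := preimage_open sG my oA; congr G; apply/seteqP; split => w /=; rewrite /A' /=.
  rewrite (_ : (fun i => _) = y w); last by apply/funext => i; rewrite mxE liftK.
  by move=> Agy; have [rho rho0 H] := HA _ Agy; apply: H; rewrite ?fg.
move=> Af; rewrite (_ : (fun i => _) = y w); last by apply/funext => i; rewrite mxE liftK.
by have [rho rho0 H] := HA _ Af; apply: H; rewrite ?gf.
Qed.

(** Continuity along bounded convergent sequences is what dominated convergence provides. If a
    sublevel set were not open, points of balls of radius [1 / (k + 1)] outside it would form such a
    sequence and contradict it. *)
Lemma seq_continuous_Gmeas (R : realType) (d : measure_display) (Omega : measurableType d)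
    (G : set (set Omega)) (r : nat) (g : ('I_r -> R) -> R) (y : Omega -> 'I_r -> R) :
  sub_sigma G ->
  (forall (z_ : nat -> 'I_r -> R) z (M : R), (forall i, z_ k i @[k --> \oo] --> z i) ->
     (forall k i, `|z_ k i| <= M) -> g (z_ k) @[k --> \oo] --> g z) ->
  (forall i, Gmeas G (fun w => y w i)) -> Gmeas G (fun w => g (y w)).
Proof.
move=> sG cg my; apply: (measurability _ (RGenInftyO.measurableE R)) => /= _ [_ [a ->] <-].
rewrite setTI (sub_sigmaE _ sG).
pose A' := [set z : 'rV[R]_r.+1 | g (fun i => z ord0 (lift ord0 i)) < a].
have oA : open A'.
  rewrite openE => z Az; rewrite /interior; apply: contrapT => Nz.
  have far k : exists z' : 'rV[R]_r.+1, ball z (k.+1%:R^-1 : R) z' /\ ~ A' z'.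
    apply: contrapT => H; apply: Nz.
    have : nbhs z (ball z (k.+1%:R^-1 : R)) by apply: nbhsx_ballx; rewrite invr_gt0.
    apply: filterS => z' bz'; apply: contrapT => NA; apply: H.
    by exists z'.
  have [z_ Hz] := choice far.
  have le k i : `|z_ k ord0 (lift ord0 i) - z ord0 (lift ord0 i)| <= k.+1%:R^-1.
    have [[_ b] _] := Hz k; have := b ord0 (lift ord0 i).
    by rewrite -ball_normE /= distrC => /ltW.
  have cv i : z_ k ord0 (lift ord0 i) @[k --> \oo] --> z ord0 (lift ord0 i).
    apply/cvgrPdist_le => e e0; have /cvgrPdist_le /(_ _ e0) := @cvg_harmonic R.
    apply: filterS => k; rewrite sub0r normrN ger0_norm ?invr_ge0//= => h.
    by rewrite distrC; apply: le_trans (le k i) h.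
  pose M := \sum_i `|z ord0 (lift ord0 i)| + 1.
  have bd k i : `|z_ k ord0 (lift ord0 i)| <= M.
    rewrite -(subrK (z ord0 (lift ord0 i)) (z_ k ord0 (lift ord0 i))).
    apply: le_trans (ler_normD _ _) _; rewrite addrC lerD//.
      by rewrite (bigD1 i)//= lerDl sumr_ge0.
    by apply: le_trans (le k i) _; rewrite invf_le1// ler1n.
  have := cg (fun k i => z_ k ord0 (lift ord0 i)) (fun i => z ord0 (lift ord0 i)) M cv bd.
  move=> cvg; have [K _ HK] : \forall k \near \oo, g (fun i => z_ k ord0 (lift ord0 i)) < a.
    exact: (cvgr_lt _ cvg).
  by have [_] := Hz K; apply; exact: (HK K (leqnn K)).
have := preimage_open sG my oA; congr G; apply/seteqP; split => w /=; rewrite /A' /= in_itv /=;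
  rewrite (_ : (fun i => _) = y w)//; by apply/funext => i; rewrite mxE liftK.
Qed.

(** * Support and size of the hat weights *)

Section hat_weights.
Context (R : realType) (tau : R).
Hypothesis tau0 : 0 < tau.

(** For [m >= 2] this is the left end of the cell around the previous time point; the first weight
    is 1 on the initial half cell and starts at 0. *)
Definition weight_start (m : nat) : R := if m == 1%N then 0 else m%:R * tau - (tau + tau / 2).
Definition weight_end (m : nat) : R := m%:R * tau + tau / 2.

Let indic_itvcc (a b r : R) : (\1_(`[a, b]%classic) : R -> R) r = (a <= r <= b)%R%:R.
Proof.
rewrite indicE; congr ((nat_of_bool _)%:R); apply/idP/idP; first by rewrite inE /= in_itv.
by move=> h; rewrite inE /= in_itv.
Qed.

Let up_piece (a r : R) : 0 <= (r - a) / tau * (a <= r <= a + tau)%R%:R <= (a <= r <= a + tau)%R%:R.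
Proof.
case: (boolP (a <= r <= a + tau)) => [/andP[h1 h2]|_]; last by rewrite mulr0 lexx.
by rewrite mulr1 divr_ge0 ?subr_ge0 ?(ltW tau0)//= ler_pdivrMr// mul1r lerBlDl.
Qed.

Let down_piece (b r : R) : 0 <= (b - r) / tau * (b - tau <= r <= b)%R%:R <= (b - tau <= r <= b)%R%:R.
Proof.
case: (boolP (b - tau <= r <= b)) => [/andP[h1 h2]|_]; last by rewrite mulr0 lexx.
by rewrite mulr1 divr_ge0 ?subr_ge0 ?(ltW tau0)//= ler_pdivrMr// mul1r lerBlDl -lerBlDr.
Qed.

Let weight1 r : weight tau 1 r = (0 <= r <= tau / 2)%R%:R +
  (weight_end 1 - r) / tau * (weight_end 1 - tau <= r <= weight_end 1)%R%:R.
Proof.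
rewrite /weight /dual_cell /weight_end /= !indic_itvcc !mul1r.
by have -> : tau + tau / 2 - tau = tau - tau / 2 by lra.
Qed.

Let weight2 m r : weight tau m.+2 r =
  (r - weight_start m.+2) / tau * (weight_start m.+2 <= r <= weight_start m.+2 + tau)%R%:R +
  (weight_end m.+2 - r) / tau * (weight_end m.+2 - tau <= r <= weight_end m.+2)%R%:R.
Proof.
rewrite /weight /dual_cell /weight_start /weight_end /= !indic_itvcc.
have e1 : m.+1%:R * tau - tau / 2 = m.+2%:R * tau - (tau + tau / 2).
  by rewrite -[m.+2]addn1 natrD mulrDl; lra.
have e2 : m.+1%:R * tau + tau / 2 = m.+2%:R * tau - (tau + tau / 2) + tau.
  by rewrite -[m.+2]addn1 natrD mulrDl; lra.
have e3 : m.+2%:R * tau - tau / 2 = m.+2%:R * tau + tau / 2 - tau by lra.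
by rewrite e1 e2 e3.
Qed.

(** The cells are closed, but the rising ramp vanishes at its left end, and for [m = 1] the point 0
    is excluded. The support may thus be taken open on the left, like the intervals of elementary
    processes. *)
Lemma weight_supp (m : nat) (r : R) : (0 < m)%N -> 0 < r -> ~ (weight_start m < r <= weight_end m) ->
  weight tau m r = 0.
Proof.
case: m => // -[_ r0|m _ r0] H.
  have {}H : ~~ (r <= weight_end 1) by apply/negP => h; apply: H; rewrite /weight_start /= r0.
  rewrite weight1 (negbTE H) andbF mulr0 addr0.
  rewrite (_ : r <= tau / 2 = false) ?andbF//; apply/negbTE; apply: contra H => h.
  by rewrite /weight_end mul1r (le_trans h)// lerDr ltW.
have e : weight_end m.+2 = weight_start m.+2 + tau + tau.
  by rewrite /weight_end /weight_start /=; lra.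
rewrite weight2; case: (leP r (weight_end m.+2)) => h.
  have rs : r <= weight_start m.+2.
    by rewrite leNgt; apply/negP => h'; apply: H; rewrite h' h.
  rewrite andbT; have -> : (weight_end m.+2 - tau <= r) = false.
    by apply/negbTE; rewrite -ltNge e addrK; apply: (le_lt_trans rs); rewrite ltrDl.
  rewrite mulr0 addr0; case: (ltP r (weight_start m.+2)) => h'; first by rewrite mulr0.
  have -> : r = weight_start m.+2 by apply/eqP; rewrite eq_le rs h'.
  by rewrite subrr !mul0r.
rewrite !andbF mulr0 addr0 (_ : r <= weight_start m.+2 + tau = false) ?andbF ?mulr0//.
by apply/negbTE; rewrite -ltNge; apply: lt_trans h; rewrite e ltrDl.
Qed.

(** Neighbouring closed cells share an end point, where both pieces take the value 1; hence the
    bound 2 for the weight and 4 for its square. *)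
Lemma weight_sqr_le (m : nat) (r : R) : (0 < m)%N -> 0 <= r ->
  weight tau m r ^+ 2 <= 4 * \1_(`[weight_start m, weight_end m]%classic) r.
Proof.
move=> m0 r0.
suff : 0 <= weight tau m r <= 2 * (weight_start m <= r <= weight_end m)%R%:R.
  rewrite indic_itvcc; set within := (weight_start m <= r <= _).
  case: within => /andP[]; rewrite ?mulr1 ?mulr0 => h1 h2.
    rewrite expr2 (_ : 4 = 2 * 2 :> R); last by rewrite -natrM.
    by apply: ler_pM.
  by rewrite (le_anti (introT andP (conj h2 h1))) expr0n.
case: m m0 => // -[_|m _].
  rewrite weight1; have := down_piece (weight_end 1) r; set x := _ * _ => /andP[x0 x1].
  rewrite addr_ge0 ?ler0n//=; apply: (le_trans (lerD (lexx _) x1)).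
  rewrite /weight_start /= r0 /=.
  have le1 : (r <= tau / 2) -> (r <= weight_end 1).
    by move=> h; rewrite /weight_end mul1r (le_trans h)// lerDr ltW.
  case: (boolP (r <= weight_end 1)) => h.
    by rewrite andbT mulr1 (_ : 2 = 1 + 1)// lerD ?lern1 ?leq_b1.
  by rewrite andbF addr0 mulr0 (contraNF le1 h).
have e : weight_end m.+2 = weight_start m.+2 + tau + tau.
  by rewrite /weight_end /weight_start /=; lra.
rewrite weight2; have := up_piece (weight_start m.+2) r; set x := _ * _ => /andP[x0 x1].
have := down_piece (weight_end m.+2) r; set y := _ * _ => /andP[y0 y1].
rewrite addr_ge0//=; apply: (le_trans (lerD x1 y1)).
rewrite (_ : 2 = 1 + 1)// mulrDl !mul1r; apply: lerD; rewrite ler_nat e.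
  case: (boolP (_ && _)) => // /andP[h1 h2]; rewrite h1 /= lt0b; apply: (le_trans h2); lra.
case: (boolP (_ && _)) => // /andP[h1 h2]; rewrite h2 andbT lt0b; apply: le_trans h1.
by rewrite addrK lerDl ltW.
Qed.

Lemma weight_measurable m : measurable_fun [set: R] (weight tau m).
Proof.
have md k : measurable_fun [set: R] (\1_(dual_cell tau k) : R -> R).
  by apply: measurable_indic; rewrite /dual_cell; case: ifP => _; exact: measurable_itv.
have mi : measurable_fun [set: R] (fun r : R => r) by exact: measurable_id.
have mc (a : R) : measurable_fun [set: R] (fun _ : R => a) by exact: measurable_cst.
rewrite /weight; case: (m == 1%N); apply: measurable_funD => //; apply: measurable_funM => //;
  apply: measurable_funM => //; exact: measurable_funB.
Qed.

End hat_weights.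

Section noise.
Context (R : realType) (n : nat) (d : measure_display) (Omega : measurableType d)
  (P : probability Omega R) (T : R) (F : R -> set (set Omega))
  (U : completeNormedModType R) (inner : {dot U for idfun}) (B : set U)
  (W : R -> U -> Omega -> R) (O : set 'rV[R]_n.+1).
Local Notation E := 'rV[R]_n.+1.
Hypotheses (hT : 0 < T) (hF : stochastic_basis P T F) (hU : inner_product_norm inner)
  (hB : orthonormal_basis inner B) (hW : cylindrical_wiener P T F W)
  (mO : measurable (O : set (Rn R n))).
Local Notation vsi := (@L2_semi_inner R n O mO 1 n.+1).
Let IP := sqi_semi_inner P.
Variables (N : nat) (tau : R).
Hypotheses (tau0 : 0 < tau) (tauN : N.+1%:R * tau = T).

Definition disc_time (m : nat) : R := if m == 0%N then 0 else m%:R * tau + tau / 2.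

Lemma disc_filtrationE m : disc_filtration F tau m = F (disc_time m).
Proof. by rewrite /disc_filtration /disc_time; case: ifP. Qed.

Lemma disc_time_ge0 m : 0 <= disc_time m.
Proof.
by rewrite /disc_time; case: ifP => // _; rewrite addr_ge0 ?mulr_ge0 ?divr_ge0 ?(ltW tau0).
Qed.

Lemma disc_time_homo k m : (k <= m)%N -> disc_time k <= disc_time m.
Proof.
move=> km; rewrite {1}/disc_time; case: eqP => k0; first exact: disc_time_ge0.
rewrite /disc_time; case: eqP => m0; first by move: km; rewrite m0 leqn0 => /eqP.
by rewrite lerD2r ler_wpM2r ?(ltW tau0)// ler_nat.
Qed.

Lemma disc_time_leT m : (m <= N)%N -> disc_time m <= T.
Proof.
move=> mN; apply: (le_trans (disc_time_homo mN)); rewrite /disc_time -tauN.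
case: eqP => _; first by rewrite mulr_ge0 ?(ltW tau0).
have := ltW tau0; rewrite -(addn1 N) natrD mulrDl mul1r => t0.
by rewrite lerD2l ler_pdivrMr// mulr_natr mulr2n lerDl.
Qed.

Lemma disc_time_itv m : (m <= N)%N -> 0 <= disc_time m <= T.
Proof. by move=> mN; rewrite disc_time_ge0 disc_time_leT. Qed.

(** Equality holds for [m = 1] and [m >= 3]; for [m = 2] the data is measurable at time 0 while the
    weight starts at [tau / 2]. *)
Lemma disc_time_start m : (0 < m)%N -> disc_time (m - 2) <= weight_start tau m.
Proof.
case: m => // -[_|m _]; first by rewrite /disc_time /weight_start.
rewrite /weight_start /= subn2 /= /disc_time; case: eqP => [->|_].
  have := ltW tau0; rewrite (_ : 2%:R * tau = tau + tau); first by move=> t0; lra.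
  by rewrite mulr_natl mulr2n.
by rewrite -(addn2 m) natrD mulrDl; have := tau0; move: (m%:R * tau) => a; lra.
Qed.

Lemma disc_time_end m : (0 < m)%N -> weight_end tau m = disc_time m.
Proof. by case: m. Qed.

Lemma weight_start_end m : weight_start tau m <= weight_end tau m.
Proof.
rewrite /weight_start /weight_end; case: eqP => _; have := ltW tau0 => t0.
  by rewrite addr_ge0 ?mulr_ge0 ?divr_ge0.
by move: (m%:R * tau) => a; lra.
Qed.

Lemma weight_start_ge0 m : (0 < m)%N -> 0 <= weight_start tau m.
Proof. by move=> m0; apply: le_trans (disc_time_start m0); exact: disc_time_ge0. Qed.

(** The 8 is the bound 4 on the squared weight times the length of its support, which is at most
    [2 * tau]. *)
Lemma integral_weight_sqr m (gam : R) : (0 < m)%N -> 0 <= gam ->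
  (\int[lebesgue_measure]_(r in `[0%R, T]) (weight tau m r ^+ 2 * gam)%:E
   <= (8 * tau * gam)%:E)%E.
Proof.
move=> m0 g0; set J : set R := `[weight_start tau m, weight_end tau m]%classic.
apply: (@le_trans _ _ (\int[lebesgue_measure]_(r in `[0%R, T]) ((4 * gam)%:E * (\1_J r)%:E))%E).
  apply: ge0_integral_mono => r; first by rewrite lee_fin mulr_ge0 ?sqr_ge0.
  rewrite /= in_itv /= => /andP[r0 _]; rewrite -EFinM lee_fin [leRHS]mulrAC; apply: (ler_wpM2r g0).
  exact: (weight_sqr_le tau0 m0 r0).
have mJ : measurable J by exact: measurable_itv.
rewrite ge0_integralZl//; last 2 first.
- by apply/measurable_EFinP; exact: measurable_indic.
- by rewrite lee_fin mulr_ge0.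
rewrite (_ : 8 * tau * gam = (4 * gam) * (2 * tau)); last by ring.
rewrite [leRHS]EFinM; apply: lee_wpmul2l; first by rewrite lee_fin mulr_ge0.
rewrite integral_indic//; apply: (@le_trans _ _ (lebesgue_measure J)).
  by apply: le_measure; rewrite ?inE//; apply: measurableI => //; exact: measurable_itv.
rewrite lebesgue_measure_itv /= lte_fin; case: ifP => _; last by rewrite lee_fin mulr_ge0// ltW.
rewrite -EFinB lee_fin /weight_start /weight_end; case: eqP => [->|_].
  by have := tau0; rewrite mul1r subr0; lra.
by have := tau0; move: (m%:R * tau) => a; lra.
Qed.

Section level.
Variables (C : R) (G : nat -> Omega -> (E -> E) -> U -> E -> E) (u : nat -> Omega -> E -> E)
  (m : nat) (U2 : R).
Hypotheses (C0 : 0 < C) (hG : data_stability P B O F tau N C G) (mN : (1 <= m <= N)%N)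
  (hu : L2_random P O (disc_filtration F tau (m - 2)) (u (m - 2)%N))
  (hU2 : (second_moment P O (u (m - 2)%N) <= U2%:E)%E) (U20 : 0 <= U2).
Variables (q : nat) (xi : 'I_q -> E -> E).
Hypotheses (Lxi : forall j, L2x O (xi j)) (oxi : orthonormal (@ip R n O 1 n.+1) xi).

Let Nz := noise P inner B T F O W tau G u m.
Let A w := G m w (u (m - 2)%N w).
Let m0 : (0 < m)%N. Proof. by case/andP: mN. Qed.
Let m2N : (m - 2 <= N)%N. Proof. by case/andP: mN => _; apply: leq_trans; exact: leq_subr. Qed.

Let sub0 : sub_sigma (disc_filtration F tau (m - 2)).
Proof. by rewrite disc_filtrationE; apply: (filtration_sub hF); exact: disc_time_itv. Qed.

Let Lu w : L2x O (u (m - 2)%N w). Proof. by case: hu => [[H _] _]; exact: H. Qed.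

Let HA w : HS B O (A w).
Proof. by have [H _ _ _] := hG mN; exact: H (Lu w). Qed.

(** [data_stability] grants joint measurability in the outcome and the field. Sets of the product
    sigma-algebra pull back to measurable sets along the graph of [u (m - 2)], which is checked on
    generating rectangles. *)
Let mA : measurable_fun [set: Omega] (fun w => HS_norm B O (A w)).
Proof.
apply: (measurability _ (RGenInftyO.measurableE R)) => /= _ [_ [a ->] <-].
rewrite setTI; have [_ H _ _] := hG mN.
pose S0 := [set A0 | HS B O A0 /\ HS_norm B O A0 < a].
have bS : norm_borel (HS B O) (HS_norm B O) S0.
  by apply: sub_sigma_algebra; exact: (HS_norm_open B mO a).
have := H _ bS; set Z := _ `&` _ => bZ.
suff : measurable [set w | Z (w, u (m - 2)%N w)].
  congr (measurable _); apply/seteqP; split => w /=; rewrite in_itv /=.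
    by move=> [_ []].
  by move=> h; split; [split; [by []|exact: Lu] | split; [exact: HA | exact: h]].
move: Z bZ; apply: smallest_sub => /=.
  split => [|Z mZ|Z mZ] /=.
  - by rewrite (_ : [set w | _] = set0)//; apply/seteqP; split.
  - rewrite (_ : [set w | _] = ~` [set w | Z (w, u (m - 2)%N w)]); first exact: measurableC.
    apply/seteqP; split => w /=; first by case.
    by move=> h; split; [split; [by []|exact: Lu] | exact: h].
  - rewrite (_ : [set w | _] = \bigcup_k [set w | Z k (w, u (m - 2)%N w)]); last first.
      by apply/seteqP; split => w [k _ h]; exists k.
    exact: bigcupT_measurable.
move=> _ [S FS [D bD <-]] /=.
rewrite (_ : [set w | _] = S `&` u (m - 2)%N @^-1` D); last by apply/seteqP; split.
apply: measurableI; first exact: sub0.2.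
by apply: sub0.2; case: hu => [[_ H'] _]; exact: H'.
Qed.

Let gam := C * (1 + U2).
Let gam0 : 0 <= gam. Proof. by rewrite mulr_ge0 ?(ltW C0) ?addr_ge0. Qed.

Let A2 : (HS_second_moment P B O A <= gam%:E)%E.
Proof.
have [_ _ H _] := hG mN; apply: le_trans (H _ hu) _.
rewrite EFinM EFinD; apply: lee_wpmul2l; first by rewrite lee_fin ltW.
by apply: leeD.
Qed.

Let wt2 := integral_weight_sqr m0 gam0.

Let ab : 0 <= weight_start tau m /\ weight_end tau m <= T.
Proof.
by split; [exact: weight_start_ge0 | rewrite disc_time_end// disc_time_leT//; case/andP: mN].
Qed.

Let supp r : 0 < r -> r <= T -> ~ (weight_start tau m < r <= weight_end tau m) -> weight tau m r = 0.
Proof. by move=> r0 _; exact: weight_supp. Qed.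

(** [ito_integral] has the default value 0, so the noise is either a genuine Ito integral or zero,
    and each estimate below treats both cases. *)
Let noiseE : is_ito_integral P inner B T F O W (fun r w x z => weight tau m r *: A w x z) Nz
  \/ Nz = fun=> 0.
Proof.
rewrite /Nz /noise /ito_integral; set S := [set X | _].
have [[X SX]|H] := pselect (exists X, S X); first by left; exact: (@xgetPex _ _ S (ex_intro _ X SX)).
by right; apply: xgetPN => X SX; apply: H; exists X.
Qed.

Definition noise_coord j : Omega -> R^o := fun w => ip O (Nz w) (xi j).

Lemma noise_L2 w : L2x O (Nz w).
Proof. by case: noiseE => [[_ [H _] _]|->]; [exact: H | exact: (si_0 vsi)]. Qed.

Let noise_coord0 j : Nz = (fun=> 0) -> noise_coord j = fun=> 0.
Proof. by move=> e; apply/funext => w; rewrite /noise_coord e (form0l vsi (Lxi j)). Qed.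

Lemma noise_coord_sqi j : sqi P (noise_coord j).
Proof.
case: noiseE => [hX|e]; last by rewrite noise_coord0//; exact: sqi_cst.
exact: (ito_coord_sqi hF hW mO Lxi oxi hX j).
Qed.

(** [32 = 4 * 8], from [ito_coord_sum] and [integral_weight_sqr]. *)
Lemma noise_coord_sum :
  \sum_j EE P (noise_coord j) (noise_coord j) <= 32 * gauss_var R * C * tau * (1 + U2).
Proof.
have v0 := gauss_var_ge0 R.
case: noiseE => [hX|e]; last first.
  rewrite big1 => [|j _]; first by rewrite !mulr_ge0 ?(ltW C0) ?(ltW tau0) ?addr_ge0.
  by rewrite noise_coord0// (form0l IP)//; exact: (sqi_cst P 0).
have := ito_coord_sum hT hF hU hB hW mO (weight_measurable tau m) HA mA A2 gam0 wt2 Lxi oxi hX.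
by rewrite /gam => h; apply: (le_trans h); rewrite le_eqVlt; apply/orP; left; apply/eqP; ring.
Qed.

Lemma noise_coord_Gmeas j : Gmeas (disc_filtration F tau m) (noise_coord j).
Proof.
rewrite disc_filtrationE -disc_time_end//.
case: noiseE => [hX|e]; last by rewrite noise_coord0//; exact: measurable_cst.
exact: (ito_coord_Gmeas hT hF hU hB hW mO HA Lxi oxi hX
  ab.1 (weight_start_end m) ab.2 supp j).
Qed.

Lemma noise_coord_orth j Y : sqi P Y -> Gmeas (F (weight_start tau m)) Y ->
  EE P Y (noise_coord j) = 0.
Proof.
move=> sY mY; case: noiseE => [hX|e]; last first.
  by rewrite noise_coord0// (si_C IP sY (sqi_cst P 0)) (form0l IP sY).
exact: (ito_coord_orth hT hF hU hB hW mO HA Lxi oxi hX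
  ab.1 (weight_start_end m) ab.2 supp j sY mY).
Qed.

End level.
End noise.

(** * Energy estimate *)

Lemma form_mul_young (R : realType) (X : lmodType R) (S : set X) (b : X -> X -> R)
    (H : semi_inner S b) (a : R) v w : 0 < a -> S v -> S w ->
  2 * b v w <= a * b w w + a^-1 * b v v.
Proof.
move=> a0 Sv Sw; have Saw := subspZ H a Sw.
have := si_ge0 H (subspB H Saw Sv).
rewrite (form_sqrB H Saw Sv) (formZl H a Sw Saw) (formZr H a Sw Sw) (formZl H a Sw Sv) (si_C H Sw Sv).
rewrite -(pmulr_rge0 _ (_ : 0 < a^-1)) ?invr_gt0//.
have -> : a^-1 * (a * (a * b w w) - 2 * (a * b v w) + b v v)
  = a * b w w + a^-1 * b v v - 2 * b v w by field; rewrite gt_eqF.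
by rewrite subr_ge0.
Qed.

Lemma sum_sqr_le_of_monotone (R : realType) (r : nat) (a b : 'I_r -> R) :
  \sum_j a j ^+ 2 <= \sum_j b j * a j -> \sum_j a j ^+ 2 <= \sum_j b j ^+ 2.
Proof.
move=> H; have : \sum_j b j * a j <= \sum_j (2^-1 * (a j ^+ 2) + 2^-1 * (b j ^+ 2)).
  by apply: ler_sum => j _; have := sqr_ge0 (b j - a j); rewrite sqrrB -mulr_natr; lra.
by rewrite big_split /= -!mulr_sumr; lra.
Qed.

(** The energy step combined with the noise bound, isolated so that linear arithmetic sees plain
    variables. Here [192 = 6 * 32], and the previous jump is enlarged from weight [1/4] to [1/2]. *)
Lemma gronwall_arith (R : realType) (a1 a2 a3 a4 a5 a6 a7 s g1 g2 g3 : R) :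
  a1 + 2^-1 * a2 + 2 * a3 <= a4 + 4^-1 * a5 + 6 * a6 ->
  a6 <= 32 * g1 * g2 * g3 * (1 + a7) -> 0 <= a5 ->
  1 + (a1 + 2^-1 * a2 + 2 * (s + a3)) <=
  1 + (a4 + 2^-1 * a5 + 2 * s) + 192 * g1 * g2 * g3 * (1 + a7).
Proof. lra. Qed.

Section integral_majorant.
Context (R : realType) (d : measure_display) (Omega : measurableType d) (P : probability Omega R).

Lemma Rintegral_ae_ge0 (H : Omega -> R) : P.-integrable [set: Omega] (EFin \o H) ->
  {ae P, forall w, 0 <= H w} -> 0 <= \int[P]_w H w.
Proof.
move=> iH H0; have mH : measurable_fun [set: Omega] H.
  by apply/measurable_EFinP; case/integrableP: iH.
have -> : \int[P]_w H w = \int[P]_w `|H w|.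
  congr fine; apply: ae_eq_integral => //.
  - exact/measurable_EFinP.
  - by apply/measurable_EFinP; exact: measurableT_comp.
  - by apply: filterS H0 => w h _ /=; rewrite ger0_norm.
by apply: Rintegral_ge0 => w _.
Qed.

(** [H] may be negative on a null set; its modulus is a nonnegative measurable majorant with the
    same integral. *)
Lemma ae_integral_le_Rintegral (f H : Omega -> R) : P.-integrable [set: Omega] (EFin \o H) ->
  (forall w, 0 <= f w) -> {ae P, forall w, f w <= H w} ->
  (\int[P]_w (f w)%:E <= (\int[P]_w H w)%:E)%E.
Proof.
move=> iH f0 fH; have mH : measurable_fun [set: Omega] H.
  by apply/measurable_EFinP; case/integrableP: iH.
have -> : (\int[P]_w H w)%:E = (\int[P]_w `|H w|%:E)%E.
  rewrite /Rintegral fineK; last exact: integrable_fin_num.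
  apply: ae_eq_integral => //.
  - exact/measurable_EFinP.
  - by apply/measurable_EFinP; exact: measurableT_comp.
  - by apply: filterS fH => w h _ /=; rewrite ger0_norm// (le_trans (f0 w)).
apply: ae_ge0_integral_mono => //.
- by apply/measurable_EFinP; exact: measurableT_comp.
- by apply: filterS fH => w h; rewrite lee_fin (le_trans h) ?ler_norm.
Qed.

End integral_majorant.

Section scheme.
Context (R : realType) (n : nat) (d : measure_display) (Omega : measurableType d)
  (P : probability Omega R) (T p : R) (F : R -> set (set Omega))
  (U : completeNormedModType R) (inner : {dot U for idfun}) (B : set U)
  (W : R -> U -> Omega -> R) (O : set 'rV[R]_n.+1).
Local Notation E := 'rV[R]_n.+1.
Hypotheses (hT : 0 < T) (hF : stochastic_basis P T F) (hU : inner_product_norm inner)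
  (hB : orthonormal_basis inner B) (hW : cylindrical_wiener P T F W)
  (oO : open O) (Ofin : (leb R n O < +oo)%E) (p1 : 1 < p).
Let mO : measurable (O : set (Rn R n)) := measurable_open oO.
Local Notation vsi := (@L2_semi_inner R n O mO 1 n.+1).
Let IP := sqi_semi_inner P.
Variables (V : set (E -> E)) (Q : set (E -> R)).
Hypotheses (hV : velocity_space O V) (hQ : pressure_space O Q).
Variables (N : nat) (tau : R).
Hypotheses (tau0 : 0 < tau) (tauN : N.+1%:R * tau = T).
Variables (C : R) (G : nat -> Omega -> (E -> E) -> U -> E -> E) (u : nat -> Omega -> E -> E).
Hypotheses (C0 : 0 < C) (hG : data_stability P B O F tau N C G)
  (hu0 : L2_random P O (F 0) (u 0%N)) (uV0 : forall w, Vdiv O V Q (u 0%N w))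
  (uV : forall m w, (1 <= m <= N)%N -> Vdiv O V Q (u m w))
  (hsch : forall m xi, (1 <= m <= N)%N -> Vdiv O V Q xi ->
     {ae P, forall w, ip O (u m w - u m.-1 w) xi + tau * visc O p (u m w) xi
       = ip O (noise P inner B T F O W tau G u m w) xi}).
Variables (r : nat) (f : 'I_r -> E -> E).
Hypotheses (Vf : forall i, Vdiv O V Q (f i)) (of_ : orthonormal (@ip R n O 1 n.+1) f)
  (fspan : forall v, Vdiv O V Q v -> ae_on O (fun x => v x = \sum_i ip O v (f i) *: f i x)).

Let Wdiv v : Vdiv O V Q v -> W1oo O v.
Proof. by move=> [Vv _]; exact: (velocity_W hV Vv). Qed.

Let Ldiv v : Vdiv O V Q v -> L2x O v.
Proof. by move=> [Vv _]; exact: (velocity_L2 oO Ofin hV Vv). Qed.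

Let Lf i : L2x O (f i). Proof. exact: (Ldiv (Vf i)). Qed.

Lemma scheme_Vdiv m w : (m <= N)%N -> Vdiv O V Q (u m w).
Proof. by case: m => [_|m mN]; [exact: uV0 | exact: uV]. Qed.

Let Vdiv_sqr v : Vdiv O V Q v -> ip O v v = \sum_i ip O v (f i) ^+ 2.
Proof.
move=> Vv; rewrite (ip_comb oO (Ldiv Vv) (Ldiv Vv) Lf (fspan Vv)).
by apply: eq_bigr => i _; rewrite expr2.
Qed.

Let comb (z : 'I_r -> R) : E -> E := \sum_i z i *: f i.

Let comb_L2 z : L2x O (comb z).
Proof. by apply: (subsp_sum vsi) => i; exact: (subspZ vsi _ (Lf i)). Qed.

Let comb_resid v : Vdiv O V Q v -> ip O (v - comb (fun i => ip O v (f i))) (v - comb (fun i => ip O v (f i))) = 0.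
Proof.
move=> Vv; apply: (L2_ae_null oO (Ldiv Vv) (comb_L2 _)).
by apply: (ae_onS _ (fspan Vv)) => x _ ->; rewrite /comb fct_sumE.
Qed.

Lemma Vdiv_random_elt (G0 : set (set Omega)) (v : Omega -> E -> E) : sub_sigma G0 ->
  (forall w, Vdiv O V Q (v w)) -> (forall i, Gmeas G0 (fun w => ip O (v w) (f i))) ->
  random_elt G0 (L2x O) (L2x_norm O) v.
Proof.
move=> sG Vv mv.
apply: (@random_elt_coords _ _ _ G0 _ _ _ v r comb (fun w i => ip O (v w) (f i)) sG).
- by move=> w; exact: (Ldiv (Vv w)).
- exact: comb_L2.
- by move=> z z'; exact: powR_ge0.
- move=> z z'; rewrite [LHS]sqr_L2_norm.
  have -> : comb z' - comb z = \sum_i (z' i - z i) *: f i.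
    by rewrite /comb -sumrB; apply: eq_bigr => i _; rewrite scalerBl.
  exact: (form_onb_sqr vsi Lf of_).
- by move=> w; rewrite [LHS]L2_norm_sqrt comb_resid// sqrtr0.
- move=> w; rewrite [LHS]L2_norm_sqrt (L2_ae_null oO (comb_L2 _) (Ldiv (Vv w))) ?sqrtr0//.
  by apply: (ae_onS _ (fspan (Vv w))) => x _ ->; rewrite /comb fct_sumE.
- exact: mv.
Qed.

Definition vel_coord m i : Omega -> R^o := fun w => ip O (u m w) (f i).
Definition noise_div m i : Omega -> R^o := noise_coord P T F inner B W O tau G u m f i.
Definition energy m : R := \sum_i EE P (vel_coord m i) (vel_coord m i).

Let good m := L2_random P O (disc_filtration F tau m) (u m).

Let sub_disc m : (m <= N)%N -> sub_sigma (disc_filtration F tau m).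
Proof.
by move=> mN; rewrite disc_filtrationE; apply: (filtration_sub hF); exact: (disc_time_itv tau0 tauN mN).
Qed.

Lemma vel_coord_Gmeas m i : (m <= N)%N -> good m -> Gmeas (disc_filtration F tau m) (vel_coord m i).
Proof. by move=> mN [ru _]; exact: (random_elt_ip mO (sub_disc mN) ru (Lf i)). Qed.

Let vel_coord_le m i w : (m <= N)%N -> vel_coord m i w ^+ 2 <= L2x_norm O (u m w) ^+ 2.
Proof.
move=> mN; have Vu := scheme_Vdiv w mN.
rewrite [L2x_norm _ _ ^+ 2]sqr_L2_norm (Vdiv_sqr Vu) (bigD1 i)//= lerDl.
by apply: sumr_ge0 => j _; exact: sqr_ge0.
Qed.

Lemma vel_coord_sqi m i : (m <= N)%N -> good m -> sqi P (vel_coord m i).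
Proof.
move=> mN gm; have mc := Gmeas_measurable (sub_disc mN) (vel_coord_Gmeas i mN gm).
apply/sqiP => //; have [_ fin] := gm; apply: le_lt_trans fin.
apply: ge0_integral_mono => w _; rewrite lee_fin; [exact: sqr_ge0 | exact: vel_coord_le].
Qed.

Lemma second_moment_energy m : (m <= N)%N -> (forall i, sqi P (vel_coord m i)) ->
  second_moment P O (u m) = (energy m)%:E.
Proof.
move=> mN su; rewrite /second_moment /energy -sumEFin.
under eq_integral => w _ do rewrite [L2x_norm _ _ ^+ 2]sqr_L2_norm (Vdiv_sqr (scheme_Vdiv w mN)) -sumEFin.
rewrite ge0_integral_sum//; last first.
- by move=> i w _; rewrite lee_fin sqr_ge0.
- by move=> i; apply/measurable_EFinP; apply: measurable_funX; exact: (sqi_measurable (su i)).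
by apply: eq_bigr => i _; rewrite (EE_integral (su i)).
Qed.

Lemma energy_ge0 m : 0 <= energy m.
Proof. by apply: sumr_ge0 => i _; apply: Rintegral_ge0 => w _; rewrite -expr2 sqr_ge0. Qed.

Let visc_span m w v : (m <= N)%N -> W1oo O v ->
  visc O p v (u m w) = \sum_i vel_coord m i w * visc O p v (f i).
Proof.
move=> mN Wv; have Vu := scheme_Vdiv w mN.
exact: (visc_comb oO Ofin p1 Wv (Wdiv Vu) (fun i => Wdiv (Vf i)) (fspan Vu)).
Qed.

Lemma scheme_ae m : (1 <= m <= N)%N -> {ae P, forall w i,
  vel_coord m i w + tau * visc O p (u m w) (f i) = vel_coord m.-1 i w + noise_div m i w}.
Proof.
move=> mN; have /andP[m0 mleN] := mN.
have : {ae P, forall w, forall i : 'I_r, ip O (u m w - u m.-1 w) (f i)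
    + tau * visc O p (u m w) (f i) = noise_div m i w}.
  exact: (@filter_forall _ _ (fun i w => _ = _) _ _ (fun i => hsch mN (Vf i))).
apply: filterS => w H i; have := H i.
have L1 := Ldiv (scheme_Vdiv w mleN).
have L2 := Ldiv (scheme_Vdiv w (leq_trans (leq_pred m) mleN)).
rewrite (formBl vsi L1 L2 (Lf i)) -/(vel_coord m i w) -/(vel_coord m.-1 i w); lra.
Qed.

(** The scheme at two outcomes is subtracted and tested with the difference of the velocities. The
    viscous contribution is nonnegative by monotonicity, so the step is nonexpansive in its data. *)
Let scheme_mono m w w' : (1 <= m <= N)%N ->
  (forall i, vel_coord m i w + tau * visc O p (u m w) (f i) = vel_coord m.-1 i w + noise_div m i w) ->
  (forall i, vel_coord m i w' + tau * visc O p (u m w') (f i) = vel_coord m.-1 i w' + noise_div m i w') ->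
  \sum_i (vel_coord m i w - vel_coord m i w') ^+ 2 <=
  \sum_i ((vel_coord m.-1 i w + noise_div m i w) - (vel_coord m.-1 i w' + noise_div m i w')) ^+ 2.
Proof.
move=> /andP[m0 mN] Hw Hw'.
have W1 := Wdiv (scheme_Vdiv w mN); have W2 := Wdiv (scheme_Vdiv w' mN).
apply: sum_sqr_le_of_monotone.
rewrite [leRHS](_ : _ = \sum_i (vel_coord m i w - vel_coord m i w') ^+ 2 +
  tau * (visc O p (u m w) (u m w) - visc O p (u m w) (u m w') - visc O p (u m w') (u m w)
   + visc O p (u m w') (u m w'))); last first.
  rewrite !(visc_span _ mN)// -!sumrB -big_split /= mulr_sumr -big_split /=.
  apply: eq_bigr => i _; move: (Hw i) (Hw' i).
  move: (visc O p (u m w) (f i)) (visc O p (u m w') (f i)) (vel_coord m i w) (vel_coord m i w')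
    => a b c c' <- <-; ring.
rewrite lerDl; apply: mulr_ge0; first exact: ltW.
exact: (visc_mono oO Ofin p1 W1 W2).
Qed.

Let scheme_bound m w : (1 <= m <= N)%N ->
  (forall i, vel_coord m i w + tau * visc O p (u m w) (f i) = vel_coord m.-1 i w + noise_div m i w) ->
  \sum_i vel_coord m i w ^+ 2 <= \sum_i (vel_coord m.-1 i w + noise_div m i w) ^+ 2.
Proof.
move=> /andP[m0 mN] Hw; have W1 := Wdiv (scheme_Vdiv w mN).
apply: sum_sqr_le_of_monotone.
rewrite [leRHS](_ : _ = \sum_i vel_coord m i w ^+ 2 + tau * visc O p (u m w) (u m w)); last first.
  rewrite (visc_span _ mN)// mulr_sumr -big_split /=.
  apply: eq_bigr => i _; move: (Hw i); move: (visc O p (u m w) (f i)) (vel_coord m i w) => a c <-; ring.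
by rewrite lerDl; apply: mulr_ge0; [exact: ltW | exact: visc_self_ge0].
Qed.

Section step.
Variable m : nat.
Hypotheses (mN : (1 <= m <= N)%N) (g1 : good m.-1) (g2 : good (m - 2)%N).
Let mleN : (m <= N)%N. Proof. by case/andP: mN. Qed.
Let m1N : (m.-1 <= N)%N. Proof. exact: leq_trans (leq_pred m) mleN. Qed.
Let m2N : (m - 2 <= N)%N. Proof. exact: leq_trans (leq_subr 2 m) mleN. Qed.

Lemma noise_div_sqi i : sqi P (noise_div m i).
Proof. exact: (noise_coord_sqi inner B hF hW mO tau G u m Lf of_ i). Qed.

Lemma noise_div_Gmeas i : Gmeas (disc_filtration F tau m) (noise_div m i).
Proof. exact: (noise_coord_Gmeas hT hF hU hB hW mO tau0 tauN hG mN g2 Lf of_ i). Qed.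

Lemma noise_div_orth i Y : sqi P Y -> Gmeas (F (weight_start tau m)) Y ->
  EE P Y (noise_div m i) = 0.
Proof. exact: (noise_coord_orth hT hF hU hB hW mO tau0 tauN hG mN g2 Lf of_ i). Qed.

Lemma noise_div_sum :
  \sum_i EE P (noise_div m i) (noise_div m i) <= 32 * gauss_var R * C * tau * (1 + energy (m - 2)).
Proof.
apply: (noise_coord_sum hT hF hU hB hW mO tau0 tauN C0 hG mN g2 _ (energy_ge0 _) Lf of_).
by rewrite (second_moment_energy m2N (fun i => vel_coord_sqi i m2N g2)).
Qed.

Let data_coord_Gmeas i : Gmeas (disc_filtration F tau m) (fun w => vel_coord m.-1 i w + noise_div m i w).
Proof.
apply: measurable_funD; last exact: noise_div_Gmeas.
apply: (Gmeas_sub (sub_disc m1N) (sub_disc mleN) _ (vel_coord_Gmeas i m1N g1)).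
rewrite !disc_filtrationE; apply: (filtration_homo hF (disc_time_ge0 tau0 _)).
- by apply: (disc_time_homo tau0); exact: leq_pred.
- exact: (disc_time_leT tau0 tauN mleN).
Qed.

(** Off one null set common to all coordinates, [scheme_mono] makes each velocity coordinate a
    1-Lipschitz function of data that is measurable at level [m]. *)
Let step_Gmeas i : Gmeas (disc_filtration F tau m) (vel_coord m i).
Proof.
have [N0 [mN0 N00 HN]] := scheme_ae mN.
have out w : ~ N0 w -> forall i, vel_coord m i w + tau * visc O p (u m w) (f i)
    = vel_coord m.-1 i w + noise_div m i w.
  by move=> Nw; apply: contrapT => h; apply: Nw; exact: HN.
have cG A : P.-negligible A -> disc_filtration F tau m A.
  by rewrite disc_filtrationE; apply: (filtration_complete hF); exact: (disc_time_itv tau0 tauN mleN).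
apply: (@Lipschitz_Gmeas R d Omega P _ (sub_disc mleN) r
  (fun w i => vel_coord m.-1 i w + noise_div m i w) (vel_coord m i) N0 cG).
- by exists N0; split.
- exact: data_coord_Gmeas.
move=> w w' /out Hw /out Hw'; apply: le_trans (scheme_mono mN Hw Hw').
by rewrite (bigD1 i)//= lerDl; apply: sumr_ge0 => j _; exact: sqr_ge0.
Qed.

Let step_sqi i : sqi P (vel_coord m i).
Proof.
have mc := Gmeas_measurable (sub_disc mleN) (step_Gmeas i).
have sy j : sqi P (vel_coord m.-1 j + noise_div m j).
  exact: (subspD IP (vel_coord_sqi j m1N g1) (noise_div_sqi j)).
have I j := sqi_integrable (sy j) (sy j).
have [J _] := Rintegral_finsum (index_enum 'I_r) measurableT I.
apply/sqiP => //; apply: le_lt_trans (ltry _).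
apply: (ae_integral_le_Rintegral J) => [w|]; first exact: sqr_ge0.
apply: filterS (scheme_ae mN) => w Hw; apply: (@le_trans _ _ (\sum_i vel_coord m i w ^+ 2)).
  by rewrite (bigD1 i)//= lerDl; apply: sumr_ge0 => j _; exact: sqr_ge0.
by apply: le_trans (scheme_bound mN Hw) _; apply: ler_sum => j _; rewrite expr2.
Qed.

Lemma scheme_step : good m.
Proof.
split; last by rewrite (second_moment_energy mleN step_sqi) ltry.
apply: (Vdiv_random_elt (sub_disc mleN)) => [w|i]; [exact: scheme_Vdiv | exact: step_Gmeas].
Qed.

End step.

(** Strong induction, since a step uses the velocity one level back in its data and two levels back
    in the noise coefficient. *)
Lemma scheme_L2_random m : (m <= N)%N -> good m.
Proof.
elim/ltn_ind: m => -[_ _|m IH mN]; first exact: hu0.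
have g1 : good m by exact: (IH m (ltnSn m) (ltnW mN)).
have g2 : good (m.+1 - 2)%N.
  apply: IH; first by rewrite ltnS subSS leq_subr.
  by apply: leq_trans (ltnW mN); rewrite subSS leq_subr.
exact: (@scheme_step m.+1 mN g1 g2).
Qed.

Let sv m i : (m <= N)%N -> sqi P (vel_coord m i).
Proof. by move=> mN; exact: (vel_coord_sqi i mN (scheme_L2_random mN)). Qed.

Let m1_le m : (1 <= m <= N)%N -> (m.-1 <= N)%N.
Proof. by case/andP=> _; exact: leq_trans (leq_pred m). Qed.

Let m2_le m : (1 <= m <= N)%N -> (m - 2 <= N)%N.
Proof. by case/andP=> _; exact: leq_trans (leq_subr 2 m). Qed.

(** By the scheme this is the expectation of [tau * visc O p (u m w) (u m w)]; written with products
    of square-integrable coordinates, its integrability is immediate. *)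
Definition dissipation m : R :=
  \sum_i EE P (vel_coord m.-1 i + noise_div m i - vel_coord m i) (vel_coord m i).

Lemma dissipation_visc m : (1 <= m <= N)%N -> exists H : Omega -> R,
  [/\ P.-integrable [set: Omega] (EFin \o H), \int[P]_w H w = dissipation m &
      {ae P, forall w, tau * visc O p (u m w) (u m w) = H w}].
Proof.
move=> mN; have mleN : (m <= N)%N by case/andP: mN.
have s1 i : sqi P (vel_coord m.-1 i + noise_div m i - vel_coord m i).
  apply: (subspB IP _ (sv i mleN)); apply: (subspD IP (sv i (m1_le mN))).
  exact: (noise_div_sqi m i).
have I i := sqi_integrable (s1 i) (sv i mleN).
have [J JE] := Rintegral_finsum (index_enum 'I_r) measurableT I.
eexists; split; [exact: J | exact: JE |].
apply: filterS (scheme_ae mN) => w Hw; rewrite (visc_span _ mleN); last exact: (Wdiv (scheme_Vdiv w mleN)).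
rewrite mulr_sumr; apply: eq_bigr => i _; rewrite !fctE.
have -> : (vel_coord m.-1 i w : R) + noise_div m i w = vel_coord m i w + tau * visc O p (u m w) (f i).
  by rewrite Hw.
by move: (visc O p (u m w) (f i)) (vel_coord m i w) => a c; ring.
Qed.

Lemma dissipation_ge0 m : (1 <= m <= N)%N -> 0 <= dissipation m.
Proof.
move=> mN; have [H [iH <- aeH]] := dissipation_visc mN.
apply: Rintegral_ae_ge0 => //; apply: filterS aeH => w <-.
by apply: mulr_ge0; [exact: ltW | exact: visc_self_ge0].
Qed.

Definition vel_jump m : R :=
  \sum_i EE P (vel_coord m i - vel_coord m.-1 i) (vel_coord m i - vel_coord m.-1 i).

Lemma vel_jump_ge0 m : 0 <= vel_jump m.
Proof. by apply: sumr_ge0 => i _; apply: Rintegral_ge0 => w _; rewrite -expr2 sqr_ge0. Qed.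

Lemma energy_step m : (1 <= m <= N)%N ->
  energy m + 2^-1 * vel_jump m + 2 * dissipation m <=
  energy m.-1 + 4^-1 * vel_jump m.-1 + 6 * \sum_i EE P (noise_div m i) (noise_div m i).
Proof.
move=> mN; have mleN : (m <= N)%N by case/andP: mN.
have m0 : (0 < m)%N by case/andP: mN.
have g2 := scheme_L2_random (m2_le mN).
rewrite /energy /vel_jump /dissipation !mulr_sumr -!big_split /=; apply: ler_sum => i _.
have sb := sv i mleN; have sa := sv i (m1_le mN).
have sc : sqi P (vel_coord m.-1.-1 i) by apply: sv; exact: leq_trans (leq_pred _) (m1_le mN).
have sz := noise_div_sqi m i.
have zc : EE P (vel_coord m.-1.-1 i) (noise_div m i) = 0.
  apply: (noise_div_orth mN g2 i sc).
  have := vel_coord_Gmeas i (m2_le mN) g2; rewrite disc_filtrationE subn2 => mc.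
  have wT : weight_start tau m <= T.
    apply: le_trans (weight_start_end tau0 m) _; rewrite disc_time_end//.
    exact: (disc_time_leT tau0 tauN mleN).
  have st := disc_time_start tau0 m0; rewrite subn2 in st.
  have t0 := disc_time_ge0 tau0 m.-2.
  apply: (Gmeas_sub (filtration_sub hF _) (filtration_sub hF _) (filtration_homo hF t0 st wT) mc).
  - by rewrite t0 (le_trans st).
  - by rewrite (le_trans t0 st).
move: sb sa sc sz zc.
move: (vel_coord m i) (vel_coord m.-1 i) (vel_coord m.-1.-1 i) (noise_div m i).
move=> b a c z sb sa sc sz zc.
(* Young with weights [1/2] and [1/4]: the noise receives the factor [2 + 4 = 6], half of the
   current jump is kept on the left, and a quarter of the previous jump is passed on to the
   recursion. *)
have y1 := form_mul_young IP (_ : 0 < 2^-1) sz (subspB IP sb sa).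
have y2 := form_mul_young IP (_ : 0 < 4^-1) sz (subspB IP sa sc).
have {}y1 := y1 (ltac:(by rewrite invr_gt0)); have {}y2 := y2 (ltac:(by rewrite invr_gt0)).
move: y1 y2; rewrite !invrK (formBr IP sb sa sz) (formBr IP sa sc sz) (si_C IP sz sc) zc subr0.
rewrite (form_sqrB IP sb sa) (form_sqrB IP sa sc).
rewrite (formBl IP (subspD IP sa sz) sb sb) (formDl IP sa sz sb) (si_C IP sb sa).
lra.
Qed.

Let kap : R := 192 * gauss_var R * C.

Let kap0 : 0 <= kap. Proof. by rewrite !mulr_ge0 ?gauss_var_ge0// ltW. Qed.

(** Half a jump is carried along to cover the quarter that the next step produces, and the
    dissipation is accumulated so that one induction bounds everything. *)
Let theta k := energy k + 2^-1 * vel_jump k + 2 * \sum_(1 <= l < k.+1) dissipation l.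

Let diss_sum_ge0 k : (k <= N)%N -> 0 <= \sum_(1 <= l < k.+1) dissipation l.
Proof.
move=> kN; rewrite big_nat_cond; apply: sumr_ge0 => l; rewrite andbT => /andP[l1 lk].
by apply: dissipation_ge0; rewrite l1 (leq_trans _ kN).
Qed.

Let energy_theta k : (k <= N)%N -> energy k <= theta k.
Proof.
move=> kN; rewrite /theta -addrA lerDl addr_ge0// mulr_ge0 ?vel_jump_ge0 ?invr_ge0//.
exact: diss_sum_ge0.
Qed.

(** Strong induction, as the noise of a step is bounded by the energy two levels back, whose growth
    factor is no larger than the current one. Adding 1 absorbs the constant of the growth condition
    and makes the recursion multiplicative. *)
Lemma discrete_gronwall k : (k <= N)%N -> 1 + theta k <= (1 + energy 0) * (1 + kap * tau) ^+ k.
Proof.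
have kt0 : 0 <= kap * tau by rewrite mulr_ge0// ltW.
have e0 := energy_ge0 0.
elim/ltn_ind: k => -[_ _|k IH kN].
  rewrite /theta big_geq// mulr0 addr0 expr0 mulr1 lerD2l.
  rewrite (_ : vel_jump 0 = 0) ?mulr0 ?addr0//; apply: big1 => i _.
  by rewrite subrr (form0l IP)//; exact: (si_0 IP).
have kN' := ltnW kN.
have mN : (1 <= k.+1 <= N)%N by rewrite kN.
have step := energy_step mN; have g2 := scheme_L2_random (m2_le mN).
have xs := noise_div_sum mN g2.
have IHk := IH k (ltnSn k) kN'.
have k1N : (k.+1 - 2 <= N)%N by exact: m2_le.
have IHk1 : 1 + energy (k.+1 - 2) <= (1 + energy 0) * (1 + kap * tau) ^+ k.
  apply: (@le_trans _ _ (1 + theta (k.+1 - 2))); first by rewrite lerD2l energy_theta.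
  apply: (le_trans (IH _ _ k1N)); first by rewrite ltnS subSS leq_subr.
  apply: ler_wpM2l; first by rewrite addr_ge0.
  by apply: ler_weXn2l; [rewrite lerDl | rewrite subSS leq_subr].
have jk := vel_jump_ge0 k.
rewrite exprSr mulrA; apply: (@le_trans _ _ ((1 + theta k) + kap * tau * (1 + energy (k.+1 - 2)))).
  have tE : theta k.+1 = energy k.+1 + 2^-1 * vel_jump k.+1 +
      2 * (\sum_(1 <= l < k.+1) dissipation l + dissipation k.+1).
    by rewrite /theta big_nat_recr.
  have step' : energy k.+1 + 2^-1 * vel_jump k.+1 + 2 * dissipation k.+1 <=
    energy k + 4^-1 * vel_jump k + 6 * \sum_i EE P (noise_div k.+1 i) (noise_div k.+1 i) := step.
  by rewrite tE; exact: (gronwall_arith _ step' xs jk).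
rewrite [leRHS]mulrDr mulr1; apply: lerD; first exact: IHk.
by rewrite [leRHS]mulrC; exact: (ler_wpM2l kt0).
Qed.

(** [(1 + kap * tau) ^ k <= exp (kap * tau * k)] and [k * tau <= T] remove the dependence on [N]. *)
Lemma energy_bound : (forall k, (k <= N)%N -> 1 + energy k <= expR (kap * T) * (1 + energy 0)) /\
  2 * \sum_(1 <= l < N.+1) dissipation l <= expR (kap * T) * (1 + energy 0).
Proof.
have e0 := energy_ge0 0.
have le k : (k <= N)%N -> 1 + theta k <= expR (kap * T) * (1 + energy 0).
  move=> kN; apply: (le_trans (discrete_gronwall kN)); rewrite mulrC.
  apply: ler_wpM2r; first by rewrite addr_ge0.
  apply: (@le_trans _ _ (expR (kap * tau) ^+ k)).
    apply: lerXn2r; rewrite ?nnegrE ?expR_ge0 ?expR_ge1Dx//.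
    by rewrite addr_ge0// mulr_ge0// ltW.
  rewrite -expRM_natl ler_expR -tauN mulrCA; apply: ler_wpM2l => //.
  by rewrite ler_wpM2r ?(ltW tau0)// ler_nat (leq_trans kN).
split=> [k kN|]; first by apply: le_trans (le k kN); rewrite lerD2l energy_theta.
apply: le_trans (le N (leqnn N)); rewrite /theta addrA lerDr.
by rewrite !addr_ge0 ?energy_ge0// mulr_ge0 ?vel_jump_ge0 ?invr_ge0.
Qed.

End scheme.

(** * Pressure *)

Lemma sum_nat_mask (V : nmodType) (N m : nat) (a : nat -> V) : (m <= N)%N ->
  \sum_(1 <= l < m.+1) a l = \sum_(l < N | (l < m)%N) a l.+1.
Proof.
move=> mN; rewrite big_add1 /= big_mkord (big_ord_widen _ (fun l => a l.+1) mN).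
by apply: eq_bigl.
Qed.

Section two_dependent.
Context (R : realType) (d : measure_display) (Omega : measurableType d) (P : probability Omega R).
Variables (H : nat -> set (set Omega)) (N : nat) (x : nat -> Omega -> R^o).
Hypotheses (sH : forall k, sub_sigma (H k)) (homoH : forall k, H k `<=` H k.+1)
  (sx : forall l, (l < N)%N -> sqi P (x l.+1)) (mx : forall l, (l < N)%N -> Gmeas (H l.+1) (x l.+1))
  (ox : forall l Y, (l < N)%N -> sqi P Y -> Gmeas (H l.-1) Y -> EE P Y (x l.+1) = 0).

Let IP := sqi_semi_inner P.
Variable mask : pred nat.

(** [mask] selects a window of indices, so that one argument serves both the maximum over all
    partial sums and the increments over [k] steps. *)
Let y (b : bool) (k : nat) : Omega -> R^o :=
  if [&& (k < N)%N, mask k & odd k == b] then x k.+1 else 0.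

(* Every second member of the sequence is a martingale difference for the filtration in which the
   other levels are skipped. *)
Let L (b : bool) (k : nat) := if odd k == b then H k.-1 else H k.

Let sL b k : sub_sigma (L b k). Proof. by rewrite /L; case: ifP. Qed.

Let homo_le j k : (j <= k)%N -> H j `<=` H k.
Proof.
move=> /subnK <-; elim: (k - j)%N => [|i IH]; first by rewrite add0n.
by apply: (subset_trans IH); rewrite addSn; exact: homoH.
Qed.

Let homoL b k : L b k `<=` L b k.+1.
Proof.
rewrite /L /=; case: (odd k); case: b => /=; apply: homo_le; rewrite ?leqnn//;
  exact: leq_trans (leq_pred k) (leqnSn k).
Qed.

Let sy b k : sqi P (y b k).
Proof. by rewrite /y; case: ifP => [/and3P[kN _ _]|_]; [exact: sx | exact: (si_0 IP)]. Qed.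

Let my b k : (k < N)%N -> Gmeas (L b k.+1) (y b k).
Proof.
move=> kN; rewrite /y; case: ifP => [/and3P[_ _ /eqP kb]|_]; last exact: measurable_cst.
by rewrite /L /= kb (_ : (~~ b == b) = false); [exact: mx | case: b {kb}].
Qed.

Let oy b k Y : (k < N)%N -> sqi P Y -> Gmeas (L b k) Y -> EE P Y (y b k) = 0.
Proof.
move=> kN sY; rewrite /L /y kN /=; case: ifP => kb mY; last first.
  by rewrite andbF (si_C IP sY (si_0 IP)) (form0l IP sY).
rewrite andbT; case: ifP => _; first exact: ox.
by rewrite (si_C IP sY (si_0 IP)) (form0l IP sY).
Qed.

Let y_sum k : (k < N)%N -> y true k + y false k = if mask k then x k.+1 else 0.
Proof.
by move=> kN; rewrite /y kN /=; case: (mask k); case: (odd k); rewrite /= ?addr0 ?add0r.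
Qed.

Let y_sqr : \sum_(l < N) EE P (y true l) (y true l) + \sum_(l < N) EE P (y false l) (y false l)
  = \sum_(l < N | mask l) EE P (x l.+1) (x l.+1).
Proof.
rewrite -big_split [RHS]big_mkcond /=; apply: eq_bigr => l _; rewrite /y ltn_ord /=.
have e0 : EE P 0 0 = 0 by exact: (form0l IP (si_0 IP)).
by case: (mask l); case: (odd l); rewrite /= ?e0 ?addr0 ?add0r.
Qed.

Lemma two_dependent_sqr :
  EE P (\sum_(l < N | mask l) x l.+1) (\sum_(l < N | mask l) x l.+1)
  <= 2 * \sum_(l < N | mask l) EE P (x l.+1) (x l.+1).
Proof.
have e b := martingale_sqr (@sL b) (@homoL b) (@sy b) (@my b) (@oy b) (leqnn N).
have sM b : sqi P (\sum_(l < N) y b l) by apply: (subsp_sum IP) => l.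
rewrite -y_sqr (_ : \sum_(l < N | mask l) x l.+1 = \sum_(l < N) y true l + \sum_(l < N) y false l).
  apply: (le_trans (form_sqrD_le IP (sM true) (sM false))).
  by rewrite !e mulrDr.
rewrite -big_split [LHS]big_mkcond /=; apply: eq_bigr => l _.
by rewrite y_sum.
Qed.

(** The factor 8 is Doob's 4 times the 2 lost in splitting into parities. *)
Lemma two_dependent_max : exists S : Omega -> R^o,
  [/\ sqi P S, EE P S S <= 8 * \sum_(l < N | mask l) EE P (x l.+1) (x l.+1) &
      forall w k, (k <= N)%N -> `|\sum_(l < k | mask l) x l.+1 w| <= S w].
Proof.
pose S b : Omega -> R^o := running_max (y b) N.
have sS b : sqi P (S b) by exact: (running_max_sqi (@sy b)).
exists (S true + S false); split.
- exact: (subspD IP (sS true) (sS false)).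
- apply: (le_trans (form_sqrD_le IP (sS true) (sS false))).
  have e b := doob_L2 (@sL b) (@homoL b) (@sy b) (@my b) (@oy b).
  by have := e true; have := e false; rewrite -/(S true) -/(S false) -y_sqr; lra.
move=> w k kN; have e b := le_running_max (y b) w kN.
have -> : \sum_(l < k | mask l) x l.+1 w = (\sum_(l < k) y true l) w + (\sum_(l < k) y false l) w.
  rewrite !fct_sumE -big_split [LHS]big_mkcond /=; apply: eq_bigr => l _.
  have lN := leq_trans (ltn_ord l) kN.
  rewrite -[RHS]/((y true l + y false l) w) y_sum//.
  by case: (mask l).
by apply: le_trans (ler_normD _ _) _; apply: lerD; exact: e.
Qed.

End two_dependent.

Section pressure.
Context (R : realType) (n : nat) (d : measure_display) (Omega : measurableType d)
  (P : probability Omega R) (T p : R) (F : R -> set (set Omega))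
  (U : completeNormedModType R) (inner : {dot U for idfun}) (B : set U)
  (W : R -> U -> Omega -> R) (O : set 'rV[R]_n.+1).
Local Notation E := 'rV[R]_n.+1.
Hypotheses (hT : 0 < T) (hF : stochastic_basis P T F) (hU : inner_product_norm inner)
  (hB : orthonormal_basis inner B) (hW : cylindrical_wiener P T F W)
  (oO : open O) (Ofin : (leb R n O < +oo)%E) (p1 : 1 < p).
Let mO : measurable (O : set (Rn R n)) := measurable_open oO.
Local Notation vsi := (@L2_semi_inner R n O mO 1 n.+1).
Let IP := sqi_semi_inner P.
Variables (V : set (E -> E)) (Q : set (E -> R)).
Hypotheses (hV : velocity_space O V) (hQ : pressure_space O Q).
Variables (N : nat) (tau : R).
Hypotheses (tau0 : 0 < tau) (tauN : N.+1%:R * tau = T).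
Variables (C : R) (G : nat -> Omega -> (E -> E) -> U -> E -> E) (u : nat -> Omega -> E -> E).
Hypotheses (C0 : 0 < C) (hG : data_stability P B O F tau N C G)
  (uV : forall m w, (m <= N)%N -> Vdiv O V Q (u m w))
  (good : forall m, (m <= N)%N -> L2_random P O (disc_filtration F tau m) (u m)).
Variables (s : nat) (e : 'I_s -> E -> E) (q : 'I_s -> E -> R).
Hypotheses (Pe : forall j, Vperp O V Q (e j)) (oe : orthonormal (@ip R n O 1 n.+1) e)
  (espan : forall v, Vperp O V Q v -> ae_on O (fun x => v x = \sum_j ip O v (e j) *: e j x))
  (Qq : forall j, Q (q j)) (qe : forall i j, pair_div O (q i) (e j) = (i == j)%:R).

Let Wdiv v : Vdiv O V Q v -> W1oo O v.
Proof. by move=> [Vv _]; exact: (velocity_W hV Vv). Qed.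
Let Ldiv v : Vdiv O V Q v -> L2x O v.
Proof. by move=> [Vv _]; exact: (velocity_L2 oO Ofin hV Vv). Qed.
Let Wperp v : Vperp O V Q v -> W1oo O v.
Proof. by move=> [Vv _]; exact: (velocity_W hV Vv). Qed.
Let Lperp v : Vperp O V Q v -> L2x O v.
Proof. by move=> [Vv _]; exact: (velocity_L2 oO Ofin hV Vv). Qed.
Let Le j : L2x O (e j). Proof. exact: (Lperp (Pe j)). Qed.

Let nz l := noise P inner B T F O W tau G u l.
Let Z l j : Omega -> R^o := noise_coord P T F inner B W O tau G u l e j.
Let vis l j w := visc O p (u l w) (e j).

Let det_coef m w j : R := \sum_(1 <= l < m.+1) tau * vis l j w.
Let sto_coef m w j : R := - \sum_(1 <= l < m.+1) Z l j w.
Let lift (y : 'I_s -> R) : E -> R := lift_pressure q y.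

Definition pi_det m w := lift (det_coef m w).
Definition pi_sto m w := lift (sto_coef m w).
(** [pi_init] does not appear because it pairs to 0 with [Vperp] almost surely, so its class is
    zero. The increments of [prs] then satisfy the equation at every outcome. *)
Definition prs m w := lift (fun j => det_coef m w j + sto_coef m w j).

Let liftQ y : Q (lift y). Proof. exact: (lift_pressureQ hQ Qq). Qed.
Let lift_e y j : pair_div O (lift y) (e j) = y j.
Proof. exact: (pair_lift_e oO Ofin hV hQ Pe Qq qe). Qed.
Let liftB y y' : lift y \- lift y' = lift (fun j => y j - y' j).
Proof.
by apply/funext => x; rewrite /lift /lift_pressure /= -sumrB; apply: eq_bigr => j _; rewrite mulrBl.
Qed.

Let perp_pair p0 xi : Q p0 -> Vperp O V Q xi ->
  pair_div O p0 xi = \sum_j ip O xi (e j) * pair_div O p0 (e j).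
Proof. exact: (pair_div_perp oO Ofin hV hQ Pe espan). Qed.

Let perp_visc l w xi : (l <= N)%N -> Vperp O V Q xi ->
  visc O p (u l w) xi = \sum_j ip O xi (e j) * vis l j w.
Proof.
move=> lN Pxi; exact: (visc_comb oO Ofin p1 (Wdiv (uV w lN)) (Wperp Pxi) (fun j => Wperp (Pe j)) (espan Pxi)).
Qed.

Let nz_L2 l w : L2x O (nz l w).
Proof. exact: (noise_L2 P T F inner B W mO tau G u l w). Qed.

Let perp_noise l w xi : Vperp O V Q xi -> ip O (nz l w) xi = \sum_j ip O xi (e j) * Z l j w.
Proof. by move=> Pxi; exact: (ip_comb oO (nz_L2 l w) (Lperp Pxi) Le (espan Pxi)). Qed.

Let div_perp0 v xi : Vdiv O V Q v -> Vperp O V Q xi -> ip O v xi = 0.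
Proof. by move=> Dv [_ Pxi]; rewrite ipC; exact: Pxi. Qed.

Lemma pi_detQ m w : Q (pi_det m w). Proof. exact: liftQ. Qed.
Lemma pi_stoQ m w : Q (pi_sto m w). Proof. exact: liftQ. Qed.
Lemma prsQ m w : Q (prs m w). Proof. exact: liftQ. Qed.

Lemma pi_det0 w : pi_det 0 w = fun=> 0.
Proof.
apply/funext => x; rewrite /pi_det /lift /lift_pressure big1// => j _.
by rewrite /det_coef big_geq// mul0r.
Qed.

Lemma pi_sto0 w : pi_sto 0 w = fun=> 0.
Proof.
apply/funext => x; rewrite /pi_sto /lift /lift_pressure big1// => j _.
by rewrite /sto_coef big_geq// oppr0 mul0r.
Qed.

Lemma prs_split m w x : prs m w x = pi_det m w x + pi_sto m w x.
Proof.
rewrite /prs /pi_det /pi_sto /lift /lift_pressure -big_split /=.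
by apply: eq_bigr => j _; rewrite mulrDl.
Qed.

Lemma prs0_pair w j : pair_div O (prs 0 w) (e j) = 0.
Proof. by rewrite lift_e /det_coef /sto_coef !big_geq// oppr0 addr0. Qed.

Lemma prs_increment m w xi : (1 <= m <= N)%N -> Vperp O V Q xi ->
  pair_div O (prs m w \- prs m.-1 w) xi
  = ip O (u m w - u m.-1 w) xi + tau * ip O (shear p \o sym_grad O (u m w)) (grad O xi)
    - ip O (nz m w) xi.
Proof.
case: m => // m /= mN Pxi.
rewrite liftB (perp_pair (liftQ _) Pxi) (perp_noise m.+1 w Pxi) -/(visc O p (u m.+1 w) xi).
(* Velocity increments lie in [Vdiv] and vanish against [xi]. *)
rewrite (perp_visc w mN Pxi) (div_perp0 _ Pxi) ?add0r; last first.
  rewrite (_ : u m.+1 w - u m w = -1 *: u m w + u m.+1 w); last by rewrite scaleN1r addrC.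
  exact: (Vdiv_lin oO Ofin hV hQ (-1) (uV w (ltnW mN)) (uV w mN)).
rewrite mulr_sumr -sumrB; apply: eq_bigr => j _; rewrite lift_e /det_coef /sto_coef.
rewrite !(big_nat_recr m.+1)//=; ring.
Qed.

Section initial.
Variable pi_init : Omega -> E -> R.
Hypothesis hinit : initial_pressure P O V Q (u 0%N) pi_init.

Lemma initial_pressure_null : {ae P, forall w j, pair_div O (pi_init w) (e j) = 0}.
Proof.
have [_ H] := hinit.
have : {ae P, forall w, forall j : 'I_s, pair_div O (pi_init w) (e j) = ip O (u 0%N w) (e j)}.
  exact: (@filter_forall _ _ (fun j w => _ = _) _ _ (fun j => H _ (Pe j))).
by apply: filterS => w Hw j; rewrite Hw (div_perp0 (uV w (leq0n N)) (Pe j)).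
Qed.

Lemma prs0_init : {ae P, forall w, qsim O V Q (prs 0 w) (pi_init w)}.
Proof.
apply: filterS initial_pressure_null => w Hw.
apply: (qsim_perp oO Ofin hV hQ Pe espan (prsQ 0 w) (hinit.1 w)) => j.
by rewrite Hw prs0_pair.
Qed.

Let pair_divB p0 p0' j : Q p0 -> Q p0' ->
  pair_div O (p0 \- p0') (e j) = pair_div O p0 (e j) - pair_div O p0' (e j).
Proof.
move=> Q0 Q0'; rewrite (_ : p0 \- p0' = (fun x => -1 * p0' x + p0 x)); last first.
  by apply/funext => x; rewrite mulN1r addrC.
rewrite (pair_div_lin oO Ofin _ (pressure_bounded hQ Q0') (pressure_bounded hQ Q0) (Wperp (Pe j))).
by rewrite mulN1r addrC.
Qed.

Lemma prs_decomposition m : {ae P, forall w, qsim O V Q (prs m w)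
  (fun x => pi_init w x + pi_det m w x + pi_sto m w x)}.
Proof.
apply: filterS initial_pressure_null => w Hw xi Pxi.
rewrite (_ : prs m w \- _ = (fun x => -1 * pi_init w x + 0)); last first.
  by apply/funext => x; rewrite /= prs_split; ring.
have Q0 := pressure0 hQ; have Qi := hinit.1 w.
rewrite (pair_div_lin oO Ofin _ (pressure_bounded hQ Qi) (pressure_bounded hQ Q0) (Wperp Pxi)).
rewrite (perp_pair Qi Pxi) (perp_pair Q0 Pxi) !big1 ?mulr0 ?addr0// => j _; last by rewrite Hw mulr0.
rewrite (_ : (fun=> 0) = lift (fun=> 0)) ?lift_e ?mulr0//.
by apply/funext => x; rewrite /lift /lift_pressure big1// => i _; rewrite mul0r.
Qed.

Lemma prs_equation : pressure_equation P inner B T F O W p V Q N G u pi_init prs.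
Proof.
have tauE : T / N.+1%:R = tau by rewrite -tauN mulrC mulKf// pnatr_eq0.
split; [by move=> m w _; exact: prsQ | exact: prs0_init |].
move=> m xi mN Pxi; apply: aeW => w.
by rewrite (prs_increment w mN Pxi) /nz tauE.
Qed.

(** By induction on [m], the increments determine the pairings with the [e j]. The equation has one
    null set per test field; as there are finitely many [e j], these null sets can be merged. *)
Lemma prs_unique prs' : pressure_equation P inner B T F O W p V Q N G u pi_init prs' ->
  forall m, (m <= N)%N -> {ae P, forall w, qsim O V Q (prs' m w) (prs m w)}.
Proof.
have tauE : T / N.+1%:R = tau by rewrite -tauN mulrC mulKf// pnatr_eq0.
move=> [Q' H0 H] m mN.
suff : {ae P, forall w j, pair_div O (prs' m w) (e j) = pair_div O (prs m w) (e j)}.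
  apply: filterS => w Hw.
  exact: (qsim_perp oO Ofin hV hQ Pe espan (Q' m w mN) (prsQ m w) Hw).
elim: m mN => [_|m IH mN].
  apply: filterS2 initial_pressure_null H0 => w Hw sim j.
  have := sim _ (Pe j); rewrite pair_divB ?Hw; [|exact: Q'|exact: hinit.1].
  by rewrite subr0 prs0_pair.
have mN' : (1 <= m.+1 <= N)%N by rewrite mN.
have step : {ae P, forall w, forall j : 'I_s, pair_div O (prs' m.+1 w \- prs' m w) (e j)
    = pair_div O (prs m.+1 w \- prs m w) (e j)}.
  apply: (@filter_forall _ _ (fun j w => _ = _) _ _) => j.
  apply: filterS (H m.+1 (e j) mN' (Pe j)) => w /=.
  by rewrite tauE => ->; rewrite (prs_increment w mN' (Pe j)).
apply: filterS2 (IH (ltnW mN)) step => w Hw st j; have := st j.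
rewrite !pair_divB; [|exact: prsQ|exact: prsQ|exact: Q'|exact: (Q' _ _ (ltnW mN))].
by rewrite Hw => /addIr.
Qed.

End initial.

Lemma pi_det_pair m w xi : (m <= N)%N -> Vperp O V Q xi ->
  pair_div O (pi_det m w) xi =
  ip O (fun x => \sum_(1 <= l < m.+1) tau *: shear p (sym_grad O (u l w) x)) (grad O xi).
Proof.
move=> mN Pxi; rewrite (perp_pair (pi_detQ m w) Pxi).
have lN (l : 'I_m) : (l.+1 <= N)%N by exact: leq_trans (ltn_ord l) mN.
rewrite (_ : (fun x => _) = \sum_(l < m) tau *: (shear p \o sym_grad O (u l.+1 w))); last first.
  by apply/funext => x; rewrite fct_sumE big_add1 /= big_mkord.
have gsi := @L2_semi_inner R n O mO n.+1 n.+1.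
rewrite (form_suml gsi _ _ (fun l : 'I_m => shear_sym_L2 oO Ofin p1 (Wdiv (uV w (lN l))))
  (grad_L2 oO Ofin (Wperp Pxi))).
rewrite (eq_bigr (fun l : 'I_m => \sum_j ip O xi (e j) * (tau * vis l.+1 j w))); last first.
  move=> l _; rewrite -/(visc O p (u l.+1 w) xi) (perp_visc w (lN l) Pxi) mulr_sumr.
  by apply: eq_bigr => j _; ring.
rewrite exchange_big /=; apply: eq_bigr => j _.
by rewrite lift_e /det_coef big_add1 /= big_mkord mulr_sumr.
Qed.

Lemma pi_sto_pair m w xi : Vperp O V Q xi ->
  pair_div O (pi_sto m w) xi = - ip O (fun x => \sum_(1 <= l < m.+1) nz l w x) xi.
Proof.
move=> Pxi; rewrite (perp_pair (pi_stoQ m w) Pxi).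
rewrite (_ : (fun x => _) = \sum_(1 <= l < m.+1) 1 *: nz l w); last first.
  by apply/funext => x; rewrite fct_sumE; apply: eq_bigr => l _; rewrite scale1r.
rewrite (form_suml vsi _ _ (fun l => nz_L2 l w) (Lperp Pxi)).
rewrite (eq_bigr (fun l => \sum_j ip O xi (e j) * Z l j w)); last first.
  by move=> l _; rewrite mul1r (perp_noise l w Pxi).
rewrite exchange_big -sumrN /=; apply: eq_bigr => j _.
by rewrite lift_e /sto_coef mulrN mulr_sumr.
Qed.

Let disc_homo k l : (k <= l)%N -> (l <= N)%N -> disc_filtration F tau k `<=` disc_filtration F tau l.
Proof.
move=> kl lN; rewrite !disc_filtrationE; apply: (filtration_homo hF (disc_time_ge0 tau0 k)).
- exact: (disc_time_homo tau0 kl).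
- exact: (disc_time_leT tau0 tauN lN).
Qed.

Let sub_disc k : (k <= N)%N -> sub_sigma (disc_filtration F tau k).
Proof.
by move=> kN; rewrite disc_filtrationE; apply: (filtration_sub hF); exact: (disc_time_itv tau0 tauN kN).
Qed.

Let m2_le m : (1 <= m <= N)%N -> (m - 2 <= N)%N.
Proof. by case/andP=> _; exact: leq_trans (leq_subr 2 m). Qed.

Let Z_sqi l j : sqi P (Z l j).
Proof. exact: (noise_coord_sqi inner B hF hW mO tau G u l Le oe j). Qed.

Let Z_Gmeas l j : (1 <= l <= N)%N -> Gmeas (disc_filtration F tau l) (Z l j).
Proof.
by move=> lN; exact: (noise_coord_Gmeas hT hF hU hB hW mO tau0 tauN hG lN (good (m2_le lN)) Le oe j).
Qed.

Let Z_orth l j Y : (1 <= l <= N)%N -> sqi P Y -> Gmeas (disc_filtration F tau (l - 2)) Y ->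
  EE P Y (Z l j) = 0.
Proof.
move=> lN sY mY; have l0 : (0 < l)%N by case/andP: lN.
apply: (noise_coord_orth hT hF hU hB hW mO tau0 tauN hG lN (good (m2_le lN)) Le oe j sY).
have st := disc_time_start tau0 l0; have t0 := disc_time_ge0 tau0 (l - 2).
have wT : weight_start tau l <= T.
  apply: le_trans (weight_start_end tau0 l) _; rewrite disc_time_end//.
  by apply: (disc_time_leT tau0 tauN); case/andP: lN.
move: mY; rewrite disc_filtrationE => mY.
apply: (Gmeas_sub (filtration_sub hF _) (filtration_sub hF _) (filtration_homo hF t0 st wT) mY).
- by rewrite t0 (le_trans st).
- by rewrite (le_trans t0 st).
Qed.

Variables (r : nat) (f : 'I_r -> E -> E).
Hypotheses (Vf : forall i, Vdiv O V Q (f i))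
  (fspan : forall v, Vdiv O V Q v -> ae_on O (fun x => v x = \sum_i ip O v (f i) *: f i x)).

Let vis_Gmeas l j : (l <= N)%N -> Gmeas (disc_filtration F tau l) (vis l j).
Proof.
move=> lN; have [ru _] := good lN.
rewrite (_ : vis l j = fun w => ip O (shear p \o strain_comb O f (fun i => ip O (u l w) (f i))) (grad O (e j))).
  apply: (@seq_continuous_Gmeas R d Omega _ r
    (fun z => ip O (shear p \o strain_comb O f z) (grad O (e j))) (fun w i => ip O (u l w) (f i)) (sub_disc lN)).
    move=> z_ z M cv bd.
    exact: (cvg_visc_comb oO Ofin p1 (Wperp (Pe j)) (fun i => Wdiv (Vf i)) cv bd).
  by move=> i; exact: (random_elt_ip mO (sub_disc lN) ru (Ldiv (Vf i))).
apply/funext => w; have Du := uV w lN.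
exact: (visc_strain_comb oO Ofin p1 (Wdiv Du) (Wperp (Pe j)) (fun i => Wdiv (Vf i)) (fspan Du)).
Qed.

Lemma prs_random_elt m : (m <= N)%N ->
  random_elt (disc_filtration F tau m) Q (Qsto O V Q) (prs m).
Proof.
move=> mN; have lift0 (y : 'I_s -> R) : Qsto O V Q (lift y - lift y) = 0.
  have -> : lift y - lift y = lift (fun j => y j - y j) by rewrite -liftB.
  rewrite (QstoE oO Ofin hV hQ Pe oe espan (liftQ _)) big1 ?sqrtr0// => j _.
  by rewrite lift_e subrr expr0n.
apply: (@random_elt_coords _ _ _ _ _ _ _ (prs m) s lift
  (fun w j => det_coef m w j + sto_coef m w j) (sub_disc mN)).
- by move=> w; exact: prsQ.
- exact: liftQ.
- move=> z z'; have -> : lift z' - lift z = lift (fun j => z' j - z j) by rewrite -liftB.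
  exact: (Qsto_ge0 oO Ofin hV hQ Pe oe espan (liftQ _)).
- move=> z z'; have -> : lift z' - lift z = lift (fun j => z' j - z j) by rewrite -liftB.
  rewrite (sqr_Qsto oO Ofin hV hQ Pe oe espan (liftQ _)).
  by apply: eq_bigr => j _; rewrite lift_e.
- by move=> w; exact: lift0.
- by move=> w; exact: lift0.
move=> j; have lN (l : 'I_m) : (1 <= l.+1 <= N)%N by rewrite /= (leq_trans (ltn_ord l)).
rewrite (_ : (fun w => _) = fun w =>
  (\sum_(l < m) tau * vis l.+1 j w) - \sum_(l < m) (Z l.+1 j w : R)); last first.
  by apply/funext => w; rewrite /det_coef /sto_coef !big_add1 /= !big_mkord.
apply: measurable_funB; apply: measurable_sum => l.
  apply: measurable_funM; first exact: measurable_cst.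
  apply: (Gmeas_sub (sub_disc _) (sub_disc mN) (disc_homo (ltn_ord l) mN) (vis_Gmeas j _));
    by case/andP: (lN l).
apply: (Gmeas_sub (sub_disc _) (sub_disc mN) (disc_homo (ltn_ord l) mN) (Z_Gmeas j (lN l))).
by case/andP: (lN l).
Qed.

Variables (KE KD : R) (dis : nat -> R).
Hypotheses (hE : forall m, (m <= N)%N -> exists U2,
    [/\ 0 <= U2, (second_moment P O (u m) <= U2%:E)%E & 1 + U2 <= KE])
  (hdis : forall m, (1 <= m <= N)%N -> exists H : Omega -> R,
    [/\ P.-integrable [set: Omega] (EFin \o H), \int[P]_w H w = dis m &
        {ae P, forall w, tau * visc O p (u m w) (u m w) = H w}])
  (hKD : \sum_(1 <= m < N.+1) dis m <= KD).

Let zb := 32 * gauss_var R * C * tau * KE.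

Let Z_sum l : (1 <= l <= N)%N -> \sum_j EE P (Z l j) (Z l j) <= zb.
Proof.
move=> lN; have [U2 [U20 hU2 leK]] := hE (m2_le lN).
apply: (le_trans (noise_coord_sum hT hF hU hB hW mO tau0 tauN C0 hG lN (good (m2_le lN)) hU2 U20 Le oe)).
apply: ler_wpM2l; last exact: leK.
by rewrite !mulr_ge0 ?gauss_var_ge0 ?ltW.
Qed.

Let KE0 : 0 <= KE.
Proof. by have [U2 [U20 _]] := hE (leq0n N); apply: le_trans; rewrite addr_ge0. Qed.

(** The filtration is frozen from level [N] on, since the martingale lemmas work with filtrations
    indexed by all natural numbers. *)
Let H k := disc_filtration F tau (minn k N).

Let sH k : sub_sigma (H k). Proof. by apply: sub_disc; exact: geq_minr. Qed.
Let homoH k : H k `<=` H k.+1.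
Proof. by apply: disc_homo; rewrite ?geq_minr// leq_min geq_minr andbT (leq_trans (geq_minl _ _)). Qed.
Let sx j l : (l < N)%N -> sqi P (Z l.+1 j). Proof. by move=> _; exact: Z_sqi. Qed.
Let mx j l : (l < N)%N -> Gmeas (H l.+1) (Z l.+1 j).
Proof. by move=> lN; rewrite /H (minn_idPl lN); exact: Z_Gmeas. Qed.
Let ox j l Y : (l < N)%N -> sqi P Y -> Gmeas (H l.-1) Y -> EE P Y (Z l.+1 j) = 0.
Proof.
move=> lN sY; rewrite /H (minn_idPl (leq_trans (leq_pred l) (ltnW lN))) => mY.
by apply: Z_orth => //; rewrite subSS subn1.
Qed.

Let pi_sto_sqr m w : Qsto O V Q (pi_sto m w) ^+ 2 = \sum_j (\sum_(1 <= l < m.+1) (Z l j w : R)) ^+ 2.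
Proof.
rewrite (sqr_Qsto oO Ofin hV hQ Pe oe espan (pi_stoQ m w)).
by apply: eq_bigr => j _; rewrite lift_e sqrrN.
Qed.

Let sum_Z_le : \sum_j \sum_(l < N) EE P (Z l.+1 j) (Z l.+1 j) <= N%:R * zb.
Proof.
rewrite exchange_big /=; apply: (@le_trans _ _ (\sum_(l < N) zb)).
  by apply: ler_sum => l _; apply: Z_sum; rewrite /=.
by rewrite sumr_const card_ord mulr_natl.
Qed.

(** The norm is Euclidean in the pairings, so its squared maximum is at most the sum of the squares
    of the maximal functions [S j]. The constant comes from [256 = 8 * 32] and [N * tau <= T]. *)
Lemma sto_max_bound :
  (\int[P]_w (\big[Num.max/0%R]_(1 <= m < N.+1) Qsto O V Q (pi_sto m w) ^+ 2)%:E
   <= (256 * gauss_var R * C * T * KE)%:E)%E.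
Proof.
have maxP j : exists S : Omega -> R^o,
  [/\ sqi P S, EE P S S <= 8 * \sum_(l < N) EE P (Z l.+1 j) (Z l.+1 j) &
      forall w k, (k <= N)%N -> `|\sum_(l < k) (Z l.+1 j w : R)| <= S w].
  have [S [sS le HS]] := @two_dependent_max _ _ _ P H N (fun l => Z l j) sH homoH (sx j) (mx j) (ox j) xpredT.
  by exists S; split.
have [S HS] := choice maxP.
have sS j : sqi P (S j) by case: (HS j).
have [J JE] := Rintegral_finsum (index_enum 'I_s) measurableT (fun j => sqi_integrable (sS j) (sS j)).
apply: (@le_trans _ _ (\int[P]_w (\sum_j (S j w : R) * S j w))%:E).
  apply: (ae_integral_le_Rintegral J) => [w|].
    elim/big_ind: _ => // [x y x0 y0|m _]; first by rewrite le_max x0.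
    exact: sqr_ge0.
  apply: aeW => w; rewrite big_nat_cond; apply: bigmax_le.
    by apply: sumr_ge0 => j _; rewrite -expr2 sqr_ge0.
  move=> m; rewrite andbT => /andP[m1 mN]; rewrite pi_sto_sqr; apply: ler_sum => j _.
  have [_ _ H'] := HS j; have := H' w m mN; rewrite big_add1 /= big_mkord => h.
  have S0 : 0 <= (S j w : R) by exact: le_trans h.
  by rewrite -expr2 -(@real_normK _ (\sum_(l < m) _)) ?num_real// ler_pXn2r ?nnegrE.
rewrite lee_fin JE; apply: (@le_trans _ _ (\sum_j 8 * \sum_(l < N) EE P (Z l.+1 j) (Z l.+1 j))).
  by apply: ler_sum => j _; case: (HS j).
rewrite -mulr_sumr; apply: (@le_trans _ _ (8 * (N%:R * zb))); first by rewrite ler_wpM2l// sum_Z_le.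
have NT : N%:R * tau <= T by rewrite -tauN ler_wpM2r ?(ltW tau0)// ler_nat.
rewrite (_ : 8 * (N%:R * zb) = 256 * gauss_var R * C * (N%:R * tau) * KE); last by rewrite /zb; ring.
apply: ler_wpM2r; first exact: KE0.
apply: ler_wpM2l; last exact: NT.
by rewrite !mulr_ge0 ?gauss_var_ge0 ?ltW.
Qed.

(** The window has [k] indices, each costing [zb]; [two_dependent_sqr] doubles this, hence 64. *)
Lemma sto_increment_bound k m : (1 <= k)%N -> (k <= m)%N -> (m <= N)%N ->
  (\int[P]_w (Qsto O V Q (pi_sto m w \- pi_sto (m - k)%N w) ^+ 2)%:E
   <= (64 * gauss_var R * C * KE * (tau * k%:R))%:E)%E.
Proof.
move=> k1 km mN; have mkN : (m - k <= N)%N by exact: leq_trans (leq_subr k m) mN.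
pose mask := [pred l : nat | (m - k <= l < m)%N].
(* Applied to the values of the noise, and to the constant [zb] to count the indices of the
   window. *)
have split_mask (V' : zmodType) (a : nat -> V') :
    \sum_(l < N | (l < m)%N) a l.+1 - \sum_(l < N | (l < m - k)%N) a l.+1
    = \sum_(l < N | mask l) a l.+1.
  rewrite (bigID (fun l : 'I_N => (l < m - k)%N)) /=.
  rewrite (_ : \sum_(i < N | (i < m)%N && (i < m - k)%N) _ = \sum_(l < N | (l < m - k)%N) a l.+1).
    rewrite addrAC subrr add0r; apply: eq_bigl => l; rewrite /mask /= -leqNgt andbC//.
  apply: eq_bigl => l; rewrite andbC; case: ltnP => //= lmk.
  by rewrite (leq_trans lmk)// leq_subr.
pose D j : Omega -> R^o := \sum_(l < N | mask l) Z l.+1 j.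
have sD j : sqi P (D j).
  by rewrite /D big_mkcond; apply: (subsp_sum IP) => l; case: ifP => _; [exact: Z_sqi | exact: (si_0 IP)].
have [J JE] := Rintegral_finsum (index_enum 'I_s) measurableT (fun j => sqi_integrable (sD j) (sD j)).
apply: (@le_trans _ _ (\int[P]_w (\sum_j (D j w : R) * D j w))%:E).
  apply: (ae_integral_le_Rintegral J) => [w|]; first exact: sqr_ge0.
  apply: aeW => w; rewrite liftB (sqr_Qsto oO Ofin hV hQ Pe oe espan (liftQ _)).
  apply: ler_sum => j _; rewrite lift_e /sto_coef.
  rewrite (sum_nat_mask (fun l => Z l j w : R) mN) (sum_nat_mask (fun l => Z l j w : R) mkN).
  rewrite opprK addrC -opprB sqrrN (split_mask R (fun l => Z l j w)) expr2.
  by rewrite /D fct_sumE.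
rewrite lee_fin JE.
apply: (@le_trans _ _ (\sum_j 2 * \sum_(l < N | mask l) EE P (Z l.+1 j) (Z l.+1 j))).
  apply: ler_sum => j _.
  exact: (@two_dependent_sqr _ _ _ P H N (fun l => Z l j) sH homoH (sx j) (mx j) (ox j) mask).
rewrite -mulr_sumr exchange_big /=.
apply: (@le_trans _ _ (2 * \sum_(l < N | mask l) zb)).
  by rewrite ler_wpM2l//; apply: ler_sum => l _; apply: Z_sum; rewrite /=.
rewrite -(split_mask R (fun=> zb)) -(sum_nat_mask (fun=> zb) mN) -(sum_nat_mask (fun=> zb) mkN).
rewrite !sumr_const_nat !subn1 /= -mulrnBr ?leq_subr// subKn//.
by rewrite -mulr_natr /zb le_eqVlt; apply/orP; left; apply/eqP; ring.
Qed.

Let det_quotient m w : (1 <= m <= N)%N ->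
  (fun x => (pi_det m w x - pi_det m.-1 w x) / tau) = lift (fun j => vis m j w).
Proof.
case: m => // m mN; apply/funext => x; rewrite -[_ - _]/((pi_det m.+1 w \- pi_det m w) x) liftB.
rewrite /lift /lift_pressure mulr_suml; apply: eq_bigr => j _.
by rewrite /det_coef (big_nat_recr m.+1)//= [_ + _ - _]addrAC subrr add0r; field; rewrite gt_eqF.
Qed.

(** The exponents [(p - 1) / p] from Hoelder and [p / (p - 1)] cancel, so the power is bounded by
    the viscous energy with constant 1. *)
Let det_norm_le m w : (1 <= m <= N)%N ->
  0 <= Qdet O V Q p (fun x => (pi_det m w x - pi_det m.-1 w x) / tau) `^ (p / (p - 1))
    <= visc O p (u m w) (u m w).
Proof.
move=> mN; rewrite powR_ge0 /= (det_quotient w mN); have mleN : (m <= N)%N by case/andP: mN.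
set v2 := visc O p (u m w) (u m w).
have v20 : 0 <= v2 by exact: visc_self_ge0.
have pp0 : 0 < p by exact: lt_trans p1.
have pm0 : 0 < p - 1 by rewrite subr_gt0.
have K0 : 0 <= v2 `^ ((p - 1) / p) by exact: powR_ge0.
have H' v : Vperp O V Q v -> `|pair_div O (lift (fun j => vis m j w)) v| <=
    v2 `^ ((p - 1) / p) * Lq_norm O p (grad O v).
  move=> Pv; rewrite (perp_pair (liftQ _) Pv).
  rewrite (eq_bigr (fun j => ip O v (e j) * vis m j w)) => [|j _]; last by rewrite lift_e.
  by rewrite -(perp_visc w mleN Pv); exact: (visc_le oO Ofin p1 (Wdiv (uV w mleN)) (Wperp Pv)).
have /andP[q0 qK] := Qdet_bounds oO Ofin hV hQ p1 (liftQ _) K0 H'.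
apply: (@le_trans _ _ ((v2 `^ ((p - 1) / p)) `^ (p / (p - 1)))).
  by apply: ge0_ler_powR; rewrite ?nnegrE// divr_ge0 ?ltW.
rewrite -powRrM (_ : (p - 1) / p * (p / (p - 1)) = 1) ?powRr1//.
by field; rewrite !gt_eqF.
Qed.

Lemma det_bound :
  (\int[P]_w (\sum_(1 <= m < N.+1) tau *
     Qdet O V Q p (fun x => (pi_det m w x - pi_det m.-1 w x) / tau) `^ (p / (p - 1)))%:E
   <= KD%:E)%E.
Proof.
have mN (m : 'I_N) : (1 <= m.+1 <= N)%N by rewrite /=.
have [Hm HHm] := choice (fun m : 'I_N => hdis (mN m)).
have [J JE] := Rintegral_finsum (index_enum 'I_N) measurableT
  (fun m => let: And3 h _ _ := HHm m in h).
apply: (@le_trans _ _ (\int[P]_w (\sum_m Hm m w))%:E); last first.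
  rewrite lee_fin JE; apply: le_trans hKD; rewrite big_add1 /= big_mkord.
  by apply: ler_sum => m _; case: (HHm m) => _ ->.
apply: (ae_integral_le_Rintegral J) => [w|].
  rewrite big_add1 /= big_mkord; apply: sumr_ge0 => m _; apply: mulr_ge0; first exact: ltW.
  by have /andP[] := det_norm_le w (mN m).
have : {ae P, forall w, forall m : 'I_N, tau * visc O p (u m.+1 w) (u m.+1 w) = Hm m w}.
  by apply: (@filter_forall _ _ (fun m w => _ = _) _ _) => m; case: (HHm m).
apply: filterS => w Hw; rewrite big_add1 /= big_mkord; apply: ler_sum => m _; rewrite -Hw.
by apply: ler_wpM2l; [exact: ltW | have /andP[] := det_norm_le w (mN m)].
Qed.

(** Division by [tau * k] cancels the length of the window, so each summand is at most
    [tau * K2 ^ (rr / 2)]. There are at most [N + 1] of them and [(N + 1) * tau = T]; the outer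
    power turns the rest back into [K2]. *)
Lemma sto_fractional_bound (rr : R) : 2 <= rr ->
  ((\big[maxe/0]_(1 <= k < N.+1) \sum_(k <= m < N.+1)
      tau%:E * ((\int[P]_w (Qsto O V Q (pi_sto m w \- pi_sto (m - k)%N w) ^+ 2)%:E)
               * (tau * k%:R)^-1%:E) `^ (rr / 2)) `^ (2 / rr)
   <= (T `^ (2 / rr) * (64 * gauss_var R * C * KE))%:E)%E.
Proof.
move=> r2; set K2 := 64 * gauss_var R * C * KE.
have rr0 : 0 < rr by exact: lt_le_trans r2.
have K20 : 0 <= K2 by apply: mulr_ge0; [rewrite !mulr_ge0 ?gauss_var_ge0 ?ltW | exact: KE0].
have I0 m k : (0 <= \int[P]_w (Qsto O V Q (pi_sto m w \- pi_sto (m - k)%N w) ^+ 2)%:E)%E.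
  by apply: integral_ge0 => w _; rewrite lee_fin sqr_ge0.
have term k m : (1 <= k)%N -> (k <= m)%N -> (m <= N)%N ->
  (tau%:E * ((\int[P]_w (Qsto O V Q (pi_sto m w \- pi_sto (m - k)%N w) ^+ 2)%:E)
               * (tau * k%:R)^-1%:E) `^ (rr / 2) <= (tau * K2 `^ (rr / 2))%:E)%E.
  move=> k1 km mN; rewrite EFinM; apply: lee_wpmul2l; first by rewrite lee_fin ltW.
  have tk0 : 0 < tau * k%:R by rewrite mulr_gt0// ltr0n.
  rewrite -poweR_EFin; apply: gt0_ler_poweR; rewrite ?divr_ge0 ?(ltW rr0)//.
  - by rewrite in_itv /= leey andbT mule_ge0// lee_fin invr_ge0 ltW.
  - by rewrite in_itv /= leey andbT lee_fin.
  apply: (@le_trans _ _ ((K2 * (tau * k%:R))%:E * (tau * k%:R)^-1%:E)%E).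
    by apply: lee_wpmul2r; [rewrite lee_fin invr_ge0 ltW | exact: sto_increment_bound].
  by rewrite -EFinM lee_fin mulfK// gt_eqF.
have max0 : (0 <= \big[maxe/0]_(1 <= k < N.+1) \sum_(k <= m < N.+1)
      tau%:E * ((\int[P]_w (Qsto O V Q (pi_sto m w \- pi_sto (m - k)%N w) ^+ 2)%:E)
               * (tau * k%:R)^-1%:E) `^ (rr / 2))%E.
  by elim/big_ind: _ => // [x y x0 y0|k _]; rewrite ?le_max ?x0//; apply: sume_ge0 => m _;
    rewrite mule_ge0 ?poweR_ge0// lee_fin ltW.
have le : (\big[maxe/0]_(1 <= k < N.+1) \sum_(k <= m < N.+1)
      tau%:E * ((\int[P]_w (Qsto O V Q (pi_sto m w \- pi_sto (m - k)%N w) ^+ 2)%:E)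
               * (tau * k%:R)^-1%:E) `^ (rr / 2) <= (T * K2 `^ (rr / 2))%:E)%E.
  rewrite big_nat_cond; apply: bigmax_le; first by rewrite lee_fin mulr_ge0 ?powR_ge0 ?ltW.
  move=> k; rewrite andbT => /andP[k1 kN].
  apply: (@le_trans _ _ (\sum_(k <= m < N.+1) (tau * K2 `^ (rr / 2))%:E)%E).
    rewrite big_nat_cond [leRHS]big_nat_cond; apply: lee_sum => m; rewrite andbT => /andP[km mN].
    exact: term.
  rewrite sumEFin lee_fin sumr_const_nat -mulrnAl; apply: ler_wpM2r; first exact: powR_ge0.
  by rewrite -tauN -mulr_natl; apply: ler_wpM2r; [exact: ltW | rewrite ler_nat leq_subr].
apply: (@le_trans _ _ ((T * K2 `^ (rr / 2))%:E `^ (2 / rr))%E).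
  apply: gt0_ler_poweR; rewrite ?divr_ge0 ?(ltW rr0)// in_itv /= leey andbT//.
  by rewrite lee_fin mulr_ge0 ?powR_ge0 ?ltW.
rewrite poweR_EFin lee_fin powRM ?powR_ge0 ?(ltW hT)// -powRrM.
by rewrite (_ : rr / 2 * (2 / rr) = 1) ?powRr1//; field; rewrite gt_eqF.
Qed.

End pressure.

(** * Assembly with constants independent of the discretization *)

Theorem theorem4
  (R : realType) (n : nat) (O : set 'rV[R]_n.+1) (T p : R)
  (d : measure_display) (Omega : measurableType d) (P : probability Omega R)
  (F : R -> set (set Omega))
  (U : completeNormedModType R) (inner : {dot U for idfun}) (B : set U)
  (W : R -> U -> Omega -> R)
  (V : R -> set ('rV[R]_n.+1 -> 'rV[R]_n.+1)) (Q : R -> set ('rV[R]_n.+1 -> R))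
  (G : nat -> nat -> Omega -> ('rV[R]_n.+1 -> 'rV[R]_n.+1) ->
       U -> 'rV[R]_n.+1 -> 'rV[R]_n.+1)
  (C : R)
  (hO : lipschitz_domain O) (hT : 0 < T) (hp : 1 < p)
  (hF : stochastic_basis P T F)
  (hU : inner_product_norm inner) (hUsep : separable U)
  (hB : orthonormal_basis inner B)
  (hW : cylindrical_wiener P T F W)
  (hV : forall h, 0 < h <= 1 -> velocity_space O (V h))
  (hQ : forall h, 0 < h <= 1 -> pressure_space O (Q h))
  (hC : 0 < C)
  (hG : forall N, (0 < N)%N -> data_stability P B O F (T / N.+1%:R) N C (G N)) :
  exists (c : R) (cr : R -> R),
  forall (h : R) (N : nat) (u0 : Omega -> 'rV[R]_n.+1 -> 'rV[R]_n.+1)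
    (u : nat -> Omega -> 'rV[R]_n.+1 -> 'rV[R]_n.+1)
    (pi_init : Omega -> 'rV[R]_n.+1 -> R),
  let tau := T / N.+1%:R in
  let sim := qsim O (V h) (Q h) in
  let nsto := Qsto O (V h) (Q h) in
  let ndet := Qdet O (V h) (Q h) p in
  0 < h <= 1 -> (0 < N)%N ->
  L2_random P O (F 0) u0 -> (forall w, Vdiv O (V h) (Q h) (u0 w)) ->
  velocity_scheme P inner B T F O W p (V h) (Q h) N (G N) u0 u ->
  initial_pressure P O (V h) (Q h) u0 pi_init ->
  exists prs : nat -> Omega -> 'rV[R]_n.+1 -> R,
  [/\ (* existence and uniqueness *)
      pressure_equation P inner B T F O W p (V h) (Q h) N (G N) u pi_init prs /\
      (forall prs', pressure_equation P inner B T F O W p (V h) (Q h) N (G N) u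
                     pi_init prs' ->
         forall m, (m <= N)%N -> {ae P, forall w, sim (prs' m w) (prs m w)}),
      (* measurability *)
      forall m, (m <= N)%N ->
        random_elt (disc_filtration F tau m) (Q h) nsto (prs m) &
      exists pi_det pi_sto : nat -> Omega -> 'rV[R]_n.+1 -> R,
      [/\ (* decomposition *)
          [/\ forall m w, (1 <= m <= N)%N -> Q h (pi_det m w) /\ Q h (pi_sto m w),
              {ae P, forall w, sim (prs 0%N w) (pi_init w)} &
              forall m, (1 <= m <= N)%N ->
                {ae P, forall w,
                  sim (prs m w) (fun x => pi_init w x + pi_det m w x + pi_sto m w x)}],
          (* explicit formula *)
          forall m xi, (1 <= m <= N)%N -> Vperp O (V h) (Q h) xi ->
            {ae P, forall w,
              pair_div O (pi_det m w) xi =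
                ip O (fun x => \sum_(1 <= l < m.+1)
                        tau *: shear p (sym_grad O (u l w) x)) (grad O xi) /\
              pair_div O (pi_sto m w) xi =
                - ip O (fun x => \sum_(1 <= l < m.+1)
                          noise P inner B T F O W tau (G N) u l w x) xi},
          (* convention for the index 0 *)
          (forall w, pi_det 0%N w = (fun=> 0)) /\ (forall w, pi_sto 0%N w = (fun=> 0)),
          (* stability *)
          (\int[P]_w (\sum_(1 <= m < N.+1)
              tau * ndet (fun x => (pi_det m w x - pi_det m.-1 w x) / tau)
                      `^ (p / (p - 1)))%:E
           + \int[P]_w (\big[Num.max/0%R]_(1 <= m < N.+1)
              nsto (pi_sto m w) ^+ 2)%:E
           <= c%:E * (second_moment P O u0 + 1))%E &
          forall r, 2 <= r ->
          ((\big[maxe/0]_(1 <= k < N.+1) \sum_(k <= m < N.+1)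
              tau%:E *
              ((\int[P]_w (nsto (pi_sto m w \- pi_sto (m - k)%N w) ^+ 2)%:E)
               * (tau * k%:R)^-1%:E) `^ (r / 2)) `^ (2 / r)
           <= (cr r)%:E * (second_moment P O u0 + 1))%E]].
Proof.
have [_ oO _ /leb_bounded_lty Ofin _] := hO.
(* [K1] is the Gronwall factor. The [1/2] below stems from the doubled dissipation in
   [energy_bound], the 256 and 64 from the two stochastic bounds. Dimensions of the discrete spaces
   do not enter, since Bessel's inequality bounds all coordinates together. *)
pose K1 := expR (192 * gauss_var R * C * T).
exists ((2^-1 + 256 * gauss_var R * C * T) * K1).
exists (fun r => T `^ (2 / r) * (64 * gauss_var R * C * K1)).
move=> h N u0 u pi_init tau sim nsto ndet h01 N0 hu0 u0V [u00 uV hsch] hinit.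
have hVh := hV h h01; have hQh := hQ h h01; have hGN := hG N N0.
have tau0 : 0 < tau by rewrite divr_gt0 ?ltr0n.
have tauN : N.+1%:R * tau = T by rewrite /tau mulrC divfK// pnatr_eq0.
have hu0' : L2_random P O (F 0) (u 0%N) by rewrite u00.
have u0V' w : Vdiv O (V h) (Q h) (u 0%N w) by rewrite u00.
have uVN m w : (m <= N)%N -> Vdiv O (V h) (Q h) (u m w).
  by case: m => [_|m mN]; [exact: u0V' | exact: uV].
have [r [f [Vf of_ fspan]]] := Vdiv_onb oO Ofin hVh hQh.
have [s [e [Pe oe espan]]] := Vperp_onb oO Ofin (Q h) hVh.
have [q [Qq qe]] := dual_pressures oO Ofin hVh hQh Pe oe.
have good m (mN : (m <= N)%N) :=
  scheme_L2_random hT hF hU hB hW oO Ofin hp hVh tau0 tauN hGN hu0' u0V' uV hsch Vf of_ fspan mN.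
have hdis m (mN : (1 <= m <= N)%N) :=
  dissipation_visc hT hF hU hB hW oO Ofin hp hVh tau0 tauN hGN hu0' u0V' uV hsch Vf of_ fspan mN.
have [hen hdiss] := energy_bound hT hF hU hB hW oO Ofin hp hVh tau0 tauN hC hGN hu0' u0V' uV hsch Vf of_ fspan.
have smE m (mN : (m <= N)%N) := second_moment_energy oO Ofin hVh u0V' uV Vf fspan mN
  (fun i => vel_coord_sqi hF oO Ofin hVh tau0 tauN u0V' uV Vf fspan i mN (good m mN)).
pose E0 := energy P O u f 0.
have E0E : second_moment P O u0 = E0%:E by rewrite -u00; exact: smE.
have hE m (mN : (m <= N)%N) : exists U2 : R,
    [/\ 0 <= U2, (second_moment P O (u m) <= U2%:E)%E & 1 + U2 <= K1 * (1 + E0)].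
  exists (energy P O u f m); split; [exact: energy_ge0 | by rewrite smE | exact: hen].
have hKD : \sum_(1 <= m < N.+1) dissipation P T F inner B W O tau (G N) u f m <= 2^-1 * (K1 * (1 + E0)).
  by rewrite ler_pdivlMl.
have hi : initial_pressure P O (V h) (Q h) (u 0%N) pi_init by rewrite u00.
exists (prs P T p F inner B W O tau (G N) u e q); split.
- split; first exact: (prs_equation F inner B W oO Ofin hp hVh hQh tauN (G N) uVN Pe espan Qq qe hi).
  exact: (prs_unique oO Ofin hp hVh hQh tauN uVN Pe espan Qq qe hi).
- exact: (prs_random_elt hT hF hU hB hW oO Ofin hp hVh hQh tau0 tauN hGN uVN good Pe oe espan Qq qe Vf fspan).
exists (pi_det p O tau u e q), (pi_sto P T F inner B W O tau (G N) u e q); split.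
- split.
  + by move=> m w _; split; [exact: (pi_detQ p hQh) | exact: (pi_stoQ P T F inner B W hQh)].
  + exact: (prs0_init T p F inner B W oO Ofin hVh hQh tau (G N) uVN Pe espan Qq qe hi).
  + by move=> m _; exact: (prs_decomposition T p F inner B W oO Ofin hVh hQh tau (G N) uVN Pe espan Qq qe hi).
- move=> m xi /andP[_ mN] Pxi; apply: aeW => w; split.
    exact: (pi_det_pair oO Ofin hp hVh hQh tau uVN Pe espan Qq qe w mN Pxi).
  exact: (pi_sto_pair P T F inner B W oO Ofin hVh hQh tau (G N) u Pe espan Qq qe m w Pxi).
- by split=> w; [exact: pi_det0 | exact: pi_sto0].
- rewrite E0E -EFinD -EFinM.
  apply: (le_trans (leeD (det_bound oO Ofin hp hVh hQh tau0 uVN Pe espan Qq qe hdis hKD)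
    (sto_max_bound hT hF hU hB hW oO Ofin hVh hQh tau0 tauN hC hGN good Pe oe espan Qq qe hE))).
  by rewrite -EFinD lee_fin le_eqVlt; apply/orP; left; apply/eqP; ring.
move=> rr r2; rewrite E0E -EFinD -EFinM.
apply: (le_trans (sto_fractional_bound hT hF hU hB hW oO Ofin hVh hQh tau0 tauN hC hGN good Pe oe espan Qq qe hE r2)).
by rewrite lee_fin le_eqVlt; apply/orP; left; apply/eqP; ring.
Qed.
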